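(* Let $b\in\mathbb{N}$ and $T\to\infty$. (i) If $b>2$, then $$I_{1,b,1}(T)=\zeta\Big(\frac{1+b}{2}\Big)T\log T+\nu_bT+O\big(T^{3/4}\log T\big).$$ (ii) If $b=2$, then the same formula holds with error term $O(T^{3/4+\varepsilon})$ for every $\varepsilon>0$ in place of $O(T^{3/4}\log T)$. (iii) If $b=1$, then $$I_{1,1,1}(T)=\frac12T(\log T)^2+c_1T\log T+c_0T+O\big(T^{3/4}\log T\big).$$ Here $$\nu_b=\zeta\Big(\frac{b+1}{2}\Big)\big(2\gamma-1-\log 2\pi\big)+b\,\zeta'\Big(\frac{b+1}{2}\Big),\qquad c_1=3\gamma-1-\log(2\pi),$$ $$c_0=3\gamma^2-3\gamma+3\gamma_1+1+(1-3\gamma)\log 2\pi+\frac{(\log 2\pi)^2}{2},$$ where $\gamma$ is Euler's constant and $\gamma_1=\frac12\lim_{s\to1}\frac{d^2}{ds^2}\big((s-1)\zeta(s)\big)$.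
   Context: $\zeta$ is the Riemann zeta function and, for $a,b,c\in\mathbb{R}^+$ and $T>1$, $$I_{a,b,c}(T)=\int_0^T\zeta(1/2+ait)\,\zeta(1/2-bit)\,\zeta(1/2-cit)\,dt.$$ Implicit constants may depend on $b$ (and on $\varepsilon$ where it appears). *)

(* Defs.v *)
From Stdlib Require Import Reals.
From Coquelicot Require Import Coquelicot.
Open Scope R_scope.

Definition Cexp (z : C) : C := (exp (Re z) * cos (Im z), exp (Re z) * sin (Im z)).

(** [x ^ s] for a real base [x > 0] and a complex exponent [s]. *)
Definition Rpower_C (x : R) (s : C) : C := Cexp (s * RtoC (ln x))%C.

Definition analytic_at (f : C -> C) (z0 : C) : Prop :=
  exists (a : nat -> C) (r : posreal), forall z : C,
    Cmod (z - z0)%C < r ->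
    @is_pseries C_AbsRing C_NormedModule a (z - z0)%C (f z).

(** The Riemann zeta function: the analytic continuation to [C \ {1}] of the
    sum of [n ^ (-s)] over [n >= 1].  This determines [zeta] away from the pole
    [s = 1], where its value is left arbitrary and is never used. *)
Definition is_riemann_zeta (zeta : C -> C) : Prop :=
  (forall s : C, s <> RtoC 1 -> analytic_at zeta s) /\
  (forall s : C, 1 < Re s ->
     @is_series C_AbsRing C_NormedModule
       (fun n : nat => Rpower_C (INR (S n)) (- s)%C) (zeta s)).

Definition zeta_integral (zeta : C -> C) (a b c T : R) : C :=
  @RInt C_R_CompleteNormedModule
    (fun t : R => zeta (RtoC (1 / 2) + Ci * RtoC (a * t))
                  * zeta (RtoC (1 / 2) - Ci * RtoC (b * t))
                  * zeta (RtoC (1 / 2) - Ci * RtoC (c * t)))%C 0 T.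

Definition euler_gamma : R :=
  real (Lim_seq (fun n : nat => sum_n_m (fun k : nat => / INR k) 1 n - ln (INR n))).

(** This is the coefficient of [(s - 1) ^ 2] in the expansion of
    [(s - 1) * zeta s] at [1], i.e. minus the usual first Stieltjes constant.
    Coquelicot's [C_derive] and [C_lim] evaluate limits along the real
    direction; they are the complex derivative and limit whenever these exist,
    as is the case here. *)
Definition gamma1 (zeta : C -> C) : C :=
  (RtoC (1 / 2) *
   C_lim (C_derive (C_derive (fun s : C => (s - RtoC 1) * zeta s))) (RtoC 1))%C.

Definition nu (zeta : C -> C) (b : nat) : C :=
  (zeta (RtoC ((INR b + 1) / 2)) * RtoC (2 * euler_gamma - 1 - ln (2 * PI))
   + RtoC (INR b) * C_derive zeta (RtoC ((INR b + 1) / 2)))%C.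

Definition coef1 : R := 3 * euler_gamma - 1 - ln (2 * PI).

Definition coef0 (zeta : C -> C) : C :=
  (RtoC (3 * euler_gamma ^ 2 - 3 * euler_gamma) + RtoC 3 * gamma1 zeta
   + RtoC (1 + (1 - 3 * euler_gamma) * ln (2 * PI) + ln (2 * PI) ^ 2 / 2))%C.

(** [f T = O (g T)] as [T -> +oo]. *)
Definition bigO_infty (f : R -> C) (g : R -> R) : Prop :=
  exists K : R, Rbar_locally p_infty (fun T : R => Cmod (f T) <= K * g T).

(* Main.v *)
(** By complex conjugation the integral becomes [\int f] along [Re s = 1/2] with
    [f(s) = zeta(1-s) zeta(s) zeta(bs + (1-b)/2)].  For [1/2 <= Re s <= 9/8], van der Corput bounds give
    [f(s) = O(t^(3/4))], so the line can be moved to [Re s = 9/8].  There the functional equation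
    [zeta(1-s) = (2 pi)^(-s) (E_+(s) + E_-(s)) zeta(s)], where [E_e] is the Mellin transform of [exp(-iex)],
    and absolute convergence give a sum over [N = h m k^b], with weight [k^((b-1)/2)], of
    [V_e(l, T) = \int_4^T E_e(s) l^(-s) dt] at [l = 2 pi N].  Up to small errors [e^(il) V_+(l, T)] does not
    depend on [l] below [T], and [V_+] is negligible above [T], as is [V_-] everywhere.  Hence the integral is
    [M(T)] times the weighted number of triples with [h m k^b <= T / (2 pi)].  The same argument applied to
    [zeta(1-s)] alone, whose integral is [T + O(T^(23/32))] by moving the line to [Re s = -1/8], shows
    [M(T) = 2 pi + O(T^(-9/32))].  The lattice points are counted by Dirichlet's hyperbola method. *)

Require Import Defs.
From Stdlib Require Import Reals.
From Coquelicot Require Import Coquelicot.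
From Stdlib Require Import Lra Lia Psatz Factorial Wf_nat ZArith List.
Open Scope R_scope.

(** * Complex-valued functions of a real variable *)

(** The transform [Em e s] stands in for [Gamma(s) exp(-i pi e s / 2)], but neither Gamma nor
    Stirling's formula enters: its size comes from van der Corput estimates, and the phase of the
    truncated integral is never computed. At [l = 2 pi N] the factor [e^(il)] equals 1, so one
    unknown, [Mmain T], multiplies the whole count; evaluating it indirectly costs a relative error
    [T^(-9/32)], which against a count of at most about [T^(33/32)] is just [T^(3/4)]. All contours
    stay above height 4, so no pole is met: the main terms arise from counting, never from residues.
    Dirichlet series are cut at [N], and [N] tends to infinity with [T] fixed, so truncation errors
    need no uniformity in [T]. [zeta] (through Euler-Maclaurin) and the Mellin transform are both
    written with Laplace transforms, so one set of lemmas gives their holomorphy. The given [zeta]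
    is only known by its local power series, and is tied to the Euler-Maclaurin formula by
    continuation along horizontal lines. *)

Definition ccont (f : R -> C) (t : R) : Prop :=
  continuous (fun u => Re (f u)) t /\ continuous (fun u => Im (f u)) t.

Definition cder (f : R -> C) (t : R) (l : C) : Prop :=
  is_derive (fun u => Re (f u)) t (Re l) /\ is_derive (fun u => Im (f u)) t (Im l).

Definition CI (f : R -> C) (a b : R) : C :=
  (RInt (fun u => Re (f u)) a b, RInt (fun u => Im (f u)) a b).

Lemma Ceq (z w : C) : Re z = Re w -> Im z = Im w -> z = w.
Proof. destruct z, w; simpl; intros; subst; reflexivity. Qed.

Lemma Re_plus z w : Re (z + w)%C = Re z + Re w. Proof. reflexivity. Qed.
Lemma Im_plus z w : Im (z + w)%C = Im z + Im w. Proof. reflexivity. Qed.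
Lemma Re_opp z : Re (- z)%C = - Re z. Proof. reflexivity. Qed.
Lemma Im_opp z : Im (- z)%C = - Im z. Proof. reflexivity. Qed.
Lemma Re_minus z w : Re (z - w)%C = Re z - Re w. Proof. reflexivity. Qed.
Lemma Im_minus z w : Im (z - w)%C = Im z - Im w. Proof. reflexivity. Qed.
Lemma Re_mult z w : Re (z * w)%C = Re z * Re w - Im z * Im w. Proof. reflexivity. Qed.
Lemma Im_mult z w : Im (z * w)%C = Re z * Im w + Im z * Re w. Proof. reflexivity. Qed.
Lemma Re_RtoC x : Re (RtoC x) = x. Proof. reflexivity. Qed.
Lemma Im_RtoC x : Im (RtoC x) = 0. Proof. reflexivity. Qed.
Lemma Re_Ci : Re Ci = 0. Proof. reflexivity. Qed.
Lemma Im_Ci : Im Ci = 1. Proof. reflexivity. Qed.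
Global Hint Rewrite Re_plus Im_plus Re_opp Im_opp Re_minus Im_minus Re_mult Im_mult
  Re_RtoC Im_RtoC Re_Ci Im_Ci : creim.

Ltac creim := autorewrite with creim.
Ltac cring := apply Ceq; creim; ring.

Lemma im_le_Cmod z : Rabs (Im z) <= Cmod z.
Proof. eapply Rle_trans; [apply Rmax_r | apply Rmax_Cmod]. Qed.

Lemma Cmod_le_ReIm z : Cmod z <= Rabs (Re z) + Rabs (Im z).
Proof.
  replace z with (RtoC (Re z) + Ci * RtoC (Im z))%C at 1 by cring.
  eapply Rle_trans; [apply Cmod_triangle|].
  rewrite Cmod_mult, Cmod_Ci, !Cmod_R. lra.
Qed.

Lemma Cmod_minus_le z w : Cmod (z - w)%C <= Cmod z + Cmod w.
Proof. unfold Cminus. rewrite <- (Cmod_opp w). apply Cmod_triangle. Qed.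

Lemma Cmod_minus_sym z w : Cmod (z - w)%C = Cmod (w - z)%C.
Proof. rewrite <- Cmod_opp. f_equal. ring. Qed.

Lemma Cmod_triangle_inv z w : Cmod z - Cmod w <= Cmod (z - w)%C.
Proof.
  pose proof (Cmod_triangle (z - w)%C w) as H.
  replace (z - w + w)%C with z in H by ring. lra.
Qed.

Lemma Cmod_RtoC_pos x : 0 <= x -> Cmod (RtoC x) = x.
Proof. intros; rewrite Cmod_R; now apply Rabs_pos_eq. Qed.

Lemma ccont_ext f g t : (forall u, f u = g u) -> ccont f t -> ccont g t.
Proof.
  intros H [A B]; split; [eapply continuous_ext; [|exact A] | eapply continuous_ext; [|exact B]];
  intros u; cbv beta; now rewrite H.
Qed.

Lemma ccont_const z t : ccont (fun _ => z) t.
Proof. split; apply continuous_const. Qed.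

Lemma ccont_plus f g t : ccont f t -> ccont g t -> ccont (fun u => f u + g u)%C t.
Proof.
  intros [A B] [D E]; split; [apply (continuous_plus (fun u => Re (f u)) (fun u => Re (g u)))
  | apply (continuous_plus (fun u => Im (f u)) (fun u => Im (g u)))]; assumption.
Qed.

Lemma ccont_opp f t : ccont f t -> ccont (fun u => - f u)%C t.
Proof.
  intros [A B]; split; [apply (continuous_opp (fun u => Re (f u)))
  | apply (continuous_opp (fun u => Im (f u)))]; assumption.
Qed.

Lemma ccont_minus f g t : ccont f t -> ccont g t -> ccont (fun u => f u - g u)%C t.
Proof. intros; apply ccont_plus; auto; now apply ccont_opp. Qed.

Lemma ccont_mult f g t : ccont f t -> ccont g t -> ccont (fun u => f u * g u)%C t.
Proof.
  intros [A B] [D E]; split.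
  - apply (continuous_minus (fun u => Re (f u) * Re (g u)) (fun u => Im (f u) * Im (g u)));
    [apply (continuous_mult (fun u => Re (f u)) (fun u => Re (g u)))
    |apply (continuous_mult (fun u => Im (f u)) (fun u => Im (g u)))]; assumption.
  - apply (continuous_plus (fun u => Re (f u) * Im (g u)) (fun u => Im (f u) * Re (g u)));
    [apply (continuous_mult (fun u => Re (f u)) (fun u => Im (g u)))
    |apply (continuous_mult (fun u => Im (f u)) (fun u => Re (g u)))]; assumption.
Qed.

Lemma ccont_RtoC (f : R -> R) (t : R) : continuous f t -> ccont (fun u => RtoC (f u)) t.
Proof. intros; split; [assumption | apply continuous_const]. Qed.

Lemma ccont_comp f (h : R -> R) t : continuous h t -> ccont f (h t) -> ccont (fun u => f (h u)) t.
Proof.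
  intros H [A B]; split; [apply (continuous_comp h (fun u => Re (f u)))
   | apply (continuous_comp h (fun u => Im (f u)))]; assumption.
Qed.

Lemma cder_ccont f t l : cder f t l -> ccont f t.
Proof. intros [A B]; split; apply (ex_derive_continuous (V := R_NormedModule)); eexists; eassumption. Qed.

Lemma cder_ext f g t l : (forall u, f u = g u) -> cder f t l -> cder g t l.
Proof.
  intros H [A B]; split; [eapply is_derive_ext; [|exact A] | eapply is_derive_ext; [|exact B]];
  intros u; cbv beta; now rewrite H.
Qed.

Lemma cder_const z t : cder (fun _ => z) t 0%C.
Proof. split; [apply (is_derive_const (V := R_NormedModule) (Re z) t)
  | apply (is_derive_const (V := R_NormedModule) (Im z) t)]. Qed.

Lemma cder_plus f g t l m : cder f t l -> cder g t m -> cder (fun u => f u + g u)%C t (l + m)%C.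
Proof.
  intros [A B] [D E]; split; [apply (is_derive_plus (fun u => Re (f u)) (fun u => Re (g u)))
  | apply (is_derive_plus (fun u => Im (f u)) (fun u => Im (g u)))]; assumption.
Qed.

Lemma cder_opp f t l : cder f t l -> cder (fun u => - f u)%C t (- l)%C.
Proof.
  intros [A B]; split; [apply (is_derive_opp (fun u => Re (f u)))
  | apply (is_derive_opp (fun u => Im (f u)))]; assumption.
Qed.

Lemma cder_minus f g t l m : cder f t l -> cder g t m -> cder (fun u => f u - g u)%C t (l - m)%C.
Proof. intros; apply cder_plus; auto; now apply cder_opp. Qed.

Lemma is_derive_Rmult (f g : R -> R) t l m : is_derive f t l -> is_derive g t m ->
  is_derive (fun u => f u * g u) t (l * g t + f t * m).
Proof. intros A B. apply (is_derive_mult f g t l m A B). intros; apply Rmult_comm. Qed.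

Lemma cder_mult f g t l m : cder f t l -> cder g t m ->
  cder (fun u => f u * g u)%C t (l * g t + f t * m)%C.
Proof.
  intros [A B] [D E]; split.
  - eapply is_derive_ext with (f := fun u => Re (f u) * Re (g u) - Im (f u) * Im (g u)); [reflexivity|].
    replace (Re (l * g t + f t * m)%C) with
      ((Re l * Re (g t) + Re (f t) * Re m) - (Im l * Im (g t) + Im (f t) * Im m)) by (creim; ring).
    apply (is_derive_minus (fun u => Re (f u) * Re (g u)) (fun u => Im (f u) * Im (g u)));
    apply is_derive_Rmult; assumption.
  - eapply is_derive_ext with (f := fun u => Re (f u) * Im (g u) + Im (f u) * Re (g u)); [reflexivity|].
    replace (Im (l * g t + f t * m)%C) with
      ((Re l * Im (g t) + Re (f t) * Im m) + (Im l * Re (g t) + Im (f t) * Re m)) by (creim; ring).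
    apply (is_derive_plus (fun u => Re (f u) * Im (g u)) (fun u => Im (f u) * Re (g u)));
    apply is_derive_Rmult; assumption.
Qed.

Lemma cder_RtoC (f : R -> R) (t l : R) : is_derive f t l -> cder (fun u => RtoC (f u)) t (RtoC l).
Proof. intros; split; [assumption | apply (is_derive_const (V := R_NormedModule) 0 t)]. Qed.

Lemma cder_eq f t l m : cder f t l -> l = m -> cder f t m.
Proof. intros H <-; exact H. Qed.

Lemma cder_scal z f t l : cder f t l -> cder (fun u => z * f u)%C t (z * l)%C.
Proof.
  intros H. eapply cder_eq. { apply cder_mult; [apply cder_const | exact H]. } cring.
Qed.

(** * The complex exponential *)

Lemma Cexp_plus z w : Cexp (z + w)%C = (Cexp z * Cexp w)%C.
Proof.
  unfold Cexp. apply Ceq; creim; simpl; rewrite exp_plus, ?cos_plus, ?sin_plus; ring.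
Qed.

Lemma Cexp_0 : Cexp 0%C = 1%C.
Proof. unfold Cexp; simpl. rewrite exp_0, cos_0, sin_0. apply Ceq; simpl; ring. Qed.

Lemma Cmod_Cexp z : Cmod (Cexp z) = exp (Re z).
Proof.
  unfold Cexp, Cmod; cbn [fst snd].
  replace ((exp (Re z) * cos (Im z)) ^ 2 + (exp (Re z) * sin (Im z)) ^ 2) with (Rsqr (exp (Re z))).
  - apply sqrt_Rsqr, Rlt_le, exp_pos.
  - pose proof (sin2_cos2 (Im z)) as H; unfold Rsqr in *.
    transitivity (exp (Re z) * exp (Re z) * (sin (Im z) * sin (Im z) + cos (Im z) * cos (Im z))).
    rewrite H; ring. ring.
Qed.

Lemma Cexp_RtoC x : Cexp (RtoC x) = RtoC (exp x).
Proof. unfold Cexp; simpl. rewrite cos_0, sin_0. apply Ceq; simpl; ring. Qed.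

Lemma cder_Cexp f t l : cder f t l -> cder (fun u => Cexp (f u)) t (l * Cexp (f t))%C.
Proof.
  intros [A B].
  assert (E : is_derive (fun u => exp (Re (f u))) t (Re l * exp (Re (f t)))).
  { apply (is_derive_comp exp (fun u => Re (f u)) t (exp (Re (f t))) (Re l)); auto.
    apply is_derive_exp. }
  split.
  - change (is_derive (fun u => exp (Re (f u)) * cos (Im (f u))) t (Re (l * Cexp (f t))%C)).
    replace (Re (l * Cexp (f t))%C)
     with (Re l * exp (Re (f t)) * cos (Im (f t)) + exp (Re (f t)) * (Im l * - sin (Im (f t))))
     by (rewrite Re_mult; unfold Cexp; simpl; ring).
    apply (is_derive_Rmult (fun u => exp (Re (f u))) (fun u => cos (Im (f u)))); auto.
    apply (is_derive_comp cos (fun u => Im (f u)) t _ (Im l)); auto. apply is_derive_cos.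
  - change (is_derive (fun u => exp (Re (f u)) * sin (Im (f u))) t (Im (l * Cexp (f t))%C)).
    replace (Im (l * Cexp (f t))%C)
     with (Re l * exp (Re (f t)) * sin (Im (f t)) + exp (Re (f t)) * (Im l * cos (Im (f t))))
     by (rewrite Im_mult; unfold Cexp; simpl; ring).
    apply (is_derive_Rmult (fun u => exp (Re (f u))) (fun u => sin (Im (f u)))); auto.
    apply (is_derive_comp sin (fun u => Im (f u)) t _ (Im l)); auto. apply is_derive_sin.
Qed.

Lemma ccont_Cexp f t : ccont f t -> ccont (fun u => Cexp (f u)) t.
Proof.
  intros [A B]. split; unfold Cexp; simpl.
  - apply (continuous_mult (fun u => exp (Re (f u))) (fun u => cos (Im (f u)))).
    + apply continuous_comp; auto. apply continuous_exp.
    + apply continuous_comp; auto. apply continuous_cos.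
  - apply (continuous_mult (fun u => exp (Re (f u))) (fun u => sin (Im (f u)))).
    + apply continuous_comp; auto. apply continuous_exp.
    + apply continuous_comp; auto. apply continuous_sin.
Qed.

(** * Integrals of complex-valued functions *)

Lemma ex_RInt_cont (f : R -> R) a b : a <= b ->
  (forall t, a <= t <= b -> continuous f t) -> ex_RInt f a b.
Proof.
  intros Hab H; apply (ex_RInt_continuous (V := R_CompleteNormedModule));
  rewrite Rmin_left, Rmax_right by assumption; intros z Hz; apply H; assumption.
Qed.

Definition exCI (f : R -> C) (a b : R) : Prop :=
  ex_RInt (fun u => Re (f u)) a b /\ ex_RInt (fun u => Im (f u)) a b.

Lemma exCI_cont f a b : a <= b -> (forall t, a <= t <= b -> ccont f t) -> exCI f a b.
Proof.
  intros Hab H; split.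
  - apply (ex_RInt_cont (fun u => Re (f u))); auto. intros t Ht. exact (proj1 (H t Ht)).
  - apply (ex_RInt_cont (fun u => Im (f u))); auto. intros t Ht. exact (proj2 (H t Ht)).
Qed.

(** The theorem integrates in a normed module of pairs, whereas all estimates are made with [CI], a
    pair of real integrals. This is the bridge between the two. *)
Lemma CI_RInt f a b : exCI f a b -> @RInt C_R_CompleteNormedModule f a b = CI f a b.
Proof.
  intros [A B]. symmetry.
  apply (RInt_fct_extend_pair (U := R_NormedModule) (V := R_NormedModule)
    (@RInt R_CompleteNormedModule) (@RInt R_CompleteNormedModule)).
  - intros; now apply is_RInt_unique.
  - intros; now apply is_RInt_unique.
  - apply (RInt_correct (V := C_R_CompleteNormedModule)).
    destruct A as [la A], B as [lb B]. exists (la, lb).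
    now apply is_RInt_fct_extend_pair.
Qed.

Lemma CI_norm_le f (g : R -> R) a b : a <= b -> exCI f a b -> ex_RInt g a b ->
  (forall x, a <= x <= b -> Cmod (f x) <= g x) -> Cmod (CI f a b) <= RInt g a b.
Proof.
  intros Hab [A B] G H.
  rewrite Cmod_norm.
  eapply (norm_RInt_le (V := C_R_NormedModule) f g a b); auto.
  - intros x Hx. specialize (H x Hx). rewrite Cmod_norm in H. exact H.
  - apply is_RInt_fct_extend_pair; apply (RInt_correct (V := R_CompleteNormedModule)); assumption.
  - apply (RInt_correct (V := R_CompleteNormedModule)); assumption.
Qed.

Lemma CI_norm_const f K a b : a <= b -> exCI f a b ->
  (forall x, a <= x <= b -> Cmod (f x) <= K) -> Cmod (CI f a b) <= K * (b - a).
Proof.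
  intros Hab F H.
  eapply Rle_trans. { apply (CI_norm_le f (fun _ => K)); auto. apply ex_RInt_const. }
  rewrite RInt_const. unfold scal; simpl; unfold mult; simpl. lra.
Qed.

Lemma CI_ext f g a b : a <= b -> (forall x, a < x < b -> f x = g x) -> CI f a b = CI g a b.
Proof.
  intros Hab H. unfold CI. f_equal; apply RInt_ext; rewrite Rmin_left, Rmax_right by assumption;
  intros x Hx; now rewrite H.
Qed.

Lemma exCI_ext f g a b : a <= b -> (forall x, a < x < b -> f x = g x) -> exCI f a b -> exCI g a b.
Proof.
  intros Hab H [A B]. split; [eapply ex_RInt_ext; [|exact A] | eapply ex_RInt_ext; [|exact B]];
  rewrite Rmin_left, Rmax_right by assumption; intros x Hx; now rewrite H.
Qed.

Lemma CI_plus f g a b : exCI f a b -> exCI g a b ->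
  CI (fun u => f u + g u)%C a b = (CI f a b + CI g a b)%C.
Proof.
  intros [A B] [D E]. apply Ceq; unfold CI; simpl.
  - apply (RInt_plus (V := R_CompleteNormedModule) (fun u => Re (f u)) (fun u => Re (g u))); assumption.
  - apply (RInt_plus (V := R_CompleteNormedModule) (fun u => Im (f u)) (fun u => Im (g u))); assumption.
Qed.

Lemma exCI_plus f g a b : exCI f a b -> exCI g a b -> exCI (fun u => f u + g u)%C a b.
Proof.
  intros [A B] [D E]; split; [apply (ex_RInt_plus (V := R_NormedModule) (fun u => Re (f u)) (fun u => Re (g u)))
  | apply (ex_RInt_plus (V := R_NormedModule) (fun u => Im (f u)) (fun u => Im (g u)))]; assumption.
Qed.

Lemma ex_RInt_Rscal (f : R -> R) k a b : ex_RInt f a b -> ex_RInt (fun u => k * f u) a b.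
Proof. intros; now apply (ex_RInt_scal (V := R_NormedModule) f). Qed.

Lemma RInt_Rscal (f : R -> R) k a b : ex_RInt f a b -> RInt (fun u => k * f u) a b = k * RInt f a b.
Proof. intros; now apply (RInt_scal (V := R_CompleteNormedModule) f). Qed.

Lemma exCI_scal z f a b : exCI f a b -> exCI (fun u => z * f u)%C a b.
Proof.
  intros [A B]; split.
  - apply (ex_RInt_minus (V := R_NormedModule) (fun u => Re z * Re (f u)) (fun u => Im z * Im (f u)));
    apply ex_RInt_Rscal; assumption.
  - apply (ex_RInt_plus (V := R_NormedModule) (fun u => Re z * Im (f u)) (fun u => Im z * Re (f u)));
    apply ex_RInt_Rscal; assumption.
Qed.

Lemma CI_scal z f a b : exCI f a b -> CI (fun u => z * f u)%C a b = (z * CI f a b)%C.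
Proof.
  intros [A B]. apply Ceq; unfold CI; simpl; rewrite <- !RInt_Rscal by assumption.
  - apply (RInt_minus (V := R_CompleteNormedModule) (fun u => Re z * Re (f u)) (fun u => Im z * Im (f u)));
    apply ex_RInt_Rscal; assumption.
  - apply (RInt_plus (V := R_CompleteNormedModule) (fun u => Re z * Im (f u)) (fun u => Im z * Re (f u)));
    apply ex_RInt_Rscal; assumption.
Qed.

Lemma exCI_minus f g a b : exCI f a b -> exCI g a b -> exCI (fun u => f u - g u)%C a b.
Proof.
  intros [A B] [D E]; split; [apply (ex_RInt_minus (V := R_NormedModule) (fun u => Re (f u)) (fun u => Re (g u)))
  | apply (ex_RInt_minus (V := R_NormedModule) (fun u => Im (f u)) (fun u => Im (g u)))]; assumption.
Qed.

Lemma CI_minus f g a b : exCI f a b -> exCI g a b ->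
  CI (fun u => f u - g u)%C a b = (CI f a b - CI g a b)%C.
Proof.
  intros [A B] [D E]. apply Ceq; unfold CI; simpl.
  - apply (RInt_minus (V := R_CompleteNormedModule) (fun u => Re (f u)) (fun u => Re (g u))); assumption.
  - apply (RInt_minus (V := R_CompleteNormedModule) (fun u => Im (f u)) (fun u => Im (g u))); assumption.
Qed.

Lemma CI_Chasles f a b c : exCI f a b -> exCI f b c -> (CI f a b + CI f b c)%C = CI f a c.
Proof.
  intros [A B] [D E]. apply Ceq; unfold CI; simpl;
  apply (RInt_Chasles (V := R_CompleteNormedModule)); assumption.
Qed.

Lemma CI_FTC f df a b : a <= b -> (forall x, a <= x <= b -> cder f x (df x)) ->
  (forall x, a <= x <= b -> ccont df x) -> CI df a b = (f b - f a)%C.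
Proof.
  intros Hab H K. apply Ceq; unfold CI; simpl; apply is_RInt_unique.
  - apply (is_RInt_derive (V := R_CompleteNormedModule) (fun u => Re (f u)) (fun u => Re (df u)));
    rewrite Rmin_left, Rmax_right by assumption; intros x Hx; [apply (H x Hx) | apply (K x Hx)].
  - apply (is_RInt_derive (V := R_CompleteNormedModule) (fun u => Im (f u)) (fun u => Im (df u)));
    rewrite Rmin_left, Rmax_right by assumption; intros x Hx; [apply (H x Hx) | apply (K x Hx)].
Qed.

Lemma RInt_FTC (f df : R -> R) a b : a <= b -> (forall x, a <= x <= b -> is_derive f x (df x)) ->
  (forall x, a <= x <= b -> continuous df x) -> @eq R (RInt df a b) (f b - f a).
Proof.
  intros Hab H K. apply is_RInt_unique.
  apply (is_RInt_derive (V := R_CompleteNormedModule) f df);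
    rewrite Rmin_left, Rmax_right by assumption; auto.
Qed.

Lemma CI_point f a : CI f a a = 0%C.
Proof. apply Ceq; unfold CI; simpl; apply (RInt_point (V := R_CompleteNormedModule)). Qed.

(** * Differentiation under the integral sign *)

Definition ccont2 (F : R -> R -> C) (x y : R) : Prop :=
  continuity_2d_pt (fun u v => Re (F u v)) x y /\ continuity_2d_pt (fun u v => Im (F u v)) x y.

(** The partial derivative is required for [t] beyond both ends of the interval because joint
    continuity at an end point is a condition on a full two-dimensional neighbourhood. *)
Lemma cder_CI_param (F F' : R -> R -> C) (a b x r : R) : a <= b -> 0 < r ->
  (forall y t, Rabs (y - x) < r -> a - r < t < b + r -> cder (fun y => F y t) y (F' y t)) ->
  (forall t, a <= t <= b -> ccont2 F' x t) ->
  (forall y t, Rabs (y - x) < r -> a <= t <= b -> ccont (F y) t) ->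
  cder (fun y => CI (F y) a b) x (CI (F' x) a b).
Proof.
  intros Hab Hr HD HC HF.
  assert (L : forall P : R -> Prop, (forall y, Rabs (y - x) < r -> P y) -> locally x P).
  { intros P HP. exists (mkposreal r Hr). intros y Hy. apply HP. exact Hy. }
  assert (key : forall (p : C -> R),
    (forall y t, Rabs (y - x) < r -> a - r < t < b + r ->
       is_derive (fun y => p (F y t)) y (p (F' y t))) ->
    (forall t, a <= t <= b -> continuity_2d_pt (fun u v => p (F' u v)) x t) ->
    (forall y t, Rabs (y - x) < r -> a <= t <= b -> continuous (fun t => p (F y t)) t) ->
    is_derive (fun y => RInt (fun u => p (F y u)) a b) x (RInt (fun u => p (F' x u)) a b)).
  { intros p D C' K.
    rewrite (RInt_ext (fun u => p (F' x u)) (fun t => Derive (fun u => p (F u t)) x)).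
    - apply (is_derive_RInt_param (fun y u => p (F y u))).
      + apply L. intros y Hy t. rewrite Rmin_left, Rmax_right by assumption. intros Ht.
        eexists. apply D; auto. lra.
      + intros t. rewrite Rmin_left, Rmax_right by assumption. intros Ht.
        apply continuity_2d_pt_ext_loc with (f := fun u v => p (F' u v)); [|now apply C'].
        exists (mkposreal r Hr). simpl. intros u v Hu Hv. symmetry.
        apply is_derive_unique, D; auto. apply Rabs_def2 in Hv. lra.
      + apply L. intros y Hy. apply ex_RInt_cont; auto.
    - intros t. rewrite Rmin_left, Rmax_right by assumption. intros Ht. symmetry.
      apply is_derive_unique, D; [|lra]. rewrite Rminus_diag, Rabs_R0; assumption. }
  split.
  - apply (key Re); [intros y t A B; exact (proj1 (HD y t A B)) | intros t A; exact (proj1 (HC t A))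
      | intros y t A B; exact (proj1 (HF y t A B))].
  - apply (key Im); [intros y t A B; exact (proj2 (HD y t A B)) | intros t A; exact (proj2 (HC t A))
      | intros y t A B; exact (proj2 (HF y t A B))].
Qed.

(** * Complex differentiability *)

(** The quadratic error term holds for every holomorphic function and makes sums, products and
    parametric integrals painless. *)
Definition chol (f : C -> C) (z l : C) : Prop :=
  exists M d, 0 <= M /\ 0 < d /\
    forall h, Cmod h < d -> Cmod (f (z + h) - f z - l * h)%C <= M * Cmod h ^ 2.

Lemma chol_eq f z l m : chol f z l -> l = m -> chol f z m.
Proof. intros H <-; exact H. Qed.

Lemma chol_ext f g z l : (forall w, f w = g w) -> chol f z l -> chol g z l.
Proof.
  intros E (M & d & HM & Hd & H). exists M, d. repeat split; auto.
  intros h Hh. rewrite <- !E. auto.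
Qed.

Lemma chol_const c z : chol (fun _ => c) z 0%C.
Proof.
  exists 0, 1. repeat split; try lra. intros h _.
  replace (c - c - 0 * h)%C with (RtoC 0) by cring. rewrite Cmod_0; lra.
Qed.

Lemma chol_id z : chol (fun w => w) z 1%C.
Proof.
  exists 0, 1. repeat split; try lra. intros h _.
  replace (z + h - z - 1 * h)%C with (RtoC 0) by cring. rewrite Cmod_0; lra.
Qed.

Lemma chol_plus f g z l m : chol f z l -> chol g z m -> chol (fun w => f w + g w)%C z (l + m)%C.
Proof.
  intros (M & d & HM & Hd & H) (M' & d' & HM' & Hd' & H').
  exists (M + M'), (Rmin d d'). repeat split; [lra | now apply Rmin_glb_lt |].
  intros h Hh.
  replace (f (z + h) + g (z + h) - (f z + g z) - (l + m) * h)%C with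
    ((f (z + h) - f z - l * h) + (g (z + h) - g z - m * h))%C by ring.
  eapply Rle_trans; [apply Cmod_triangle|].
  assert (Cmod h < d) by (eapply Rlt_le_trans; [exact Hh | apply Rmin_l]).
  assert (Cmod h < d') by (eapply Rlt_le_trans; [exact Hh | apply Rmin_r]).
  specialize (H h); specialize (H' h). lra.
Qed.

Lemma chol_mult f g z l m : chol f z l -> chol g z m ->
  chol (fun w => f w * g w)%C z (l * g z + f z * m)%C.
Proof.
  intros (M & d & HM & Hd & H) (M' & d' & HM' & Hd' & H').
  set (e := Rmin 1 (Rmin d d')).
  assert (He : 0 < e) by (repeat apply Rmin_glb_lt; lra).
  pose proof (Cmod_ge_0 (f z)); pose proof (Cmod_ge_0 (g z));
  pose proof (Cmod_ge_0 l); pose proof (Cmod_ge_0 m).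
  exists (M * (Cmod (g z) + Cmod m + M') + Cmod (f z) * M' + Cmod l * (Cmod m + M')), e.
  repeat split; [|assumption|].
  { repeat apply Rplus_le_le_0_compat; apply Rmult_le_pos; lra. }
  intros h Hh.
  assert (h1 : Cmod h < 1) by (eapply Rlt_le_trans; [exact Hh | apply Rmin_l]).
  assert (h2 : Cmod h < d).
  { eapply Rlt_le_trans; [exact Hh|]. unfold e. eapply Rle_trans; [apply Rmin_r | apply Rmin_l]. }
  assert (h3 : Cmod h < d').
  { eapply Rlt_le_trans; [exact Hh|]. unfold e. eapply Rle_trans; [apply Rmin_r | apply Rmin_r]. }
  specialize (H h h2); specialize (H' h h3).
  pose proof (Cmod_ge_0 h) as h0.
  assert (hsq : Cmod h ^ 2 <= Cmod h) by nra.
  assert (G1 : Cmod (g (z + h) - g z)%C <= (Cmod m + M') * Cmod h).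
  { replace (g (z + h) - g z)%C with ((g (z + h) - g z - m * h) + m * h)%C by ring.
    eapply Rle_trans; [apply Cmod_triangle|]. rewrite Cmod_mult. nra. }
  assert (G : Cmod (g (z + h)%C) <= Cmod (g z) + Cmod m + M').
  { replace (g (z + h)%C) with ((g (z + h) - g z) + g z)%C by ring.
    eapply Rle_trans; [apply Cmod_triangle|]. nra. }
  replace (f (z + h) * g (z + h) - f z * g z - (l * g z + f z * m) * h)%C with
   ((f (z + h) - f z - l * h) * g (z + h) + f z * (g (z + h) - g z - m * h)
     + l * h * (g (z + h) - g z))%C by ring.
  eapply Rle_trans; [apply Cmod_triangle|].
  eapply Rle_trans; [apply Rplus_le_compat_r, Cmod_triangle|].
  rewrite !Cmod_mult.
  assert (A1 : Cmod (f (z + h) - f z - l * h)%C * Cmod (g (z + h)%C)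
     <= M * Cmod h ^ 2 * (Cmod (g z) + Cmod m + M')).
  { apply Rmult_le_compat; auto using Cmod_ge_0. }
  assert (A2 : Cmod (f z) * Cmod (g (z + h) - g z - m * h)%C <= Cmod (f z) * (M' * Cmod h ^ 2)).
  { apply Rmult_le_compat_l; auto. }
  assert (A3 : Cmod l * Cmod h * Cmod (g (z + h) - g z)%C
     <= Cmod l * Cmod h * ((Cmod m + M') * Cmod h)).
  { apply Rmult_le_compat_l; auto. now apply Rmult_le_pos. }
  nra.
Qed.

Lemma chol_scal c f z l : chol f z l -> chol (fun w => c * f w)%C z (c * l)%C.
Proof.
  intros H. eapply chol_eq. { apply chol_mult; [apply chol_const | exact H]. } cring.
Qed.

Lemma chol_opp f z l : chol f z l -> chol (fun w => - f w)%C z (- l)%C.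
Proof.
  intros H. apply chol_ext with (f := fun w => (- (1) * f w)%C). { intros; ring. }
  eapply chol_eq; [apply chol_scal, H|]. ring.
Qed.

Lemma chol_minus f g z l m : chol f z l -> chol g z m -> chol (fun w => f w - g w)%C z (l - m)%C.
Proof. intros; apply chol_plus; auto; now apply chol_opp. Qed.

Lemma chol_affine f a b z l : chol f (a * z + b)%C l -> chol (fun w => f (a * w + b))%C z (a * l)%C.
Proof.
  intros (M & d & HM & Hd & H).
  pose proof (Cmod_ge_0 a).
  exists (M * Cmod a ^ 2), (d / (Cmod a + 1)). repeat split.
  - apply Rmult_le_pos; auto. apply pow2_ge_0.
  - apply Rdiv_lt_0_compat; lra.
  - intros h Hh.
    replace (a * (z + h) + b)%C with (a * z + b + a * h)%C by ring.
    replace (a * l * h)%C with (l * (a * h))%C by ring.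
    eapply Rle_trans.
    + apply H. rewrite Cmod_mult. apply Rle_lt_trans with ((Cmod a + 1) * Cmod h).
      * apply Rmult_le_compat_r; [apply Cmod_ge_0 | lra].
      * apply (Rmult_lt_compat_l (Cmod a + 1)) in Hh; [|lra].
        replace ((Cmod a + 1) * (d / (Cmod a + 1))) with d in Hh by (field; lra). exact Hh.
    + rewrite Cmod_mult. right; ring.
Qed.

Lemma chol_inv (z : C) : z <> RtoC 0 -> chol (fun w => / w)%C z (- / (z * z))%C.
Proof.
  intros Hz. assert (H0 : 0 < Cmod z) by (apply Cmod_gt_0; exact Hz).
  exists (2 / Cmod z ^ 3), (Cmod z / 2). repeat split.
  - apply Rlt_le, Rdiv_lt_0_compat; [lra | now apply pow_lt].
  - lra.
  - intros h Hh.
    assert (H1 : Cmod z / 2 <= Cmod (z + h)%C).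
    { pose proof (Cmod_triangle (z + h)%C (- h)%C) as T. rewrite Cmod_opp in T.
      replace (z + h + - h)%C with z in T by ring. lra. }
    assert (H2 : (z + h)%C <> RtoC 0) by (apply Cmod_gt_0; lra).
    replace (/ (z + h) - / z - - / (z * z) * h)%C with (h * h / (z * z * (z + h)))%C
      by (field; split; assumption).
    rewrite Cmod_div, !Cmod_mult by (repeat apply Cmult_neq_0; auto).
    apply (Rmult_le_reg_r (Cmod z * Cmod z * Cmod (z + h)%C)); [repeat apply Rmult_lt_0_compat; lra|].
    replace (Cmod h * Cmod h / (Cmod z * Cmod z * Cmod (z + h)%C) * (Cmod z * Cmod z * Cmod (z + h)%C))
      with (Cmod h ^ 2) by (field; split; apply Rgt_not_eq; lra).
    replace (2 / Cmod z ^ 3 * Cmod h ^ 2 * (Cmod z * Cmod z * Cmod (z + h)%C)) with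
      (Cmod h ^ 2 * (2 * Cmod (z + h)%C / Cmod z)) by (field; lra).
    rewrite <- (Rmult_1_r (Cmod h ^ 2)) at 1.
    apply Rmult_le_compat_l; [apply pow2_ge_0|].
    apply (Rmult_le_reg_r (Cmod z)); [lra|].
    replace (2 * Cmod (z + h)%C / Cmod z * Cmod z) with (2 * Cmod (z + h)%C) by (field; lra). lra.
Qed.

Lemma chol_ball f z l eps : chol f z l -> 0 < eps -> exists d, 0 < d /\
  forall w, Cmod (w - z)%C < d -> Cmod (f w - f z)%C < eps.
Proof.
  intros (M & d & HM & Hd & H) He.
  pose proof (Cmod_ge_0 l).
  exists (Rmin (Rmin 1 d) (eps / (M + Cmod l + 1))). split.
  { repeat apply Rmin_glb_lt; try lra. apply Rdiv_lt_0_compat; lra. }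
  intros w Hw. set (h := (w - z)%C) in *.
  assert (h1 : Cmod h < 1).
  { eapply Rlt_le_trans; [exact Hw|]. eapply Rle_trans; [apply Rmin_l | apply Rmin_l]. }
  assert (h2 : Cmod h < d).
  { eapply Rlt_le_trans; [exact Hw|]. eapply Rle_trans; [apply Rmin_l | apply Rmin_r]. }
  assert (h3 : Cmod h < eps / (M + Cmod l + 1)).
  { eapply Rlt_le_trans; [exact Hw|]. apply Rmin_r. }
  specialize (H h h2). replace (z + h)%C with w in H by (unfold h; ring).
  replace (f w - f z)%C with ((f w - f z - l * h) + l * h)%C by ring.
  eapply Rle_lt_trans; [apply Cmod_triangle|]. rewrite Cmod_mult.
  pose proof (Cmod_ge_0 h).
  apply (Rmult_lt_compat_l (M + Cmod l + 1)) in h3; [|lra].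
  replace ((M + Cmod l + 1) * (eps / (M + Cmod l + 1))) with eps in h3 by (field; lra).
  assert (M * Cmod h ^ 2 <= M * Cmod h) by (apply Rmult_le_compat_l; [lra|nra]).
  lra.
Qed.

Lemma is_derive_quad (f : R -> R) x l M d : 0 <= M -> 0 < d ->
  (forall h, Rabs h < d -> Rabs (f (x + h) - f x - l * h) <= M * h ^ 2) -> is_derive f x l.
Proof.
  intros HM Hd H. apply is_derive_Reals. intros eps He.
  assert (He' : 0 < Rmin d (eps / (M + 1))).
  { apply Rmin_glb_lt; auto. apply Rdiv_lt_0_compat; lra. }
  exists (mkposreal _ He'). simpl. intros h Hh0 Hh.
  assert (h1 : Rabs h < d) by (eapply Rlt_le_trans; [exact Hh | apply Rmin_l]).
  assert (h2 : Rabs h < eps / (M + 1)) by (eapply Rlt_le_trans; [exact Hh | apply Rmin_r]).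
  specialize (H h h1).
  replace ((f (x + h) - f x) / h - l) with ((f (x + h) - f x - l * h) / h) by (field; auto).
  unfold Rdiv. rewrite Rabs_mult, Rabs_inv.
  assert (P : 0 < Rabs h) by now apply Rabs_pos_lt.
  apply (Rmult_lt_reg_r (Rabs h)); auto. rewrite Rmult_assoc, Rinv_l, Rmult_1_r by lra.
  eapply Rle_lt_trans; [exact H|].
  apply (Rmult_lt_compat_l (M + 1)) in h2; [|lra].
  replace ((M + 1) * (eps / (M + 1))) with eps in h2 by (field; lra).
  rewrite <- (pow2_abs h). nra.
Qed.

Lemma chol_cder f z w t l : chol f (z + RtoC t * w)%C l ->
  cder (fun u => f (z + RtoC u * w)%C) t (w * l)%C.
Proof.
  intros (M & d & HM & Hd & H).
  pose proof (Cmod_ge_0 w).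
  assert (K : forall h, Rabs h < d / (Cmod w + 1) ->
    Cmod (f (z + RtoC (t + h) * w) - f (z + RtoC t * w) - RtoC h * (w * l))%C
     <= M * Cmod w ^ 2 * h ^ 2).
  { intros h Hh. specialize (H (RtoC h * w)%C).
    rewrite Cmod_mult, Cmod_R in H.
    replace (z + RtoC (t + h) * w)%C with (z + RtoC t * w + RtoC h * w)%C
      by (rewrite RtoC_plus; ring).
    replace (RtoC h * (w * l))%C with (l * (RtoC h * w))%C by ring.
    eapply Rle_trans.
    - apply H. apply Rle_lt_trans with ((Cmod w + 1) * Rabs h); [pose proof (Rabs_pos h); nra|].
      apply (Rmult_lt_compat_l (Cmod w + 1)) in Hh; [|lra].
      replace ((Cmod w + 1) * (d / (Cmod w + 1))) with d in Hh by (field; lra). exact Hh.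
    - rewrite Rpow_mult_distr, pow2_abs. right; ring. }
  assert (P : 0 <= M * Cmod w ^ 2) by (apply Rmult_le_pos; [lra | apply pow2_ge_0]).
  assert (Q : 0 < d / (Cmod w + 1)) by (apply Rdiv_lt_0_compat; lra).
  split; apply (is_derive_quad _ _ _ _ _ P Q); intros h Hh; specialize (K h Hh).
  - eapply Rle_trans; [|exact K]. eapply Rle_trans; [|apply re_le_Cmod].
    right. f_equal. rewrite !Re_minus, (Re_mult (RtoC h)), Re_RtoC, Im_RtoC. ring.
  - eapply Rle_trans; [|exact K]. eapply Rle_trans; [|apply im_le_Cmod].
    right. f_equal. rewrite !Im_minus, (Im_mult (RtoC h)), Re_RtoC, Im_RtoC. ring.
Qed.

(** * Holomorphic functions in real coordinates and Cauchy's theorem *)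

Definition Cpt (x y : R) : C := (x, y).

Lemma chol_cder_re f x y l : chol f (Cpt x y) l -> cder (fun u => f (Cpt u y)) x l.
Proof.
  intros H. eapply cder_eq; [|apply Cmult_1_l].
  eapply cder_ext; [|apply chol_cder with (f := f) (z := Cpt 0 y) (w := RtoC 1) (t := x)].
  - intros u. cbv beta. f_equal. apply Ceq; simpl; ring.
  - replace (Cpt 0 y + RtoC x * 1)%C with (Cpt x y); auto. apply Ceq; simpl; ring.
Qed.

Lemma chol_cder_im f x y l : chol f (Cpt x y) l -> cder (fun v => f (Cpt x v)) y (Ci * l)%C.
Proof.
  intros H.
  eapply cder_ext; [|apply chol_cder with (f := f) (z := Cpt x 0) (w := Ci) (t := y)].
  - intros u. cbv beta. f_equal. apply Ceq; simpl; ring.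
  - replace (Cpt x 0 + RtoC y * Ci)%C with (Cpt x y); auto. apply Ceq; simpl; ring.
Qed.

Lemma chol_ccont2 f x y l : chol f (Cpt x y) l -> ccont2 (fun u v => f (Cpt u v)) x y.
Proof.
  intros H.
  assert (K : forall eps : posreal, exists d : posreal, forall u v, Rabs (u - x) < d -> Rabs (v - y) < d ->
    Cmod (f (Cpt u v) - f (Cpt x y))%C < eps).
  { intros eps. destruct (chol_ball _ _ _ eps H (cond_pos eps)) as (d & Hd & K).
    assert (Hd2 : 0 < d / 2) by lra. exists (mkposreal _ Hd2). simpl. intros u v Hu Hv.
    apply K. eapply Rle_lt_trans; [apply Cmod_le_ReIm|].
    change (Rabs (u - x) + Rabs (v - y) < d). lra. }
  split; intros eps; destruct (K eps) as (d & Kd); exists d; intros u v Hu Hv;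
  specialize (Kd u v Hu Hv).
  - eapply Rle_lt_trans; [|exact Kd]. eapply Rle_trans; [|apply re_le_Cmod]. right; reflexivity.
  - eapply Rle_lt_trans; [|exact Kd]. eapply Rle_trans; [|apply im_le_Cmod]. right; reflexivity.
Qed.

(** Cauchy's theorem on a rectangle: the left-hand side as a function of [b] has derivative
    [\int_c^d f' (b + iv) dv = -i (f (b + id) - f (b + ic))]. *)
Lemma Cauchy_rectangle (f f' f'' : C -> C) a b c d r : a <= b -> c <= d -> 0 < r ->
  (forall x y, a - r < x < b + r -> c - r < y < d + r ->
     chol f (Cpt x y) (f' (Cpt x y)) /\ chol f' (Cpt x y) (f'' (Cpt x y))) ->
  (Ci * (CI (fun v => f (Cpt b v)) c d - CI (fun v => f (Cpt a v)) c d))%C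
  = (CI (fun u => f (Cpt u d)) a b - CI (fun u => f (Cpt u c)) a b)%C.
Proof.
  intros Hab Hcd Hr H.
  assert (D : forall x, a <= x <= b -> cder (fun u => CI (fun v => f (Cpt u v)) c d) x
     (CI (fun v => f' (Cpt x v)) c d)).
  { intros x Hx. apply cder_CI_param with (F := fun u v => f (Cpt u v))
      (F' := fun u v => f' (Cpt u v)) (r := r); auto.
    - intros y t Hy Ht. apply chol_cder_re, H; auto. apply Rabs_def2 in Hy. lra.
    - intros t Ht. apply chol_ccont2 with (l := f'' (Cpt x t)). apply H; lra.
    - intros y t Hy Ht. eapply cder_ccont, chol_cder_im, H; [|lra]. apply Rabs_def2 in Hy. lra. }
  assert (E : forall x, a <= x <= b ->
    CI (fun v => f' (Cpt x v)) c d = (- Ci * (f (Cpt x d) - f (Cpt x c)))%C).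
  { intros x Hx.
    assert (E1 : CI (fun v => Ci * f' (Cpt x v))%C c d = (f (Cpt x d) - f (Cpt x c))%C).
    { apply (CI_FTC (fun v => f (Cpt x v))); auto.
      - intros y Hy. apply chol_cder_im, H; lra.
      - intros y Hy. apply ccont_mult; [apply ccont_const|].
        eapply cder_ccont, chol_cder_im, H; lra. }
    rewrite CI_scal in E1.
    - rewrite <- E1. generalize (CI (fun v => f' (Cpt x v)) c d). intros Z; cring.
    - apply exCI_cont; auto. intros y Hy. eapply cder_ccont, chol_cder_im, H; lra. }
  assert (X : forall y, c <= y <= d -> exCI (fun u => f (Cpt u y)) a b).
  { intros y Hy. apply exCI_cont; auto. intros u Hu. eapply cder_ccont, chol_cder_re, H; lra. }
  rewrite <- (CI_FTC (fun u => CI (fun v => f (Cpt u v)) c d)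
     (fun x => (- Ci * (f (Cpt x d) - f (Cpt x c)))%C) a b); auto.
  - rewrite CI_scal by (apply exCI_minus; apply X; lra).
    rewrite CI_minus by (apply X; lra).
    generalize (CI (fun u => f (Cpt u d)) a b), (CI (fun u => f (Cpt u c)) a b).
    intros Z W; cring.
  - intros x Hx. rewrite <- E; auto.
  - intros x Hx. apply ccont_mult; [apply ccont_const|].
    apply ccont_minus; eapply cder_ccont, chol_cder_re, H; lra.
Qed.

(** * Limits of complex sequences *)

Definition clim (u : nat -> C) (l : C) : Prop :=
  forall eps, 0 < eps -> exists N, forall n, (N <= n)%nat -> Cmod (u n - l)%C <= eps.

Lemma clim_bound u l z B : clim u l ->
  (exists N, forall n, (N <= n)%nat -> Cmod (u n - z)%C <= B) -> Cmod (l - z)%C <= B.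
Proof.
  intros H [N HN]. apply le_epsilon. intros eps He.
  destruct (H eps He) as [N' HN'].
  specialize (HN (max N N') (Nat.le_max_l _ _)). specialize (HN' (max N N') (Nat.le_max_r _ _)).
  replace (l - z)%C with ((u (max N N') - z) - (u (max N N') - l))%C by ring.
  eapply Rle_trans; [apply Cmod_minus_le|]. lra.
Qed.

Lemma clim_unique u l m : clim u l -> clim u m -> l = m.
Proof.
  intros H K. assert (E : Cmod (l - m)%C <= 0).
  { apply le_epsilon. intros eps He. rewrite Rplus_0_l.
    apply (clim_bound u); auto. }
  assert (F : (l - m)%C = RtoC 0) by (apply Cmod_eq_0; pose proof (Cmod_ge_0 (l - m)%C); lra).
  replace l with (l - m + m)%C by ring. rewrite F. ring.
Qed.

Lemma clim_ReIm u l : is_lim_seq (fun n => Re (u n)) (Re l) -> is_lim_seq (fun n => Im (u n)) (Im l) ->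
  clim u l.
Proof.
  intros A B eps He.
  apply is_lim_seq_spec in A; apply is_lim_seq_spec in B.
  assert (He2 : 0 < eps / 2) by lra.
  destruct (A (mkposreal _ He2)) as [N HN]; destruct (B (mkposreal _ He2)) as [N' HN'].
  exists (max N N'). intros n Hn.
  eapply Rle_trans; [apply Cmod_le_ReIm|].
  specialize (HN n). specialize (HN' n). simpl in HN, HN'.
  rewrite Re_minus, Im_minus.
  assert (Rabs (Re (u n) - Re l) < eps / 2) by (apply HN; lia).
  assert (Rabs (Im (u n) - Im l) < eps / 2) by (apply HN'; lia). lra.
Qed.

(** The limit is spelled out with [Lim_seq] so that, for partial integrals, it is literally the
    value of [Lap]. *)
Lemma clim_cauchy u : (forall eps, 0 < eps -> exists N, forall n m, (N <= n)%nat -> (N <= m)%nat ->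
    Cmod (u n - u m)%C <= eps) ->
  clim u (real (Lim_seq (fun n => Re (u n))), real (Lim_seq (fun n => Im (u n)))).
Proof.
  intros H.
  assert (K : forall p : C -> R, (forall z, Rabs (p z) <= Cmod z) -> (forall z w, p (z - w)%C = p z - p w) ->
     is_lim_seq (fun n => p (u n)) (real (Lim_seq (fun n => p (u n))))).
  { intros p Hp Hm. apply Lim_seq_correct', ex_lim_seq_cauchy_corr.
    intros eps. assert (He2 : 0 < eps / 2) by (pose proof (cond_pos eps); lra).
    destruct (H _ He2) as [N HN]. exists N. intros n m Hn Hm'.
    rewrite <- Hm. eapply Rle_lt_trans; [apply Hp|].
    eapply Rle_lt_trans; [apply HN; assumption|]. pose proof (cond_pos eps); lra. }
  apply clim_ReIm; apply K; first [apply re_le_Cmod | apply im_le_Cmod | reflexivity].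
Qed.

Lemma clim_ext u v l : (forall n, u n = v n) -> clim u l -> clim v l.
Proof. intros E H eps He. destruct (H eps He) as [N HN]. exists N. intros; rewrite <- E; auto. Qed.

Lemma clim_const z : clim (fun _ => z) z.
Proof.
  intros eps He. exists O. intros _ _. replace (z - z)%C with (RtoC 0) by ring. rewrite Cmod_0. lra.
Qed.

Lemma clim_plus u v l m : clim u l -> clim v m -> clim (fun n => u n + v n)%C (l + m)%C.
Proof.
  intros H K eps He. destruct (H (eps / 2)) as [N HN]; [lra|]. destruct (K (eps / 2)) as [N' HN']; [lra|].
  exists (max N N'). intros n Hn.
  replace (u n + v n - (l + m))%C with ((u n - l) + (v n - m))%C by ring.
  eapply Rle_trans; [apply Cmod_triangle|].
  specialize (HN n); specialize (HN' n).
  assert (Cmod (u n - l)%C <= eps / 2) by (apply HN; lia).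
  assert (Cmod (v n - m)%C <= eps / 2) by (apply HN'; lia). lra.
Qed.

Lemma clim_mult u v l m : clim u l -> clim v m -> clim (fun n => u n * v n)%C (l * m)%C.
Proof.
  intros H K eps He.
  set (D := Cmod l + Cmod m + 1).
  assert (HD : 0 < D) by (pose proof (Cmod_ge_0 l); pose proof (Cmod_ge_0 m); unfold D; lra).
  set (e := Rmin 1 (eps / D)).
  assert (He' : 0 < e) by (apply Rmin_glb_lt; [lra | apply Rdiv_lt_0_compat; assumption]).
  destruct (H e He') as [N HN]; destruct (K e He') as [N' HN'].
  exists (max N N'). intros n Hn.
  assert (A : Cmod (u n - l)%C <= e) by (apply HN; lia).
  assert (B : Cmod (v n - m)%C <= e) by (apply HN'; lia).
  replace (u n * v n - l * m)%C with ((u n - l) * (v n - m) + (l * (v n - m) + m * (u n - l)))%C by ring.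
  eapply Rle_trans; [apply Cmod_triangle|].
  eapply Rle_trans; [apply Rplus_le_compat_l, Cmod_triangle|].
  rewrite !Cmod_mult.
  assert (e1 : e <= 1) by apply Rmin_l.
  assert (eD : e * D <= eps).
  { apply Rle_trans with (eps / D * D); [apply Rmult_le_compat_r; [lra | apply Rmin_r] | right; field; lra]. }
  pose proof (Cmod_ge_0 l); pose proof (Cmod_ge_0 m);
  pose proof (Cmod_ge_0 (u n - l)%C); pose proof (Cmod_ge_0 (v n - m)%C).
  unfold D in *.
  assert (Cmod (u n - l)%C * Cmod (v n - m)%C <= e * 1) by (apply Rmult_le_compat; lra).
  assert (Cmod l * Cmod (v n - m)%C <= Cmod l * e) by (apply Rmult_le_compat_l; lra).
  assert (Cmod m * Cmod (u n - l)%C <= Cmod m * e) by (apply Rmult_le_compat_l; lra).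
  lra.
Qed.

(** * Taylor expansion of the exponential *)

(** The Taylor polynomial of [exp (t h)] of degree below [K]. The real variable [t] is kept apart
    from [h] so that remainders can be integrated in [t]. *)
Fixpoint texp (K : nat) (h : C) (t : R) : C :=
  match K with
  | O => RtoC 0
  | S k => (texp k h t + RtoC (t ^ k / INR (fact k)) * h ^ k)%C
  end.

Lemma is_derive_R_eq (f : R -> R) (x l m : R) : is_derive f x l -> l = m -> is_derive f x m.
Proof. intros H <-; exact H. Qed.

Lemma is_derive_pow_fact K t :
  is_derive (fun u => u ^ S K / INR (fact (S K))) t (t ^ K / INR (fact K)).
Proof.
  evar_last.
  - apply (is_derive_ext (fun u => / INR (fact (S K)) * u ^ S K)).
    { intros u. apply Rmult_comm. }
    apply is_derive_scal, is_derive_pow, is_derive_id.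
  - change (fact (S K)) with (S K * fact K)%nat. rewrite mult_INR.
    change (/ (INR (S K) * INR (fact K)) * (INR (S K) * 1 * t ^ K) = t ^ K / INR (fact K)).
    pose proof (INR_fact_neq_0 K). pose proof (not_0_INR (S K) ltac:(lia)). field; auto.
Qed.

Lemma cder_texp K h t : cder (texp (S K) h) t (h * texp K h t)%C.
Proof.
  induction K as [|K IH].
  - eapply cder_ext with (f := fun _ => RtoC 1).
    + intros u. simpl. cring || (apply Ceq; simpl; field).
    + eapply cder_eq; [apply cder_const|]. simpl. cring.
  - change (texp (S (S K)) h) with
      (fun t => (texp (S K) h t + RtoC (t ^ S K / INR (fact (S K))) * h ^ S K)%C).
    eapply cder_eq.
    + apply cder_plus; [exact IH|].
      eapply cder_ext with (f := fun t => (h ^ S K * RtoC (t ^ S K / INR (fact (S K))))%C);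
        [intros; ring|].
      apply cder_scal. apply cder_RtoC with (l := t ^ K / INR (fact K)).
      apply is_derive_pow_fact.
    + simpl. ring.
Qed.

Lemma texp_0 K h : texp (S K) h 0 = RtoC 1.
Proof.
  induction K as [|K IH].
  - simpl. apply Ceq; simpl; field.
  - change (texp (S (S K)) h 0) with (texp (S K) h 0 + RtoC (0 ^ S K / INR (fact (S K))) * h ^ S K)%C.
    rewrite IH. replace (0 ^ S K / INR (fact (S K))) with 0.
    + cring.
    + rewrite pow_i by lia. unfold Rdiv; ring.
Qed.

(** The remainder of order [K + 1] has derivative [h] times the remainder of order [K], so
    integrating from 0 gives the induction step. The fixed [U] keeps the exponential factor constant
    under the integral. *)
Lemma Cexp_texp K h U t : 0 <= t <= U ->
  Cmod (Cexp (RtoC t * h) - texp K h t)%C <= t ^ K / INR (fact K) * Cmod h ^ K * exp (U * Cmod h).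
Proof.
  revert t. induction K as [|K IH]; intros t Ht.
  - simpl. replace (Cexp (RtoC t * h) - RtoC 0)%C with (Cexp (RtoC t * h)) by cring.
    rewrite Cmod_Cexp. replace (1 / 1 * 1 * exp (U * Cmod h)) with (exp (U * Cmod h)) by field.
    assert (Re (RtoC t * h)%C <= U * Cmod h).
    { rewrite Re_mult, Re_RtoC, Im_RtoC. pose proof (re_le_Cmod h) as B. apply Rabs_le_between in B.
      pose proof (Cmod_ge_0 h). nra. }
    destruct (Rle_lt_or_eq_dec _ _ H); [left; now apply exp_increasing | right; congruence].
  - set (F := fun t => (Cexp (RtoC t * h) - texp (S K) h t)%C).
    set (F' := fun t => (h * (Cexp (RtoC t * h) - texp K h t))%C).
    assert (DF : forall x, cder F x (F' x)).
    { intros x. unfold F, F'. eapply cder_eq.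
      - apply cder_minus; [|apply cder_texp]. apply cder_Cexp.
        eapply cder_ext with (f := fun t => (h * RtoC t)%C); [intros; ring|].
        apply cder_scal, cder_RtoC. apply is_derive_id.
      - unfold one; simpl. cring. }
    assert (CF : forall x, ccont F' x).
    { intros x. unfold F'. apply ccont_mult; [apply ccont_const|]. apply ccont_minus.
      - apply ccont_Cexp, ccont_mult; [|apply ccont_const]. apply ccont_RtoC, continuous_id.
      - destruct K; [apply ccont_const | eapply cder_ccont, cder_texp]. }
    assert (E : (Cexp (RtoC t * h) - texp (S K) h t)%C = CI F' 0 t).
    { rewrite (CI_FTC F F') by (intros; auto; lra). unfold F. rewrite texp_0.
      replace (RtoC 0 * h)%C with (RtoC 0) by ring. rewrite Cexp_0. ring. }
    rewrite E.
    assert (G : forall x, continuous (fun x => (Cmod h ^ S K * exp (U * Cmod h) / INR (fact K)) * x ^ K) x).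
    { intros x. apply (continuous_scal_r _ (fun x => x ^ K)).
      apply (ex_derive_continuous (V := R_NormedModule)). eexists. apply is_derive_pow, is_derive_id. }
    eapply Rle_trans.
    { apply (CI_norm_le F' (fun x => (Cmod h ^ S K * exp (U * Cmod h) / INR (fact K)) * x ^ K)).
      - lra.
      - apply exCI_cont; auto; lra.
      - apply ex_RInt_cont; auto; lra.
      - intros x Hx. unfold F'. rewrite Cmod_mult.
        specialize (IH x ltac:(lra)).
        apply (Rmult_le_compat_l (Cmod h)) in IH; [|apply Cmod_ge_0].
        eapply Rle_trans; [exact IH|]. right. simpl. field. apply INR_fact_neq_0. }
    right.
    rewrite (RInt_FTC (fun x => (Cmod h ^ S K * exp (U * Cmod h)) * (x ^ S K / INR (fact (S K))))).
    + rewrite pow_i by lia. field. apply INR_fact_neq_0.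
    + lra.
    + intros x Hx. apply (is_derive_R_eq _ _ (Cmod h ^ S K * exp (U * Cmod h) * (x ^ K / INR (fact K)))).
      * apply is_derive_scal, is_derive_pow_fact.
      * field. apply INR_fact_neq_0.
    + intros; apply G.
Qed.

Lemma Cexp_quad h : Cmod (Cexp h - 1 - h)%C <= Cmod h ^ 2 * exp (Cmod h).
Proof.
  pose proof (Cexp_texp 2 h 1 1 ltac:(lra)) as H.
  replace (RtoC 1 * h)%C with h in H by ring.
  replace (Cexp h - 1 - h)%C with (Cexp h - texp 2 h 1)%C.
  - eapply Rle_trans; [exact H|]. rewrite Rmult_1_l. simpl.
    pose proof (exp_pos (Cmod h)). pose proof (Cmod_ge_0 h).
    apply Rmult_le_compat_r; [lra|]. nra.
  - apply Ceq; simpl; field.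
Qed.

Lemma chol_Cexp z : chol Cexp z (Cexp z).
Proof.
  exists (Cmod (Cexp z) * exp 1), 1. repeat split; [|lra|].
  - apply Rmult_le_pos; [apply Cmod_ge_0 | left; apply exp_pos].
  - intros h Hh. rewrite Cexp_plus.
    replace (Cexp z * Cexp h - Cexp z - Cexp z * h)%C with (Cexp z * (Cexp h - 1 - h))%C by ring.
    rewrite Cmod_mult, Rmult_assoc. apply Rmult_le_compat_l; [apply Cmod_ge_0|].
    eapply Rle_trans; [apply Cexp_quad|]. rewrite (Rmult_comm (exp 1)).
    apply Rmult_le_compat_l; [apply pow2_ge_0|]. left; now apply exp_increasing.
Qed.

(** * Laplace transforms *)

Definition lint (g : R -> C) (p : C) (u : R) : C := (Cexp (- (p * RtoC u)) * g u)%C.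

(** [\int_0^oo e^(-pu) g(u) du], along integer upper limits; [Lim_seq] makes it total, and it is only used
    on the half-plane of convergence. *)
Definition Lap (g : R -> C) (p : C) : C :=
  (real (Lim_seq (fun n => Re (CI (lint g p) 0 (INR n)))),
   real (Lim_seq (fun n => Im (CI (lint g p) 0 (INR n))))).

Definition lapdom (g : R -> C) (M a : R) : Prop :=
  0 <= M /\ (forall u, 0 <= u -> ccont g u) /\ (forall u, 0 <= u -> Cmod (g u) <= M * exp (a * u)).

Lemma ccont_lint g M a p u : lapdom g M a -> 0 <= u -> ccont (lint g p) u.
Proof.
  intros (_ & H & _) Hu. apply ccont_mult; auto.
  apply ccont_Cexp, ccont_opp, ccont_mult; [apply ccont_const | apply ccont_RtoC, continuous_id].
Qed.

Lemma exCI_lint g M a p U V : lapdom g M a -> 0 <= U <= V -> exCI (lint g p) U V.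
Proof. intros H HU. apply exCI_cont; [lra|]. intros; eapply ccont_lint; eauto; lra. Qed.

Lemma Cmod_lint g M a p u : lapdom g M a -> 0 <= u ->
  Cmod (lint g p u) <= M * exp (- (Re p - a) * u).
Proof.
  intros (HM & _ & H) Hu. unfold lint. rewrite Cmod_mult, Cmod_Cexp.
  replace (Re (- (p * RtoC u))%C) with (- Re p * u) by (creim; ring).
  replace (- (Re p - a) * u) with (- Re p * u + a * u) by ring. rewrite exp_plus.
  specialize (H u Hu). pose proof (exp_pos (- Re p * u)). nra.
Qed.

Lemma continuous_exp_lin k x : continuous (fun u => exp (k * u)) x.
Proof.
  apply (ex_derive_continuous (V := R_NormedModule)). auto_derive; auto.
Qed.

Lemma RInt_exp_lin k K U V : 0 < k -> U <= V ->
  @eq R (RInt (fun u => K * exp (- k * u)) U V) (K / k * (exp (- k * U) - exp (- k * V))).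
Proof.
  intros Hk HUV. rewrite (RInt_FTC (fun u => K * (- / k * exp (- k * u)))).
  - field; lra.
  - exact HUV.
  - intros x _. auto_derive; auto. field; lra.
  - intros x _. apply (ex_derive_continuous (V := R_NormedModule)). auto_derive; auto.
Qed.

Lemma RInt_exp_lin_le k K U V : 0 < k -> 0 <= K -> U <= V ->
  RInt (fun u => K * exp (- k * u)) U V <= K / k * exp (- k * U).
Proof.
  intros Hk HK HUV. rewrite RInt_exp_lin by assumption.
  pose proof (exp_pos (- k * V)).
  apply Rmult_le_compat_l; [|lra]. apply Rdiv_le_0_compat; lra.
Qed.

Lemma ex_RInt_exp_lin k K U V : U <= V -> ex_RInt (fun u => K * exp (- k * u)) U V.
Proof.
  intros. apply ex_RInt_cont; auto. intros x _.
  apply (ex_derive_continuous (V := R_NormedModule)). auto_derive; auto.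
Qed.

Lemma CI_exp_bound f K k U V : 0 < k -> 0 <= K -> U <= V -> exCI f U V ->
  (forall u, U <= u <= V -> Cmod (f u) <= K * exp (- k * u)) ->
  Cmod (CI f U V) <= K / k * exp (- k * U).
Proof.
  intros Hk HK HUV X H. eapply Rle_trans.
  - apply (CI_norm_le f (fun u => K * exp (- k * u))); auto. now apply ex_RInt_exp_lin.
  - now apply RInt_exp_lin_le.
Qed.

Lemma exp_small k K eps : 0 < k -> 0 < eps -> exists U0, 0 <= U0 /\
  forall U, U0 <= U -> K * exp (- k * U) <= eps.
Proof.
  intros Hk He. exists (Rabs K / (k * eps)).
  assert (P : 0 < k * eps) by (apply Rmult_lt_0_compat; assumption).
  split. { apply Rdiv_le_0_compat; [apply Rabs_pos | exact P]. }
  intros U HU. pose proof (Rle_abs K).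
  assert (Q : Rabs K <= k * eps * U).
  { apply (Rmult_le_compat_l (k * eps)) in HU; [|lra].
    replace (k * eps * (Rabs K / (k * eps))) with (Rabs K) in HU by (field; split; lra). exact HU. }
  pose proof (Rabs_pos K). pose proof (exp_pos (- k * U)).
  assert (E : k * U * exp (- k * U) <= 1).
  { replace (- k * U) with (- (k * U)) by ring. rewrite exp_Ropp.
    pose proof (exp_ineq1_le (k * U)). pose proof (exp_pos (k * U)).
    apply (Rmult_le_reg_r (exp (k * U))); auto. rewrite Rmult_assoc, Rinv_l by lra. lra. }
  apply Rle_trans with (k * eps * U * exp (- k * U)).
  - apply Rmult_le_compat_r; lra.
  - replace (k * eps * U * exp (- k * U)) with (eps * (k * U * exp (- k * U))) by ring.
    apply Rle_trans with (eps * 1); [apply Rmult_le_compat_l|]; lra.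
Qed.

Lemma Lap_clim g M a p : lapdom g M a -> a < Re p -> clim (fun n => CI (lint g p) 0 (INR n)) (Lap g p).
Proof.
  intros H Hp. apply clim_cauchy. intros eps He.
  set (k := Re p - a). assert (Hk : 0 < k) by (unfold k; lra).
  pose proof (proj1 H) as HM.
  destruct (exp_small k (M / k) eps Hk He) as (U0 & HU0 & HU).
  assert (key : forall n m, U0 <= INR n -> (n <= m)%nat ->
     Cmod (CI (lint g p) 0 (INR m) - CI (lint g p) 0 (INR n))%C <= eps).
  { intros n m Hn Hnm. apply le_INR in Hnm. pose proof (pos_INR n).
    rewrite <- (CI_Chasles (lint g p) 0 (INR n) (INR m));
      try (apply (exCI_lint g M a); auto; lra).
    replace (CI (lint g p) 0 (INR n) + CI (lint g p) (INR n) (INR m) - CI (lint g p) 0 (INR n))%C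
      with (CI (lint g p) (INR n) (INR m)) by ring.
    eapply Rle_trans; [|apply (HU (INR n)); exact Hn].
    apply CI_exp_bound; auto.
    - apply (exCI_lint g M a); auto; lra.
    - intros u Hu. apply (Cmod_lint g M a); auto; lra. }
  destruct (INR_unbounded U0) as [N HN].
  exists N. intros n m Hn Hm. apply le_INR in Hn as Hn'. apply le_INR in Hm as Hm'.
  destruct (Nat.le_ge_cases n m).
  - rewrite Cmod_minus_sym. apply key; auto; lra.
  - apply key; [lra | lia].
Qed.

Lemma Lap_tail g M a p U : lapdom g M a -> a < Re p -> 0 <= U ->
  Cmod (Lap g p - CI (lint g p) 0 U)%C <= M / (Re p - a) * exp (- (Re p - a) * U).
Proof.
  intros H Hp HU. eapply clim_bound; [eapply Lap_clim; eassumption|].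
  destruct (INR_unbounded U) as [N HN]. exists N. intros n Hn. apply le_INR in Hn.
  rewrite <- (CI_Chasles (lint g p) 0 U (INR n)) by (apply (exCI_lint g M a); auto; lra).
  replace (CI (lint g p) 0 U + CI (lint g p) U (INR n) - CI (lint g p) 0 U)%C
    with (CI (lint g p) U (INR n)) by ring.
  apply CI_exp_bound; try lra.
  - apply H.
  - apply (exCI_lint g M a); auto; lra.
  - intros u Hu. apply (Cmod_lint g M a); auto; lra.
Qed.

Lemma Lap_conv g M a p eps : lapdom g M a -> a < Re p -> 0 < eps ->
  exists U0, 0 <= U0 /\ forall U, U0 <= U -> Cmod (Lap g p - CI (lint g p) 0 U)%C <= eps.
Proof.
  intros H Hp He. destruct (exp_small (Re p - a) (M / (Re p - a)) eps ltac:(lra) He) as (U0 & H0 & HU).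
  exists U0. split; auto. intros U HU'. eapply Rle_trans; [apply (Lap_tail g M a); auto; lra|]. auto.
Qed.

Lemma Lap_norm g M a p : lapdom g M a -> a < Re p -> Cmod (Lap g p) <= M / (Re p - a).
Proof.
  intros H Hp. pose proof (Lap_tail g M a p 0 H Hp (Rle_refl 0)) as T.
  rewrite CI_point, Rmult_0_r, exp_0, Rmult_1_r in T.
  replace (Lap g p - 0)%C with (Lap g p) in T by cring. exact T.
Qed.

Lemma lapdom_weaken g M a M' a' : lapdom g M a -> M <= M' -> a <= a' -> lapdom g M' a'.
Proof.
  intros (HM & Hc & Hb) HMM Haa. split; [lra|]. split; [exact Hc|].
  intros u Hu. eapply Rle_trans; [apply Hb; exact Hu|].
  apply Rmult_le_compat; auto.
  - left; apply exp_pos.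
  - destruct (Rle_lt_or_eq_dec (a * u) (a' * u)) as [L|L]; [nra| |].
    + left; now apply exp_increasing.
    + rewrite L; lra.
Qed.

Lemma exp_lin_le x d : 0 < d -> x <= / d * exp (d * x).
Proof.
  intros Hd. pose proof (exp_ineq1_le (d * x)).
  apply (Rmult_le_reg_l d); auto. rewrite <- Rmult_assoc, Rinv_r, Rmult_1_l by lra. lra.
Qed.

Lemma lapdom_mul_u g M a d : 0 < d -> lapdom g M a ->
  lapdom (fun u => RtoC (- u) * g u)%C (M / d) (a + d).
Proof.
  intros Hd (HM & Hc & Hb). split; [apply Rdiv_le_0_compat; lra|]. split.
  - intros u Hu. apply ccont_mult; auto. apply ccont_RtoC.
    apply (continuous_opp (fun u : R => u)), continuous_id.
  - intros u Hu. rewrite Cmod_mult, Cmod_R, Rabs_Ropp, Rabs_pos_eq by exact Hu.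
    specialize (Hb u Hu). rewrite Rmult_plus_distr_r, exp_plus.
    pose proof (exp_lin_le u d Hd). pose proof (exp_pos (d * u)). pose proof (Cmod_ge_0 (g u)).
    replace (M / d * (exp (a * u) * exp (d * u))) with ((/ d * exp (d * u)) * (M * exp (a * u)))
      by (field; lra).
    apply Rmult_le_compat; auto.
Qed.

Lemma Lap_chol g M a p : lapdom g M a -> a < Re p ->
  chol (Lap g) p (Lap (fun u => RtoC (- u) * g u)%C p).
Proof.
  (* A quarter of the margin [Re p - a] absorbs each of the two factors [u], a third quarter absorbs
     [exp (|h| u)], and the last one keeps the integral convergent. *)
  intros H Hp. set (d := (Re p - a) / 4). assert (Hd : 0 < d) by (unfold d; lra).
  pose proof H as (HM & Hc & Hb).
  exists (M * (/ d * / d) / d), d. repeat split; auto.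
  { apply Rdiv_le_0_compat; auto. apply Rmult_le_pos; auto.
    apply Rmult_le_pos; left; now apply Rinv_0_lt_compat. }
  intros h Hh. apply le_epsilon. intros eps He.
  set (e := eps / (2 + Cmod h)). pose proof (Cmod_ge_0 h) as h0.
  assert (He' : 0 < e) by (apply Rdiv_lt_0_compat; lra).
  pose proof (re_le_Cmod h) as Rh. apply Rabs_le_between in Rh.
  assert (Hph : a < Re (p + h)%C) by (rewrite Re_plus; unfold d in *; lra).
  pose proof (lapdom_mul_u g M a d Hd H) as H1.
  assert (Hp1 : a + d < Re p) by (unfold d in *; lra).
  destruct (Lap_conv g M a p e H Hp He') as (U1 & P1 & Q1).
  destruct (Lap_conv g M a (p + h)%C e H Hph He') as (U2 & P2 & Q2).
  destruct (Lap_conv _ _ _ p e H1 Hp1 He') as (U3 & P3 & Q3).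
  set (U := Rmax U1 (Rmax U2 U3)).
  assert (A1 : U1 <= U) by apply Rmax_l.
  assert (A2 : U2 <= U) by (eapply Rle_trans; [apply Rmax_l | apply Rmax_r]).
  assert (A3 : U3 <= U) by (eapply Rle_trans; [apply Rmax_r | apply Rmax_r]).
  specialize (Q1 U A1); specialize (Q2 U A2); specialize (Q3 U A3).
  set (X := CI (lint g p) 0 U) in *. set (Y := CI (lint g (p + h)%C) 0 U) in *.
  set (Z := CI (lint (fun u => RtoC (- u) * g u)%C p) 0 U) in *.
  replace (Lap g (p + h) - Lap g p - Lap (fun u => RtoC (- u) * g u) p * h)%C with
    ((Lap g (p + h) - Y) - (Lap g p - X) - h * (Lap (fun u => RtoC (- u) * g u) p - Z)
      + (Y - X - h * Z))%C by ring.
  eapply Rle_trans; [apply Cmod_triangle|]. rewrite Rplus_comm. apply Rplus_le_compat.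
  2:{ eapply Rle_trans; [apply Cmod_minus_le|]. rewrite Cmod_mult.
      eapply Rle_trans; [apply Rplus_le_compat_r, Cmod_minus_le|].
      apply Rle_trans with (e * (2 + Cmod h)); [nra|]. unfold e; right; field; lra. }
  assert (EX : exCI (lint g p) 0 U) by (apply (exCI_lint g M a); auto; lra).
  assert (EY : exCI (lint g (p + h)%C) 0 U) by (apply (exCI_lint g M a); auto; lra).
  assert (EZ : exCI (lint (fun u => RtoC (- u) * g u)%C p) 0 U)
    by (eapply exCI_lint; [exact H1 | lra]).
  unfold X, Y, Z. rewrite <- CI_scal by exact EZ. rewrite <- CI_minus by assumption.
  rewrite <- CI_minus; [|apply exCI_minus; assumption | apply exCI_scal; assumption].
  eapply Rle_trans.
  { apply (CI_exp_bound _ (M * (/ d * / d) * Cmod h ^ 2) d); auto.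
    - repeat apply Rmult_le_pos; auto; try (left; now apply Rinv_0_lt_compat). lra.
    - lra.
    - apply exCI_minus; [apply exCI_minus | apply exCI_scal]; assumption.
    - intros u Hu. unfold lint.
      replace (Cexp (- ((p + h) * RtoC u)) * g u - Cexp (- (p * RtoC u)) * g u
         - h * (Cexp (- (p * RtoC u)) * (RtoC (- u) * g u)))%C
       with ((Cexp (- (p * RtoC u)) * g u) * (Cexp (- (h * RtoC u)) - 1 - - (h * RtoC u)))%C.
      2:{ replace (- ((p + h) * RtoC u))%C with (- (p * RtoC u) + - (h * RtoC u))%C by ring.
          rewrite Cexp_plus, RtoC_opp. ring. }
      rewrite Cmod_mult.
      assert (T := Cexp_quad (- (h * RtoC u))%C).
      rewrite Cmod_opp, Cmod_mult, Cmod_RtoC_pos in T by lra.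
      pose proof (Cmod_lint g M a p u H ltac:(lra)) as L. unfold lint in L.
      eapply Rle_trans.
      { apply Rmult_le_compat; [apply Cmod_ge_0 | apply Cmod_ge_0 | exact L | exact T]. }
      replace (- (Re p - a) * u) with (- d * u + (- d * u + (- d * u + - d * u)))
        by (unfold d; field).
      rewrite !exp_plus.
      pose proof (exp_lin_le u d Hd) as U2'.
      assert (Eh : exp (Cmod h * u) <= exp (d * u)).
      { destruct (Rle_lt_or_eq_dec (Cmod h * u) (d * u)) as [L'|L']; [nra| |].
        - left; now apply exp_increasing.
        - rewrite L'; lra. }
      replace (- d * u) with (- (d * u)) by ring. rewrite exp_Ropp.
      set (E := exp (d * u)) in *. assert (PE : 0 < E) by apply exp_pos.
      assert (iE : 0 < / E) by now apply Rinv_0_lt_compat.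
      assert (Hd' : 0 < / d) by now apply Rinv_0_lt_compat.
      apply Rle_trans with (M * (/ E * (/ E * (/ E * / E))) * (Cmod h ^ 2 * (/ d * E * (/ d * E)) * E)).
      + apply Rmult_le_compat_l.
        { repeat apply Rmult_le_pos; lra. }
        rewrite Rpow_mult_distr.
        apply Rmult_le_compat; auto.
        * apply Rmult_le_pos; apply pow2_ge_0.
        * left; apply exp_pos.
        * apply Rmult_le_compat_l; [apply pow2_ge_0|]. simpl. rewrite Rmult_1_r.
          apply Rmult_le_compat; lra.
      + right. field. lra. }
  rewrite Rmult_0_r, exp_0. right. field. lra.
Qed.

Lemma Lap_ext g h p : (forall u, 0 <= u -> g u = h u) -> Lap g p = Lap h p.
Proof.
  intros E. unfold Lap.
  assert (K : forall n, CI (lint g p) 0 (INR n) = CI (lint h p) 0 (INR n)).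
  { intros n. apply CI_ext; [apply pos_INR|]. intros u Hu. unfold lint. rewrite E; auto; lra. }
  f_equal; f_equal; apply Lim_seq_ext; intros n; now rewrite K.
Qed.

Lemma Lap_plus g h M a N b p : lapdom g M a -> lapdom h N b -> a < Re p -> b < Re p ->
  Lap (fun u => g u + h u)%C p = (Lap g p + Lap h p)%C.
Proof.
  intros G H Ha Hb. apply (clim_unique (fun n => CI (lint (fun u => g u + h u)%C p) 0 (INR n))).
  - apply (Lap_clim _ (M + N) (Rmax a b)); [|now apply Rmax_lub_lt].
    pose proof (lapdom_weaken _ _ _ M (Rmax a b) G (Rle_refl _) (Rmax_l _ _)) as (A1 & A2 & A3).
    pose proof (lapdom_weaken _ _ _ N (Rmax a b) H (Rle_refl _) (Rmax_r _ _)) as (B1 & B2 & B3).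
    split; [lra|]. split.
    + intros; apply ccont_plus; auto.
    + intros u Hu. eapply Rle_trans; [apply Cmod_triangle|]. specialize (A3 u Hu); specialize (B3 u Hu). lra.
  - eapply clim_ext; [|apply clim_plus; eapply Lap_clim; eassumption].
    intros n. cbv beta. pose proof (pos_INR n). symmetry.
    rewrite <- CI_plus; [|eapply exCI_lint; eauto; lra | eapply exCI_lint; eauto; lra].
    apply CI_ext; auto. intros u Hu. unfold lint. ring.
Qed.

Lemma Lap_scal c g M a p : lapdom g M a -> a < Re p -> Lap (fun u => c * g u)%C p = (c * Lap g p)%C.
Proof.
  intros G Ha. apply (clim_unique (fun n => CI (lint (fun u => c * g u)%C p) 0 (INR n))).
  - apply (Lap_clim _ (Cmod c * M) a); auto. destruct G as (A & B & D).
    split; [apply Rmult_le_pos; auto; apply Cmod_ge_0|]. split.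
    + intros; apply ccont_mult; auto using ccont_const.
    + intros u Hu. rewrite Cmod_mult, Rmult_assoc. apply Rmult_le_compat_l; auto using Cmod_ge_0.
  - eapply clim_ext; [|apply clim_mult; [apply clim_const | eapply Lap_clim; eassumption]].
    intros n. cbv beta. pose proof (pos_INR n). symmetry.
    rewrite <- CI_scal; [|eapply exCI_lint; eauto; lra].
    apply CI_ext; auto. intros u Hu. unfold lint. ring.
Qed.

Lemma Lap_shift g c p : Lap (fun u => Cexp (c * RtoC u) * g u)%C p = Lap g (p - c)%C.
Proof.
  unfold Lap.
  assert (K : forall n, CI (lint (fun u => Cexp (c * RtoC u) * g u)%C p) 0 (INR n)
     = CI (lint g (p - c)%C) 0 (INR n)).
  { intros n. apply CI_ext; [apply pos_INR|]. intros u Hu. unfold lint.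
    replace (- ((p - c) * RtoC u))%C with (- (p * RtoC u) + c * RtoC u)%C by ring.
    rewrite Cexp_plus. ring. }
  f_equal; f_equal; apply Lim_seq_ext; intros n; now rewrite K.
Qed.

Lemma Lap_by_parts g g' M a M' a' p : lapdom g M a -> lapdom g' M' a' -> a < Re p -> a' < Re p ->
  (forall u, 0 <= u -> cder g u (g' u)) ->
  Lap g' p = (p * Lap g p - g 0)%C.
Proof.
  intros G G' Ha Ha' D.
  apply (clim_unique (fun n => CI (lint g' p) 0 (INR n))). { eapply Lap_clim; eassumption. }
  intros eps He.
  pose proof (Cmod_ge_0 p) as Cp.
  assert (e2 : 0 < eps / (2 + Cmod p)) by (apply Rdiv_lt_0_compat; lra).
  destruct (Lap_conv g M a p _ G Ha e2) as (U1 & _ & Q1).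
  destruct (exp_small (Re p - a) M _ ltac:(lra) e2) as (U2 & _ & Q2).
  destruct (INR_unbounded (Rmax U1 U2)) as [N HN]. exists N. intros n Hn. apply le_INR in Hn.
  pose proof (Rmax_l U1 U2); pose proof (Rmax_r U1 U2). pose proof (pos_INR n).
  specialize (Q1 (INR n) ltac:(lra)). specialize (Q2 (INR n) ltac:(lra)).
  assert (EG : exCI (lint g p) 0 (INR n)) by (eapply exCI_lint; eauto; lra).
  assert (EG' : exCI (lint g' p) 0 (INR n)) by (eapply exCI_lint; eauto; lra).
  assert (E : (CI (lint g' p) 0 (INR n) - p * CI (lint g p) 0 (INR n))%C = (lint g p (INR n) - g 0)%C).
  { rewrite <- CI_scal by assumption.
    rewrite <- CI_minus; [|assumption | apply exCI_scal; assumption].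
    rewrite (CI_FTC (lint g p)); auto.
    - unfold lint at 2. replace (- (p * RtoC 0))%C with (RtoC 0) by ring. rewrite Cexp_0. ring.
    - intros x Hx. unfold lint. eapply cder_eq.
      + apply cder_mult; [|apply D; lra]. apply cder_Cexp, cder_opp, cder_scal, cder_RtoC, is_derive_id.
      + unfold one; simpl. cring.
    - intros x Hx. apply ccont_minus; [eapply ccont_lint; eauto; lra|].
      apply ccont_mult; [apply ccont_const | eapply ccont_lint; eauto; lra]. }
  replace (CI (lint g' p) 0 (INR n)) with
    (p * CI (lint g p) 0 (INR n) + (CI (lint g' p) 0 (INR n) - p * CI (lint g p) 0 (INR n)))%C by ring.
  rewrite E.
  replace (p * CI (lint g p) 0 (INR n) + (lint g p (INR n) - g 0) - (p * Lap g p - g 0))%C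
    with (lint g p (INR n) - p * (Lap g p - CI (lint g p) 0 (INR n)))%C by ring.
  eapply Rle_trans; [apply Cmod_minus_le|]. rewrite Cmod_mult.
  pose proof (Cmod_lint g M a p (INR n) G ltac:(lra)) as L.
  set (e := eps / (2 + Cmod p)) in *.
  apply Rle_trans with (e + Cmod p * e); [nra|].
  apply Rle_trans with (e * (2 + Cmod p)); [nra|]. unfold e; right; field; lra.
Qed.

(** * Uniqueness of analytic continuation along a horizontal line *)

Fixpoint Csum (a : nat -> C) (n : nat) : C :=
  match n with O => RtoC 0 | S k => (Csum a k + a k)%C end.

Lemma Csum_ext a b n : (forall k, (k < n)%nat -> a k = b k) -> Csum a n = Csum b n.
Proof.
  induction n as [|n IH]; intros H; simpl; auto. rewrite IH, H; auto.
Qed.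

Lemma sum_n_Csum (a : nat -> C) n : @sum_n C_AbelianMonoid a n = Csum a (S n).
Proof.
  induction n as [|n IH].
  - rewrite sum_O. simpl. cring.
  - rewrite sum_Sn, IH. reflexivity.
Qed.

Lemma is_series_clim (a : nat -> C) (l : C) :
  @is_series C_AbsRing C_NormedModule a l -> clim (Csum a) l.
Proof.
  intros H eps He.
  assert (He2 : 0 < eps / 2) by lra.
  assert (L : locally (T := C_UniformSpace) l (fun z => Cmod (z - l)%C < eps)).
  { exists (mkposreal _ He2). intros z Hz.
    apply (C_NormedModule_mixin_compat2 l z (mkposreal _ He2)) in Hz.
    eapply Rlt_le_trans; [exact Hz|]. simpl.
    assert (sqrt 2 <= 2). { rewrite <- (sqrt_Rsqr 2) at 2 by lra. apply sqrt_le_1_alt. unfold Rsqr; lra. }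
    nra. }
  destruct (H _ L) as [N HN]. exists (S N). intros n Hn. destruct n as [|n]; [lia|].
  rewrite <- sum_n_Csum. left. apply HN. lia.
Qed.

Lemma clim_is_series (a : nat -> C) (l : C) :
  clim (Csum a) l -> @is_series C_AbsRing C_NormedModule a l.
Proof.
  intros H P [eps HP].
  assert (He2 : 0 < eps / 2) by (pose proof (cond_pos eps); lra).
  destruct (H _ He2) as [N HN]. exists N. intros n Hn.
  change (@sum_n C_AbelianMonoid) with (@sum_n C_AbelianMonoid).
  apply HP. apply C_NormedModule_mixin_compat1.
  eapply Rle_lt_trans; [|apply Rlt_eps2_eps, cond_pos].
  specialize (HN (S n) ltac:(lia)). rewrite <- sum_n_Csum in HN. exact HN.
Qed.

Lemma pow_n_RtoC (x : R) k : @pow_n C_Ring (RtoC x) k = RtoC (x ^ k).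
Proof.
  induction k as [|k IH]; [reflexivity|]. simpl pow_n. rewrite IH, RtoC_pow.
  change (RtoC x * RtoC x ^ k = RtoC (x * x ^ k))%C. rewrite RtoC_mult, RtoC_pow. reflexivity.
Qed.

Lemma pow_n_Cpow (h : C) k : @pow_n C_Ring h k = (h ^ k)%C.
Proof. induction k as [|k IH]; [reflexivity|]. simpl pow_n. rewrite IH. reflexivity. Qed.

(** * Power series expansions and analyticity of Laplace transforms *)

Lemma analytic_at_plus f g z : analytic_at f z -> analytic_at g z -> analytic_at (fun w => f w + g w)%C z.
Proof.
  intros (a & r & H) (b & r' & H').
  assert (P : 0 < Rmin r r') by (apply Rmin_glb_lt; apply cond_pos).
  exists (PS_plus a b), (mkposreal _ P). simpl. intros w Hw.
  apply (is_pseries_plus (K := C_AbsRing) (V := C_NormedModule)).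
  - apply H. eapply Rlt_le_trans; [exact Hw | apply Rmin_l].
  - apply H'. eapply Rlt_le_trans; [exact Hw | apply Rmin_r].
Qed.

Lemma analytic_at_scal c f z : analytic_at f z -> analytic_at (fun w => c * f w)%C z.
Proof.
  intros (a & r & H). exists (PS_scal (K := C_AbsRing) (V := C_NormedModule) c a), r. intros w Hw.
  apply (is_pseries_scal (K := C_AbsRing) (V := C_NormedModule)).
  - apply Cmult_comm.
  - now apply H.
Qed.

Lemma analytic_at_ext f g z : (forall w, f w = g w) -> analytic_at f z -> analytic_at g z.
Proof. intros E (a & r & H). exists a, r. intros w Hw. rewrite <- E. auto. Qed.

(** Writing [w = z + (w - z)], multiplication by [w - z] merely shifts the coefficients. *)
Lemma analytic_at_mul_id f z : analytic_at f z -> analytic_at (fun w => w * f w)%C z.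
Proof.
  intros A. apply analytic_at_ext with (f := fun w => (z * f w + (w - z) * f w)%C).
  { intros; ring. }
  apply analytic_at_plus; [now apply analytic_at_scal|].
  destruct A as (a & r & H). exists (PS_incr_1 (K := C_AbsRing) (V := C_NormedModule) a), r.
  intros w Hw. apply (is_pseries_incr_1 (K := C_AbsRing) (V := C_NormedModule)). now apply H.
Qed.

Lemma analytic_at_const c z : analytic_at (fun _ => c) z.
Proof.
  exists (fun n => match n with O => c | _ => RtoC 0 end), (mkposreal 1 Rlt_0_1). intros w _.
  apply clim_is_series.
  intros eps He. exists 1%nat. intros n Hn.
  replace (Csum _ n) with c.
  { replace (c - c)%C with (RtoC 0) by ring. rewrite Cmod_0. lra. }
  induction Hn as [|n Hn IH].
  - simpl. unfold scal; simpl. unfold mult; simpl. change (c = 0 + 1 * c)%C. cring.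
  - simpl Csum. rewrite <- IH. destruct n; [lia|].
    unfold scal; simpl. unfold mult; simpl.
    match goal with |- _ = Cplus _ (Cmult ?x _) => generalize x end. intros; cring.
Qed.

Lemma analytic_at_shift f b z : analytic_at f (z + b)%C -> analytic_at (fun w => f (w + b)%C) z.
Proof.
  intros (a & r & H). exists a, r. intros w Hw.
  replace (w - z)%C with (w + b - (z + b))%C by ring. apply H.
  replace (w + b - (z + b))%C with (w - z)%C by ring. exact Hw.
Qed.

Lemma pow_fact_le_exp x K : 0 <= x -> x ^ K / INR (fact K) <= exp x.
Proof.
  intros Hx. revert x Hx. induction K as [|K IH]; intros x Hx.
  - simpl. pose proof (exp_ineq1_le x). lra.
  - assert (D : forall y, is_derive (fun u => exp u - u ^ S K / INR (fact (S K))) y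
       (exp y - y ^ K / INR (fact K))).
    { intros y. apply (is_derive_minus exp (fun u => u ^ S K / INR (fact (S K)))).
      - apply is_derive_exp.
      - apply is_derive_pow_fact. }
    destruct (MVT_gen (fun u => exp u - u ^ S K / INR (fact (S K))) 0 x
      (fun y => exp y - y ^ K / INR (fact K))) as (c & Hc & E).
    + intros y _. apply D.
    + intros y _. apply derivable_continuous_pt. exists (exp y - y ^ K / INR (fact K)).
      apply is_derive_Reals, D.
    + rewrite Rmin_left, Rmax_right in Hc by lra.
      rewrite exp_0, pow_i in E by lia. specialize (IH c ltac:(lra)).
      unfold Rdiv in E at 2. rewrite Rmult_0_l in E.
      assert (0 <= (exp c - c ^ K / INR (fact K)) * (x - 0)) by (apply Rmult_le_pos; lra). lra.
Qed.

Lemma lapdom_mul g M a (f : R -> C) N b : 0 <= N -> lapdom g M a -> (forall u, 0 <= u -> ccont f u) ->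
  (forall u, 0 <= u -> Cmod (f u) <= N * exp (b * u)) -> lapdom (fun u => f u * g u)%C (N * M) (b + a).
Proof.
  intros HN (HM & Hc & Hb) Fc Fb. split; [now apply Rmult_le_pos|]. split.
  - intros u Hu. apply ccont_mult; auto.
  - intros u Hu. rewrite Cmod_mult, Rmult_plus_distr_r, exp_plus.
    replace (N * M * (exp (b * u) * exp (a * u))) with ((N * exp (b * u)) * (M * exp (a * u))) by ring.
    apply Rmult_le_compat; auto using Cmod_ge_0.
Qed.

Lemma ccont_texp K h u : ccont (texp K h) u.
Proof. destruct K; [apply ccont_const | eapply cder_ccont, cder_texp]. Qed.

Lemma pow_fact_bound d u K : 0 < d -> 0 <= u -> u ^ K / INR (fact K) <= (/ d) ^ K * exp (d * u).
Proof.
  intros Hd Hu. pose proof (pow_fact_le_exp (d * u) K ltac:(nra)) as H.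
  rewrite Rpow_mult_distr in H.
  apply (Rmult_le_compat_l ((/ d) ^ K)) in H; [|apply pow_le; left; now apply Rinv_0_lt_compat].
  eapply Rle_trans; [|exact H]. right. rewrite pow_inv. field.
  split; [apply INR_fact_neq_0 | apply pow_nonzero; lra].
Qed.

Lemma lapdom_pow_fact g M a d K h : 0 < d -> lapdom g M a ->
  lapdom (fun u => (RtoC (u ^ K / INR (fact K)) * h ^ K) * g u)%C ((/ d * Cmod h) ^ K * M) (d + a).
Proof.
  intros Hd G. apply lapdom_mul; auto.
  - apply pow_le, Rmult_le_pos; [left; now apply Rinv_0_lt_compat | apply Cmod_ge_0].
  - intros u Hu. apply ccont_mult; [|apply ccont_const]. apply ccont_RtoC.
    apply (ex_derive_continuous (V := R_NormedModule)). auto_derive; auto.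
  - intros u Hu. rewrite Cmod_mult, Cmod_RtoC_pos, Cmod_pow.
    2:{ apply Rdiv_le_0_compat; [now apply pow_le | apply INR_fact_lt_0]. }
    rewrite Rpow_mult_distr.
    replace ((/ d) ^ K * Cmod h ^ K * exp (d * u)) with ((/ d) ^ K * exp (d * u) * Cmod h ^ K) by ring.
    apply Rmult_le_compat_r; [apply pow_le, Cmod_ge_0|]. now apply pow_fact_bound.
Qed.

Lemma lapdom_texp g M a d K h : 0 < d -> lapdom g M a ->
  exists M', lapdom (fun u => texp K h u * g u)%C M' (d + a).
Proof.
  intros Hd G. induction K as [|K [M' IH]].
  - exists 0. simpl. split; [lra|]. split.
    + intros u Hu. apply ccont_mult; [apply ccont_const | apply G; auto].
    + intros u Hu. rewrite Cmod_mult, Cmod_0. lra.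
  - pose proof (lapdom_pow_fact g M a d K h Hd G) as P.
    exists (M' + ((/ d * Cmod h) ^ K * M)). destruct IH as (A1 & A2 & A3); destruct P as (B1 & B2 & B3).
    split; [lra|]. split.
    + intros u Hu. apply ccont_mult; [apply ccont_texp | apply G; auto].
    + intros u Hu. simpl texp. rewrite Cmult_plus_distr_r.
      eapply Rle_trans; [apply Cmod_triangle|]. specialize (A3 u Hu); specialize (B3 u Hu). lra.
Qed.

Lemma Cpow_opp_mul h K : ((- h) ^ K)%C = (h ^ K * (- (1)) ^ K)%C.
Proof. induction K as [|K IH]; simpl; [ring|]. rewrite IH. ring. Qed.

Lemma exp_le x y : x <= y -> exp x <= exp y.
Proof. intros [H|H]; [left; now apply exp_increasing | rewrite H; lra]. Qed.

Lemma geom_clim r K eps : 0 <= r < 1 -> 0 < eps -> exists N, forall n, (N <= n)%nat -> K * r ^ n <= eps.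
Proof.
  intros Hr He. destruct (pow_lt_1_zero r ltac:(rewrite Rabs_pos_eq; lra) (eps / (Rabs K + 1))) as [N HN].
  { apply Rdiv_lt_0_compat; auto. pose proof (Rabs_pos K); lra. }
  exists N. intros n Hn. specialize (HN n Hn). pose proof (Rabs_pos K). pose proof (Rle_abs K).
  assert (P : 0 <= r ^ n) by (apply pow_le; lra). rewrite Rabs_pos_eq in HN by exact P.
  apply Rle_trans with ((Rabs K + 1) * r ^ n); [apply Rmult_le_compat_r; lra|].
  apply (Rmult_lt_compat_l (Rabs K + 1)) in HN; [|lra].
  replace ((Rabs K + 1) * (eps / (Rabs K + 1))) with eps in HN by (field; lra). lra.
Qed.

(** Expanding [exp (-h u)] under the integral gives the coefficients [Lap ((-u)^k / k! g)]. The
    factor [u^K / K!] costs [d^(-K) exp (d u)], so for [|h| < d / 2] the remainder decays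
    geometrically; the remaining part of the margin pays for the exponentials. *)
Lemma analytic_at_Lap g M a p : lapdom g M a -> a < Re p -> analytic_at (Lap g) p.
Proof.
  intros G Hp. set (d := (Re p - a) / 4). assert (Hd : 0 < d) by (unfold d; lra).
  pose proof G as (HM & Gc & Gb).
  set (gk := fun k u => (RtoC (u ^ k / INR (fact k)) * (- (1)) ^ k * g u)%C).
  exists (fun k => Lap (gk k) p), (mkposreal (d / 2) ltac:(lra)). simpl. intros w Hw.
  set (h := (w - p)%C) in *.
  apply clim_is_series.
  assert (Hda : d + a < Re p) by (unfold d in *; lra).
  assert (S : forall K, Csum (fun k => h ^ k * Lap (gk k) p)%C K
     = Lap (fun u => texp K (- h) u * g u)%C p).
  { induction K as [|K IH].
    - simpl. rewrite (Lap_scal _ g M a) by auto. ring.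
    - simpl Csum. rewrite IH.
      pose proof (lapdom_pow_fact g M a d K (- (1))%C Hd G) as D1.
      pose proof (lapdom_pow_fact g M a d K (- h)%C Hd G) as D2.
      destruct (lapdom_texp g M a d K (- h)%C Hd G) as [M' D3].
      rewrite <- (Lap_scal _ _ _ _ _ D1) by exact Hda.
      simpl texp.
      rewrite (Lap_ext (fun u => (texp K (- h) u + RtoC (u ^ K / INR (fact K)) * (- h) ^ K) * g u)%C
        (fun u => texp K (- h) u * g u + (RtoC (u ^ K / INR (fact K)) * (- h) ^ K) * g u)%C)
        by (intros; ring).
      rewrite (Lap_plus _ _ _ _ _ _ _ D3 D2) by exact Hda. f_equal.
      apply Lap_ext. intros u _. rewrite (Cpow_opp_mul h). ring. }
  intros eps He.
  assert (Hr : 0 <= / d * Cmod h < 1).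
  { pose proof (Cmod_ge_0 h). pose proof (Rinv_0_lt_compat d Hd). split; [nra|].
    apply (Rmult_lt_reg_l d); auto. rewrite <- Rmult_assoc, Rinv_r by lra. lra. }
  destruct (geom_clim (/ d * Cmod h) (M / d) eps Hr He) as [N HN].
  exists N. intros K HK.
  rewrite (Csum_ext _ (fun k => h ^ k * Lap (gk k) p)%C).
  2:{ intros k _. rewrite pow_n_Cpow. reflexivity. }
  rewrite S. rewrite Cmod_minus_sym.
  replace w with (p - (- h))%C by (unfold h; ring).
  rewrite <- Lap_shift.
  destruct (lapdom_texp g M a d K (- h)%C Hd G) as [M' D3].
  assert (D4 : lapdom (fun u => (Cexp (- h * RtoC u) - texp K (- h) u) * g u)%C
     ((/ d * Cmod h) ^ K * M) (2 * d + a)).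
  { apply lapdom_mul; auto.
    - apply pow_le; lra.
    - intros u Hu. apply ccont_minus; [|apply ccont_texp].
      apply ccont_Cexp, ccont_mult; [apply ccont_const | apply ccont_RtoC, continuous_id].
    - intros u Hu. rewrite (Cmult_comm (- h)).
      eapply Rle_trans; [apply (Cexp_texp K (- h) u u); lra|].
      rewrite Cmod_opp, Rpow_mult_distr.
      pose proof (pow_fact_bound d u K Hd Hu) as B.
      replace (2 * d * u) with (d * u + d * u) by ring. rewrite exp_plus.
      assert (E : exp (u * Cmod h) <= exp (d * u)) by (apply exp_le; nra).
      replace ((/ d) ^ K * Cmod h ^ K * (exp (d * u) * exp (d * u))) with
        (((/ d) ^ K * exp (d * u)) * Cmod h ^ K * exp (d * u)) by ring.
      pose proof (pow_le (Cmod h) K (Cmod_ge_0 h)).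
      apply Rmult_le_compat; auto.
      + apply Rmult_le_pos; auto. apply Rdiv_le_0_compat; [now apply pow_le | apply INR_fact_lt_0].
      + left; apply exp_pos.
      + apply Rmult_le_compat_r; auto. }
  rewrite (Lap_ext (fun u => Cexp (- h * RtoC u) * g u)%C
    (fun u => texp K (- h) u * g u + (Cexp (- h * RtoC u) - texp K (- h) u) * g u)%C) by (intros; ring).
  rewrite (Lap_plus _ _ _ _ _ _ _ D3 D4) by (unfold d in *; lra).
  match goal with |- Cmod ?x <= _ => replace x with
    (Lap (fun u => (Cexp (- h * RtoC u) - texp K (- h) u) * g u)%C p) by ring end.
  eapply Rle_trans; [apply (Lap_norm _ _ _ _ D4); unfold d in *; lra|].
  eapply Rle_trans; [|apply (HN K HK)].
  replace (M / d * (/ d * Cmod h) ^ K) with ((/ d * Cmod h) ^ K * M * / d) by (field; lra).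
  apply Rmult_le_compat_l.
  - apply Rmult_le_pos; auto. apply pow_le; lra.
  - apply Rinv_le_contravar; auto. unfold d; lra.
Qed.

(** On real increments a complex power series splits into two real ones, which opens the theory of
    real power series for the identity theorem on a horizontal line. *)
Lemma is_pseries_real_parts (a : nat -> C) (h : R) (l : C) :
  @is_pseries C_AbsRing C_NormedModule a (RtoC h) l ->
  is_pseries (fun k => Re (a k)) h (Re l) /\ is_pseries (fun k => Im (a k)) h (Im l).
Proof.
  intros H. apply is_series_clim in H.
  assert (E : forall n, Csum (fun k => scal (K := C_Ring) (@pow_n C_Ring (RtoC h) k) (a k)) (S n)
     = (sum_n (fun k => h ^ k * Re (a k)) n, sum_n (fun k => h ^ k * Im (a k)) n)).
  { intros n. rewrite (Csum_ext _ (fun k => (RtoC (h ^ k) * a k)%C)).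
    2:{ intros k _. rewrite pow_n_RtoC. reflexivity. }
    induction n as [|n IH].
    - rewrite !sum_O. apply Ceq; unfold Re, Im; simpl; ring.
    - rewrite !sum_Sn. change (Csum (fun k => RtoC (h ^ k) * a k)%C (S (S n))) with
        (Csum (fun k => RtoC (h ^ k) * a k) (S n) + RtoC (h ^ S n) * a (S n))%C.
      rewrite IH. apply Ceq; rewrite ?Re_plus, ?Im_plus, ?Re_mult, ?Im_mult, Re_RtoC, Im_RtoC;
      unfold Re, Im, plus; simpl; ring. }
  assert (K : forall (p : C -> R) (b : nat -> R), (forall z, Rabs (p z) <= Cmod z) ->
     (forall z w, p (z - w)%C = p z - p w) ->
     (forall n, p (Csum (fun k => scal (K := C_Ring) (@pow_n C_Ring (RtoC h) k) (a k)) (S n))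
         = sum_n (fun k => h ^ k * b k) n) -> is_pseries b h (p l)).
  { intros p b Hp Hm Hs. apply is_pseries_R.
    change (is_lim_seq (sum_n (fun k => b k * h ^ k)) (Finite (p l))).
    apply (is_lim_seq_ext (fun n => sum_n (fun k => h ^ k * b k) n)).
    { intros n. apply sum_n_ext. intros k. apply Rmult_comm. }
    apply is_lim_seq_spec. intros eps. assert (He2 : 0 < eps / 2) by (pose proof (cond_pos eps); lra).
    destruct (H _ He2) as [N HN]. exists N. intros n Hn. rewrite <- Hs, <- Hm.
    eapply Rle_lt_trans; [apply Hp|]. specialize (HN (S n) ltac:(lia)).
    eapply Rle_lt_trans; [exact HN|]. pose proof (cond_pos eps); lra. }
  split; [apply (K Re) | apply (K Im)]; auto using re_le_Cmod, im_le_Cmod;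
    intros n; rewrite E; reflexivity.
Qed.

Lemma CV_radius_decr_n (b : nat -> R) k : CV_radius (PS_decr_n b k) = CV_radius b.
Proof.
  induction k as [|k IH]; [reflexivity|]. rewrite <- IH, <- (CV_radius_decr_1 (PS_decr_n b k)).
  apply CV_radius_ext. intros n. unfold PS_decr_n, PS_decr_1. f_equal; lia.
Qed.

(** Vanishing is known on one side only, since the continuation moves from right to left. If the
    coefficients below [k] vanish, dividing by [h^k] leaves a series that is continuous at 0, zero
    to the right of it, and equal to [b k] at 0. *)
Lemma PSeries_zero_right (b : nat -> R) r : 0 < r ->
  (forall h, 0 < h < r -> is_pseries b h 0) -> forall k, b k = 0.
Proof.
  intros Hr H k.
  assert (R0 : Rbar_lt 0 (CV_radius b)).
  { apply Rbar_lt_le_trans with (Finite (r / 2)); [simpl; lra|].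
    replace (r / 2) with (Rabs (r / 2)) by (apply Rabs_pos_eq; lra).
    apply Rbar_not_lt_le. intros L. apply CV_disk_outside in L. apply L.
    assert (E : ex_series (fun n => b n * (r / 2) ^ n)).
    { exists 0. eapply is_series_ext; [|apply (H (r / 2)); lra].
      intros n. unfold scal; simpl; unfold mult; simpl. rewrite pow_n_pow. ring. }
    now apply ex_series_lim_0. }
  induction k as [k IH] using lt_wf_ind.
  set (c := PS_decr_n b k).
  assert (Rc : Rbar_lt 0 (CV_radius c)).
  { unfold c. rewrite CV_radius_decr_n. exact R0. }
  assert (Z : forall h, 0 < h < r -> PSeries c h = 0).
  { intros h Hh. pose proof (PSeries_decr_n_aux b k h IH) as E.
    rewrite (is_pseries_unique b h 0) in E by auto.
    assert (h ^ k <> 0) by (apply pow_nonzero; lra).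
    symmetry in E. apply Rmult_integral in E. destruct E; [contradiction | assumption]. }
  assert (Cc : continuity_pt (PSeries c) 0) by (apply PSeries_continuity; rewrite Rabs_R0; exact Rc).
  assert (V : PSeries c 0 = b k).
  { rewrite PSeries_0. unfold c, PS_decr_n. f_equal; lia. }
  rewrite <- V.
  destruct (Req_dec (PSeries c 0) 0) as [E|E]; auto. exfalso.
  destruct (Cc (Rabs (PSeries c 0))) as (d & Hd & K); [now apply Rabs_pos_lt|].
  set (h := Rmin (r / 2) (d / 2)).
  assert (h1 : 0 < h) by (apply Rmin_glb_lt; lra).
  assert (h2 : h <= r / 2) by apply Rmin_l. assert (h3 : h <= d / 2) by apply Rmin_r.
  specialize (K h). simpl in K. unfold R_dist in K. rewrite Z in K by lra.
  assert (Rabs (0 - PSeries c 0) < Rabs (PSeries c 0)).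
  { apply K. split; [split; [exact I | lra]|]. rewrite Rminus_0_r, Rabs_pos_eq; lra. }
  rewrite Rminus_0_l, Rabs_Ropp in H0. lra.
Qed.

(** The zeros are pushed to the left: at the infimum [-m] of the abscissas beyond which [f]
    vanishes, the local expansion vanishes on its right half, hence identically, hence also a little
    further to the left. *)
Lemma identity_on_line (f : C -> C) (t : R) : (forall x, -1 < x -> analytic_at f (Cpt x t)) ->
  (forall x, 1 < x -> f (Cpt x t) = RtoC 0) -> forall x, -1 < x -> f (Cpt x t) = RtoC 0.
Proof.
  intros A Z.
  set (P := fun m => forall x, - 1 < x -> m < x -> f (Cpt x t) = RtoC 0).
  (* [completeness] yields suprema, so the abscissas enter with the opposite sign; the bound
     [u <= 1] reflects the left end -1 of the domain. *)
  destruct (completeness (fun u => P (- u) /\ u <= 1)) as [m [Hub Hlub]].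
  { exists 1. intros u [_ Hu]. exact Hu. }
  { exists (-1). split; [|lra]. intros x _ Hx. apply Z. lra. }
  assert (m1 : -1 <= m).
  { apply Hub. split; [|lra]. intros x _ Hx. apply Z. lra. }
  assert (Pm : P (- m)).
  { intros x Hx1 Hx.
    destruct (Classical_Prop.classic (f (Cpt x t) = RtoC 0)) as [|N]; auto. exfalso.
    assert (B : m <= - x).
    { apply Hlub. intros u [Hu _]. apply Rnot_lt_le. intros L. apply N, Hu; lra. }
    lra. }
  assert (Hm1 : m <= 1). { apply Hlub. intros u [_ Hu]. exact Hu. }
  intros x Hx. destruct (Rlt_le_dec (- m) x) as [L|L]; [now apply Pm|]. exfalso.
  assert (M1 : -1 < - m) by lra.
  destruct (A (- m) M1) as (a & r & Ha).
  assert (S : forall h, Rabs h < r -> is_pseries (fun k => Re (a k)) h (Re (f (Cpt (- m + h) t))) /\ is_pseries (fun k => Im (a k)) h (Im (f (Cpt (- m + h) t)))).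
  { intros h Hh. apply is_pseries_real_parts.
    specialize (Ha (Cpt (- m + h) t)).
    replace (Cpt (- m + h) t - Cpt (- m) t)%C with (RtoC h) in Ha by (apply Ceq; simpl; ring).
    apply Ha. rewrite Cmod_R. exact Hh. }
  pose proof (cond_pos r) as Hr.
  assert (S0 : forall h, 0 < h < r -> f (Cpt (- m + h) t) = RtoC 0).
  { intros h Hh. apply Pm; lra. }
  assert (aR : forall k, Re (a k) = 0).
  { apply (PSeries_zero_right _ r Hr). intros h Hh.
    replace 0 with (Re (f (Cpt (- m + h) t))) by (rewrite S0 by assumption; reflexivity).
    apply (proj1 (S h ltac:(rewrite Rabs_pos_eq; lra))). }
  assert (aI : forall k, Im (a k) = 0).
  { apply (PSeries_zero_right _ r Hr). intros h Hh.
    replace 0 with (Im (f (Cpt (- m + h) t))) by (rewrite S0 by assumption; reflexivity).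
    apply (proj2 (S h ltac:(rewrite Rabs_pos_eq; lra))). }
  assert (PZ : forall (b : nat -> R) h l, (forall k, b k = 0) -> is_pseries b h l -> l = 0).
  { intros b h l Hb H. rewrite <- (is_pseries_unique _ _ _ H).
    rewrite (PSeries_ext b (fun _ => 0) h Hb). apply PSeries_const_0. }
  set (e := Rmin (r / 2) ((1 - m) / 2)).
  assert (e1 : 0 < e) by (apply Rmin_glb_lt; lra).
  assert (e2 : e <= r / 2) by apply Rmin_l.
  assert (e3 : e <= (1 - m) / 2) by apply Rmin_r.
  assert (m + e <= m); [|lra].
  apply Hub. split; [|lra]. intros y Hy1 Hy.
  destruct (Rlt_le_dec (- m) y) as [L'|L']; [now apply Pm|].
  destruct (S (y + m)) as [S1 S2]; [apply Rabs_def1; lra|].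
  replace (- m + (y + m)) with y in S1, S2 by ring.
  apply Ceq; simpl.
  - exact (PZ _ _ _ aR S1).
  - exact (PZ _ _ _ aI S2).
Qed.

(** * The zeta function to the right of [Re s = -1] *)

Lemma Rpower_C_plus x s t : Rpower_C x (s + t)%C = (Rpower_C x s * Rpower_C x t)%C.
Proof. unfold Rpower_C. rewrite <- Cexp_plus. f_equal. ring. Qed.

Lemma Rpower_C_1 x : 0 < x -> Rpower_C x (RtoC 1) = RtoC x.
Proof.
  intros Hx. unfold Rpower_C. replace (RtoC 1 * RtoC (ln x))%C with (RtoC (ln x)) by ring.
  rewrite Cexp_RtoC, exp_ln; auto.
Qed.

Lemma Rpower_C_base1 s : Rpower_C 1 s = RtoC 1.
Proof.
  unfold Rpower_C. rewrite ln_1. replace (s * RtoC 0)%C with (RtoC 0) by ring. apply Cexp_0.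
Qed.

Lemma Rpower_C_mult x y s : 0 < x -> 0 < y -> Rpower_C (x * y) s = (Rpower_C x s * Rpower_C y s)%C.
Proof.
  intros. unfold Rpower_C. rewrite <- Cexp_plus, ln_mult, RtoC_plus by assumption. f_equal. ring.
Qed.

Lemma Cmod_Rpower_C x s : Cmod (Rpower_C x s) = Rpower x (Re s).
Proof.
  unfold Rpower_C, Rpower. rewrite Cmod_Cexp. f_equal. creim. ring.
Qed.

(** The continuous primitive of the sawtooth [frac_part x - 1/2] that vanishes at the integers, that
    is, half the second periodic Bernoulli function up to a constant. Using it instead of the
    sawtooth moves the half-plane of convergence one unit to the left, to [Re s > -1]. *)
Definition bt (x : R) : R := (frac_part x ^ 2 - frac_part x) / 2.

Lemma frac_part_unit (k : Z) x : IZR k <= x < IZR k + 1 -> frac_part x = x - IZR k.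
Proof.
  intros H. unfold frac_part. rewrite <- (Int_part_spec x k); lra.
Qed.

Lemma bt_unit (k : Z) x : IZR k <= x <= IZR k + 1 -> bt x = (x - IZR k) * (x - IZR k - 1) / 2.
Proof.
  intros H. unfold bt. destruct (Rlt_le_dec x (IZR k + 1)).
  - rewrite (frac_part_unit k) by lra. field.
  - rewrite (frac_part_unit (k + 1)) by (rewrite plus_IZR; lra). rewrite plus_IZR.
    replace x with (IZR k + 1) by lra. field.
Qed.

Lemma bt_bound x : Rabs (bt x) <= 1 / 8.
Proof.
  unfold bt. pose proof (base_fp x) as [H0 H1]. set (f := frac_part x) in *.
  pose proof (pow2_ge_0 (f - 1 / 2)). apply Rabs_le. split; nra.
Qed.

Lemma bt_lipschitz x y : Rabs (bt x - bt y) <= / 2 * Rabs (x - y).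
Proof.
  assert (W : forall x y, x <= y -> Rabs (bt x - bt y) <= / 2 * (y - x)).
  { clear. intros x y Hxy.
    pose proof (base_fp x) as [Fx0 Fx1]. pose proof (base_fp y) as [Fy0 Fy1].
    pose proof (Rplus_Int_part_frac_part x) as Ex. pose proof (Rplus_Int_part_frac_part y) as Ey.
    unfold bt. set (u := frac_part x) in *. set (v := frac_part y) in *.
    destruct (Z.lt_ge_cases (Int_part x) (Int_part y)) as [L|L].
    - assert (I : IZR (Int_part x) + 1 <= IZR (Int_part y)).
      { rewrite <- plus_IZR. apply IZR_le. lia. }
      apply Rabs_le. split; nra.
    - assert (I : IZR (Int_part y) <= IZR (Int_part x)) by now apply IZR_le.
      assert (J : Int_part x = Int_part y).
      { apply Z.le_antisymm; auto. apply Z.lt_succ_r, lt_IZR. unfold Z.succ. rewrite plus_IZR. lra. }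
      rewrite J in Ex. apply Rabs_le. split; nra. }
  destruct (Rle_lt_dec x y).
  - rewrite (Rabs_left1 (x - y)) by lra. replace (- (x - y)) with (y - x) by ring. now apply W.
  - rewrite (Rabs_pos_eq (x - y)), Rabs_minus_sym by lra. apply W; lra.
Qed.

Lemma continuous_bt x : continuous bt x.
Proof.
  apply continuity_pt_filterlim. intros eps He. exists eps. split; auto.
  intros y [_ Hy]. simpl in *. unfold R_dist in *.
  eapply Rle_lt_trans; [apply bt_lipschitz|]. pose proof (Rabs_pos (y - x)). lra.
Qed.

(** [Lap gb (s + 1) = \int_1^oo bt(x) x^(-s-2) dx], so that [Zx] below is the Euler-Maclaurin formula for zeta. *)
Definition gb (u : R) : C := RtoC (bt (exp u)).

Lemma lapdom_gb : lapdom gb (1 / 8) 0.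
Proof.
  split; [lra|]. split.
  - intros u _. apply ccont_RtoC. apply continuous_comp; [apply continuous_exp | apply continuous_bt].
  - intros u _. unfold gb. rewrite Cmod_R, Rmult_0_l, exp_0, Rmult_1_r. apply bt_bound.
Qed.

Definition zsum (s : C) (N : nat) : C := Csum (fun k => Rpower_C (INR (S k)) (- s)%C) N.

Definition Zx (s : C) : C :=
  (/ (s - 1) + RtoC (1 / 2) - s * (s + 1) * Lap gb (s + 1))%C.

Lemma cder_Cexp_lin c u : cder (fun v => Cexp (c * RtoC v)) u (c * Cexp (c * RtoC u))%C.
Proof.
  eapply cder_eq.
  - apply cder_Cexp, cder_scal, cder_RtoC, is_derive_id.
  - unfold one; simpl. cring.
Qed.

Lemma Cexp_mul_exp p u : (Cexp (p * RtoC u) * RtoC (exp u))%C = Cexp ((p + 1) * RtoC u).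
Proof. rewrite <- Cexp_RtoC, <- Cexp_plus. f_equal. ring. Qed.

Lemma EM_step s n : (0 < n)%nat -> s <> RtoC 1 ->
  (s * (s + 1) * CI (lint gb (s + 1)) (ln (INR n)) (ln (INR (S n))))%C =
  ((Rpower_C (INR (S n)) (1 - s) - Rpower_C (INR n) (1 - s)) / (1 - s)
    - RtoC (1 / 2) * (Rpower_C (INR (S n)) (- s) + Rpower_C (INR n) (- s)))%C.
Proof.
  intros Hn Hs.
  assert (n0 : 0 < INR n) by (apply lt_0_INR; lia).
  assert (Hln : ln (INR n) <= ln (INR (S n))) by (apply ln_le; auto; apply le_INR; lia).
  set (N := INR n) in *.
  assert (SN : INR (S n) = N + 1) by (unfold N; apply S_INR).
  assert (Hs' : (1 - s)%C <> RtoC 0).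
  { intros E. apply Hs. replace s with (1 - (1 - s))%C by ring. rewrite E. ring. }
  (* On a unit interval [bt (exp u)] is a quadratic polynomial in [exp u], so the integrand [Q'] is
     a sum of three exponentials and [Q] is its termwise primitive. *)
  set (Q := fun u => (RtoC (1 / 2) * (s * (s + 1) / (1 - s) * Cexp ((1 - s) * RtoC u)
      + (RtoC (2 * N + 1) * (s + 1) * Cexp (- s * RtoC u)
      - RtoC (N * (N + 1)) * s * Cexp (- (s + 1) * RtoC u))))%C).
  set (Q' := fun u => (s * (s + 1) * (Cexp (- (s + 1) * RtoC u) *
      RtoC ((exp u - N) * (exp u - N - 1) / 2)))%C).
  assert (DQ : forall u, cder Q u (Q' u)).
  { intros u. unfold Q, Q'. eapply cder_eq.
    - apply cder_scal, cder_plus; [|apply cder_minus]; apply cder_scal, cder_Cexp_lin.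
    - replace (Cexp ((1 - s) * RtoC u))%C with (Cexp (- (s + 1) * RtoC u) * RtoC (exp u) * RtoC (exp u))%C.
      2:{ rewrite !Cexp_mul_exp. f_equal. ring. }
      replace (Cexp (- s * RtoC u))%C with (Cexp (- (s + 1) * RtoC u) * RtoC (exp u))%C.
      2:{ rewrite !Cexp_mul_exp. f_equal. ring. }
      set (w := Cexp (- (s + 1) * RtoC u)).
      replace (RtoC ((exp u - N) * (exp u - N - 1) / 2)) with
        (RtoC (1 / 2) * (RtoC (exp u) * RtoC (exp u) - RtoC (2 * N + 1) * RtoC (exp u) + RtoC (N * (N + 1))))%C.
      2:{ apply Ceq; creim; field. }
      set (e := RtoC (exp u)). set (A := RtoC (2 * N + 1)). set (B := RtoC (N * (N + 1))).
      field. exact Hs'. }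
  assert (E : CI (fun u => s * (s + 1) * lint gb (s + 1) u)%C (ln N) (ln (INR (S n))) =
     (Q (ln (INR (S n))) - Q (ln N))%C).
  { rewrite <- (CI_FTC Q Q'); auto.
    - apply CI_ext; auto. intros u Hu. unfold Q', lint, gb.
      assert (L1 : N < exp u) by (rewrite <- (exp_ln N) by auto; apply exp_increasing; lra).
      assert (L2 : exp u < N + 1).
      { rewrite <- SN, <- (exp_ln (INR (S n))) by (rewrite SN; lra). apply exp_increasing; lra. }
      rewrite (bt_unit (Z.of_nat n)); rewrite <- INR_IZR_INZ; fold N; [|lra].
      replace (- (s + 1) * RtoC u)%C with (- ((s + 1) * RtoC u))%C by ring. reflexivity.
    - intros x _. unfold Q'. apply ccont_mult; [apply ccont_const|].
      apply ccont_mult; [eapply cder_ccont, cder_Cexp_lin|].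
      apply ccont_RtoC, (ex_derive_continuous (V := R_NormedModule)). auto_derive; auto. }
  rewrite CI_scal in E by (apply (exCI_lint gb (1 / 8) 0); [apply lapdom_gb|]; split; auto;
     rewrite <- ln_1; apply ln_le; [lra|]; unfold N; change 1 with (INR 1); apply le_INR; lia).
  rewrite E.
  assert (R1 : forall x, 0 < x -> Rpower_C x (- s) = (Rpower_C x (- (s + 1)) * RtoC x)%C).
  { intros x Hx. rewrite <- (Rpower_C_1 x Hx). rewrite <- Rpower_C_plus. f_equal. ring. }
  assert (R2 : forall x, 0 < x -> Rpower_C x (1 - s) = (Rpower_C x (- (s + 1)) * RtoC x * RtoC x)%C).
  { intros x Hx. rewrite <- (Rpower_C_1 x Hx). rewrite <- !Rpower_C_plus. f_equal. ring. }
  unfold Q. change (Cexp (?a * RtoC (ln ?x)))%C with (Rpower_C x a).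
  rewrite SN. rewrite !R1, !R2 by lra.
  replace (RtoC (2 * N + 1)) with (RtoC 2 * RtoC N + 1)%C by cring.
  replace (RtoC (N * (N + 1))) with (RtoC N * (RtoC N + 1))%C by cring.
  replace (RtoC (N + 1)) with (RtoC N + 1)%C by cring.
  generalize (Rpower_C (N + 1) (- (s + 1))), (Rpower_C N (- (s + 1))). intros w w'.
  replace (RtoC (1 / 2)) with (/ RtoC 2)%C by (rewrite <- RtoC_inv by lra; f_equal; field).
  field. exact Hs'.
Qed.

Lemma EM_sum s N : (0 < N)%nat -> s <> RtoC 1 ->
  (s * (s + 1) * CI (lint gb (s + 1)) 0 (ln (INR N)))%C =
  ((Rpower_C (INR N) (1 - s) - 1) / (1 - s) + RtoC (1 / 2)
    + RtoC (1 / 2) * Rpower_C (INR N) (- s) - zsum s N)%C.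
Proof.
  intros HN Hs.
  assert (Hs' : (1 - s)%C <> RtoC 0).
  { intros E. apply Hs. replace s with (1 - (1 - s))%C by ring. rewrite E. ring. }
  induction N as [|N IH]; [lia|]. destruct N as [|N].
  - simpl (INR 1). rewrite ln_1, CI_point, !Rpower_C_base1. unfold zsum. simpl Csum.
    simpl (INR 1). rewrite Rpower_C_base1. 
    replace (RtoC (1 / 2)) with (/ RtoC 2)%C by (rewrite <- RtoC_inv by lra; f_equal; field).
    field. exact Hs'.
  - assert (L0 : 0 <= ln (INR (S N))).
    { rewrite <- ln_1. apply ln_le; [lra|]. change 1 with (INR 1). apply le_INR; lia. }
    assert (L1 : ln (INR (S N)) <= ln (INR (S (S N)))).
    { apply ln_le; [apply lt_0_INR; lia | apply le_INR; lia]. }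
    rewrite <- (CI_Chasles (lint gb (s + 1)) 0 (ln (INR (S N))) (ln (INR (S (S N)))))
      by (apply (exCI_lint gb (1 / 8) 0); [apply lapdom_gb | lra]).
    rewrite Cmult_plus_distr_l, IH, EM_step by (auto; lia).
    change (zsum s (S (S N))) with (zsum s (S N) + Rpower_C (INR (S (S N))) (- s))%C.
    replace (RtoC (1 / 2)) with (/ RtoC 2)%C by (rewrite <- RtoC_inv by lra; f_equal; field).
    field. exact Hs'.
Qed.

(** Euler-Maclaurin cut at an arbitrary [N]. Letting [N] grow identifies [Zx] with the Dirichlet
    series; taking [N] as a power of the height bounds [Zx] in the critical strip. *)
Lemma Zx_zsum s N : (0 < N)%nat -> s <> RtoC 1 ->
  Zx s = (zsum s N + Rpower_C (INR N) (1 - s) / (s - 1) - RtoC (1 / 2) * Rpower_C (INR N) (- s)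
     - s * (s + 1) * (Lap gb (s + 1) - CI (lint gb (s + 1)) 0 (ln (INR N))))%C.
Proof.
  intros HN Hs.
  assert (Hs' : (1 - s)%C <> RtoC 0).
  { intros E. apply Hs. replace s with (1 - (1 - s))%C by ring. rewrite E. ring. }
  assert (Hs'' : (s - 1)%C <> RtoC 0).
  { intros E. apply Hs. replace s with ((s - 1) + 1)%C by ring. rewrite E. ring. }
  pose proof (EM_sum s N HN Hs) as E. unfold Zx.
  set (I := CI (lint gb (s + 1)) 0 (ln (INR N))) in *.
  replace (zsum s N) with ((Rpower_C (INR N) (1 - s) - 1) / (1 - s) + RtoC (1 / 2)
    + RtoC (1 / 2) * Rpower_C (INR N) (- s) - s * (s + 1) * I)%C by (rewrite E; ring).
  field. auto.
Qed.

Lemma Zx_tail s N : (0 < N)%nat -> -1 < Re s ->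
  Cmod (Lap gb (s + 1) - CI (lint gb (s + 1)) 0 (ln (INR N)))%C
   <= 1 / 8 / (Re s + 1) * Rpower (INR N) (- (Re s + 1)).
Proof.
  intros HN Hs.
  eapply Rle_trans.
  - apply (Lap_tail gb (1 / 8) 0); [apply lapdom_gb | creim; lra|].
    rewrite <- ln_1. apply ln_le; [lra|]. change 1 with (INR 1). apply le_INR; lia.
  - right. unfold Rpower. creim. f_equal. + f_equal. ring. + f_equal. ring.
Qed.

Lemma Rpower_small a eps : 0 < a -> 0 < eps ->
  exists N, forall n, (N <= n)%nat -> Rpower (INR n) (- a) <= eps.
Proof.
  intros Ha He. destruct (exp_small a 1 eps Ha He) as (U & _ & HU).
  destruct (INR_unbounded (exp U)) as [N HN]. exists N. intros n Hn.
  apply le_INR in Hn. unfold Rpower. specialize (HU (ln (INR n))). rewrite Rmult_1_l in HU. apply HU.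
  rewrite <- (ln_exp U). apply ln_le; [apply exp_pos | lra].
Qed.

Lemma zsum_Zx s : 1 < Re s -> clim (zsum s) (Zx s).
Proof.
  intros Hs.
  assert (Hs1 : s <> RtoC 1) by (intros ->; simpl in Hs; lra).
  assert (Hs2 : (s - 1)%C <> RtoC 0).
  { intros E. apply Hs1. replace s with ((s - 1) + 1)%C by ring. rewrite E. ring. }
  set (K := Cmod (/ (s - 1))%C + 1 / 2 + Cmod (s * (s + 1))%C * (1 / 8 / (Re s + 1))).
  assert (K0 : 0 < K).
  { pose proof (Cmod_ge_0 (/ (s - 1))%C). pose proof (Cmod_ge_0 (s * (s + 1))%C).
    assert (0 <= Cmod (s * (s + 1))%C * (1 / 8 / (Re s + 1))).
    { apply Rmult_le_pos; auto. apply Rdiv_le_0_compat; lra. } unfold K; lra. }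
  intros eps He.
  destruct (Rpower_small (Re s - 1) (eps / K) ltac:(lra) ltac:(apply Rdiv_lt_0_compat; auto)) as [N HN].
  exists (S N). intros n Hn. specialize (HN n ltac:(lia)).
  rewrite (Zx_zsum s n) by (auto; lia).
  assert (n1 : 1 <= INR n) by (change 1 with (INR 1); apply le_INR; lia).
  set (P := Rpower (INR n) (- (Re s - 1))) in *.
  assert (M : forall a, a <= - (Re s - 1) -> Rpower (INR n) a <= P).
  { intros a Ha. unfold P. destruct (Req_dec (INR n) 1) as [E|E].
    - rewrite E. unfold Rpower. rewrite ln_1, !Rmult_0_r. lra.
    - apply Rle_Rpower; lra. }
  match goal with |- Cmod ?z <= _ => replace z with
    (- (/ (s - 1) * Rpower_C (INR n) (1 - s)) + (RtoC (1 / 2) * Rpower_C (INR n) (- s)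
     + s * (s + 1) * (Lap gb (s + 1) - CI (lint gb (s + 1)) 0 (ln (INR n)))))%C by (unfold Cdiv; ring) end.
  apply Rle_trans with (K * P).
  - unfold K.
    eapply Rle_trans; [apply Cmod_triangle|].
    eapply Rle_trans; [apply Rplus_le_compat_l, Cmod_triangle|].
    rewrite Cmod_opp, !(Cmod_mult _ (Rpower_C _ _)), (Cmod_mult (s * (s + 1))), !Cmod_Rpower_C, Cmod_RtoC_pos by lra.
    pose proof (Zx_tail s n ltac:(lia) ltac:(lra)) as T.
    pose proof (M (Re (1 - s)%C) ltac:(creim; lra)). pose proof (M (Re (- s)%C) ltac:(creim; lra)).
    pose proof (M (- (Re s + 1)) ltac:(lra)).
    assert (T' : Cmod (Lap gb (s + 1) - CI (lint gb (s + 1)) 0 (ln (INR n)))%C <= 1 / 8 / (Re s + 1) * P).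
    { eapply Rle_trans; [exact T|]. apply Rmult_le_compat_l; auto. apply Rdiv_le_0_compat; lra. }
    pose proof (Cmod_ge_0 (/ (s - 1))%C). pose proof (Cmod_ge_0 (s * (s + 1))%C).
    apply (Rmult_le_compat_l (Cmod (s * (s + 1))%C)) in T'; auto.
    apply (Rmult_le_compat_l (Cmod (/ (s - 1))%C)) in H; auto.
    lra.
  - apply (Rmult_le_compat_l K) in HN; [|lra].
    replace (K * (eps / K)) with eps in HN by (field; lra). exact HN.
Qed.

Lemma zeta_series (zeta : C -> C) s : is_riemann_zeta zeta -> 1 < Re s -> clim (zsum s) (zeta s).
Proof. intros [_ H] Hs. apply is_series_clim. apply H. exact Hs. Qed.

(** A horizontal line off the real axis avoids the pole and reaches the half-plane of convergence,
    where both functions are the limit of the same partial sums. *)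
Lemma zeta_Zx (zeta : C -> C) s : is_riemann_zeta zeta -> -1 < Re s -> Im s <> 0 -> zeta s = Zx s.
Proof.
  intros Hz Hs Ht.
  assert (N1 : forall z, Im z <> 0 -> z <> RtoC 1) by (intros z Hi ->; apply Hi; reflexivity).
  assert (N2 : forall z, Im z <> 0 -> (z - 1)%C <> RtoC 0).
  { intros z Hi E. apply (N1 z Hi). replace z with ((z - 1) + 1)%C by ring. rewrite E. ring. }
  (* This is [(w - 1) (zeta w - Zx w)] multiplied out, so that the quotient [1 / (w - 1)] disappears
     and only sums, scalings and multiplications by [w] remain. *)
  set (f := fun w => (w * zeta w + - (1) * zeta w + (RtoC (- (1 / 2)) + RtoC (- (1 / 2)) * w
      + w * (w * (w * Lap gb (w + 1)) + - (1) * Lap gb (w + 1))))%C).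
  assert (fE : forall w, Im w <> 0 -> f w = ((w - 1) * (zeta w - Zx w))%C).
  { intros w Hw. unfold f, Zx. rewrite RtoC_opp.
    replace (RtoC (1 / 2)) with (/ RtoC 2)%C by (rewrite <- RtoC_inv by lra; f_equal; field).
    field. now apply N2. }
  assert (Z : f (Cpt (Re s) (Im s)) = RtoC 0).
  { apply identity_on_line; auto.
    - intros x Hx. assert (A : analytic_at zeta (Cpt x (Im s))) by (apply Hz, N1; exact Ht).
      assert (L : analytic_at (fun w => Lap gb (w + 1))%C (Cpt x (Im s))).
      { apply (analytic_at_shift (Lap gb)). apply (analytic_at_Lap gb (1 / 8) 0); [apply lapdom_gb|].
        simpl. lra. }
      assert (B1 := analytic_at_plus _ _ _ (analytic_at_mul_id _ _ A) (analytic_at_scal (- (1))%C _ _ A)).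
      assert (B2 := analytic_at_scal (RtoC (- (1 / 2))) _ _
        (analytic_at_mul_id _ _ (analytic_at_const (RtoC 1) (Cpt x (Im s))))).
      assert (B3 := analytic_at_plus _ _ _ (analytic_at_const (RtoC (- (1 / 2))) _) B2).
      assert (B4 := analytic_at_mul_id _ _ (analytic_at_plus _ _ _
        (analytic_at_mul_id _ _ (analytic_at_mul_id _ _ L)) (analytic_at_scal (- (1))%C _ _ L))).
      eapply analytic_at_ext; [|exact (analytic_at_plus _ _ _ B1 (analytic_at_plus _ _ _ B3 B4))].
      intros w. unfold f. cbv beta. ring.
    - intros x Hx. rewrite fE by exact Ht.
      rewrite (clim_unique (zsum (Cpt x (Im s))) (zeta (Cpt x (Im s))) (Zx (Cpt x (Im s)))).
      + ring.
      + apply zeta_series; auto.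
      + apply zsum_Zx; auto. }
  replace (Cpt (Re s) (Im s)) with s in Z by (destruct s; reflexivity).
  rewrite fE in Z by exact Ht.
  assert (D : (zeta s - Zx s)%C = RtoC 0).
  { replace (zeta s - Zx s)%C with (/ (s - 1) * ((s - 1) * (zeta s - Zx s)))%C by (field; now apply N2).
    rewrite Z. ring. }
  replace (zeta s) with ((zeta s - Zx s) + Zx s)%C by ring. rewrite D. ring.
Qed.

Lemma zeta_Zx_right (zeta : C -> C) s : is_riemann_zeta zeta -> 1 < Re s -> zeta s = Zx s.
Proof. intros Hz Hs. apply (clim_unique (zsum s)); [now apply zeta_series | now apply zsum_Zx]. Qed.

(** * Oscillatory integrals and the Mellin transform of [exp (- i e x)] *)

Definition cis (x : R) : C := Cexp (Ci * RtoC x).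

Lemma Cmod_cis x : Cmod (cis x) = 1.
Proof.
  unfold cis. rewrite Cmod_Cexp. replace (Re (Ci * RtoC x)%C) with 0 by (creim; ring). apply exp_0.
Qed.

Lemma cder_cis (f : R -> R) t l : is_derive f t l -> cder (fun u => cis (f u)) t (Ci * RtoC l * cis (f t))%C.
Proof. intros H. unfold cis. now apply cder_Cexp, cder_scal, cder_RtoC. Qed.

(** First derivative test: integrate [w phi' e^(i phi)] by parts. *)
Lemma vdc_first (w w' ph ph' : R -> R) a b : a <= b ->
  (forall u, a <= u <= b -> is_derive w u (w' u)) -> (forall u, a <= u <= b -> continuous w' u) ->
  (forall u, a <= u <= b -> is_derive ph u (ph' u)) -> (forall u, a <= u <= b -> continuous ph' u) ->
  (forall u, a <= u <= b -> 0 <= w' u) \/ (forall u, a <= u <= b -> w' u <= 0) ->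
  Cmod (CI (fun u => RtoC (w u * ph' u) * cis (ph u))%C a b) <= Rabs (w a) + Rabs (w b) + Rabs (w b - w a).
Proof.
  intros Hab Dw Cw Dp Cp S.
  set (F := fun u => (- Ci * (RtoC (w u) * cis (ph u)))%C).
  assert (DF : forall u, a <= u <= b -> cder F u
     (- Ci * (RtoC (w' u) * cis (ph u)) + RtoC (w u * ph' u) * cis (ph u))%C).
  { intros u Hu. unfold F. eapply cder_eq.
    - apply cder_scal, cder_mult; [apply cder_RtoC, Dw, Hu | apply cder_cis, Dp, Hu].
    - rewrite RtoC_mult. generalize (cis (ph u)). intros z. cring. }
  assert (cw : forall u, a <= u <= b -> continuous w u).
  { intros u Hu. apply (ex_derive_continuous (V := R_NormedModule)). exists (w' u). now apply Dw. }
  assert (cc : forall u, a <= u <= b -> ccont (fun u => cis (ph u)) u).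
  { intros u Hu. eapply cder_ccont, cder_cis, Dp, Hu. }
  assert (C1 : forall u, a <= u <= b -> ccont (fun u => RtoC (w' u) * cis (ph u))%C u).
  { intros u Hu. apply ccont_mult; [apply ccont_RtoC, Cw, Hu | now apply cc]. }
  assert (C2 : forall u, a <= u <= b -> ccont (fun u => RtoC (w u * ph' u) * cis (ph u))%C u).
  { intros u Hu. apply ccont_mult; [|now apply cc]. apply ccont_RtoC.
    apply (continuous_mult w ph'); auto. }
  assert (X1 : exCI (fun u => RtoC (w' u) * cis (ph u))%C a b) by now apply exCI_cont.
  assert (X2 : exCI (fun u => RtoC (w u * ph' u) * cis (ph u))%C a b) by now apply exCI_cont.
  assert (E : (- Ci * CI (fun u => RtoC (w' u) * cis (ph u)) a b
     + CI (fun u => RtoC (w u * ph' u) * cis (ph u)) a b)%C = (F b - F a)%C).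
  { rewrite <- (CI_FTC F _ a b Hab DF).
    - rewrite CI_plus; [|now apply exCI_scal | exact X2]. now rewrite CI_scal.
    - intros u Hu. apply ccont_plus; [|now apply C2]. apply ccont_mult; [apply ccont_const | now apply C1]. }
  assert (N : Cmod (CI (fun u => RtoC (w' u) * cis (ph u))%C a b) <= Rabs (w b - w a)).
  { assert (I : forall (s : R), s = 1 \/ s = -1 -> (forall u, a <= u <= b -> 0 <= s * w' u) ->
      Cmod (CI (fun u => RtoC (w' u) * cis (ph u))%C a b) <= s * (w b - w a)).
    { intros s Hs P.
      assert (E2 : @eq R (RInt (fun u => s * w' u) a b) (s * (w b - w a))).
      { rewrite (RInt_FTC (fun u => s * w u)); auto; [ring| |].
        - intros u Hu. apply is_derive_scal, Dw, Hu.
        - intros u Hu. apply (continuous_scal_r (V := R_NormedModule) s w'), Cw, Hu. }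
      rewrite <- E2. apply CI_norm_le; auto.
      - apply ex_RInt_cont; auto. intros u Hu.
        apply (continuous_scal_r (V := R_NormedModule) s w'), Cw, Hu.
      - intros u Hu. rewrite Cmod_mult, Cmod_cis, Rmult_1_r, Cmod_R.
        specialize (P u Hu). destruct Hs; subst s; apply Rabs_le; lra. }
    destruct S as [S|S].
    - eapply Rle_trans; [apply (I 1); auto; intros u Hu; specialize (S u Hu); lra|].
      rewrite Rmult_1_l. apply Rle_abs.
    - eapply Rle_trans; [apply (I (-1)); auto; intros u Hu; specialize (S u Hu); lra|].
      rewrite Rabs_minus_sym. eapply Rle_trans; [|apply Rle_abs]. lra. }
  replace (CI (fun u => RtoC (w u * ph' u) * cis (ph u))%C a b) with
    (F b - F a + Ci * CI (fun u => RtoC (w' u) * cis (ph u)) a b)%C by (rewrite <- E; ring).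
  eapply Rle_trans; [apply Cmod_triangle|]. rewrite Cmod_mult, Cmod_Ci, Rmult_1_l.
  assert (MF : forall u, Cmod (F u) = Rabs (w u)).
  { intros u. unfold F. rewrite !Cmod_mult, Cmod_cis, Cmod_opp, Cmod_Ci, Cmod_R. ring. }
  eapply Rle_trans; [apply Rplus_le_compat_r, Cmod_minus_le|]. rewrite !MF. lra.
Qed.

(** The function [exp (-iex)] after [x = exp (-u)] on (0, 1) and, in [gB], after [x = exp u] on (1,
    oo): the two halves of the Mellin integral become Laplace transforms at [s] and at [-s]. *)
Definition gA (e : R) (u : R) : C := cis (- (e * exp (- u))).
Definition gB (e : R) (u : R) : C := cis (- (e * exp u)).

Lemma cder_gA e u : cder (gA e) u (Ci * RtoC e * (Cexp (- (1) * RtoC u) * gA e u))%C.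
Proof.
  eapply cder_eq.
  - apply (cder_cis (fun u => - (e * exp (- u)))). auto_derive; [auto|reflexivity].
  - fold (gA e u). generalize (gA e u). intros z.
    replace (Cexp (- (1) * RtoC u))%C with (RtoC (exp (- u))).
    + cring.
    + rewrite <- Cexp_RtoC. f_equal. cring.
Qed.

Lemma cder_gB e u : cder (gB e) u (- (Ci * RtoC e) * (Cexp (RtoC 1 * RtoC u) * gB e u))%C.
Proof.
  eapply cder_eq.
  - apply (cder_cis (fun u => - (e * exp u))). auto_derive; [auto|reflexivity].
  - fold (gB e u). generalize (gB e u). intros z.
    replace (Cexp (RtoC 1 * RtoC u))%C with (RtoC (exp u)).
    + cring.
    + rewrite <- Cexp_RtoC. f_equal. cring.
Qed.

Lemma lapdom_gA e : lapdom (gA e) 1 0.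
Proof.
  split; [lra|]. split.
  - intros u _. eapply cder_ccont, cder_gA.
  - intros u _. unfold gA. rewrite Cmod_cis, Rmult_0_l, exp_0. lra.
Qed.

Lemma lapdom_gB e : lapdom (gB e) 1 0.
Proof.
  split; [lra|]. split.
  - intros u _. eapply cder_ccont, cder_gB.
  - intros u _. unfold gB. rewrite Cmod_cis, Rmult_0_l, exp_0. lra.
Qed.

Lemma lapdom_Cexp_lin c z g M a : lapdom g M a ->
  lapdom (fun u => z * (Cexp (RtoC c * RtoC u) * g u))%C (Cmod z * M) (c + a).
Proof.
  intros G.
  pose proof (lapdom_mul g M a (fun u => z * Cexp (RtoC c * RtoC u))%C (Cmod z) c (Cmod_ge_0 z) G) as H.
  assert (H' : lapdom (fun u => z * Cexp (RtoC c * RtoC u) * g u)%C (Cmod z * M) (c + a)).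
  { apply H.
    - intros u _. apply ccont_mult; [apply ccont_const | eapply cder_ccont, cder_Cexp_lin].
    - intros u _. rewrite Cmod_mult, Cmod_Cexp. right. f_equal. f_equal. creim. ring. }
  destruct H' as (A & B & D). split; auto. split.
  - intros u Hu. eapply ccont_ext; [|apply (B u Hu)]. intros v. cbv beta. ring.
  - intros u Hu. eapply Rle_trans; [|apply (D u Hu)]. right. f_equal. ring.
Qed.

Definition e0 (e : R) : C := cis (- e).
Definition ie (e : R) : C := (Ci * RtoC e)%C.
Definition LA (e : R) (s : C) : C := Lap (gA e) s.
Definition LB (e : R) (q : C) : C := Lap (gB e) q.

Lemma gA_0 e : gA e 0 = e0 e.
Proof. unfold gA, e0. f_equal. rewrite Ropp_0, exp_0. ring. Qed.

Lemma gB_0 e : gB e 0 = e0 e.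
Proof. unfold gB, e0. f_equal. rewrite exp_0. ring. Qed.

Lemma LA_rec e p : 0 < Re p -> (ie e * LA e (p + 1))%C = (p * LA e p - e0 e)%C.
Proof.
  intros Hp. unfold LA. rewrite <- gA_0.
  pose proof (lapdom_Cexp_lin (-1) (ie e) (gA e) 1 0 (lapdom_gA e)) as G.
  rewrite <- (Lap_by_parts (gA e) (fun u => ie e * (Cexp (RtoC (-1) * RtoC u) * gA e u))%C 1 0 _ _ p
    (lapdom_gA e) G); try lra.
  - assert (E : lapdom (fun u => Cexp (RtoC (-1) * RtoC u) * gA e u)%C 1 (-1)).
    { pose proof (lapdom_Cexp_lin (-1) (RtoC 1) (gA e) 1 0 (lapdom_gA e)) as (A & B & D).
      rewrite Cmod_1, Rmult_1_r in *. rewrite Rplus_0_r in D. split; auto. split.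
      - intros u Hu. eapply ccont_ext; [|apply (B u Hu)]. intros v. cbv beta. ring.
      - intros u Hu. eapply Rle_trans; [|apply (D u Hu)]. right. f_equal. ring. }
    rewrite (Lap_scal _ _ _ _ p E) by lra. rewrite Lap_shift. do 2 f_equal. cring.
  - intros u _. eapply cder_eq; [apply cder_gA|]. unfold ie. 
    replace (- (1) * RtoC u)%C with (RtoC (-1) * RtoC u)%C by cring. reflexivity.
Qed.

Lemma LB_rec e p : 1 < Re p -> (- ie e * LB e (p - 1))%C = (p * LB e p - e0 e)%C.
Proof.
  intros Hp. unfold LB. rewrite <- gB_0.
  pose proof (lapdom_Cexp_lin 1 (- ie e)%C (gB e) 1 0 (lapdom_gB e)) as G.
  rewrite <- (Lap_by_parts (gB e) (fun u => - ie e * (Cexp (RtoC 1 * RtoC u) * gB e u))%C 1 0 _ _ p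
    (lapdom_gB e) G); try lra.
  - assert (E : lapdom (fun u => Cexp (RtoC 1 * RtoC u) * gB e u)%C 1 1).
    { pose proof (lapdom_Cexp_lin 1 (RtoC 1) (gB e) 1 0 (lapdom_gB e)) as (A & B & D).
      rewrite Cmod_1, Rmult_1_r in *. rewrite Rplus_0_r in D. split; auto. split.
      - intros u Hu. eapply ccont_ext; [|apply (B u Hu)]. intros v. cbv beta. ring.
      - intros u Hu. eapply Rle_trans; [|apply (D u Hu)]. right. f_equal. ring. }
    rewrite (Lap_scal _ _ _ _ p E) by lra. rewrite Lap_shift. reflexivity.
  - intros u _. eapply cder_eq; [apply cder_gB|]. reflexivity.
Qed.

(** One integration by parts continues [LB] one unit to the left; three steps reach [Re q > -3]. *)
Definition Bstep (e : R) (F : C -> C) (q : C) : C := ((e0 e - (q + 1) * F (q + 1)) / ie e)%C.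
Definition LBx (e : R) : C -> C := Bstep e (Bstep e (Bstep e (LB e))).
(** [\int_0^oo x^(s-1) e^(-iex) dx], split at [x = 1], with the second part continued by [LBx]. *)
Definition Em (e : R) (s : C) : C := (LA e s + LBx e (- s))%C.

Lemma ie_neq_0 e : e = 1 \/ e = -1 -> ie e <> RtoC 0.
Proof.
  intros He E. apply (f_equal snd) in E. unfold ie in E; simpl in E.
  destruct He; subst e; lra.
Qed.

Lemma Bstep_LB e q : e = 1 \/ e = -1 -> 0 < Re q -> Bstep e (LB e) q = LB e q.
Proof.
  intros He Hq. unfold Bstep. pose proof (LB_rec e (q + 1) ltac:(creim; lra)) as H.
  replace (q + 1 - 1)%C with q in H by ring.
  replace (e0 e - (q + 1) * LB e (q + 1))%C with (ie e * LB e q)%C.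
  - field. now apply ie_neq_0.
  - replace (ie e * LB e q)%C with (- (- ie e * LB e q))%C by ring. rewrite H. ring.
Qed.

Lemma Bstep_ext e F G q : F (q + 1)%C = G (q + 1)%C -> Bstep e F q = Bstep e G q.
Proof. intros H. unfold Bstep. now rewrite H. Qed.

Lemma LBx_1 e q : e = 1 \/ e = -1 -> -1 < Re q -> LBx e q = Bstep e (LB e) q.
Proof.
  intros He Hq. unfold LBx. apply Bstep_ext.
  rewrite (Bstep_ext e (Bstep e (LB e)) (LB e)).
  - apply Bstep_LB; auto. creim; lra.
  - apply Bstep_LB; auto. creim; lra.
Qed.

Lemma LBx_rec e q : e = 1 \/ e = -1 -> -3 < Re q -> LBx e q = Bstep e (LBx e) q.
Proof.
  intros He Hq. unfold LBx. apply Bstep_ext, Bstep_ext, Bstep_ext. symmetry.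
  apply Bstep_LB; auto. creim; lra.
Qed.

(** The counterpart of [Gamma (s + 1) = s Gamma s]: each half satisfies the recursion up to a
    boundary term at [x = 1], and the two boundary terms [e0 e] cancel. *)
Lemma Em_rec e s : e = 1 \/ e = -1 -> 0 < Re s < 2 -> (ie e * Em e (s + 1))%C = (s * Em e s)%C.
Proof.
  intros He Hs. unfold Em. rewrite !Cmult_plus_distr_l.
  rewrite LA_rec by lra.
  rewrite (LBx_rec e (- (s + 1))%C He) by (creim; lra). unfold Bstep at 1.
  replace (- (s + 1) + 1)%C with (- s)%C by ring.
  field. now apply ie_neq_0.
Qed.

(** * Holomorphic functions on regions *)

(** A second derivative is recorded because the rectangle theorem needs the first one to be
    continuous. *)
Definition holo (D : C -> Prop) (f : C -> C) : Prop :=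
  exists f' f'', forall z, D z -> chol f z (f' z) /\ chol f' z (f'' z).

Lemma holo_const D c : holo D (fun _ => c).
Proof. exists (fun _ => RtoC 0), (fun _ => RtoC 0). intros; split; apply chol_const. Qed.

Lemma holo_id D : holo D (fun z => z).
Proof. exists (fun _ => RtoC 1), (fun _ => RtoC 0). intros; split; [apply chol_id | apply chol_const]. Qed.

Lemma holo_plus D f g : holo D f -> holo D g -> holo D (fun z => f z + g z)%C.
Proof.
  intros (f' & f'' & F) (g' & g'' & G).
  exists (fun z => f' z + g' z)%C, (fun z => f'' z + g'' z)%C.
  intros z Hz. destruct (F z Hz), (G z Hz). split; now apply chol_plus.
Qed.

Lemma holo_mult D f g : holo D f -> holo D g -> holo D (fun z => f z * g z)%C.
Proof.
  intros (f' & f'' & F) (g' & g'' & G).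
  exists (fun z => f' z * g z + f z * g' z)%C,
    (fun z => (f'' z * g z + f' z * g' z) + (f' z * g' z + f z * g'' z))%C.
  intros z Hz. destruct (F z Hz), (G z Hz). split; [now apply chol_mult|].
  apply chol_plus; now apply chol_mult.
Qed.

Lemma holo_ext (D : C -> Prop) f g : (forall z, f z = g z) -> holo D f -> holo D g.
Proof.
  intros E (f' & f'' & F). exists f', f''. intros z Hz. destruct (F z Hz). split; auto.
  now apply chol_ext with f.
Qed.

Lemma holo_scal D c f : holo D f -> holo D (fun z => c * f z)%C.
Proof. intros; apply holo_mult; auto using holo_const. Qed.

Lemma holo_opp D f : holo D f -> holo D (fun z => - f z)%C.
Proof. intros H. apply holo_ext with (fun z => - (1) * f z)%C; [intros; ring | now apply holo_scal]. Qed.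

Lemma holo_minus D f g : holo D f -> holo D g -> holo D (fun z => f z - g z)%C.
Proof. intros; apply holo_plus; auto using holo_opp. Qed.

Lemma holo_affine (D : C -> Prop) f a b : holo D f ->
  holo (fun z => D (a * z + b)%C) (fun z => f (a * z + b)%C).
Proof.
  intros (f' & f'' & F). exists (fun z => a * f' (a * z + b))%C, (fun z => a * (a * f'' (a * z + b)))%C.
  intros z Hz. destruct (F _ Hz). split; [now apply chol_affine|]. now apply chol_scal, chol_affine.
Qed.

Lemma holo_weaken (D D' : C -> Prop) f : (forall z, D' z -> D z) -> holo D f -> holo D' f.
Proof. intros H (f' & f'' & F). exists f', f''. intros z Hz. apply F, H, Hz. Qed.

Lemma holo_Cexp D : holo D Cexp.
Proof. exists Cexp, Cexp. intros; split; apply chol_Cexp. Qed.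

Lemma holo_Rpower_C D x : holo D (Rpower_C x).
Proof.
  unfold Rpower_C. apply holo_ext with (fun z => Cexp (RtoC (ln x) * z + RtoC 0)%C).
  - intros z. f_equal. ring.
  - apply (holo_weaken (fun _ => True)); [auto|].
    apply (holo_affine (fun _ => True) Cexp (RtoC (ln x)) (RtoC 0)), holo_Cexp.
Qed.

Lemma holo_Lap g M a : lapdom g M a -> holo (fun p => a < Re p) (Lap g).
Proof.
  intros G. exists (Lap (fun u => RtoC (- u) * g u)%C),
    (Lap (fun u => RtoC (- u) * (RtoC (- u) * g u))%C).
  intros p Hp. split; [now apply (Lap_chol g M a)|].
  assert (d0 : 0 < (Re p - a) / 2) by lra.
  apply (Lap_chol _ _ _ _ (lapdom_mul_u g M a _ d0 G)). lra.
Qed.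

Lemma holo_inv : holo (fun z => z <> RtoC 0) (fun z => / z)%C.
Proof.
  exists (fun z => - (/ z * / z))%C,
    (fun z => - (- (/ z * / z) * / z + / z * - (/ z * / z)))%C.
  assert (K : forall z, z <> RtoC 0 -> chol (fun z => / z)%C z (- (/ z * / z))%C).
  { intros z Hz. eapply chol_eq; [now apply chol_inv|]. now field. }
  intros z Hz. split; auto. apply chol_opp. apply (chol_mult (fun z => / z)%C (fun z => / z)%C); auto.
Qed.

Lemma Cauchy_holo (D : C -> Prop) f a b c d r : holo D f -> a <= b -> c <= d -> 0 < r ->
  (forall x y, a - r < x < b + r -> c - r < y < d + r -> D (Cpt x y)) ->
  (Ci * (CI (fun v => f (Cpt b v)) c d - CI (fun v => f (Cpt a v)) c d))%C
  = (CI (fun u => f (Cpt u d)) a b - CI (fun u => f (Cpt u c)) a b)%C.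
Proof.
  intros (f' & f'' & F) Hab Hcd Hr H. apply (Cauchy_rectangle f f' f'' a b c d r); auto.
Qed.

Lemma holo_ccont_im D f x y : holo D f -> D (Cpt x y) -> ccont (fun v => f (Cpt x v)) y.
Proof. intros (f' & f'' & F) H. eapply cder_ccont, chol_cder_im, F, H. Qed.

Lemma holo_ccont_re D f x y : holo D f -> D (Cpt x y) -> ccont (fun u => f (Cpt u y)) x.
Proof. intros (f' & f'' & F) H. eapply cder_ccont, chol_cder_re, F, H. Qed.

Lemma holo_Bstep e F a : holo (fun q => a < Re q) F -> holo (fun q => a - 1 < Re q) (Bstep e F).
Proof.
  intros H. unfold Bstep.
  assert (A : holo (fun q => a - 1 < Re q) (fun q => F (1 * q + 1)%C)).
  { eapply holo_weaken; [|apply holo_affine, H]. intros z Hz. cbv beta. creim. lra. }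
  apply holo_ext with (fun q => / ie e * (e0 e - (q + 1) * F (1 * q + 1)))%C.
  { intros z. replace (1 * z + 1)%C with (z + 1)%C by ring. unfold Cdiv. ring. }
  apply holo_scal, holo_minus; [apply holo_const|]. apply holo_mult; auto.
  apply holo_plus; [apply holo_id | apply holo_const].
Qed.

Lemma holo_Em e : holo (fun s => 0 < Re s < 3) (Em e).
Proof.
  apply holo_plus.
  - eapply holo_weaken; [|apply (holo_Lap _ _ _ (lapdom_gA e))]. intros z Hz. cbv beta. lra.
  - apply holo_ext with (fun s => LBx e (- (1) * s + 0)%C). { intros s. f_equal. ring. }
    pose proof (holo_Bstep e _ _ (holo_Bstep e _ _ (holo_Bstep e _ _ (holo_Lap _ _ _ (lapdom_gB e))))) as H.
    eapply holo_weaken; [|apply holo_affine, H]. intros z Hz. cbv beta. creim. lra.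
Qed.

(** * Size of the Mellin transform *)

Lemma Cmod_ge_im z : Im z <= Cmod z.
Proof. eapply Rle_trans; [apply Rle_abs | apply im_le_Cmod]. Qed.

Lemma LA_bound e s : e = 1 \/ e = -1 -> 0 < Re s -> 0 < Im s -> Cmod (LA e s) <= 2 / Im s.
Proof.
  intros He Hs Ht. pose proof (LA_rec e s Hs) as R.
  assert (E : (s * LA e s)%C = (e0 e + ie e * LA e (s + 1))%C) by (rewrite R; ring).
  apply (f_equal Cmod) in E. rewrite Cmod_mult in E.
  assert (B : Cmod (e0 e + ie e * LA e (s + 1))%C <= 2).
  { eapply Rle_trans; [apply Cmod_triangle|]. unfold e0, ie. rewrite Cmod_cis, !Cmod_mult, Cmod_Ci, Cmod_R.
    assert (Rabs e = 1). { destruct He; subst e; [apply Rabs_pos_eq; lra | rewrite Rabs_left; lra]. }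
    rewrite H. unfold LA. pose proof (Lap_norm _ _ _ (s + 1)%C (lapdom_gA e) ltac:(creim; lra)) as L.
    assert (1 / (Re (s + 1)%C - 0) <= 1).
    { creim. apply (Rmult_le_reg_r (Re s + 1 - 0)); [lra|]. unfold Rdiv.
      rewrite Rmult_assoc, Rinv_l by lra. lra. }
    lra. }
  pose proof (Cmod_ge_im s). pose proof (Cmod_ge_0 (LA e s)).
  apply (Rmult_le_reg_r (Im s)); auto. unfold Rdiv. rewrite Rmult_assoc, Rinv_l by lra. nra.
Qed.

Lemma LB_finite e s U : e = 1 \/ e = -1 -> 0 <= U ->
  (CI (lint (gB e) (- s)) 0 U)%C = ((e0 e - lint (gB e) (1 - s) U
     - (1 - s) * CI (lint (gB e) (1 - s)) 0 U) / ie e)%C.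
Proof.
  intros He HU.
  assert (X1 : exCI (lint (gB e) (- s)) 0 U) by (apply (exCI_lint _ _ _ _ _ _ (lapdom_gB e)); lra).
  assert (X2 : exCI (lint (gB e) (1 - s)) 0 U) by (apply (exCI_lint _ _ _ _ _ _ (lapdom_gB e)); lra).
  assert (E : (- ie e * CI (lint (gB e) (- s)) 0 U + - (1 - s) * CI (lint (gB e) (1 - s)) 0 U)%C
      = (lint (gB e) (1 - s) U - e0 e)%C).
  { rewrite <- CI_scal by exact X1. rewrite <- (CI_scal (- (1 - s))) by exact X2.
    rewrite <- CI_plus; [|now apply exCI_scal | now apply exCI_scal].
    rewrite (CI_FTC (lint (gB e) (1 - s))); auto.
    - f_equal. unfold lint. rewrite gB_0. replace (- ((1 - s) * 0))%C with (RtoC 0) by ring.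
      rewrite Cexp_0. ring.
    - intros u Hu. eapply cder_eq.
      + unfold lint. apply cder_mult; [|apply cder_gB].
        apply cder_Cexp, cder_opp, cder_scal, cder_RtoC, is_derive_id.
      + unfold lint. replace (- (- s * RtoC u))%C with (- ((1 - s) * RtoC u) + RtoC 1 * RtoC u)%C by ring.
        rewrite Cexp_plus. unfold ie, one; simpl. fold (ie e).
        generalize (Cexp (- ((1 - s) * RtoC u))), (Cexp (RtoC 1 * RtoC u)), (gB e u). intros. ring.
    - intros u Hu. apply ccont_plus; (apply ccont_mult; [apply ccont_const|]);
      apply (ccont_lint _ _ _ _ _ (lapdom_gB e)); lra. }
  pose proof (ie_neq_0 e He) as N.
  replace (CI (lint (gB e) (- s)) 0 U) with (/ ie e * (ie e * CI (lint (gB e) (- s)) 0 U))%C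
    by (field; exact N).
  replace (ie e * CI (lint (gB e) (- s)) 0 U)%C with
   (- (1 - s) * CI (lint (gB e) (1 - s)) 0 U - (lint (gB e) (1 - s) U - e0 e))%C by (rewrite <- E; ring).
  field. exact N.
Qed.

(** For [0 < Re s < 1] the integral over (1, oo) converges only conditionally. One integration by
    parts, [LB_finite], writes its truncations through an absolutely convergent integral, and in
    this form their limit is the continued transform; a bound for all truncations therefore
    survives. *)
Lemma LBx_limit e s K : e = 1 \/ e = -1 -> 0 < Re s < 1 ->
  (forall U, 0 <= U -> Cmod (CI (lint (gB e) (- s)) 0 U) <= K) -> Cmod (LBx e (- s)) <= K.
Proof.
  intros He Hs H. rewrite LBx_1 by (auto; creim; lra). unfold Bstep.
  replace (- s + 1)%C with (1 - s)%C by ring.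
  assert (G : 0 < Re (1 - s)%C) by (creim; lra).
  apply le_epsilon. intros eps Heps.
  assert (Ce : Cmod (ie e) = 1).
  { unfold ie. rewrite Cmod_mult, Cmod_Ci, Cmod_R.
    destruct He; subst e; [rewrite Rabs_pos_eq; lra | rewrite Rabs_left; lra]. }
  pose proof (ie_neq_0 e He) as N. pose proof (Cmod_ge_0 (1 - s)%C) as C1.
  set (d := eps / (1 + Cmod (1 - s)%C)). assert (Hd : 0 < d) by (apply Rdiv_lt_0_compat; lra).
  destruct (Lap_conv _ _ _ (1 - s)%C d (lapdom_gB e) G Hd) as (U1 & P1 & Q1).
  destruct (exp_small (Re (1 - s)%C) 1 d G Hd) as (U2 & P2 & Q2).
  set (U := Rmax U1 U2). assert (L1 : U1 <= U) by apply Rmax_l. assert (L2 : U2 <= U) by apply Rmax_r.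
  specialize (Q1 U L1). specialize (Q2 U L2). specialize (H U ltac:(lra)).
  rewrite LB_finite in H by (auto; lra).
  fold (LB e (1 - s)) in Q1. set (J := CI (lint (gB e) (1 - s)) 0 U) in *.
  replace ((e0 e - (1 - s) * LB e (1 - s)) / ie e)%C with
   ((e0 e - lint (gB e) (1 - s) U - (1 - s) * J) / ie e
     + (lint (gB e) (1 - s) U - (1 - s) * (LB e (1 - s) - J)) / ie e)%C by (field; exact N).
  eapply Rle_trans; [apply Cmod_triangle|]. apply Rplus_le_compat; auto.
  rewrite Cmod_div, Ce by exact N. unfold Rdiv. rewrite Rinv_1, Rmult_1_r.
  eapply Rle_trans; [apply Cmod_minus_le|]. rewrite Cmod_mult.
  pose proof (Cmod_lint _ _ _ (1 - s)%C U (lapdom_gB e) ltac:(lra)) as L.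
  rewrite Rminus_0_r in L.
  apply Rle_trans with (d + Cmod (1 - s)%C * d).
  - apply Rplus_le_compat; [lra|]. apply Rmult_le_compat_l; lra.
  - unfold d. right. field. lra.
Qed.

Lemma Rpower_pos x a : 0 < Rpower x a.
Proof. apply exp_pos. Qed.

Lemma Rpower_le_base x y a : 0 < x <= y -> 0 <= a -> Rpower x a <= Rpower y a.
Proof. intros; apply Rle_Rpower_l; lra. Qed.

Lemma exp_lin_Rpower T s u : 0 < T -> 0 <= s -> exp u <= T -> exp (s * u) <= Rpower T s.
Proof.
  intros HT Hs Hu. unfold Rpower. apply exp_le. apply Rmult_le_compat_l; auto.
  rewrite <- (ln_exp u). apply ln_le; auto. apply exp_pos.
Qed.

Lemma exp_lin_Rpower_ge T s u : 0 < T -> s <= 1 -> T <= exp u -> exp (s * u) <= exp u * Rpower T (s - 1).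
Proof.
  intros HT Hs Hu. unfold Rpower. rewrite <- exp_plus. apply exp_le.
  assert (ln T <= u) by (rewrite <- (ln_exp u); apply ln_le; auto). nra.
Qed.

Lemma ln_le_sub1 x : 0 < x -> ln x <= x - 1.
Proof. intros Hx. pose proof (exp_ineq1_le (ln x)). rewrite exp_ln in H; lra. Qed.

(** The Mellin integrand at [s + iT] in the variable [u = ln x]. Its phase has derivative
    [T - e exp u], so it is stationary only for [e = 1], at [x = T]. *)
Definition oscf (e s T u : R) : C := (RtoC (exp (s * u)) * cis (T * u - e * exp u))%C.

Lemma ccont_oscf e s T u : ccont (oscf e s T) u.
Proof.
  apply ccont_mult.
  - apply ccont_RtoC, continuous_exp_lin.
  - eapply cder_ccont, cder_cis. auto_derive; auto.
Qed.

Lemma exCI_oscf e s T a b : a <= b -> exCI (oscf e s T) a b.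
Proof. intros; apply exCI_cont; auto. intros; apply ccont_oscf. Qed.

(** First derivative test with weight [exp (s u) / (T - e exp u)]. The alternative in the hypotheses
    is the sign of the numerator of its derivative, i.e. its monotonicity; three boundary quantities
    bounded through [K] give the factor 4. *)
Lemma oscf_nonstationary e s T a b K : a <= b -> e = 1 \/ e = -1 ->
  (forall u, a <= u <= b -> T - e * exp u <> 0) ->
  (forall u, a <= u <= b -> 0 <= s * (T - e * exp u) + e * exp u) \/
  (forall u, a <= u <= b -> s * (T - e * exp u) + e * exp u <= 0) ->
  (forall u, a <= u <= b -> exp (s * u) <= K * Rabs (T - e * exp u)) ->
  Cmod (CI (oscf e s T) a b) <= 4 * K.
Proof.
  intros Hab He Hn Hs HK.
  set (w := fun u => exp (s * u) / (T - e * exp u)).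
  set (w' := fun u => exp (s * u) * (s * (T - e * exp u) + e * exp u) / (T - e * exp u) ^ 2).
  assert (P : forall u, a <= u <= b -> 0 < exp (s * u) / (T - e * exp u) ^ 2).
  { intros u Hu. apply Rdiv_lt_0_compat; [apply exp_pos|]. specialize (Hn u Hu).
    assert (0 <= (T - e * exp u) ^ 2) by apply pow2_ge_0.
    destruct (Req_dec ((T - e * exp u) ^ 2) 0) as [Z|Z]; [|lra].
    exfalso. apply Hn. simpl in Z. rewrite Rmult_1_r in Z. now apply Rmult_integral in Z; destruct Z. }
  rewrite (CI_ext _ (fun u => RtoC (w u * (T - e * exp u)) * cis (T * u - e * exp u))%C a b Hab).
  2:{ intros u Hu. unfold oscf, w. do 2 f_equal. field. apply Hn; lra. }
  assert (W : forall u, a <= u <= b -> Rabs (w u) <= K).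
  { intros u Hu. unfold w, Rdiv. rewrite Rabs_mult, Rabs_inv, (Rabs_pos_eq (exp _)) by (left; apply exp_pos).
    assert (0 < Rabs (T - e * exp u)) by (apply Rabs_pos_lt, Hn, Hu).
    apply (Rmult_le_reg_r (Rabs (T - e * exp u))); auto.
    rewrite Rmult_assoc, Rinv_l, Rmult_1_r by lra. now apply HK. }
  eapply Rle_trans; [apply (vdc_first w w' (fun u => T * u - e * exp u) (fun u => T - e * exp u))|]; auto.
  - intros u Hu. unfold w, w'. specialize (Hn u Hu). auto_derive; auto. field; auto.
  - intros u Hu. unfold w'. apply (ex_derive_continuous (V := R_NormedModule)). auto_derive.
    specialize (Hn u Hu). rewrite Rmult_1_r. intros F. apply Rmult_integral in F. destruct F; auto.
  - intros u Hu. auto_derive; auto. ring.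
  - intros u Hu. apply (ex_derive_continuous (V := R_NormedModule)). auto_derive; auto.
  - destruct Hs as [Hs|Hs]; [left|right]; intros u Hu; specialize (Hs u Hu); specialize (P u Hu); unfold w'.
    + replace (exp (s * u) * (s * (T - e * exp u) + e * exp u) / (T - e * exp u) ^ 2) with
       (exp (s * u) / (T - e * exp u) ^ 2 * (s * (T - e * exp u) + e * exp u)) by (unfold Rdiv; ring).
      apply Rmult_le_pos; lra.
    + replace (exp (s * u) * (s * (T - e * exp u) + e * exp u) / (T - e * exp u) ^ 2) with
       (- (exp (s * u) / (T - e * exp u) ^ 2 * - (s * (T - e * exp u) + e * exp u))) by (unfold Rdiv; ring).
      assert (0 <= exp (s * u) / (T - e * exp u) ^ 2 * - (s * (T - e * exp u) + e * exp u)).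
      { apply Rmult_le_pos; lra. } lra.
  - assert (Wa := W a ltac:(lra)). assert (Wb := W b ltac:(lra)).
    assert (Rabs (w b - w a) <= Rabs (w b) + Rabs (w a)).
    { unfold Rminus. eapply Rle_trans; [apply Rabs_triang|]. rewrite Rabs_Ropp; lra. }
    lra.
Qed.

Lemma Rpower_split T s : 0 < T -> Rpower T (s - 1 / 2) * sqrt T = Rpower T s.
Proof.
  intros HT. rewrite <- (Rpower_sqrt T HT), <- Rpower_plus. f_equal. field.
Qed.

Lemma Rpower_half_split T s : 0 < T -> Rpower T (s - 1) * sqrt T = Rpower T (s - 1 / 2).
Proof.
  intros HT. rewrite <- (Rpower_sqrt T HT), <- Rpower_plus. f_equal. field.
Qed.

Lemma sqrt_facts T : 4 <= T -> 2 <= sqrt T /\ sqrt T * sqrt T = T.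
Proof.
  intros HT. assert (Q : sqrt T * sqrt T = T) by (apply sqrt_sqrt; lra).
  split; auto. rewrite <- (sqrt_Rsqr 2) by lra. apply sqrt_le_1_alt. unfold Rsqr; lra.
Qed.

(** The interval is cut where [exp u = T - sqrt T] and [exp u = T + sqrt T]. Outside, the derivative
    test gives [4 K] and [8 K]; in between, the length at most [4 / sqrt T] and the integrand at
    most [2 T^s] give another [8 K], where [K = T^(s - 1/2)]. *)
Lemma oscf_bound_pos s T U : 4 <= T -> 0 < s < 1 -> 0 <= U ->
  Cmod (CI (oscf 1 s T) 0 U) <= 20 * Rpower T (s - 1 / 2).
Proof.
  intros HT Hs HU. destruct (sqrt_facts T HT) as [Q2 Q].
  set (r := sqrt T) in *. set (K := Rpower T (s - 1 / 2)).
  assert (K0 : 0 < K) by apply Rpower_pos.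
  assert (KT : K * r = Rpower T s) by (apply Rpower_split; lra).
  assert (KT' : Rpower T (s - 1) * r = K) by (apply Rpower_half_split; lra).
  assert (P1 : 2 <= T - r) by nra.
  set (p := ln (T - r)). set (q := ln (T + r)).
  assert (p0 : 0 <= p) by (unfold p; rewrite <- ln_1; apply ln_le; lra).
  assert (pq : p <= q) by (unfold p, q; apply ln_le; lra).
  assert (ep : exp p = T - r) by (apply exp_ln; lra).
  assert (eq : exp q = T + r) by (apply exp_ln; lra).
  set (p' := Rmin U p). set (q' := Rmin U q).
  assert (A1 : p' <= p) by apply Rmin_r. assert (A2 : p' <= U) by apply Rmin_l.
  assert (A3 : 0 <= p') by (apply Rmin_glb; lra).
  assert (A4 : p' <= q') by (apply Rmin_glb; lra).
  assert (A5 : q' <= q) by apply Rmin_r. assert (A6 : q' <= U) by apply Rmin_l.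
  assert (A7 : q' - p' <= q - p).
  { unfold p', q', Rmin. destruct (Rle_dec U q), (Rle_dec U p); lra. }
  assert (mono : forall x y, x <= y -> exp x <= exp y) by apply exp_le.
  rewrite <- (CI_Chasles _ 0 p' U) by (apply exCI_oscf; lra).
  rewrite <- (CI_Chasles _ p' q' U) by (apply exCI_oscf; lra).
  eapply Rle_trans; [apply Cmod_triangle|].
  eapply Rle_trans; [apply Rplus_le_compat_l, Cmod_triangle|].
  assert (B1 : Cmod (CI (oscf 1 s T) 0 p') <= 4 * K).
  { apply oscf_nonstationary; auto.
    - intros u Hu. specialize (mono u p ltac:(lra)). lra.
    - left. intros u Hu. specialize (mono u p ltac:(lra)). pose proof (exp_pos u). nra.
    - intros u Hu. specialize (mono u p ltac:(lra)). rewrite Rabs_pos_eq by lra.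
      apply Rle_trans with (Rpower T s).
      + apply exp_lin_Rpower; lra.
      + rewrite <- KT. apply Rmult_le_compat_l; lra. }
  assert (B3 : Cmod (CI (oscf 1 s T) q' U) <= 4 * (2 * K)).
  { destruct (Rle_dec U q) as [L|L].
    - assert (E : q' = U) by (unfold q'; apply Rmin_left; lra).
      rewrite E, CI_point, Cmod_0. lra.
    - assert (E : q' = q) by (unfold q'; apply Rmin_right; lra). rewrite E.
      apply oscf_nonstationary; auto; try lra.
      + intros u Hu. specialize (mono q u ltac:(lra)). lra.
      + left. intros u Hu. specialize (mono q u ltac:(lra)). nra.
      + intros u Hu. specialize (mono q u ltac:(lra)). rewrite Rabs_left by lra.
        eapply Rle_trans; [apply (exp_lin_Rpower_ge T); lra|].
        rewrite <- KT'. set (P := Rpower T (s - 1)).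
        assert (0 < P) by apply Rpower_pos.
        replace (2 * (P * r) * - (T - 1 * exp u)) with (P * (2 * r * (exp u - T))) by ring.
        rewrite Rmult_comm. apply Rmult_le_compat_l; [lra|]. nra. }
  assert (B2 : Cmod (CI (oscf 1 s T) p' q') <= 8 * K).
  { eapply Rle_trans.
    - apply (CI_norm_const _ (2 * Rpower T s)); auto.
      + now apply exCI_oscf.
      + intros u Hu. unfold oscf. rewrite Cmod_mult, Cmod_cis, Rmult_1_r, Cmod_RtoC_pos by (left; apply exp_pos).
        specialize (mono u q ltac:(lra)).
        apply Rle_trans with (Rpower (2 * T) s).
        * apply exp_lin_Rpower; nra.
        * rewrite <- Rpower_mult_distr by lra.
          apply Rmult_le_compat_r; [left; apply Rpower_pos|].
          rewrite <- (Rpower_1 2) at 2 by lra. apply Rle_Rpower; lra.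
    - rewrite <- KT.
      assert (L : q - p <= 4 / r).
      { unfold p, q. rewrite <- ln_div by lra.
        eapply Rle_trans; [apply ln_le_sub1, Rdiv_lt_0_compat; lra|].
        apply (Rmult_le_reg_r (r * (T - r))); [nra|].
        replace (((T + r) / (T - r) - 1) * (r * (T - r))) with (2 * r * r) by (field; lra).
        replace (4 / r * (r * (T - r))) with (4 * (T - r)) by (field; lra). nra. }
      apply Rle_trans with (2 * (K * r) * (4 / r)).
      + apply Rmult_le_compat_l; [nra|lra].
      + right. field. lra. }
  lra.
Qed.

(** There is no stationary point, but the weight is not monotone: its derivative changes sign once,
    where [(1 - s) exp u = s T], and the integral is cut there. *)
Lemma oscf_bound_neg s T U : 4 <= T -> 0 < s < 1 -> 0 <= U ->
  Cmod (CI (oscf (-1) s T) 0 U) <= 20 * Rpower T (s - 1 / 2).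
Proof.
  intros HT Hs HU. destruct (sqrt_facts T HT) as [Q2 Q].
  set (K := Rpower T (s - 1)). assert (K0 : 0 < K) by apply Rpower_pos.
  assert (KT : K * sqrt T = Rpower T (s - 1 / 2)) by (apply Rpower_half_split; lra).
  assert (KT' : K * T = Rpower T s).
  { unfold K. rewrite <- (Rpower_1 T) at 2 by lra. rewrite <- Rpower_plus. f_equal. ring. }
  set (p := ln (s * T / (1 - s))).
  assert (pp : 0 < s * T / (1 - s)) by (apply Rdiv_lt_0_compat; nra).
  assert (ep : exp p * (1 - s) = s * T) by (unfold p; rewrite exp_ln by auto; field; lra).
  set (p' := Rmax 0 (Rmin U p)).
  assert (A1 : 0 <= p') by apply Rmax_l.
  assert (A2 : p' <= U) by (apply Rmax_lub; auto; apply Rmin_l).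
  assert (W : forall u, exp (s * u) <= K * Rabs (T - -1 * exp u)).
  { intros u. pose proof (exp_pos u). rewrite Rabs_pos_eq by lra.
    destruct (Rle_dec (exp u) T).
    - apply Rle_trans with (Rpower T s); [apply exp_lin_Rpower; lra|]. rewrite <- KT'.
      apply Rmult_le_compat_l; lra.
    - eapply Rle_trans; [apply (exp_lin_Rpower_ge T); lra|]. fold K. rewrite Rmult_comm.
      apply Rmult_le_compat_l; lra. }
  rewrite <- (CI_Chasles _ 0 p' U) by (apply exCI_oscf; lra).
  eapply Rle_trans; [apply Cmod_triangle|].
  assert (B1 : Cmod (CI (oscf (-1) s T) 0 p') <= 4 * K).
  { destruct (Rle_dec p 0) as [L|L].
    - assert (E : p' = 0).
      { unfold p'. apply Rmax_left. eapply Rle_trans; [apply Rmin_r | exact L]. }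
      rewrite E, CI_point, Cmod_0. lra.
    - apply oscf_nonstationary; auto.
      + intros u _. pose proof (exp_pos u). lra.
      + left. intros u Hu. assert (p' <= p) by (apply Rmax_lub; [lra | apply Rmin_r]).
        pose proof (exp_le u p ltac:(lra)). nra. }
  assert (B2 : Cmod (CI (oscf (-1) s T) p' U) <= 4 * K).
  { destruct (Rle_dec U p) as [L|L].
    - assert (E : p' = U). { unfold p'. rewrite Rmin_left by auto. now apply Rmax_right. }
      rewrite E, CI_point, Cmod_0. lra.
    - apply oscf_nonstationary; auto.
      + intros u _. pose proof (exp_pos u). lra.
      + right. intros u Hu. assert (p <= p').
        { unfold p'. rewrite Rmin_right by lra. apply Rmax_r. }
        pose proof (exp_le p u ltac:(lra)). nra. }
  rewrite <- KT. nra.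
Qed.

Lemma Em_bound_01 e s T : e = 1 \/ e = -1 -> 4 <= T -> 0 < s < 1 ->
  Cmod (Em e (Cpt s T)) <= 22 * Rpower T (s - 1 / 2).
Proof.
  intros He HT Hs. unfold Em.
  assert (H1 : Cmod (LA e (Cpt s T)) <= 2 * Rpower T (s - 1 / 2)).
  { eapply Rle_trans; [apply LA_bound; auto; simpl; lra|]. simpl.
    unfold Rdiv. apply Rmult_le_compat_l; [lra|].
    rewrite <- (Rpower_1 T) at 1 by lra. rewrite <- Rpower_Ropp. apply Rle_Rpower; lra. }
  assert (H2 : Cmod (LBx e (- Cpt s T)) <= 20 * Rpower T (s - 1 / 2)).
  { apply LBx_limit; auto. intros U HU.
    rewrite (CI_ext _ (oscf e s T)) by
     (auto; intros u _; unfold lint, oscf, gB, cis;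
      rewrite <- Cexp_RtoC, <- !Cexp_plus; f_equal; apply Ceq; simpl; ring).
    destruct He; subst e; [now apply oscf_bound_pos | now apply oscf_bound_neg]. }
  eapply Rle_trans; [apply Cmod_triangle|]. lra.
Qed.

Lemma Em_step e s T K : e = 1 \/ e = -1 -> 4 <= T -> 0 < s < 2 ->
  Cmod (Em e (Cpt s T)) <= K * Rpower T (s - 1 / 2) ->
  Cmod (Em e (Cpt (s + 1) T)) <= 2 * K * Rpower T (s + 1 - 1 / 2).
Proof.
  intros He HT Hs H. pose proof (Em_rec e (Cpt s T) He Hs) as R.
  apply (f_equal Cmod) in R. rewrite !Cmod_mult in R.
  assert (Ce : Cmod (ie e) = 1).
  { unfold ie. rewrite Cmod_mult, Cmod_Ci, Cmod_R.
    destruct He; subst e; [rewrite Rabs_pos_eq; lra | rewrite Rabs_left; lra]. }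
  rewrite Ce, Rmult_1_l in R.
  replace (Cpt s T + 1)%C with (Cpt (s + 1) T) in R by (apply Ceq; simpl; ring). rewrite R.
  assert (S : Cmod (Cpt s T) <= 2 * T).
  { eapply Rle_trans; [apply Cmod_le_ReIm|]. simpl. rewrite !Rabs_pos_eq; lra. }
  apply Rle_trans with (2 * T * (K * Rpower T (s - 1 / 2))).
  - apply Rmult_le_compat; auto using Cmod_ge_0.
  - right. replace (s + 1 - 1 / 2) with (s - 1 / 2 + 1) by ring. rewrite Rpower_plus, Rpower_1 by lra. ring.
Qed.

(** The bound on the open strip [0 < Re s < 1], carried to the right by the recursion, misses the
    integer abscissas. Continuity supplies the missing one inside the range 9/8 to 17/8, namely
    2. *)
Lemma Em_bound_cont e s T K : 1 < s < 3 -> 4 <= T -> 0 <= K ->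
  (forall x, 0 < x < s -> s - 1 < x -> Cmod (Em e (Cpt x T)) <= K * Rpower T (x - 1 / 2)) ->
  Cmod (Em e (Cpt s T)) <= K * Rpower T (s - 1 / 2).
Proof.
  intros Hs HT HK H. apply le_epsilon. intros eps He.
  destruct (holo_Em e) as (E' & E'' & HE). destruct (HE (Cpt s T)) as [D _]; [simpl; lra|].
  destruct (chol_ball _ _ _ eps D He) as (d & Hd & Hb).
  set (x := s - Rmin (d / 2) (1 / 2)).
  assert (0 < Rmin (d / 2) (1 / 2)) by (apply Rmin_glb_lt; lra).
  pose proof (Rmin_l (d / 2) (1 / 2)). pose proof (Rmin_r (d / 2) (1 / 2)).
  specialize (Hb (Cpt x T)). specialize (H x ltac:(unfold x; lra) ltac:(unfold x; lra)).
  replace (Cpt x T - Cpt s T)%C with (RtoC (x - s)) in Hb by (apply Ceq; simpl; ring).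
  rewrite Cmod_R, Rabs_left in Hb by (unfold x; lra). specialize (Hb ltac:(unfold x; lra)).
  rewrite Cmod_minus_sym in Hb.
  pose proof (Cmod_triangle_inv (Em e (Cpt s T)) (Em e (Cpt x T))) as Tr.
  assert (Mo : Rpower T (x - 1 / 2) <= Rpower T (s - 1 / 2)) by (apply Rle_Rpower; unfold x; lra).
  apply (Rmult_le_compat_l K) in Mo; auto. lra.
Qed.

Lemma Em_bound e s T : e = 1 \/ e = -1 -> 4 <= T -> 9 / 8 <= s <= 17 / 8 ->
  Cmod (Em e (Cpt s T)) <= 88 * Rpower T (s - 1 / 2).
Proof.
  intros He HT Hs.
  assert (B1 : forall x, 1 < x < 2 -> Cmod (Em e (Cpt x T)) <= 44 * Rpower T (x - 1 / 2)).
  { intros x Hx. replace x with (x - 1 + 1) by ring. replace 44 with (2 * 22) by ring.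
    apply Em_step; auto; try lra. apply Em_bound_01; auto; lra. }
  assert (M : forall x, 44 * Rpower T (x - 1 / 2) <= 88 * Rpower T (x - 1 / 2)).
  { intros x. pose proof (Rpower_pos T (x - 1 / 2)). lra. }
  destruct (Rtotal_order s 2) as [L|[L|L]].
  - eapply Rle_trans; [apply B1; lra | apply M].
  - subst s. eapply Rle_trans; [|apply M]. apply Em_bound_cont; auto; try lra.
    intros x H1 H2. apply B1; lra.
  - replace s with (s - 1 + 1) by ring. replace 88 with (2 * 44) by ring.
    apply Em_step; auto; try lra. apply B1; lra.
Qed.

(** * The truncated inverse Mellin transform *)

Lemma ccont2_mult F G x y : ccont2 F x y -> ccont2 G x y -> ccont2 (fun u v => F u v * G u v)%C x y.
Proof.
  intros [A B] [D E]. split.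
  - apply (continuity_2d_pt_minus (fun u v => Re (F u v) * Re (G u v)) (fun u v => Im (F u v) * Im (G u v)));
    apply continuity_2d_pt_mult; assumption.
  - apply (continuity_2d_pt_plus (fun u v => Re (F u v) * Im (G u v)) (fun u v => Im (F u v) * Re (G u v)));
    apply continuity_2d_pt_mult; assumption.
Qed.

Lemma ccont2_Cexp F x y : ccont2 F x y -> ccont2 (fun u v => Cexp (F u v)) x y.
Proof.
  intros [A B]. split; unfold Cexp; simpl.
  - apply (continuity_2d_pt_mult (fun u v => exp (Re (F u v))) (fun u v => cos (Im (F u v)))).
    + apply continuity_1d_2d_pt_comp; auto. apply derivable_continuous, derivable_exp.
    + apply continuity_1d_2d_pt_comp; auto. apply continuity_cos.
  - apply (continuity_2d_pt_mult (fun u v => exp (Re (F u v))) (fun u v => sin (Im (F u v)))).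
    + apply continuity_1d_2d_pt_comp; auto. apply derivable_continuous, derivable_exp.
    + apply continuity_1d_2d_pt_comp; auto. apply continuity_sin.
Qed.

Lemma ccont2_const z x y : ccont2 (fun _ _ => z) x y.
Proof. split; apply continuity_2d_pt_const. Qed.

Lemma ccont2_fst f x y : ccont f x -> ccont2 (fun u _ => f u) x y.
Proof.
  intros [A B]. split.
  - apply (continuity_1d_2d_pt_comp (fun u => Re (f u)) (fun u _ => u)); [|apply continuity_2d_pt_id1].
    now apply continuity_pt_filterlim.
  - apply (continuity_1d_2d_pt_comp (fun u => Im (f u)) (fun u _ => u)); [|apply continuity_2d_pt_id1].
    now apply continuity_pt_filterlim.
Qed.

Lemma ccont2_snd f x y : ccont f y -> ccont2 (fun _ v => f v) x y.
Proof.
  intros [A B]. split.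
  - apply (continuity_1d_2d_pt_comp (fun u => Re (f u)) (fun _ v => v)); [|apply continuity_2d_pt_id2].
    now apply continuity_pt_filterlim.
  - apply (continuity_1d_2d_pt_comp (fun u => Im (f u)) (fun _ v => v)); [|apply continuity_2d_pt_id2].
    now apply continuity_pt_filterlim.
Qed.

Lemma continuous_ln x : 0 < x -> continuous ln x.
Proof. intros. apply (ex_derive_continuous (V := R_NormedModule)). auto_derive; auto. Qed.

Lemma cder_Rpower_C z x : 0 < x -> cder (fun u => Rpower_C u z) x (z * Rpower_C x (z - 1))%C.
Proof.
  intros Hx. eapply cder_eq.
  - unfold Rpower_C. apply cder_Cexp, cder_scal, cder_RtoC. apply (is_derive_ln x Hx).
  - assert (E : Cexp (z * RtoC (ln x))%C = (Rpower_C x (z - 1) * RtoC x)%C).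
    { rewrite <- (Rpower_C_1 x Hx), <- Rpower_C_plus. unfold Rpower_C. f_equal. ring. }
    change (z * RtoC (/ x) * Cexp (z * RtoC (ln x)) = z * Rpower_C x (z - 1))%C. rewrite E.
    rewrite RtoC_inv by lra.
    assert (RtoC x <> RtoC 0) by (intros F; apply (f_equal fst) in F; simpl in F; lra).
    field. assumption.
Qed.

Lemma cder_CI_upper f a b r : r < a -> r < b -> (forall t, r < t -> ccont f t) ->
  cder (fun u => CI f a u) b (f b).
Proof.
  intros Ha Hb H.
  assert (K : forall p : C -> R, (forall t, r < t -> continuous (fun u => p (f u)) t) ->
    is_derive (fun u => RInt (fun t => p (f t)) a u) b (p (f b))).
  { intros p Hp. apply (is_derive_RInt (fun t => p (f t)) (fun u => RInt (fun t => p (f t)) a u) a b).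
    - assert (P : 0 < b - r) by lra. exists (mkposreal _ P). intros y Hy.
      apply (RInt_correct (V := R_CompleteNormedModule)).
      apply (ex_RInt_continuous (V := R_CompleteNormedModule)). intros z Hz. apply Hp.
      assert (Rabs (y - b) < b - r) by exact Hy. apply Rabs_def2 in H0.
      assert (r < Rmin a y) by (apply Rmin_glb_lt; lra). lra.
    - now apply Hp. }
  split; [apply (K Re (fun t Ht => proj1 (H t Ht))) | apply (K Im (fun t Ht => proj2 (H t Ht)))].
Qed.

(** Here [f] oscillates and [h] varies slowly: the primitive of [f] is bounded by [p], and [q]
    dominates what remains under the integral. In the application [q] is an explicit power. *)
Lemma CI_by_parts_bound f h h' (p q : R -> R) a b r : r < a -> a <= b ->
  (forall t, r < t -> ccont f t) ->
  (forall t, a <= t <= b -> cder h t (h' t)) -> (forall t, a <= t <= b -> ccont h' t) ->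
  (forall t, a <= t <= b -> Cmod (CI f a t) <= p t) ->
  (forall t, a <= t <= b -> p t * Cmod (h' t) <= q t) -> (forall t, a <= t <= b -> continuous q t) ->
  Cmod (CI (fun t => f t * h t)%C a b) <= p b * Cmod (h b) + RInt q a b.
Proof.
  intros Hr Hab Cf Dh Ch Hp Hq Cq.
  set (P := fun t => CI f a t).
  assert (DP : forall t, a <= t <= b -> cder P t (f t)).
  { intros t Ht. apply (cder_CI_upper f a t r); auto; lra. }
  assert (C1 : forall t, a <= t <= b -> ccont (fun t => f t * h t)%C t).
  { intros t Ht. apply ccont_mult; [apply Cf; lra | eapply cder_ccont, Dh, Ht]. }
  assert (C2 : forall t, a <= t <= b -> ccont (fun t => P t * h' t)%C t).
  { intros t Ht. apply ccont_mult; [eapply cder_ccont, DP, Ht | now apply Ch]. }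
  assert (X1 := exCI_cont _ a b Hab C1). assert (X2 := exCI_cont _ a b Hab C2).
  assert (E : CI (fun t => f t * h t)%C a b = (P b * h b - CI (fun t => P t * h' t) a b)%C).
  { assert (E1 : CI (fun t => f t * h t + P t * h' t)%C a b = (P b * h b - P a * h a)%C).
    { apply (CI_FTC (fun t => P t * h t)%C); auto.
      - intros t Ht. apply cder_mult; auto.
      - intros t Ht. apply ccont_plus; auto. }
    rewrite CI_plus in E1 by assumption. unfold P at 3 in E1. rewrite CI_point in E1.
    replace (CI (fun t => f t * h t)%C a b) with
     (CI (fun t => f t * h t) a b + CI (fun t => P t * h' t) a b - CI (fun t => P t * h' t) a b)%C by ring.
    rewrite E1. ring. }
  rewrite E. eapply Rle_trans; [apply Cmod_minus_le|]. apply Rplus_le_compat.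
  - rewrite Cmod_mult. apply Rmult_le_compat_r; [apply Cmod_ge_0|]. apply Hp; lra.
  - apply CI_norm_le; auto.
    + now apply ex_RInt_cont.
    + intros t Ht. rewrite Cmod_mult. eapply Rle_trans; [|now apply Hq].
      apply Rmult_le_compat_r; [apply Cmod_ge_0 | now apply Hp].
Qed.

(** To the right of 1, so that Dirichlet series converge absolutely, yet close to it: the boundary
    terms grow like [t^(c0 - 1/2) = t^(5/8)], below the exponent 3/4. *)
Definition c0 : R := 9 / 8.

Definition VE (e l T : R) : C := CI (fun t => Em e (Cpt c0 t) * Rpower_C l (- Cpt c0 t))%C 4 T.

(** The horizontal side at height [t] of the rectangle between the lines [c0] and [c0 + 1], with the
    oscillating factor [l^(-it)] taken out. *)
Definition hE (e t l : R) : C := CI (fun x => Em e (Cpt x t) * RtoC (Rpower l (- x)))%C c0 (c0 + 1).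

Lemma Cpt_shift1 x t : (Cpt x t + 1)%C = Cpt (x + 1) t.
Proof. apply Ceq; simpl; ring. Qed.

Lemma Em_ccont_im e x t : 0 < x < 3 -> ccont (fun v => Em e (Cpt x v)) t.
Proof. intros H. apply (holo_ccont_im _ _ _ _ (holo_Em e)). exact H. Qed.

Lemma Em_ccont_re e x t : 0 < x < 3 -> ccont (fun u => Em e (Cpt u t)) x.
Proof. intros H. apply (holo_ccont_re _ _ _ _ (holo_Em e)). exact H. Qed.

Lemma ccont_Cpt_im x t : ccont (fun v => Cpt x v) t.
Proof. split; simpl; [apply continuous_const | apply continuous_id]. Qed.

Lemma Em_line_ccont e x l t : 0 < x < 3 ->
  ccont (fun v => Em e (Cpt x v) * Rpower_C l (- Cpt x v))%C t.
Proof.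
  intros Hx. apply ccont_mult; [now apply Em_ccont_im|].
  unfold Rpower_C. apply ccont_Cexp, ccont_mult; [|apply ccont_const]. apply ccont_opp, ccont_Cpt_im.
Qed.

(** Differentiating [l^(-s)] produces [-s l^(-s-1)], and the recursion turns [s Em e s] into [ie e]
    times [Em e (s + 1)]: the derivative is the same integral on the line one unit to the right. *)
Lemma cder_VE e l T : e = 1 \/ e = -1 -> 0 < l -> 4 <= T ->
  cder (fun l => VE e l T) l
    (- ie e * CI (fun t => Em e (Cpt (c0 + 1) t) * Rpower_C l (- Cpt (c0 + 1) t)) 4 T)%C.
Proof.
  intros He Hl HT. unfold VE, c0.
  rewrite <- CI_scal by (apply exCI_cont; auto; intros t Ht; apply Em_line_ccont; lra).
  apply (cder_CI_param (fun l t => Em e (Cpt (9 / 8) t) * Rpower_C l (- Cpt (9 / 8) t))%C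
    (fun l t => - ie e * (Em e (Cpt (9 / 8 + 1) t) * Rpower_C l (- Cpt (9 / 8 + 1) t)))%C 4 T l l); auto.
  - intros y t Hy _. apply Rabs_def2 in Hy. assert (y0 : 0 < y) by lra.
    eapply cder_eq; [apply cder_scal, (cder_Rpower_C (- Cpt (9 / 8) t) y y0)|].
    replace (- Cpt (9 / 8) t - 1)%C with (- Cpt (9 / 8 + 1) t)%C by (apply Ceq; simpl; ring).
    pose proof (Em_rec e (Cpt (9 / 8) t) He ltac:(simpl; lra)) as R.
    rewrite Cpt_shift1 in R.
    replace (- ie e * (Em e (Cpt (9 / 8 + 1) t) * Rpower_C y (- Cpt (9 / 8 + 1) t)))%C with
      (- (ie e * Em e (Cpt (9 / 8 + 1) t)) * Rpower_C y (- Cpt (9 / 8 + 1) t))%C by ring.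
    rewrite R. ring.
  - intros t Ht. apply ccont2_mult; [apply ccont2_const|].
    apply ccont2_mult; [apply (ccont2_snd (fun t => Em e (Cpt (9 / 8 + 1) t))), Em_ccont_im; lra|].
    unfold Rpower_C. apply ccont2_Cexp, ccont2_mult.
    + apply (ccont2_snd (fun t => - Cpt (9 / 8 + 1) t)%C), ccont_opp, ccont_Cpt_im.
    + apply (ccont2_fst (fun l => RtoC (ln l))), ccont_RtoC, continuous_ln, Hl.
  - intros y t _ Ht. apply Em_line_ccont; lra.
Qed.

Lemma Rpower_C_Cpt l x t : Rpower_C l (- Cpt x t) = (RtoC (Rpower l (- x)) * cis (- (t * ln l)))%C.
Proof.
  unfold Rpower_C, Rpower, cis. rewrite <- Cexp_RtoC, <- Cexp_plus. f_equal. apply Ceq; simpl; ring.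
Qed.

Lemma hE_exCI e t l : exCI (fun x => Em e (Cpt x t) * RtoC (Rpower l (- x)))%C c0 (c0 + 1).
Proof.
  apply exCI_cont; [unfold c0; lra|]. intros x Hx. unfold c0 in Hx.
  apply ccont_mult; [apply Em_ccont_re; lra|]. apply ccont_RtoC.
  unfold Rpower. apply (ex_derive_continuous (V := R_NormedModule)). auto_derive; auto.
Qed.

Lemma VE_shift e l T : 4 <= T ->
  (CI (fun t => Em e (Cpt c0 t) * Rpower_C l (- Cpt c0 t)) 4 T
    - CI (fun t => Em e (Cpt (c0 + 1) t) * Rpower_C l (- Cpt (c0 + 1) t)) 4 T)%C
  = (Ci * (hE e T l * cis (- (T * ln l)) - hE e 4 l * cis (- (4 * ln l))))%C.
Proof.
  intros HT.
  assert (H : holo (fun s => 0 < Re s < 3) (fun s => Em e s * Rpower_C l (- s))%C).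
  { apply holo_mult; [apply holo_Em|].
    apply holo_ext with (fun s => Rpower_C l (- (1) * s + 0)%C). { intros s. f_equal. ring. }
    eapply holo_weaken; [|apply (holo_affine (fun _ => True)), holo_Rpower_C]. intros; exact I. }
  pose proof (Cauchy_holo _ _ c0 (c0 + 1) 4 T (1 / 8) H ltac:(unfold c0; lra) HT ltac:(lra)) as E.
  assert (E' := E ltac:(intros x y Hx _; unfold c0 in Hx; simpl; lra)). clear E.
  assert (hh : forall t, CI (fun x => Em e (Cpt x t) * Rpower_C l (- Cpt x t))%C c0 (c0 + 1)
     = (cis (- (t * ln l)) * hE e t l)%C).
  { intros t. unfold hE. rewrite <- CI_scal by apply hE_exCI.
    apply CI_ext; [unfold c0; lra|]. intros x _. rewrite Rpower_C_Cpt. ring. }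
  cbv beta in E'. rewrite !hh in E'.
  set (I1 := CI (fun t => Em e (Cpt c0 t) * Rpower_C l (- Cpt c0 t))%C 4 T) in *.
  set (I2 := CI (fun t => Em e (Cpt (c0 + 1) t) * Rpower_C l (- Cpt (c0 + 1) t))%C 4 T) in *.
  replace (I1 - I2)%C with (Ci * (Ci * (I2 - I1)))%C.
  - rewrite E'. ring.
  - generalize I1, I2. intros. cring.
Qed.

(** The recursion [i e E(s+1) = s E(s)] and Cauchy's theorem cancel the integrals over [t]: only boundary terms
    at heights 4 and [T] remain, so [e^(iel) V] varies slowly in [l] away from [l = T]. *)
Lemma cder_cis_VE e l T : e = 1 \/ e = -1 -> 0 < l -> 4 <= T ->
  cder (fun l => cis (e * l) * VE e l T)%C l
   (- RtoC e * (cis (e * l - T * ln l) * hE e T l - cis (e * l - 4 * ln l) * hE e 4 l))%C.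
Proof.
  intros He Hl HT. eapply cder_eq.
  - apply cder_mult; [|now apply cder_VE].
    apply (cder_cis (fun l => e * l)). auto_derive; [auto|reflexivity].
  - assert (cc : forall t, cis (e * l - t * ln l) = (cis (e * l) * cis (- (t * ln l)))%C).
    { intros t. unfold cis. rewrite <- Cexp_plus. f_equal. cring. }
    rewrite !cc. pose proof (VE_shift e l T HT) as S. fold (VE e l T) in S.
    set (I2 := CI (fun t => Em e (Cpt (c0 + 1) t) * Rpower_C l (- Cpt (c0 + 1) t))%C 4 T) in *.
    unfold ie. rewrite Rmult_1_r.
    transitivity (cis (e * l) * (Ci * RtoC e * (VE e l T - I2)))%C; [ring|]. rewrite S.
    generalize (cis (e * l)), (hE e T l), (cis (- (T * ln l))), (hE e 4 l), (cis (- (4 * ln l))).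
    intros z A p B q. transitivity (Ci * Ci * (RtoC e * (z * p * A - z * q * B)))%C; [ring|].
    replace (Ci * Ci)%C with (- (1))%C by cring. ring.
Qed.

Definition osc (e t l : R) : C := cis (e * l - t * ln l).

Lemma ccont_osc e t l : 0 < l -> ccont (osc e t) l.
Proof. intros Hl. eapply cder_ccont, cder_cis. auto_derive; [exact Hl | reflexivity]. Qed.

Lemma exCI_osc e t a b : 0 < a <= b -> exCI (osc e t) a b.
Proof. intros H. apply exCI_cont; [lra|]. intros l Hl. apply ccont_osc. lra. Qed.

(** The weight [l / (e l - t)] has derivative [-t / (e l - t)^2], of constant sign, so unlike for
    [oscf] monotonicity is automatic. *)
Lemma osc_first e t a b K : 0 < a -> a <= b -> 0 < t ->
  (forall l, a <= l <= b -> e * l - t <> 0) -> (forall l, a <= l <= b -> l <= K * Rabs (e * l - t)) ->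
  Cmod (CI (osc e t) a b) <= 4 * K.
Proof.
  intros Ha Hab Ht Hn HK.
  set (w := fun l => l / (e * l - t)). set (w' := fun l => - t / (e * l - t) ^ 2).
  rewrite (CI_ext _ (fun l => RtoC (w l * ((e * l - t) / l)) * cis (e * l - t * ln l))%C a b Hab).
  2:{ intros l Hl. unfold osc, w. specialize (Hn l ltac:(lra)).
      replace (l / (e * l - t) * ((e * l - t) / l)) with 1 by (field; lra). ring. }
  assert (W : forall l, a <= l <= b -> Rabs (w l) <= K).
  { intros l Hl. unfold w, Rdiv. rewrite Rabs_mult, Rabs_inv, (Rabs_pos_eq l) by lra.
    assert (0 < Rabs (e * l - t)) by (apply Rabs_pos_lt, Hn, Hl).
    apply (Rmult_le_reg_r (Rabs (e * l - t))); auto.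
    rewrite Rmult_assoc, Rinv_l, Rmult_1_r by lra. now apply HK. }
  assert (D0 : forall l, a <= l <= b -> 0 < (e * l - t) ^ 2).
  { intros l Hl. specialize (Hn l Hl). apply pow2_gt_0; auto. }
  eapply Rle_trans; [apply (vdc_first w w' (fun l => e * l - t * ln l) (fun l => (e * l - t) / l))|]; auto.
  - intros l Hl. specialize (Hn l Hl). unfold w, w'. auto_derive; auto. field; auto.
  - intros l Hl. specialize (D0 l Hl). unfold w'. apply (ex_derive_continuous (V := R_NormedModule)).
    auto_derive. simpl in D0. lra.
  - intros l Hl. auto_derive; [lra|]. field. lra.
  - intros l Hl. apply (ex_derive_continuous (V := R_NormedModule)). auto_derive. lra.
  - right. intros l Hl. specialize (D0 l Hl). unfold w'.
    assert (0 <= t / (e * l - t) ^ 2) by (apply Rdiv_le_0_compat; lra).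
    unfold Rdiv in *. rewrite Ropp_mult_distr_l_reverse. lra.
  - assert (Wa := W a ltac:(lra)). assert (Wb := W b ltac:(lra)).
    assert (Rabs (w b - w a) <= Rabs (w b) + Rabs (w a)).
    { unfold Rminus. eapply Rle_trans; [apply Rabs_triang|]. rewrite Rabs_Ropp; lra. }
    lra.
Qed.

Lemma le_div_mul x y z : 0 < z -> x * z <= y -> x <= y / z.
Proof. intros Hz H. apply (Rmult_le_reg_r z); auto. unfold Rdiv. rewrite Rmult_assoc, Rinv_l; lra. Qed.

Lemma div_le_mul x y z : 0 < z -> y <= x * z -> y / z <= x.
Proof. intros Hz H. apply (Rmult_le_reg_r z); auto. unfold Rdiv. rewrite Rmult_assoc, Rinv_l; lra. Qed.

Lemma osc_neg t a b : 0 < a -> a <= b -> 0 < t -> Cmod (CI (osc (-1) t) a b) <= 4 * (b / (b + t)).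
Proof.
  intros Ha Hab Ht. apply osc_first; auto.
  - intros l Hl. lra.
  - intros l Hl. rewrite Rabs_left by lra.
    replace (b / (b + t) * - (-1 * l - t)) with (b * (l + t) / (b + t)) by (field; lra).
    apply le_div_mul; nra.
Qed.

Lemma osc_below t a b : 0 < a -> a <= b -> b < t -> Cmod (CI (osc 1 t) a b) <= 4 * (b / (t - b)).
Proof.
  intros Ha Hab Ht. apply osc_first; auto; try lra.
  - intros l Hl. lra.
  - intros l Hl. rewrite Rabs_left by lra.
    replace (b / (t - b) * - (1 * l - t)) with (b * (t - l) / (t - b)) by (field; lra).
    apply le_div_mul; nra.
Qed.

Lemma osc_above t a b : 0 < t -> t < a -> a <= b -> Cmod (CI (osc 1 t) a b) <= 4 * (a / (a - t)).
Proof.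
  intros Ht Ha Hab. apply osc_first; auto; try lra.
  - intros l Hl. lra.
  - intros l Hl. rewrite Rabs_pos_eq by lra.
    replace (a / (a - t) * (1 * l - t)) with (a * (l - t) / (a - t)) by (field; lra).
    apply le_div_mul; nra.
Qed.

(** The piece within [sqrt t] of the stationary point [l = t] is bounded by its length [2 sqrt t];
    the derivative test gives [4 sqrt t] below it and [8 sqrt t] above it. *)
Lemma osc_any t a b : 4 <= t -> 0 < a -> a <= b -> Cmod (CI (osc 1 t) a b) <= 14 * sqrt t.
Proof.
  intros Ht Ha Hab. destruct (sqrt_facts t Ht) as [Q2 Q]. set (r := sqrt t) in *.
  set (p := Rmax a (Rmin b (t - r))). set (q := Rmax p (Rmin b (t + r))).
  assert (A1 : a <= p) by apply Rmax_l.
  assert (A2 : p <= b) by (apply Rmax_lub; auto; apply Rmin_l).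
  assert (A3 : p <= q) by apply Rmax_l.
  assert (A4 : q <= b) by (apply Rmax_lub; auto; apply Rmin_l).
  rewrite <- (CI_Chasles _ a p b) by (apply exCI_osc; lra).
  rewrite <- (CI_Chasles _ p q b) by (apply exCI_osc; lra).
  eapply Rle_trans; [apply Cmod_triangle|].
  eapply Rle_trans; [apply Rplus_le_compat_l, Cmod_triangle|].
  assert (B1 : Cmod (CI (osc 1 t) a p) <= 4 * r).
  { destruct (Rle_dec (Rmin b (t - r)) a) as [L|L].
    - assert (E : p = a) by (apply Rmax_left, L). rewrite E, CI_point, Cmod_0. lra.
    - assert (E : p <= t - r) by (unfold p; rewrite Rmax_right by lra; apply Rmin_r).
      eapply Rle_trans; [apply osc_below; lra|].
      apply Rmult_le_compat_l; [lra|]. apply div_le_mul; nra. }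
  assert (B2 : Cmod (CI (osc 1 t) p q) <= 2 * r).
  { eapply Rle_trans; [apply (CI_norm_const _ 1); auto|].
    - apply exCI_osc; lra.
    - intros l _. unfold osc. rewrite Cmod_cis. lra.
    - destruct (Rle_dec (Rmin b (t + r)) p) as [L|L].
      + assert (E : q = p) by (apply Rmax_left, L). lra.
      + assert (E : q = Rmin b (t + r)) by (apply Rmax_right; lra).
        assert (q <= t + r) by (rewrite E; apply Rmin_r).
        assert (t - r <= p); [|lra].
        destruct (Rle_dec (t - r) b).
        * unfold p. rewrite Rmin_right by auto. apply Rmax_r.
        * exfalso. assert (p = b) by (unfold p; rewrite Rmin_left by lra; apply Rmax_right; lra). lra. }
  assert (B3 : Cmod (CI (osc 1 t) q b) <= 8 * r).
  { destruct (Rle_dec b (t + r)) as [L|L].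
    - assert (E : q = b) by (unfold q; rewrite Rmin_left by lra; apply Rmax_right; lra).
      rewrite E, CI_point, Cmod_0. lra.
    - assert (E : t + r <= q) by (unfold q; rewrite Rmin_right by lra; apply Rmax_r).
      eapply Rle_trans; [apply osc_above; lra|].
      replace (8 * r) with (4 * (2 * r)) by ring.
      apply Rmult_le_compat_l; [lra|]. apply div_le_mul; nra. }
  lra.
Qed.

(** [Bq t l = t^(c - 1/2) l^(-c)] is the size of the boundary terms. *)
Definition Bq (t l : R) : R := Rpower t (5 / 8) * Rpower l (- (9 / 8)).

Lemma Bq_pos t l : 0 < Bq t l.
Proof. apply Rmult_lt_0_compat; apply Rpower_pos. Qed.

Lemma Rpower_neg_le a b x : 0 < a <= b -> 0 <= x -> Rpower b (- x) <= Rpower a (- x).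
Proof.
  intros H Hx. rewrite !Rpower_Ropp. apply Rinv_le_contravar; [apply Rpower_pos|].
  now apply Rpower_le_base.
Qed.

Lemma Bq_anti t a b : 0 < a <= b -> Bq t b <= Bq t a.
Proof.
  intros H. apply Rmult_le_compat_l; [left; apply Rpower_pos|]. apply Rpower_neg_le; lra.
Qed.

Lemma Bq_mono s t l : 0 < s <= t -> Bq s l <= Bq t l.
Proof.
  intros H. apply Rmult_le_compat_r; [left; apply Rpower_pos|]. apply Rpower_le_base; lra.
Qed.

(** Relative to [Bq] the left side is [(t / l)^(x - 9/8)] with an exponent between 0 and 1, and
    [1 + t / l] dominates every such power, whether [t] exceeds [l] or not. *)
Lemma Em_weight t l x : 0 < t -> 0 < l -> 9 / 8 <= x <= 17 / 8 ->
  Rpower t (x - 1 / 2) * Rpower l (- x) <= Bq t l * (1 + t / l).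
Proof.
  intros Ht Hl Hx. unfold Bq.
  assert (M : Rpower (t / l) (x - 9 / 8) <= 1 + t / l).
  { assert (0 < t / l) by (apply Rdiv_lt_0_compat; auto).
    destruct (Rle_dec 1 (t / l)).
    - apply Rle_trans with (t / l); [|lra]. rewrite <- (Rpower_1 (t / l)) at 2 by auto.
      apply Rle_Rpower; lra.
    - apply Rle_trans with 1; [|lra]. rewrite <- (Rpower_O (t / l)) by auto.
      apply Rle_trans with (Rpower 1 (x - 9 / 8)); [apply Rpower_le_base; lra|].
      unfold Rpower. rewrite ln_1, !Rmult_0_r, Rmult_0_l. lra. }
  apply Rle_trans with (Rpower t (5 / 8) * Rpower l (- (9 / 8)) * Rpower (t / l) (x - 9 / 8)).
  - right. replace (x - 1 / 2) with (5 / 8 + (x - 9 / 8)) by field.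
    replace (- x) with (- (9 / 8) + - (x - 9 / 8)) by field.
    unfold Rdiv at 7. rewrite <- Rpower_mult_distr by (auto; now apply Rinv_0_lt_compat).
    rewrite !Rpower_plus.
    replace (Rpower (/ l) (x - 9 / 8)) with (Rpower l (- (x - 9 / 8))); [ring|].
    unfold Rpower. rewrite ln_Rinv by auto. f_equal. ring.
  - apply Rmult_le_compat_l; auto. left; apply Bq_pos.
Qed.

(** [hE] with an additional factor [q x]. The family is closed under differentiation in [l], which
    replaces [q] by [-x q] and contributes [1 / l]. *)
Definition hq (q : R -> R) (e t l : R) : C :=
  CI (fun x => Em e (Cpt x t) * (RtoC (q x) * Cexp (RtoC (- x) * RtoC (ln l))))%C c0 (c0 + 1).

Lemma hq_ccont (q : R -> R) e t l x : 9 / 8 <= x <= 17 / 8 -> continuous q x ->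
  ccont (fun x => Em e (Cpt x t) * (RtoC (q x) * Cexp (RtoC (- x) * RtoC (ln l))))%C x.
Proof.
  intros Hx Hq. apply ccont_mult; [apply Em_ccont_re; lra|]. apply ccont_mult; [now apply ccont_RtoC|].
  apply ccont_Cexp, ccont_mult; [|apply ccont_const]. apply ccont_RtoC.
  apply (continuous_opp (V := R_NormedModule) (fun v => v)), continuous_id.
Qed.

Lemma hq_exCI (q : R -> R) e t l : (forall x, continuous q x) ->
  exCI (fun x => Em e (Cpt x t) * (RtoC (q x) * Cexp (RtoC (- x) * RtoC (ln l))))%C c0 (c0 + 1).
Proof.
  intros Hq. apply exCI_cont; unfold c0; [lra|]. intros x Hx. apply hq_ccont; auto; lra.
Qed.

Lemma cder_hq (q : R -> R) e t l : 0 < l -> (forall x, continuous q x) ->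
  cder (hq q e t) l (RtoC (/ l) * hq (fun x => - x * q x)%R e t l)%C.
Proof.
  intros Hl Hq.
  assert (Hq' : forall x, continuous (fun x => - x * q x) x).
  { intros x. apply (continuous_mult (fun x => - x) q); auto.
    apply (continuous_opp (V := R_NormedModule) (fun v => v)), continuous_id. }
  unfold hq. rewrite <- CI_scal by (apply hq_exCI; auto).
  apply (cder_CI_param
    (fun l x => Em e (Cpt x t) * (RtoC (q x) * Cexp (RtoC (- x) * RtoC (ln l))))%C
    (fun l x => RtoC (/ l) * (Em e (Cpt x t) * (RtoC (- x * q x) * Cexp (RtoC (- x) * RtoC (ln l)))))%C
    c0 (c0 + 1) l (Rmin l (1 / 2))); unfold c0.
  - lra.
  - apply Rmin_glb_lt; lra.
  - intros y x Hy _. assert (Rmin l (1 / 2) <= l) by apply Rmin_l.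
    apply Rabs_def2 in Hy. assert (y0 : 0 < y) by lra. eapply cder_eq.
    + apply cder_scal, cder_scal, cder_Cexp, cder_scal, cder_RtoC. apply (is_derive_ln y y0).
    + rewrite RtoC_mult. ring.
  - intros x Hx. apply ccont2_mult.
    { apply (ccont2_fst (fun u => RtoC (/ u))), ccont_RtoC.
      apply (ex_derive_continuous (V := R_NormedModule)). auto_derive. lra. }
    apply ccont2_mult.
    { apply (ccont2_snd (fun x => Em e (Cpt x t))), Em_ccont_re. lra. }
    apply ccont2_mult.
    { apply (ccont2_snd (fun v => RtoC (- v * q v))), ccont_RtoC, Hq'. }
    apply ccont2_Cexp, ccont2_mult.
    + apply (ccont2_snd (fun v => RtoC (- v))), ccont_RtoC.
      apply (continuous_opp (V := R_NormedModule) (fun v => v)), continuous_id.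
    + apply (ccont2_fst (fun u => RtoC (ln u))), ccont_RtoC, continuous_ln, Hl.
  - intros y x Hy Hx. apply hq_ccont; auto; lra.
Qed.

Lemma hq_bound (q : R -> R) Q e t l : e = 1 \/ e = -1 -> 4 <= t -> 0 < l -> (forall x, continuous q x) ->
  0 <= Q -> (forall x, 9 / 8 <= x <= 17 / 8 -> Rabs (q x) <= Q) ->
  Cmod (hq q e t l) <= 88 * Q * (Bq t l * (1 + t / l)).
Proof.
  intros He Ht Hl Hc HQ Hq. eapply Rle_trans.
  - apply (CI_norm_const _ (88 * Q * (Bq t l * (1 + t / l)))); [unfold c0; lra | now apply hq_exCI|].
    intros x Hx. unfold c0 in Hx. rewrite !Cmod_mult, Cmod_R, Cmod_Cexp.
    replace (exp (Re (RtoC (- x) * RtoC (ln l))%C)) with (Rpower l (- x))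
      by (unfold Rpower; f_equal; creim; ring).
    pose proof (Em_bound e x t He Ht ltac:(lra)) as B. pose proof (Em_weight t l x ltac:(lra) Hl ltac:(lra)).
    specialize (Hq x ltac:(lra)). pose proof (Rpower_pos l (- x)). pose proof (Rpower_pos t (x - 1 / 2)).
    apply Rle_trans with (88 * Rpower t (x - 1 / 2) * (Q * Rpower l (- x))).
    + apply Rmult_le_compat; auto using Cmod_ge_0.
      * apply Rmult_le_pos; [apply Rabs_pos | lra].
      * apply Rmult_le_compat_r; lra.
    + replace (88 * Rpower t (x - 1 / 2) * (Q * Rpower l (- x))) with
       (88 * Q * (Rpower t (x - 1 / 2) * Rpower l (- x))) by ring.
      apply Rmult_le_compat_l; lra.
  - right. ring.
Qed.

Lemma hE_hq e t l : hE e t l = hq (fun _ => 1) e t l.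
Proof.
  apply CI_ext; [unfold c0; lra|]. intros x _.
  rewrite <- RtoC_mult, Cexp_RtoC. unfold Rpower. ring.
Qed.

(** Integration by parts with [osc] as the oscillating factor. As [hE] and its logarithmic
    derivative are only bounded up to [1 + t / l], the hypothesis asks for the product of this
    factor with the partial integrals. *)
Lemma osc_hE_bound e t a b K : e = 1 \/ e = -1 -> 4 <= t -> 0 < a -> a <= b -> 0 <= K ->
  (forall l, a <= l <= b -> Cmod (CI (osc e t) a l) * (1 + t / l) <= K) ->
  Cmod (CI (fun l => osc e t l * hE e t l)%C a b) <= 275 * K * Bq t a.
Proof.
  intros He Ht Ha Hab HK HP.
  set (h := hq (fun _ => 1) e t). set (h' := fun l => (RtoC (/ l) * hq (fun x => - x * 1)%R e t l)%C).
  assert (c1 : forall x : R, continuous (fun _ : R => 1) x) by (intros; apply continuous_const).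
  assert (c2 : forall x : R, continuous (fun x : R => - x * 1) x).
  { intros x. apply (ex_derive_continuous (V := R_NormedModule)). auto_derive; auto. }
  assert (T0 : forall l, a <= l <= b -> 0 < t / l) by (intros; apply Rdiv_lt_0_compat; lra).
  rewrite (CI_ext _ (fun l => osc e t l * h l)%C a b Hab) by (intros; now rewrite hE_hq).
  set (p := fun l => K / (1 + t / l)).
  set (k := 187 * K * Rpower t (5 / 8)).
  (* The constant 187 is [88 * 17/8]: 88 bounds the transform and [|x| <= 17/8] comes from
     differentiating [l^(-x)]. With the boundary term it makes 275. *)
  assert (Kt : 0 <= K * Rpower t (5 / 8)) by (apply Rmult_le_pos; auto; left; apply Rpower_pos).
  set (q := fun l => k * Rpower l (- (17 / 8))).
  eapply Rle_trans.
  - apply (CI_by_parts_bound (osc e t) h h' p q a b 0); auto.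
    + intros l Hl. now apply ccont_osc.
    + intros l Hl. apply cder_hq; auto; lra.
    + intros l Hl. unfold h'. apply ccont_mult.
      * apply ccont_RtoC, (ex_derive_continuous (V := R_NormedModule)). auto_derive. lra.
      * eapply cder_ccont. apply (cder_hq (fun x => - x * 1) e t l ltac:(lra) c2).
    + intros l Hl. unfold p. specialize (T0 l Hl). apply le_div_mul; [lra|]. now apply HP.
    + intros l Hl. specialize (T0 l Hl). unfold h', p, q, k. rewrite Cmod_mult, Cmod_R.
      assert (il : 0 < / l) by (apply Rinv_0_lt_compat; lra).
      rewrite (Rabs_pos_eq (/ l)) by lra.
      assert (B : Cmod (hq (fun x => - x * 1) e t l) <= 88 * (17 / 8) * (Bq t l * (1 + t / l))).
      { apply hq_bound; auto; try lra. intros x Hx. rewrite Rmult_1_r, Rabs_Ropp, Rabs_pos_eq; lra. }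
      apply Rle_trans with (K / (1 + t / l) * (/ l * (88 * (17 / 8) * (Bq t l * (1 + t / l))))).
      * apply Rmult_le_compat_l; [apply Rdiv_le_0_compat; lra|]. apply Rmult_le_compat_l; lra.
      * right. unfold Bq. replace (- (17 / 8)) with (- (9 / 8) + - (1)) by field.
        rewrite Rpower_plus, (Rpower_Ropp l 1), Rpower_1 by lra. field. split; lra.
    + intros l Hl. unfold q, Rpower. apply (ex_derive_continuous (V := R_NormedModule)). auto_derive. lra.
  - assert (B1 : p b * Cmod (h b) <= 88 * K * Bq t a).
    { assert (Tb := T0 b ltac:(lra)). unfold p, h.
      assert (B : Cmod (hq (fun _ => 1) e t b) <= 88 * 1 * (Bq t b * (1 + t / b))).
      { apply hq_bound; auto; try lra. intros x Hx. rewrite Rabs_pos_eq; lra. }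
      apply Rle_trans with (K / (1 + t / b) * (88 * 1 * (Bq t b * (1 + t / b)))).
      - apply Rmult_le_compat_l; [apply Rdiv_le_0_compat; lra | exact B].
      - replace (K / (1 + t / b) * (88 * 1 * (Bq t b * (1 + t / b)))) with (88 * K * Bq t b) by (field; lra).
        apply Rmult_le_compat_l; [lra|]. apply Bq_anti; lra. }
    assert (B2 : RInt q a b <= 187 * K * Bq t a).
    { rewrite (RInt_FTC (fun l => - (8 / 9) * k * Rpower l (- (9 / 8)))).
      - pose proof (Rpower_pos b (- (9 / 8))). unfold k, Bq.
        pose proof (Rpower_pos a (- (9 / 8))).
        assert (0 <= K * Rpower t (5 / 8) * Rpower b (- (9 / 8))) by (apply Rmult_le_pos; lra).
        assert (0 <= K * Rpower t (5 / 8) * Rpower a (- (9 / 8))) by (apply Rmult_le_pos; lra).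
        lra.
      - lra.
      - intros l Hl. unfold q, Rpower. auto_derive; [lra|].
        replace (- (17 / 8) * ln l) with (- (9 / 8) * ln l + - ln l) by field.
        rewrite exp_plus, exp_Ropp, exp_ln by lra. field. lra.
      - intros l Hl. unfold q, Rpower. apply (ex_derive_continuous (V := R_NormedModule)).
        auto_derive. lra. }
    lra.
Qed.

Lemma VE_diff e T a b : e = 1 \/ e = -1 -> 4 <= T -> 0 < a -> a <= b ->
  (cis (e * b) * VE e b T - cis (e * a) * VE e a T)%C =
  (- RtoC e * (CI (fun l => osc e T l * hE e T l) a b - CI (fun l => osc e 4 l * hE e 4 l) a b))%C.
Proof.
  intros He HT Ha Hab.
  assert (c1 : forall x : R, continuous (fun _ : R => 1) x) by (intros; apply continuous_const).
  assert (C : forall t l, a <= l <= b -> ccont (fun l => osc e t l * hE e t l)%C l).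
  { intros t l Hl. apply ccont_mult; [apply ccont_osc; lra|].
    eapply ccont_ext; [intros u; symmetry; apply hE_hq|]. eapply cder_ccont, cder_hq; auto; lra. }
  rewrite <- CI_minus by (apply exCI_cont; auto).
  rewrite <- CI_scal by (apply exCI_minus; apply exCI_cont; auto).
  symmetry. apply (CI_FTC (fun l => cis (e * l) * VE e l T)%C); auto.
  - intros l Hl. apply cder_cis_VE; auto; lra.
  - intros l Hl. apply ccont_mult; [apply ccont_const|]. apply ccont_minus; auto.
Qed.

(** The lower edge has its stationary point at [l = 4]. Starting at 6 keeps away from it and still
    admits every [l = 2 pi N], because [2 pi > 6]. *)
Lemma osc_hE_4 e a b : e = 1 \/ e = -1 -> 6 <= a -> a <= b ->
  Cmod (CI (fun l => osc e 4 l * hE e 4 l)%C a b) <= 5500 * Bq 4 a.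
Proof.
  intros He Ha Hab. replace 5500 with (275 * 20) by ring. apply osc_hE_bound; auto; try lra.
  intros l Hl. assert (L : 1 + 4 / l <= 5 / 3).
  { assert (4 / l <= 2 / 3) by (apply div_le_mul; lra). lra. }
  assert (L0 : 0 < 4 / l) by (apply Rdiv_lt_0_compat; lra).
  assert (P : Cmod (CI (osc e 4) a l) <= 12).
  { destruct He; subst e.
    - eapply Rle_trans; [apply osc_above; lra|]. assert (a / (a - 4) <= 3) by (apply div_le_mul; lra). lra.
    - eapply Rle_trans; [apply osc_neg; lra|]. assert (l / (l + 4) <= 1) by (apply div_le_mul; lra). lra. }
  apply Rle_trans with (12 * (5 / 3)); [|lra]. apply Rmult_le_compat; try lra. apply Cmod_ge_0.
Qed.

Lemma VE_diff_bound e T a b K : e = 1 \/ e = -1 -> 4 <= T -> 6 <= a -> a <= b -> 0 <= K ->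
  (forall l, a <= l <= b -> Cmod (CI (osc e T) a l) * (1 + T / l) <= K) ->
  Cmod (cis (e * b) * VE e b T - cis (e * a) * VE e a T)%C <= 275 * K * Bq T a + 5500 * Bq T a.
Proof.
  intros He HT Ha Hab HK HP. rewrite VE_diff by (auto; lra).
  rewrite Cmod_mult, Cmod_opp, Cmod_R.
  replace (Rabs e) with 1 by (destruct He; subst e; [rewrite Rabs_pos_eq; lra | rewrite Rabs_left; lra]).
  rewrite Rmult_1_l. eapply Rle_trans; [apply Cmod_minus_le|]. apply Rplus_le_compat.
  - apply osc_hE_bound; auto; lra.
  - eapply Rle_trans; [apply osc_hE_4; auto|]. apply Rmult_le_compat_l; [lra|]. apply Bq_mono; lra.
Qed.

Lemma VE_decay e l T : e = 1 \/ e = -1 -> 4 <= T -> 0 < l ->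
  Cmod (VE e l T) <= 88 * Rpower T (5 / 8) * T * Rpower l (- (9 / 8)).
Proof.
  intros He HT Hl. unfold VE.
  assert (K0 : 0 <= 88 * Rpower T (5 / 8) * Rpower l (- (9 / 8))).
  { pose proof (Rpower_pos T (5 / 8)). pose proof (Rpower_pos l (- (9 / 8))).
    repeat apply Rmult_le_pos; lra. }
  eapply Rle_trans.
  - apply (CI_norm_const _ (88 * Rpower T (5 / 8) * Rpower l (- (9 / 8)))); auto.
    + apply exCI_cont; auto. intros t Ht. apply Em_line_ccont. unfold c0; lra.
    + intros t Ht. rewrite Cmod_mult, Cmod_Rpower_C. simpl Re. unfold c0.
      apply Rmult_le_compat_r; [left; apply Rpower_pos|].
      eapply Rle_trans; [apply Em_bound; auto; lra|]. replace (9 / 8 - 1 / 2) with (5 / 8) by field.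
      apply Rmult_le_compat_l; [lra|]. apply Rpower_le_base; lra.
  - replace (88 * Rpower T (5 / 8) * T * Rpower l (- (9 / 8))) with
     (88 * Rpower T (5 / 8) * Rpower l (- (9 / 8)) * T) by ring.
    apply Rmult_le_compat_l; lra.
Qed.

(** For fixed [T] the integral tends to 0 as [l] grows, by [VE_decay]; a bound for differences that
    is uniform in the upper end thus bounds the value itself. *)
Lemma VE_from_infinity e T a K : e = 1 \/ e = -1 -> 4 <= T -> 6 <= a -> 0 <= K ->
  (forall l, a <= l -> Cmod (CI (osc e T) a l) * (1 + T / l) <= K) ->
  Cmod (VE e a T) <= 275 * K * Bq T a + 5500 * Bq T a.
Proof.
  intros He HT Ha HK HP. apply le_epsilon. intros eps Heps.
  destruct (exp_small (9 / 8) (88 * Rpower T (5 / 8) * T) eps ltac:(lra) Heps) as (U & HU0 & HU).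
  set (b := Rmax a (exp U)).
  assert (b1 : a <= b) by apply Rmax_l. assert (b2 : exp U <= b) by apply Rmax_r.
  assert (D := VE_diff_bound e T a b K He HT Ha b1 HK ltac:(intros l Hl; apply HP; lra)).
  assert (V := VE_decay e b T He HT ltac:(lra)).
  assert (E : 88 * Rpower T (5 / 8) * T * Rpower b (- (9 / 8)) <= eps).
  { unfold Rpower at 2. apply HU. rewrite <- (ln_exp U). apply ln_le; auto. apply exp_pos. }
  assert (M : Cmod (VE e a T) = Cmod (cis (e * a) * VE e a T)%C) by (rewrite Cmod_mult, Cmod_cis; ring).
  rewrite M.
  pose proof (Cmod_triangle_inv (cis (e * a) * VE e a T)%C (cis (e * b) * VE e b T)%C) as Tr.
  rewrite Cmod_minus_sym in Tr. rewrite (Cmod_mult (cis (e * b))), Cmod_cis in Tr. lra.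
Qed.

(** The part of [VE] with [e = 1] which is not negligible for [l <= T]. *)
Definition Mmain (T : R) : C := (cis (T / 2) * VE 1 (T / 2) T)%C.

(** The loss in the transition range around the stationary point: of size 1 within [sqrt T] of [T],
    then decaying like [sqrt T / |l - T|]. Beyond [2 T] the terms [Bq] suffice. *)
Definition near (T l : R) : R := if Rle_dec l (2 * T) then sqrt T / (sqrt T + Rabs (l - T)) else 0.

Lemma Bq_half T l : 0 < l <= T -> Bq T (T / 2) <= 3 * Bq T l.
Proof.
  intros Hl. apply Rle_trans with (3 * Bq T T).
  2:{ apply Rmult_le_compat_l; [lra|]. now apply Bq_anti. }
  unfold Bq. replace (T / 2) with (T * / 2) by field. rewrite <- Rpower_mult_distr by lra.
  assert (Rpower (/ 2) (- (9 / 8)) <= 3).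
  { unfold Rpower. rewrite ln_Rinv by lra.
    replace (- (9 / 8) * - ln 2) with (ln 2 + / 8 * ln 2) by field.
    rewrite exp_plus, exp_ln by lra.
    assert (exp (/ 8 * ln 2) <= 3 / 2); [|lra].
    assert (L : / 8 * ln 2 <= ln (3 / 2)).
    { replace 2 with ((3 / 2) * (4 / 3)) at 1 by field. rewrite ln_mult by lra.
      assert (ln (4 / 3) <= ln (3 / 2)) by (apply ln_le; lra).
      assert (0 <= ln (3 / 2)) by (rewrite <- ln_1; apply ln_le; lra). lra. }
    apply exp_le in L. rewrite (exp_ln (3 / 2)) in L by lra. exact L. }
  pose proof (Rpower_pos T (5 / 8)). pose proof (Rpower_pos T (- (9 / 8))).
  assert (0 <= Rpower T (5 / 8) * Rpower T (- (9 / 8))) by (apply Rmult_le_pos; lra).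
  rewrite <- Rmult_assoc. rewrite (Rmult_comm 3). apply Rmult_le_compat_l; lra.
Qed.

Lemma Bq_diag T l : 4 <= T -> T / 2 <= l -> Bq T l <= 3 / sqrt T.
Proof.
  intros HT Hl. destruct (sqrt_facts T HT) as [Q2 Q].
  apply Rle_trans with (Bq T (T / 2)); [apply Bq_anti; lra|].
  eapply Rle_trans; [apply (Bq_half T T); lra|]. unfold Bq. rewrite <- Rpower_plus.
  replace (5 / 8 + - (9 / 8)) with (- (/ 2)) by field. rewrite Rpower_Ropp, Rpower_sqrt by lra.
  right; reflexivity.
Qed.

(** Merges the two bounds for the oscillating integral, the uniform one and the one improving with
    the distance [d] from the stationary point, into the single factor [near]. *)
Lemma near_ge T l P d : 4 <= T -> l <= 2 * T -> d = Rabs (l - T) -> P <= 14 * sqrt T -> 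
  (0 < d -> P <= 8 * T / d) -> P * (1 / sqrt T) <= 28 * near T l.
Proof.
  intros HT Hl Hd P1 P2. destruct (sqrt_facts T HT) as [Q2 Q]. set (r := sqrt T) in *.
  unfold near. destruct (Rle_dec l (2 * T)) as [_|n]; [|contradiction]. fold r. rewrite <- Hd.
  assert (0 <= d) by (rewrite Hd; apply Rabs_pos).
  replace (P * (1 / r)) with (P / r) by (field; lra).
  apply div_le_mul; [lra|].
  replace (28 * (r / (r + d)) * r) with (28 * T / (r + d)) by (rewrite <- Q; field; lra).
  apply le_div_mul; [lra|].
  destruct (Rle_dec d r).
  - destruct (Rle_dec 0 P); [|nra]. apply Rle_trans with (14 * r * (2 * r)); [|nra].
    apply Rmult_le_compat; lra.
  - specialize (P2 ltac:(lra)). destruct (Rle_dec 0 P); [|nra].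
    apply Rle_trans with (8 * T / d * (2 * d)).
    + apply Rmult_le_compat; lra.
    + replace (8 * T / d * (2 * d)) with (16 * T) by (field; lra). lra.
Qed.

(** With [e = -1] there is no stationary point, and the factor [1 + T / b] exactly compensates
    [b / (b + T)]. *)
Lemma VE_neg T l : 4 <= T -> 6 <= l -> Cmod (VE (-1) l T) <= 6600 * Bq T l.
Proof.
  intros HT Hl. replace 6600 with (275 * 4 + 5500) by ring. rewrite Rmult_plus_distr_r.
  apply VE_from_infinity; auto; try lra. intros b Hb.
  assert (0 < T / b) by (apply Rdiv_lt_0_compat; lra).
  apply Rle_trans with (4 * (b / (b + T)) * (1 + T / b)).
  - apply Rmult_le_compat_r; [lra|]. apply osc_neg; lra.
  - right. field. lra.
Qed.

Lemma Bq_near T l : 0 <= near T l.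
Proof.
  unfold near. destruct (Rle_dec l (2 * T)); [|lra]. unfold Rdiv.
  apply Rmult_le_pos; [apply sqrt_pos|].
  destruct (Req_dec (sqrt T + Rabs (l - T)) 0) as [E|E].
  - rewrite E, Rinv_0. lra.
  - left. apply Rinv_0_lt_compat. pose proof (sqrt_pos T). pose proof (Rabs_pos (l - T)). lra.
Qed.

Lemma VE_pos_above T l : 12 <= T -> T <= l -> Cmod (VE 1 l T) <= 11000 * Bq T l + 70000 * near T l.
Proof.
  intros HT Hl. pose proof (Bq_near T l). pose proof (Bq_pos T l).
  assert (I : 1 = 1 \/ 1 = -1) by (left; reflexivity).
  destruct (Rle_dec l (2 * T)) as [L|L].
  - destruct (sqrt_facts T ltac:(lra)) as [Q2 Q]. set (r := sqrt T) in *.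
    (* At [l = T] the second bound would divide by zero, so the uniform bound takes its place
       there. *)
    set (P := Rmin (14 * r) (if Req_EM_T l T then 14 * r else 4 * (l / (l - T)))).
    assert (P0 : 0 <= P).
    { apply Rmin_glb; [lra|]. destruct (Req_EM_T l T); [lra|].
      apply Rmult_le_pos; [lra|]. apply Rdiv_le_0_compat; lra. }
    assert (B : Cmod (VE 1 l T) <= 275 * (2 * P) * Bq T l + 5500 * Bq T l).
    { apply VE_from_infinity; auto; try lra. intros b Hb.
      assert (0 < T / b) by (apply Rdiv_lt_0_compat; lra).
      assert (T / b <= 1) by (apply div_le_mul; lra).
      rewrite (Rmult_comm 2). apply Rmult_le_compat; try lra; [apply Cmod_ge_0|].
      apply Rmin_glb; [apply osc_any; lra|]. destruct (Req_EM_T l T); [apply osc_any; lra|].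
      apply osc_above; lra. }
    assert (N : P * (1 / r) <= 28 * near T l).
    { apply (near_ge T l P (Rabs (l - T))); auto; try lra; [apply Rmin_l|].
      rewrite (Rabs_pos_eq (l - T)) by lra. intros Hd. eapply Rle_trans; [apply Rmin_r|].
      destruct (Req_EM_T l T); [lra|]. unfold Rdiv.
      assert (0 < / (l - T)) by (apply Rinv_0_lt_compat; lra). rewrite <- Rmult_assoc.
      apply Rmult_le_compat_r; lra. }
    assert (D : Bq T l <= 3 / r) by (apply Bq_diag; lra).
    assert (P * Bq T l <= 3 * (28 * near T l)).
    { apply Rle_trans with (P * (3 / r)); [apply Rmult_le_compat_l; auto|].
      replace (P * (3 / r)) with (3 * (P * (1 / r))) by (field; lra). lra. }
    lra.
  - assert (B : Cmod (VE 1 l T) <= 275 * 20 * Bq T l + 5500 * Bq T l).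
    { apply VE_from_infinity; auto; try lra. intros b Hb.
      assert (0 < T / b) by (apply Rdiv_lt_0_compat; lra).
      assert (T / b <= 1 / 2) by (apply div_le_mul; lra).
      assert (l / (l - T) <= 2) by (apply div_le_mul; lra).
      pose proof (osc_above T l b ltac:(lra) ltac:(lra) Hb). 
      apply Rle_trans with (8 * (3 / 2)); [|lra]. apply Rmult_le_compat; try lra. apply Cmod_ge_0. }
    lra.
Qed.

(** The comparison runs upwards from the smaller of [l] and [T / 2], so it never passes the
    stationary point [T]. Up to [T / 2] a constant bound is enough; only above it does [near]
    appear. *)
Lemma VE_pos_below T l : 12 <= T -> 6 <= l <= T ->
  Cmod (cis l * VE 1 l T - Mmain T)%C <= 16500 * Bq T l + 70000 * near T l.
Proof.
  intros HT Hl. pose proof (Bq_near T l). pose proof (Bq_pos T l). unfold Mmain.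
  assert (I : 1 = 1 \/ 1 = -1) by (left; reflexivity).
  replace (cis l) with (cis (1 * l)) by (f_equal; ring).
  replace (cis (T / 2)) with (cis (1 * (T / 2))) by (f_equal; ring).
  destruct (Rle_dec l (T / 2)) as [L|L].
  - rewrite Cmod_minus_sym.
    assert (B : Cmod (cis (1 * (T / 2)) * VE 1 (T / 2) T - cis (1 * l) * VE 1 l T)%C
       <= 275 * 12 * Bq T l + 5500 * Bq T l).
    { apply VE_diff_bound; auto; try lra. intros b Hb.
      assert (0 < T / b) by (apply Rdiv_lt_0_compat; lra).
      apply Rle_trans with (4 * (b / (T - b)) * (1 + T / b)).
      - apply Rmult_le_compat_r; [lra|]. apply osc_below; lra.
      - replace (4 * (b / (T - b)) * (1 + T / b)) with (4 * (b + T) / (T - b)) by (field; lra).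
        apply div_le_mul; lra. }
    lra.
  - destruct (sqrt_facts T ltac:(lra)) as [Q2 Q]. set (r := sqrt T) in *.
    set (P := Rmin (14 * r) (if Req_EM_T l T then 14 * r else 4 * (l / (T - l)))).
    assert (P0 : 0 <= P).
    { apply Rmin_glb; [lra|]. destruct (Req_EM_T l T); [lra|].
      apply Rmult_le_pos; [lra|]. apply Rdiv_le_0_compat; lra. }
    assert (B : Cmod (cis (1 * l) * VE 1 l T - cis (1 * (T / 2)) * VE 1 (T / 2) T)%C
       <= 275 * (3 * P) * Bq T (T / 2) + 5500 * Bq T (T / 2)).
    { apply VE_diff_bound; auto; try lra. intros b Hb.
      assert (0 < T / b) by (apply Rdiv_lt_0_compat; lra).
      assert (T / b <= 2) by (apply div_le_mul; lra).
      rewrite (Rmult_comm 3). apply Rmult_le_compat; try lra; [apply Cmod_ge_0|].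
      apply Rmin_glb; [apply osc_any; lra|]. destruct (Req_EM_T l T); [apply osc_any; lra|].
      eapply Rle_trans; [apply osc_below; lra|]. apply Rmult_le_compat_l; [lra|].
      apply div_le_mul; [lra|]. replace (l / (T - l) * (T - b)) with (l * (T - b) / (T - l)) by (field; lra).
      apply le_div_mul; nra. }
    assert (N : P * (1 / r) <= 28 * near T l).
    { apply (near_ge T l P (Rabs (l - T))); auto; try lra; [apply Rmin_l|].
      rewrite (Rabs_left1 (l - T)) by lra. intros Hd. eapply Rle_trans; [apply Rmin_r|].
      destruct (Req_EM_T l T); [lra|]. replace (- (l - T)) with (T - l) by ring. unfold Rdiv.
      assert (0 < / (T - l)) by (apply Rinv_0_lt_compat; lra). rewrite <- Rmult_assoc.
      apply Rmult_le_compat_r; lra. }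
    assert (D : Bq T (T / 2) <= 3 / r) by (apply Bq_diag; lra).
    assert (P * Bq T (T / 2) <= 3 * (28 * near T l)).
    { apply Rle_trans with (P * (3 / r)); [apply Rmult_le_compat_l; auto|].
      replace (P * (3 / r)) with (3 * (P * (1 / r))) by (field; lra). lra. }
    pose proof (Bq_half T l ltac:(lra)). lra.
Qed.

(** * The Fourier series of [bt] *)

(** The constants are kept inside the sum so that every partial sum vanishes at 0, as [bt] does;
    this makes the Mellin integrals used later converge at 0. *)
Fixpoint fN (N : nat) (x : R) : R :=
  match N with
  | O => 0
  | S k => fN k x + (cos (2 * INR (S k) * PI * x) - 1) / (2 * PI ^ 2 * INR (S k) ^ 2)
  end.

Fixpoint fN' (N : nat) (x : R) : R :=
  match N with
  | O => 0
  | S k => fN' k x - sin (2 * INR (S k) * PI * x) / (PI * INR (S k))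
  end.

(** The Dirichlet kernel [sin ((2N+1) pi x) / sin (pi x)]; the second derivative of [fN N] is
    [1 - DK N]. *)
Fixpoint DK (N : nat) (x : R) : R :=
  match N with
  | O => 1
  | S k => DK k x + 2 * cos (2 * INR (S k) * PI * x)
  end.

Lemma is_derive_fN N x : is_derive (fN N) x (fN' N x).
Proof.
  induction N as [|N IH].
  - apply (is_derive_const (V := R_NormedModule) 0 x).
  - apply (is_derive_plus (fN N) (fun x => (cos (2 * INR (S N) * PI * x) - 1) / (2 * PI ^ 2 * INR (S N) ^ 2)) x
      (fN' N x) (- (sin (2 * INR (S N) * PI * x) / (PI * INR (S N))))); auto.
    pose proof PI_RGT_0. pose proof (not_0_INR (S N) ltac:(lia)) as Hn. revert Hn.
    generalize (INR (S N)). intros n Hn. auto_derive; auto. field. split; lra.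
Qed.

Lemma is_derive_fN' N x : is_derive (fN' N) x (1 - DK N x).
Proof.
  induction N as [|N IH].
  - simpl. replace (1 - 1) with 0 by ring. apply (is_derive_const (V := R_NormedModule) 0 x).
  - replace (1 - DK (S N) x) with (1 - DK N x + - (2 * cos (2 * INR (S N) * PI * x))) by (cbn [DK]; ring).
    apply (is_derive_plus (fN' N) (fun x => - (sin (2 * INR (S N) * PI * x) / (PI * INR (S N)))) x); auto.
    pose proof PI_RGT_0. pose proof (not_0_INR (S N) ltac:(lia)) as Hn. revert Hn.
    generalize (INR (S N)). intros n Hn. auto_derive; auto. field. split; lra.
Qed.

Lemma DK_sin N x : sin (PI * x) * DK N x = sin ((2 * INR N + 1) * PI * x).
Proof.
  induction N as [|N IH].
  - simpl. rewrite Rmult_1_r. f_equal. ring.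
  - cbn [DK]. rewrite Rmult_plus_distr_l, IH, S_INR.
    set (a := 2 * (INR N + 1) * PI * x). set (b := PI * x).
    replace ((2 * INR N + 1) * PI * x) with (a - b) by (unfold a, b; ring).
    replace ((2 * (INR N + 1) + 1) * PI * x) with (a + b) by (unfold a, b; ring).
    rewrite sin_minus, sin_plus. ring.
Qed.

Lemma sin_INR_PI n : sin (INR n * PI) = 0.
Proof.
  induction n as [|n IH]; [simpl; rewrite Rmult_0_l; apply sin_0|].
  rewrite S_INR, Rmult_plus_distr_r, Rmult_1_l, neg_sin, IH. ring.
Qed.

Lemma fN'_half N : fN' N (1 / 2) = 0.
Proof.
  induction N as [|N IH]; auto. cbn [fN']. rewrite IH.
  replace (2 * INR (S N) * PI * (1 / 2)) with (INR (S N) * PI) by field.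
  rewrite sin_INR_PI. unfold Rdiv. ring.
Qed.

Lemma deriv_nonpos_decr (h h' : R -> R) a b : a <= b ->
  (forall y, a <= y <= b -> is_derive h y (h' y)) -> (forall y, a <= y <= b -> h' y <= 0) -> h b <= h a.
Proof.
  intros Hab D S. destruct (MVT_gen h a b h') as (c & Hc & E).
  - intros y. rewrite Rmin_left, Rmax_right by auto. intros Hy. apply D; lra.
  - intros y. rewrite Rmin_left, Rmax_right by auto. intros Hy.
    apply derivable_continuous_pt. exists (h' y). apply is_derive_Reals, D, Hy.
  - rewrite Rmin_left, Rmax_right in Hc by auto. specialize (S c Hc). nra.
Qed.

Lemma sin_lower y : 0 <= y <= PI / 2 -> y / 3 <= sin y.
Proof.
  intros Hy. pose proof PI_4. pose proof PI_RGT_0. destruct (Rle_dec y (PI / 3)).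
  - assert (D : y / 3 - sin y <= 0 / 3 - sin 0); [|rewrite sin_0 in D; lra].
    apply (deriv_nonpos_decr (fun y => y / 3 - sin y) (fun y => 1 / 3 - cos y)); [lra| |].
    + intros z _. auto_derive; auto. field.
    + intros z Hz. assert (cos (PI / 3) <= cos z) by (apply cos_decr_1; lra).
      rewrite cos_PI3 in *. lra.
  - assert (S : sin (PI / 3) <= sin y) by (apply sin_incr_1; lra).
    rewrite sin_PI3 in S.
    assert (3 / 2 <= sqrt 3).
    { rewrite <- (sqrt_Rsqr (3 / 2)) by lra. apply sqrt_le_1_alt. unfold Rsqr; lra. }
    lra.
Qed.

Definition Rr (N : nat) (x : R) : R := fN N x - (x ^ 2 - x) / 2.
Definition Rr' (N : nat) (x : R) : R := fN' N x - (x - 1 / 2).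

Lemma is_derive_Rr N x : is_derive (Rr N) x (Rr' N x).
Proof.
  apply (is_derive_minus (fN N) (fun x => (x ^ 2 - x) / 2)); [apply is_derive_fN|].
  auto_derive; auto. field.
Qed.

Lemma is_derive_Rr' N x : is_derive (Rr' N) x (- DK N x).
Proof.
  replace (- DK N x) with ((1 - DK N x) - 1) by ring.
  apply (is_derive_minus (fN' N) (fun x => x - 1 / 2)); [apply is_derive_fN'|].
  auto_derive; auto. 
Qed.

(** The derivative of [Rr'] is minus the Dirichlet kernel. Adding [G] removes its leading
    oscillation, and what remains is dominated by [-B'] with [B] decreasing. Integrating from [x] to
    1/2, where [Rr'] vanishes, gives [2 B x]. *)
Lemma Rr'_tail N x : 0 < x <= 1 / 2 -> Rabs (Rr' N x) <= 1 / ((2 * INR N + 1) * x).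
Proof.
  intros Hx. set (M := 2 * INR N + 1). assert (HM : 1 <= M) by (pose proof (pos_INR N); unfold M; lra).
  pose proof PI_RGT_0 as Pp. pose proof PI2_3_2 as P3.
  set (G := fun y => - cos (M * PI * y) / (M * PI * sin (PI * y))).
  set (B := fun y => 1 / (M * PI * sin (PI * y))).
  set (B' := fun y => - cos (PI * y) / (M * sin (PI * y) ^ 2)).
  set (A' := fun y => cos (M * PI * y) * cos (PI * y) / (M * sin (PI * y) ^ 2)).
  assert (Pr : forall y, x <= y <= 1 / 2 -> 0 < PI * y <= PI / 2).
  { intros y Hy. split; [apply Rmult_lt_0_compat; lra|].
    replace (PI / 2) with (PI * (1 / 2)) by field. apply Rmult_le_compat_l; lra. }
  assert (Sp : forall y, x <= y <= 1 / 2 -> 0 < sin (PI * y))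
    by (intros y Hy; destruct (Pr y Hy); apply sin_gt_0; lra).
  assert (DB : forall y, x <= y <= 1 / 2 -> is_derive B y (B' y)).
  { intros y Hy. specialize (Sp y Hy). unfold B, B'. auto_derive.
    - apply Rgt_not_eq. repeat (lra || apply Rmult_lt_0_compat).
    - field. lra. }
  assert (DA : forall y, x <= y <= 1 / 2 -> is_derive (fun y => Rr' N y + G y) y (A' y)).
  { intros y Hy. specialize (Sp y Hy).
    replace (A' y) with (- DK N y + (sin (M * PI * y) / sin (PI * y) + A' y)).
    - apply (is_derive_plus (Rr' N) G); [apply is_derive_Rr'|]. unfold G, A'. auto_derive.
      + apply Rgt_not_eq. repeat (lra || apply Rmult_lt_0_compat).
      + field. lra.
    - unfold M at 1. rewrite <- DK_sin. field. lra. }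
  assert (W : forall s, s = 1 \/ s = -1 ->
     s * (Rr' N x + G x) <= B x + (s * (Rr' N (1 / 2) + G (1 / 2)) - B (1 / 2))).
  { intros s Hs.
    assert (H : B x - s * (Rr' N x + G x) >= B (1 / 2) - s * (Rr' N (1 / 2) + G (1 / 2))); [|lra].
    apply Rle_ge, (deriv_nonpos_decr (fun y => B y - s * (Rr' N y + G y)) (fun y => B' y - s * A' y)).
    - lra.
    - intros y Hy. apply (is_derive_minus B (fun y => s * (Rr' N y + G y))); [now apply DB|].
      now apply is_derive_scal, DA.
    - intros y Hy. specialize (Sp y Hy). unfold B', A'.
      assert (C0 : 0 <= cos (PI * y)) by (pose proof (Pr y Hy); apply cos_ge_0; lra).
      pose proof (COS_bound (M * PI * y)).
      replace (- cos (PI * y) / (M * sin (PI * y) ^ 2) -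
         s * (cos (M * PI * y) * cos (PI * y) / (M * sin (PI * y) ^ 2))) with
       (- (cos (PI * y) * (1 + s * cos (M * PI * y)) * / (M * sin (PI * y) ^ 2))) by (field; lra).
      assert (0 < / (M * sin (PI * y) ^ 2)).
      { apply Rinv_0_lt_compat, Rmult_lt_0_compat; [lra | now apply pow_lt]. }
      assert (0 <= 1 + s * cos (M * PI * y)) by (destruct Hs; subst s; lra).
      assert (0 <= cos (PI * y) * (1 + s * cos (M * PI * y)) * / (M * sin (PI * y) ^ 2)).
      { repeat (lra || apply Rmult_le_pos). } lra. }
  assert (Z : Rr' N (1 / 2) = 0) by (unfold Rr'; rewrite fN'_half; field).
  assert (GB : forall y, x <= y <= 1 / 2 -> Rabs (G y) <= B y).
  { intros y Hy. specialize (Sp y Hy). unfold G, B, Rdiv. rewrite Rabs_mult, Rabs_Ropp.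
    assert (0 < / (M * PI * sin (PI * y))).
    { apply Rinv_0_lt_compat. repeat (lra || apply Rmult_lt_0_compat). }
    rewrite (Rabs_pos_eq (/ _)) by lra. apply Rmult_le_compat_r; [lra|].
    apply Rabs_le. pose proof (COS_bound (M * PI * y)). lra. }
  pose proof (GB x ltac:(lra)) as G1. pose proof (GB (1 / 2) ltac:(lra)) as G2.
  apply Rabs_le_between in G1. apply Rabs_le_between in G2.
  pose proof (W 1 ltac:(auto)) as W1. pose proof (W (-1) ltac:(auto)) as W2. rewrite Z in W1, W2.
  assert (T : 2 * B x <= 1 / (M * x)).
  { unfold B. pose proof (Sp x ltac:(lra)). pose proof (Pr x ltac:(lra)). pose proof (sin_lower (PI * x) ltac:(lra)).
    replace (2 * (1 / (M * PI * sin (PI * x)))) with (2 / (M * PI * sin (PI * x))) by (field; lra).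
    assert (Hmx : 0 < M * x) by nra.
    apply div_le_mul; [repeat (lra || apply Rmult_lt_0_compat)|].
    replace (1 / (M * x) * (M * PI * sin (PI * x))) with (PI * sin (PI * x) / x) by (field; lra).
    apply le_div_mul; [lra|]. nra. }
  apply Rabs_le. lra.
Qed.

Lemma Rabs_sin_le y : Rabs (sin y) <= Rabs y.
Proof.
  assert (P : forall y, 0 <= y -> Rabs (sin y) <= y).
  { clear. intros y Hy. apply Rabs_le.
    assert (A : sin y - y <= sin 0 - 0).
    { apply (deriv_nonpos_decr (fun y => sin y - y) (fun y => cos y - 1)); auto.
      - intros z _. auto_derive; auto. ring.
      - intros z _. pose proof (COS_bound z). lra. }
    assert (B : - sin y - y <= - sin 0 - 0).
    { apply (deriv_nonpos_decr (fun y => - sin y - y) (fun y => - cos y - 1)); auto.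
      - intros z _. auto_derive; auto. ring.
      - intros z _. pose proof (COS_bound z). lra. }
    rewrite sin_0 in *. lra. }
  destruct (Rle_dec 0 y).
  - rewrite (Rabs_pos_eq y) by auto. now apply P.
  - rewrite (Rabs_left y) by lra. rewrite <- Rabs_Ropp, <- sin_neg. apply P. lra.
Qed.

Lemma fN'_bound N x : 0 <= x -> Rabs (fN' N x) <= 2 * INR N * x.
Proof.
  intros Hx. induction N as [|N IH].
  - simpl. rewrite Rabs_R0. lra.
  - cbn [fN']. rewrite S_INR. unfold Rminus. eapply Rle_trans; [apply Rabs_triang|]. rewrite Rabs_Ropp.
    assert (Rabs (sin (2 * (INR N + 1) * PI * x) / (PI * (INR N + 1))) <= 2 * x).
    { pose proof PI_RGT_0. pose proof (pos_INR N). assert (0 < PI * (INR N + 1)) by nra.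
      unfold Rdiv. rewrite Rabs_mult, Rabs_inv, (Rabs_pos_eq (PI * _)) by lra.
      apply div_le_mul; auto. eapply Rle_trans; [apply Rabs_sin_le|]. rewrite Rabs_pos_eq.
      - right; ring.
      - repeat (lra || apply Rmult_le_pos). }
    lra.
Qed.

(** With [M = 2N + 1], the bounds [1 / (M x)] and 3/2 are combined into a small power of
    [1 / (M x)]: it still decays in [N] and is integrable at [x = 0]. *)
Lemma Rr'_bound N x : 0 < x <= 1 / 2 ->
  Rabs (Rr' N x) <= 3 / 2 * Rpower (2 * INR N + 1) (- (1 / 16)) * Rpower x (- (1 / 16)).
Proof.
  intros Hx. pose proof (pos_INR N) as HN.
  set (M := 2 * INR N + 1). assert (HM : 1 <= M) by (unfold M; lra).
  rewrite Rmult_assoc, Rpower_mult_distr by lra.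
  assert (Mx : 0 < M * x) by nra.
  destruct (Rle_dec 1 (M * x)).
  - eapply Rle_trans; [now apply Rr'_tail|]. fold M.
    assert (1 / (M * x) <= Rpower (M * x) (- (1 / 16))).
    { unfold Rdiv. rewrite Rmult_1_l. rewrite <- (Rpower_1 (M * x)) at 1 by auto.
      rewrite <- Rpower_Ropp. apply Rle_Rpower; lra. }
    pose proof (Rpower_pos (M * x) (- (1 / 16))). lra.
  - assert (1 <= Rpower (M * x) (- (1 / 16))).
    { apply Rle_trans with (Rpower 1 (- (1 / 16))).
      - unfold Rpower. rewrite ln_1, Rmult_0_r, exp_0. lra.
      - apply Rpower_neg_le; lra. }
    assert (Rabs (Rr' N x) <= 3 / 2); [|lra].
    unfold Rr', Rminus. eapply Rle_trans; [apply Rabs_triang|]. rewrite Rabs_Ropp.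
    pose proof (fN'_bound N x ltac:(lra)).
    assert (Rabs (x + - (1 / 2)) <= 1 / 2) by (apply Rabs_le; lra).
    assert (2 * INR N * x <= 1) by (unfold M in *; nra). lra.
Qed.

Lemma fN_0 N : fN N 0 = 0.
Proof.
  induction N as [|N IH]; auto. cbn [fN]. rewrite IH, Rmult_0_r, cos_0. unfold Rdiv. ring.
Qed.

Lemma Rr_0 N : Rr N 0 = 0.
Proof. unfold Rr. rewrite fN_0. field. Qed.

Lemma Rr_bound_half N x : 0 < x <= 1 / 2 ->
  Rabs (Rr N x) <= 8 / 5 * Rpower (2 * INR N + 1) (- (1 / 16)) * Rpower x (15 / 16).
Proof.
  intros Hx. apply le_epsilon. intros eps He.
  set (K := Rpower (2 * INR N + 1) (- (1 / 16))). assert (K0 : 0 < K) by apply Rpower_pos.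
  pose proof (pos_INR N) as HN.
  set (L := 2 * INR N + 1).
  (* The comparison power is not differentiable at 0, so the main argument starts at [d]; below [d]
     the derivative is at most [L] and contributes at most [L d <= eps]. *)
  set (d := Rmin x (eps / L)).
  assert (d0 : 0 < d) by (apply Rmin_glb_lt; [lra | apply Rdiv_lt_0_compat; unfold L; lra]).
  assert (dx : d <= x) by apply Rmin_l.
  assert (dL : L * d <= eps).
  { apply Rle_trans with (L * (eps / L)); [apply Rmult_le_compat_l; [unfold L; lra | apply Rmin_r]|].
    right. field. unfold L; lra. }
  assert (W : forall s, s = 1 \/ s = -1 -> s * Rr N x <= 8 / 5 * K * Rpower x (15 / 16) + eps).
  { intros s Hs.
    assert (A : s * Rr N x - 8 / 5 * K * Rpower x (15 / 16) <= s * Rr N d - 8 / 5 * K * Rpower d (15 / 16)).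
    { apply (deriv_nonpos_decr (fun y => s * Rr N y - 8 / 5 * K * Rpower y (15 / 16))
        (fun y => s * Rr' N y - 3 / 2 * K * Rpower y (- (1 / 16)))); auto.
      - intros y Hy. apply (is_derive_minus (fun y => s * Rr N y) (fun y => 8 / 5 * K * Rpower y (15 / 16))).
        + apply is_derive_scal, is_derive_Rr.
        + unfold Rpower. auto_derive; [lra|].
          replace (- (1 / 16) * ln y) with (15 / 16 * ln y + - ln y) by field.
          rewrite exp_plus, exp_Ropp, exp_ln by lra. field. lra.
      - intros y Hy. pose proof (Rr'_bound N y ltac:(lra)) as B. fold K in B.
        apply Rabs_le_between in B. destruct Hs; subst s; lra. }
    assert (B : s * Rr N d - L * d <= s * Rr N 0 - L * 0).
    { apply (deriv_nonpos_decr (fun y => s * Rr N y - L * y) (fun y => s * Rr' N y - L)); [lra| |].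
      - intros y Hy. apply (is_derive_minus (fun y => s * Rr N y) (fun y => L * y)).
        + apply is_derive_scal, is_derive_Rr.
        + auto_derive; auto. ring.
      - intros y Hy. pose proof (fN'_bound N y ltac:(lra)) as F. apply Rabs_le_between in F.
        assert (2 * INR N * y <= INR N) by nra. unfold Rr', L.
        destruct Hs; subst s; lra. }
    rewrite Rr_0 in B. pose proof (Rpower_pos d (15 / 16)).
    assert (0 <= 8 / 5 * K * Rpower d (15 / 16)) by (repeat (lra || apply Rmult_le_pos)). lra. }
  pose proof (W 1 ltac:(auto)). pose proof (W (-1) ltac:(auto)). apply Rabs_le. lra.
Qed.

Lemma fN_sym N x : fN N (1 - x) = fN N x.
Proof.
  induction N as [|N IH]; auto. cbn [fN]. rewrite IH. do 3 f_equal.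
  replace (2 * INR (S N) * PI * (1 - x)) with (- (2 * INR (S N) * PI * x) + 2 * INR (S N) * PI) by ring.
  now rewrite cos_period, cos_neg.
Qed.

Lemma fN_shift N x k : fN N (x + INR k) = fN N x.
Proof.
  induction N as [|N IH]; auto. cbn [fN]. rewrite IH. do 3 f_equal.
  replace (2 * INR (S N) * PI * (x + INR k)) with (2 * INR (S N) * PI * x + 2 * INR (S N * k) * PI)
    by (rewrite mult_INR; ring).
  now rewrite cos_period.
Qed.

Lemma Rr_bound N x : 0 < x < 1 ->
  Rabs (Rr N x) <= 8 / 5 * Rpower (2 * INR N + 1) (- (1 / 16)) * Rpower x (15 / 16).
Proof.
  intros Hx. destruct (Rle_dec x (1 / 2)); [apply Rr_bound_half; lra|].
  replace (Rr N x) with (Rr N (1 - x)) by (unfold Rr; rewrite fN_sym; field).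
  eapply Rle_trans; [apply Rr_bound_half; lra|]. apply Rmult_le_compat_l.
  - pose proof (Rpower_pos (2 * INR N + 1) (- (1 / 16))). lra.
  - apply Rpower_le_base; lra.
Qed.

Lemma bt_fN N x : 0 <= x -> Rabs (bt x - fN N x) <= 8 / 5 * Rpower (2 * INR N + 1) (- (1 / 16)).
Proof.
  intros Hx. pose proof (base_fp x) as [F0 F1]. pose proof (Rplus_Int_part_frac_part x) as E.
  set (f := frac_part x) in *.
  assert (I0 : (0 <= Int_part x)%Z).
  { apply Z.lt_succ_r, lt_IZR. unfold Z.succ. rewrite plus_IZR. simpl. lra. }
  assert (Ek : IZR (Int_part x) = INR (Z.to_nat (Int_part x))) by (rewrite INR_IZR_INZ, Z2Nat.id; auto).
  assert (B : bt x - fN N x = - Rr N f).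
  { unfold bt, Rr. fold f. rewrite E at 1. rewrite Ek, Rplus_comm, fN_shift. ring. }
  rewrite B, Rabs_Ropp. pose proof (Rpower_pos (2 * INR N + 1) (- (1 / 16))).
  destruct (Req_dec f 0) as [Z|Z].
  - rewrite Z, Rr_0, Rabs_R0. lra.
  - eapply Rle_trans; [apply Rr_bound; lra|].
    assert (Rpower f (15 / 16) <= 1).
    { apply Rle_trans with (Rpower 1 (15 / 16)); [apply Rpower_le_base; lra|].
      unfold Rpower. rewrite ln_1, Rmult_0_r, exp_0. lra. }
    rewrite <- (Rmult_1_r (8 / 5 * _)) at 2. apply Rmult_le_compat_l; lra.
Qed.

Lemma bt_fN_0 N x : 0 < x <= 1 ->
  Rabs (bt x - fN N x) <= 8 / 5 * Rpower (2 * INR N + 1) (- (1 / 16)) * Rpower x (15 / 16).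
Proof.
  intros Hx. destruct (Req_dec x 1) as [E|E].
  - subst x. replace (Rpower 1 (15 / 16)) with 1 by (unfold Rpower; rewrite ln_1, Rmult_0_r, exp_0; auto).
    rewrite Rmult_1_r. apply bt_fN. lra.
  - replace (bt x - fN N x) with (- Rr N x).
    + rewrite Rabs_Ropp. apply Rr_bound. lra.
    + unfold Rr. rewrite (bt_unit 0 x); simpl; [|lra]. field.
Qed.

(** * The functional equation on [Re s = 9/8] *)

(** [meldom F M] makes the Mellin integral [\int_0^oo F(x) x^(s-3) dx] converge for [Re s = 9/8]. *)
Definition meldom (F : R -> C) (M : R) : Prop :=
  0 <= M /\ (forall x, 0 < x -> ccont F x) /\
  (forall x, 0 < x -> Cmod (F x) <= M) /\ (forall x, 0 < x <= 1 -> Cmod (F x) <= M * Rpower x (15 / 16)).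

(** Split at [x = 1], with the two logarithmic substitutions already used for [Em]. *)
Definition mel (F : R -> C) (s : C) : C :=
  (Lap (fun u => F (exp (- u))) (s - 2) + Lap (fun u => F (exp u)) (2 - s))%C.

Lemma lapdom_mel_0 F M : meldom F M -> lapdom (fun u => F (exp (- u))) M (- (15 / 16)).
Proof.
  intros (HM & Fc & _ & Fb). split; auto. split.
  - intros u _. apply (ccont_comp F (fun u => exp (- u))); [|apply Fc, exp_pos].
    apply (ex_derive_continuous (V := R_NormedModule)). auto_derive; auto.
  - intros u Hu. eapply Rle_trans; [apply Fb; split; [apply exp_pos|]|].
    + rewrite <- exp_0. apply exp_le. lra.
    + unfold Rpower. rewrite ln_exp. right. f_equal. f_equal. field.
Qed.

Lemma lapdom_mel_1 F M : meldom F M -> lapdom (fun u => F (exp u)) M 0.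
Proof.
  intros (HM & Fc & Fb & _). split; auto. split.
  - intros u _. apply (ccont_comp F exp); [apply continuous_exp | apply Fc, exp_pos].
  - intros u _. rewrite Rmult_0_l, exp_0, Rmult_1_r. apply Fb, exp_pos.
Qed.

Definition c98 (s : C) : Prop := Re s = 9 / 8.

Lemma c98_0 s : c98 s -> - (15 / 16) < Re (s - 2)%C.
Proof. unfold c98. intros H. creim. lra. Qed.

Lemma c98_1 s : c98 s -> 0 < Re (2 - s)%C.
Proof. unfold c98. intros H. creim. lra. Qed.

Lemma mel_bound F M s : meldom F M -> c98 s -> Cmod (mel F s) <= 18 * M.
Proof.
  intros H Hs. pose proof (proj1 H) as HM. unfold mel.
  eapply Rle_trans; [apply Cmod_triangle|].
  pose proof (Lap_norm _ _ _ _ (lapdom_mel_0 F M H) (c98_0 s Hs)) as A.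
  pose proof (Lap_norm _ _ _ _ (lapdom_mel_1 F M H) (c98_1 s Hs)) as B.
  assert (E1 : M / (Re (s - 2)%C - - (15 / 16)) = 16 * M) by (creim; rewrite Hs; field).
  assert (E2 : M / (Re (2 - s)%C - 0) = 8 / 7 * M) by (creim; rewrite Hs; field).
  rewrite E1 in A. rewrite E2 in B. lra.
Qed.

Lemma meldom_plus F G M N : meldom F M -> meldom G N -> meldom (fun x => F x + G x)%C (M + N).
Proof.
  intros (A1 & A2 & A3 & A4) (B1 & B2 & B3 & B4). split; [lra|]. split; [|split].
  - intros; apply ccont_plus; auto.
  - intros x Hx. eapply Rle_trans; [apply Cmod_triangle|]. specialize (A3 x Hx). specialize (B3 x Hx). lra.
  - intros x Hx. eapply Rle_trans; [apply Cmod_triangle|]. specialize (A4 x Hx). specialize (B4 x Hx). lra.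
Qed.

Lemma meldom_scal z F M : meldom F M -> meldom (fun x => z * F x)%C (Cmod z * M).
Proof.
  intros (A1 & A2 & A3 & A4). pose proof (Cmod_ge_0 z). split; [now apply Rmult_le_pos|]. split; [|split].
  - intros; apply ccont_mult; auto using ccont_const.
  - intros x Hx. rewrite Cmod_mult. apply Rmult_le_compat_l; auto.
  - intros x Hx. rewrite Cmod_mult, Rmult_assoc. apply Rmult_le_compat_l; auto.
Qed.

Lemma mel_plus F G M N s : meldom F M -> meldom G N -> c98 s ->
  mel (fun x => F x + G x)%C s = (mel F s + mel G s)%C.
Proof.
  intros HF HG Hs. unfold mel.
  rewrite (Lap_plus _ _ _ _ _ _ _ (lapdom_mel_0 F M HF) (lapdom_mel_0 G N HG)) by now apply c98_0.
  rewrite (Lap_plus _ _ _ _ _ _ _ (lapdom_mel_1 F M HF) (lapdom_mel_1 G N HG)) by now apply c98_1.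
  ring.
Qed.

Lemma mel_scal z F M s : meldom F M -> c98 s -> mel (fun x => z * F x)%C s = (z * mel F s)%C.
Proof.
  intros HF Hs. unfold mel.
  rewrite (Lap_scal _ _ _ _ _ (lapdom_mel_0 F M HF)) by now apply c98_0.
  rewrite (Lap_scal _ _ _ _ _ (lapdom_mel_1 F M HF)) by now apply c98_1.
  ring.
Qed.

Lemma mel_ext F G s : (forall x, 0 < x -> F x = G x) -> mel F s = mel G s.
Proof. intros H. unfold mel. f_equal; apply Lap_ext; intros u _; apply H, exp_pos. Qed.

Lemma CI_lin f (k v a b : R) : a <= b -> (k = 1 \/ k = -1) -> (forall t, ccont f t) ->
  CI (fun u => f (k * u + v)) a b =
  (RtoC k * (if Rle_dec 0 k then CI f (k * a + v) (k * b + v) else - CI f (k * b + v) (k * a + v)))%C.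
Proof.
  intros Hab Hk Cf.
  assert (X : forall p : C -> R, (forall t, continuous (fun u => p (f u)) t) ->
    k * RInt (fun u => p (f (k * u + v))) a b = RInt (fun u => p (f u)) (k * a + v) (k * b + v)).
  { intros p Hp.
    assert (E : forall a b, ex_RInt (fun u => p (f u)) a b).
    { intros x y. apply (ex_RInt_continuous (V := R_CompleteNormedModule)). auto. }
    rewrite <- (RInt_comp_lin (V := R_CompleteNormedModule) (fun u => p (f u)) k v a b (E _ _)).
    rewrite (RInt_scal (V := R_CompleteNormedModule) (fun u => p (f (k * u + v)))).
    - reflexivity.
    - apply (ex_RInt_continuous (V := R_CompleteNormedModule)). intros z _.
      apply (continuous_comp (fun u => k * u + v) (fun u => p (f u))); auto.
      apply (ex_derive_continuous (V := R_NormedModule)). auto_derive; auto. }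
  assert (Y : forall p : C -> R, (forall t, continuous (fun u => p (f u)) t) -> forall x y,
    @eq R (- RInt (fun u => p (f u)) x y) (RInt (fun u => p (f u)) y x)).
  { intros p Hp x y. apply (opp_RInt_swap (V := R_CompleteNormedModule) (fun u => p (f u))).
    apply (ex_RInt_continuous (V := R_CompleteNormedModule)). auto. }
  assert (R1 : k * Re (CI (fun u => f (k * u + v)) a b) = Re (CI f (k * a + v) (k * b + v)))
    by exact (X Re (fun t => proj1 (Cf t))).
  assert (R2 : k * Im (CI (fun u => f (k * u + v)) a b) = Im (CI f (k * a + v) (k * b + v)))
    by exact (X Im (fun t => proj2 (Cf t))).
  assert (S1 : forall x y, - Re (CI f x y) = Re (CI f y x)) by exact (Y Re (fun t => proj1 (Cf t))).
  assert (S2 : forall x y, - Im (CI f x y) = Im (CI f y x)) by exact (Y Im (fun t => proj2 (Cf t))).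
  destruct Hk; subst k.
  - destruct (Rle_dec 0 1); [|lra]. apply Ceq; creim; lra.
  - destruct (Rle_dec 0 (-1)); [lra|]. rewrite <- S1 in R1. rewrite <- S2 in R2.
    apply Ceq; creim; lra.
Qed.

Definition melint (F : R -> C) (s : C) (u : R) : C := (Cexp ((s - 2) * RtoC u) * F (exp u))%C.

Lemma ccont_melint F M s u : meldom F M -> ccont (melint F s) u.
Proof.
  intros (_ & Fc & _). apply ccont_mult.
  - eapply cder_ccont, cder_Cexp_lin.
  - apply (ccont_comp F exp); [apply continuous_exp | apply Fc, exp_pos].
Qed.

Lemma mel_conv F M s eps : meldom F M -> c98 s -> 0 < eps ->
  exists U, 0 <= U /\ forall a b, a <= - U -> U <= b -> Cmod (mel F s - CI (melint F s) a b)%C <= eps.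
Proof.
  intros H Hs He. assert (He2 : 0 < eps / 2) by lra.
  destruct (Lap_conv _ _ _ _ _ (lapdom_mel_0 F M H) (c98_0 s Hs) He2) as (U1 & P1 & Q1).
  destruct (Lap_conv _ _ _ _ _ (lapdom_mel_1 F M H) (c98_1 s Hs) He2) as (U2 & P2 & Q2).
  exists (Rmax U1 U2). pose proof (Rmax_l U1 U2). pose proof (Rmax_r U1 U2). split; [lra|].
  intros a b Ha Hb. specialize (Q1 (- a) ltac:(lra)). specialize (Q2 b ltac:(lra)).
  assert (C : forall t, ccont (melint F s) t) by (intros; eapply ccont_melint; eassumption).
  assert (E1 : CI (lint (fun u => F (exp (- u))) (s - 2)) 0 (- a) = CI (melint F s) a 0).
  { rewrite (CI_ext _ (fun u => melint F s (-1 * u + 0)) 0 (- a)).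
    2: lra.
    2:{ intros u _. unfold lint, melint. replace (-1 * u + 0) with (- u) by ring.
        replace (- ((s - 2) * RtoC u))%C with ((s - 2) * RtoC (- u))%C by cring. reflexivity. }
    rewrite CI_lin by (auto; lra). destruct (Rle_dec 0 (-1)); [lra|].
    replace (-1 * 0 + 0) with 0 by ring. replace (-1 * - a + 0) with a by ring. cring. }
  assert (E2 : CI (lint (fun u => F (exp u)) (2 - s)) 0 b = CI (melint F s) 0 b).
  { apply CI_ext; [lra|]. intros u _. unfold lint, melint. f_equal. f_equal. ring. }
  rewrite E1 in Q1. rewrite E2 in Q2. unfold mel.
  rewrite <- (CI_Chasles (melint F s) a 0 b) by (apply exCI_cont; auto; lra).
  match goal with |- Cmod (?x + ?y - (?z + ?w))%C <= _ =>
    replace (x + y - (z + w))%C with ((x - z) + (y - w))%C by ring end.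
  eapply Rle_trans; [apply Cmod_triangle|]. lra.
Qed.

(** In the variable [ln x] a dilation is a translation by [ln l]. It moves the splitting point, so
    both sides are compared through windows [[-U, U]] and their translates, with [U] large enough
    for both. *)
Lemma mel_dilate F M N l s : meldom F M -> meldom (fun x => F (l * x)%R) N -> 0 < l -> c98 s ->
  mel (fun x => F (l * x)%R) s = (Rpower_C l (2 - s) * mel F s)%C.
Proof.
  intros HF HG Hl Hs.
  set (z := Rpower_C l (2 - s)). pose proof (Cmod_ge_0 z) as Hz.
  assert (D : Cmod (mel (fun x => F (l * x)%R) s - z * mel F s)%C <= 0).
  { apply le_epsilon. intros eps He. rewrite Rplus_0_l.
    assert (e1 : 0 < eps / (1 + Cmod z)) by (apply Rdiv_lt_0_compat; lra).
    destruct (mel_conv F M s _ HF Hs e1) as (U1 & P1 & Q1).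
    destruct (mel_conv _ N s _ HG Hs e1) as (U2 & P2 & Q2).
    set (k := ln l). pose proof (Rle_abs k). pose proof (Rle_abs (- k)). rewrite Rabs_Ropp in H0.
    set (U := U1 + U2 + Rabs k).
    specialize (Q1 (- U + k) (U + k) ltac:(unfold U; lra) ltac:(unfold U; lra)).
    specialize (Q2 (- U) U ltac:(unfold U; lra) ltac:(unfold U; lra)).
    assert (C : forall t, ccont (melint F s) t) by (intros; eapply ccont_melint; eassumption).
    assert (UU : - U <= U) by (unfold U; pose proof (Rabs_pos k); lra).
    assert (E : CI (melint (fun x => F (l * x)%R) s) (- U) U = (z * CI (melint F s) (- U + k) (U + k))%C).
    { rewrite <- CI_scal by (apply exCI_cont; auto; lra).
      assert (C2 : forall t, ccont (fun u => z * melint F s u)%C t)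
        by (intros; apply ccont_mult; auto using ccont_const).
      pose proof (CI_lin (fun u => z * melint F s u)%C 1 k (- U) U UU ltac:(auto) C2) as L.
      destruct (Rle_dec 0 1); [|lra].
      replace (1 * - U + k) with (- U + k) in L by ring. replace (1 * U + k) with (U + k) in L by ring.
      replace (CI (fun u => z * melint F s u)%C (- U + k) (U + k)) with
        (RtoC 1 * CI (fun u => z * melint F s u) (- U + k) (U + k))%C by ring.
      rewrite <- L. apply CI_ext; auto. intros u _. unfold melint, z, Rpower_C.
      rewrite Cmult_assoc, <- Cexp_plus. f_equal.
      - f_equal. fold k. replace (1 * u + k) with (u + k) by ring. rewrite RtoC_plus. ring.
      - f_equal. replace (1 * u + k) with (k + u) by ring. unfold k. rewrite exp_plus, exp_ln by auto. reflexivity. }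
    rewrite E in Q2.
    match type of Q1 with Cmod (_ - ?x)%C <= _ => set (X := x) in * end.
    replace (mel (fun x => F (l * x)%R) s - z * mel F s)%C with
      ((mel (fun x => F (l * x)%R) s - z * X) - z * (mel F s - X))%C by ring.
    eapply Rle_trans; [apply Cmod_minus_le|]. rewrite Cmod_mult.
    apply Rle_trans with (eps / (1 + Cmod z) + Cmod z * (eps / (1 + Cmod z))).
    - apply Rplus_le_compat; [exact Q2|]. apply Rmult_le_compat_l; auto.
    - right. field. lra. }
  assert (Z : (mel (fun x => F (l * x)%R) s - z * mel F s)%C = RtoC 0).
  { apply Cmod_eq_0. pose proof (Cmod_ge_0 (mel (fun x => F (l * x)%R) s - z * mel F s)%C). lra. }
  replace (mel (fun x => F (l * x)%R) s) with
   ((mel (fun x => F (l * x)%R) s - z * mel F s) + z * mel F s)%C by ring.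
  rewrite Z. ring.
Qed.

(** The 1 is subtracted for the sake of convergence at 0 in the Mellin integral with [x^(s-3)]. *)
Definition Fe (e x : R) : C := (cis (- (e * x)) - 1)%C.

Lemma Cmod_cis_sub1 x : Cmod (cis x - 1)%C <= 2 * Rabs x.
Proof.
  assert (E : (cis x - 1)%C = (cos x - 1, sin x)).
  { unfold cis, Cexp. replace (Re (Ci * RtoC x)%C) with 0 by (creim; ring).
    replace (Im (Ci * RtoC x)%C) with x by (creim; ring). rewrite exp_0. apply Ceq; simpl; ring. }
  rewrite E. eapply Rle_trans; [apply Cmod_le_ReIm|]. simpl.
  pose proof (Rabs_sin_le x) as S.
  assert (K : Rabs (cos x - 1) <= Rabs x).
  { replace x with (2 * (x / 2)) at 1 by field. rewrite cos_2a_sin.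
    replace (1 - 2 * sin (x / 2) * sin (x / 2) - 1) with (- (2 * sin (x / 2) * sin (x / 2))) by ring.
    rewrite Rabs_Ropp, !Rabs_mult, (Rabs_pos_eq 2) by lra.
    pose proof (Rabs_sin_le (x / 2)) as S2. unfold Rdiv in S2 at 2. rewrite Rabs_mult, (Rabs_pos_eq (/ 2)) in S2 by lra.
    assert (Rabs (sin (x / 2)) <= 1) by (apply Rabs_le; pose proof (SIN_bound (x / 2)); lra).
    pose proof (Rabs_pos (sin (x / 2))). nra. }
  lra.
Qed.

Lemma meldom_Fe e l : 0 < l -> e = 1 \/ e = -1 -> meldom (fun x => Fe e (l * x)) (2 + 2 * l).
Proof.
  intros Hl He. split; [lra|]. split; [|split].
  - intros x _. unfold Fe. apply ccont_minus; [|apply ccont_const].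
    eapply cder_ccont, (cder_cis (fun x => - (e * (l * x)))). auto_derive; auto.
  - intros x _. unfold Fe. eapply Rle_trans; [apply Cmod_minus_le|]. rewrite Cmod_cis, Cmod_1. lra.
  - intros x Hx. unfold Fe. eapply Rle_trans; [apply Cmod_cis_sub1|].
    rewrite Rabs_Ropp, Rabs_mult. replace (Rabs e) with 1
      by (destruct He; subst e; [rewrite Rabs_pos_eq; lra | rewrite Rabs_left; lra]).
    rewrite Rabs_pos_eq by nra.
    assert (x <= Rpower x (15 / 16)).
    { unfold Rpower. rewrite <- (exp_ln x) at 1 by lra. apply exp_le.
      assert (ln x <= 0) by (rewrite <- ln_1; apply ln_le; lra). lra. }
    pose proof (Rpower_pos x (15 / 16)). nra.
Qed.

(** Two integrations by parts lower [x^(s-1)] to [x^(s-3)]; they are carried out on the Laplace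
    transforms of the two halves, by the recursions for [LA] and [LB]. *)
Lemma mel_Fe e s : e = 1 \/ e = -1 -> c98 s -> (- (s - 1) * (s - 2) * mel (Fe e) s)%C = Em e s.
Proof.
  intros He Hs. pose proof (ie_neq_0 e He) as Ni.
  assert (N2 : (s - 2)%C <> RtoC 0).
  { intros E. apply (f_equal Re) in E. unfold c98 in Hs. rewrite Re_minus, !Re_RtoC in E. lra. }
  assert (N1 : (s - 1)%C <> RtoC 0).
  { intros E. apply (f_equal Re) in E. unfold c98 in Hs. rewrite Re_minus, !Re_RtoC in E. lra. }
  assert (D1 : meldom (fun x => Fe e (1 * x)) (2 + 2 * 1)) by (apply meldom_Fe; lra).
  assert (D0 : meldom (Fe e) 4).
  { destruct D1 as (A & B & D & E). replace (2 + 2 * 1) with 4 in * by ring.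
    split; auto. split; [|split]; intros x Hx; specialize (B x); specialize (D x); specialize (E x);
    rewrite Rmult_1_l in *; auto.
    eapply ccont_ext; [|apply B; exact Hx]. intros u. cbv beta. now rewrite Rmult_1_l. }
  assert (A1 : (ie e * LA e (s - 1))%C = ((s - 2) * Lap (fun u => Fe e (exp (- u))) (s - 2) - (e0 e - 1))%C).
  { unfold LA.
    pose proof (lapdom_Cexp_lin (-1) (ie e) (gA e) 1 0 (lapdom_gA e)) as G.
    replace (e0 e - 1)%C with (Fe e (exp (- 0))) by (unfold Fe, e0; rewrite Ropp_0, exp_0, Rmult_1_r; reflexivity).
    rewrite <- (Lap_by_parts (fun u => Fe e (exp (- u))) (fun u => ie e * (Cexp (RtoC (-1) * RtoC u) * gA e u))%C
      _ _ _ _ (s - 2)%C (lapdom_mel_0 _ _ D0) G).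
    - assert (E : lapdom (fun u => Cexp (RtoC (-1) * RtoC u) * gA e u)%C 1 (-1)).
      { pose proof (lapdom_Cexp_lin (-1) (RtoC 1) (gA e) 1 0 (lapdom_gA e)) as (A & B & D).
        rewrite Cmod_1, Rmult_1_r in *. rewrite Rplus_0_r in D. split; auto. split.
        - intros u Hu. eapply ccont_ext; [|apply (B u Hu)]. intros v. cbv beta. ring.
        - intros u Hu. eapply Rle_trans; [|apply (D u Hu)]. right. f_equal. ring. }
      rewrite (Lap_scal _ _ _ _ _ E) by (pose proof (c98_0 s Hs); lra). rewrite Lap_shift.
      do 2 f_equal. cring.
    - now apply c98_0.
    - pose proof (c98_0 s Hs). lra.
    - intros u _. unfold Fe. eapply cder_eq.
      + apply cder_minus; [apply (cder_gA e u) | apply cder_const].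
      + unfold ie. replace (- (1) * RtoC u)%C with (RtoC (-1) * RtoC u)%C by cring. ring. }
  assert (A2 : (ie e * LA e s)%C = ((s - 1) * LA e (s - 1) - e0 e)%C).
  { rewrite <- LA_rec by (unfold c98 in Hs; creim; lra). do 2 f_equal. ring. }
  assert (O1 : Lap (fun _ => RtoC 1) (2 - s)%C = (/ (2 - s))%C).
  { assert (G1 : lapdom (fun _ => RtoC 1) 1 0).
    { split; [lra|]. split; [intros; apply ccont_const|]. intros u _. rewrite Cmod_1, Rmult_0_l, exp_0. lra. }
    assert (G0 : lapdom (fun _ => RtoC 0) 0 0).
    { split; [lra|]. split; [intros; apply ccont_const|]. intros u _. rewrite Cmod_0. lra. }
    pose proof (Lap_by_parts (fun _ => RtoC 1) (fun _ => RtoC 0) 1 0 0 0 (2 - s)%C G1 G0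
      (c98_1 s Hs) (c98_1 s Hs) (fun u _ => cder_const (RtoC 1) u)) as P.
    assert (Z : Lap (fun _ => RtoC 0) (2 - s)%C = RtoC 0).
    { rewrite (Lap_ext _ (fun u => RtoC 0 * (fun _ => RtoC 1) u)%C) by (intros; ring).
      rewrite (Lap_scal _ _ _ _ _ G1) by now apply c98_1. ring. }
    rewrite Z in P.
    replace (Lap (fun _ => RtoC 1) (2 - s)%C) with
      (/ (2 - s) * ((2 - s) * Lap (fun _ => RtoC 1) (2 - s) - 1) + / (2 - s))%C.
    - rewrite <- P. ring.
    - field. intros E. apply N2. replace (s - 2)%C with (- (2 - s))%C by ring. rewrite E. ring. }
  assert (A3 : Lap (fun u => Fe e (exp u)) (2 - s)%C = (LB e (2 - s) - / (2 - s))%C).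
  { rewrite <- O1. unfold LB.
    assert (G1 : lapdom (fun _ => RtoC 1) 1 0).
    { split; [lra|]. split; [intros; apply ccont_const|]. intros u _. rewrite Cmod_1, Rmult_0_l, exp_0. lra. }
    assert (Gm : lapdom (fun _ => - (1) * RtoC 1)%C 1 0).
    { split; [lra|]. split; [intros; apply ccont_const|]. intros u _.
      rewrite Cmod_mult, Cmod_m1, Cmod_1, Rmult_0_l, exp_0. lra. }
    rewrite (Lap_ext _ (fun u => gB e u + - (1) * RtoC 1)%C) by (intros; unfold Fe, gB; ring).
    rewrite (Lap_plus _ _ _ _ _ _ _ (lapdom_gB e) Gm) by now apply c98_1.
    rewrite (Lap_scal (- (1))%C _ _ _ _ G1) by now apply c98_1. ring. }
  unfold Em, mel. rewrite A3.
  assert (B1 : LBx e (- s) = ((e0 e - (1 - s) * ((e0 e - (2 - s) * LB e (2 - s)) / ie e)) / ie e)%C).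
  { unfold LBx. unfold Bstep at 1. unfold Bstep at 1.
    replace (- s + 1 + 1)%C with (2 - s)%C by ring.
    rewrite (Bstep_LB e (2 - s)) by (auto; now apply c98_1).
    replace (- s + 1)%C with (1 - s)%C by ring. reflexivity. }
  rewrite B1.
  set (L1 := Lap (fun u => Fe e (exp (- u))) (s - 2)) in *. set (L2 := LB e (2 - s)) in *.
  set (a0 := LA e s) in *. set (a1 := LA e (s - 1)) in *.
  assert (Q1 : L1 = ((ie e * a1 + (e0 e - 1)) / (s - 2))%C).
  { rewrite A1. field. exact N2. }
  assert (Q2 : a1 = ((ie e * a0 + e0 e) / (s - 1))%C).
  { rewrite A2. field. exact N1. }
  rewrite Q1, Q2.
  assert (I2 : (ie e * ie e)%C = (- (1))%C).
  { unfold ie. destruct He; subst e; cring. }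
  assert (N2' : (2 - s)%C <> RtoC 0).
  { intros E. apply N2. replace (s - 2)%C with (- (2 - s))%C by ring. rewrite E. ring. }
  assert (I3 : (/ ie e)%C = (- ie e)%C).
  { replace (- ie e)%C with (- (ie e * ie e) * / ie e)%C by (field; exact Ni). rewrite I2. ring. }
  unfold Cdiv. rewrite I3.
  transitivity (- (ie e * ie e) * a0 + - ie e * e0 e - (s - 1) * e0 e
     - (s - 1) * (s - 2) * L2)%C.
  - field. split; auto.
  - transitivity (a0 + (- ie e * e0 e - (ie e * ie e) * ((1 - s) * e0 e
      - (1 - s) * (2 - s) * L2)))%C; [rewrite I2; ring|]. ring.
Qed.

Lemma continuous_fN N x : continuous (fN N) x.
Proof. apply (ex_derive_continuous (V := R_NormedModule)). exists (fN' N x). apply is_derive_fN. Qed.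

Lemma meldom_bt_fN N : meldom (fun x => RtoC (bt x - fN N x)) (8 / 5 * Rpower (2 * INR N + 1) (- (1 / 16))).
Proof.
  pose proof (Rpower_pos (2 * INR N + 1) (- (1 / 16))). split; [lra|]. split; [|split].
  - intros x _. apply ccont_RtoC, (continuous_minus (V := R_NormedModule) bt (fN N));
      [apply continuous_bt | apply continuous_fN].
  - intros x Hx. rewrite Cmod_R. apply bt_fN. lra.
  - intros x Hx. rewrite Cmod_R. now apply bt_fN_0.
Qed.

(** On (0, 1) [bt] is the polynomial [(x^2 - x) / 2], whose Mellin integral accounts for the
    rational terms of [Zx (1 - s)]; the part over (1, oo) is the Laplace transform in [Zx]. *)
Lemma mel_bt s : c98 s -> (- (s - 1) * (s - 2) * mel (fun x => RtoC (bt x)) s)%C = Zx (1 - s).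
Proof.
  intros Hs. unfold mel, Zx.
  assert (N : forall k : R, k <> 9 / 8 -> (s - RtoC k)%C <> RtoC 0).
  { intros k Hk E. apply (f_equal Re) in E. unfold c98 in Hs. rewrite Re_minus, !Re_RtoC in E. lra. }
  assert (G1 : lapdom (fun _ => RtoC 1) 1 0).
  { split; [lra|]. split; [intros; apply ccont_const|]. intros u _. rewrite Cmod_1, Rmult_0_l, exp_0. lra. }
  assert (O1 : forall p, 0 < Re p -> Lap (fun _ => RtoC 1) p = (/ p)%C).
  { intros p Hp.
    assert (G0 : lapdom (fun _ => RtoC 0) 0 0).
    { split; [lra|]. split; [intros; apply ccont_const|]. intros u _. rewrite Cmod_0. lra. }
    pose proof (Lap_by_parts (fun _ => RtoC 1) (fun _ => RtoC 0) 1 0 0 0 p G1 G0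
      Hp Hp (fun u _ => cder_const (RtoC 1) u)) as P.
    assert (Z : Lap (fun _ => RtoC 0) p = RtoC 0).
    { rewrite (Lap_ext _ (fun u => RtoC 0 * (fun _ => RtoC 1) u)%C) by (intros; ring).
      rewrite (Lap_scal _ _ _ _ _ G1) by exact Hp. ring. }
    rewrite Z in P.
    assert (p <> RtoC 0) by (intros ->; simpl in Hp; lra).
    replace (Lap (fun _ => RtoC 1) p) with (/ p * (p * Lap (fun _ => RtoC 1) p - 1) + / p)%C by (field; auto).
    rewrite <- P. ring. }
  assert (Gk : forall k z, lapdom (fun u => z * (Cexp (RtoC k * RtoC u) * RtoC 1))%C (Cmod z * 1) (k + 0))
    by (intros; apply lapdom_Cexp_lin, G1).
  assert (Lk : forall (k : R) z p, k < Re p -> Lap (fun u => z * (Cexp (RtoC k * RtoC u) * RtoC 1))%C p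
     = (z * / (p - RtoC k))%C).
  { intros k z p Hp.
    assert (E : lapdom (fun u => Cexp (RtoC k * RtoC u) * RtoC 1)%C 1 k).
    { pose proof (Gk k (RtoC 1)) as (A & B & D). rewrite Cmod_1, Rmult_1_r in *. rewrite Rplus_0_r in D.
      split; auto. split.
      - intros u Hu. eapply ccont_ext; [|apply (B u Hu)]. intros v. cbv beta. ring.
      - intros u Hu. eapply Rle_trans; [|apply (D u Hu)]. right. f_equal. ring. }
    rewrite (Lap_scal _ _ _ _ _ E) by exact Hp. rewrite Lap_shift. rewrite O1; auto. creim. lra. }
  pose proof Hs as Hs'. unfold c98 in Hs'.
  assert (A1 : Lap (fun u => RtoC (bt (exp (- u)))) (s - 2)%C =
     (RtoC (1 / 2) * / (s - 2 - RtoC (-2)) + RtoC (- (1 / 2)) * / (s - 2 - RtoC (-1)))%C).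
  { rewrite <- !Lk by (creim; lra).
    rewrite <- (Lap_plus _ _ _ _ _ _ _ (Gk (-2) (RtoC (1 / 2))) (Gk (-1) (RtoC (- (1 / 2))))) by (creim; lra).
    apply Lap_ext. intros u Hu. rewrite (bt_unit 0).
    2:{ simpl. split; [left; apply exp_pos|]. rewrite Rplus_0_l, <- exp_0. apply exp_le. lra. }
    rewrite <- !RtoC_mult, !Cexp_RtoC, <- !RtoC_mult, <- RtoC_plus. f_equal. simpl.
    replace (-2 * u) with (- u + - u) by ring. replace (-1 * u) with (- u) by ring. rewrite exp_plus. field. }
  rewrite A1. unfold gb. replace (1 - s + 1)%C with (2 - s)%C by ring.
  replace (s - 2 - RtoC (-2))%C with s by cring. replace (s - 2 - RtoC (-1))%C with (s - 1)%C by cring.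
  assert (N0 : s <> RtoC 0) by (intros ->; simpl in Hs'; lra).
  assert (N1 : (s - 1)%C <> RtoC 0) by (apply N; lra).
  replace (RtoC (1 / 2)) with (/ RtoC 2)%C by (rewrite <- RtoC_inv by lra; f_equal; field).
  replace (RtoC (- (1 / 2))) with (- / RtoC 2)%C by (rewrite <- RtoC_inv, <- RtoC_opp by lra; f_equal; field).
  field. split; auto. intros E. apply N0. replace s with (- (1 - s - 1))%C by ring. rewrite E. ring.
Qed.

(** The n-th Fourier term is a multiple of [Fe 1 + Fe (-1)] dilated by [2 pi n], and the dilation
    yields the power of [2 pi n]. The outcome is the functional equation with [Zx s] replaced by its
    partial sum. *)
Lemma mel_fN N s : c98 s -> (exists M, meldom (fun x => RtoC (fN N x)) M) /\
  (- (s - 1) * (s - 2) * mel (fun x => RtoC (fN N x)) s)%C =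
  (Rpower_C (2 * PI) (- s) * (Em 1 s + Em (-1) s) * zsum s N)%C.
Proof.
  intros Hs. pose proof PI_RGT_0 as Pp.
  assert (Z0 : meldom (fun x => RtoC 0) 0).
  { split; [lra|]. split; [intros; apply ccont_const|].
    split; intros; rewrite Cmod_0; [lra|]. rewrite Rmult_0_l. lra. }
  induction N as [|N [[M HM] IH]].
  - split; [exists 0; exact Z0|].
    cbn [fN]. unfold zsum. cbn [Csum].
    rewrite (mel_ext _ (fun x => RtoC 0 * (fun _ => RtoC 0) x)%C) by (intros; ring).
    rewrite (mel_scal _ _ _ _ Z0 Hs). ring.
  - set (n := INR (S N)). assert (n0 : 0 < n) by (apply lt_0_INR; lia).
    set (l := 2 * PI * n). assert (l0 : 0 < l) by (unfold l; repeat (lra || apply Rmult_lt_0_compat)).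
    set (k := RtoC (/ (4 * PI ^ 2 * n ^ 2))).
    pose proof (meldom_Fe 1 l l0 ltac:(auto)) as F1. pose proof (meldom_Fe (-1) l l0 ltac:(auto)) as F2.
    pose proof (meldom_scal k _ _ (meldom_plus _ _ _ _ F1 F2)) as G.
    assert (E : forall x, RtoC (fN (S N) x) = (RtoC (fN N x) + k * (Fe 1 (l * x)%R + Fe (-1) (l * x)%R))%C).
    { intros x. cbn [fN]. fold n. rewrite RtoC_plus. f_equal.
      assert (X : (Fe 1 (l * x)%R + Fe (-1) (l * x)%R)%C = RtoC (2 * (cos (2 * n * PI * x) - 1))).
      { unfold Fe, cis, Cexp.
        replace (Re (Ci * RtoC (- (1 * (l * x))))%C) with 0 by (creim; ring).
        replace (Re (Ci * RtoC (- (-1 * (l * x))))%C) with 0 by (creim; ring).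
        replace (Im (Ci * RtoC (- (1 * (l * x))))%C) with (- (2 * n * PI * x)) by (creim; unfold l; ring).
        replace (Im (Ci * RtoC (- (-1 * (l * x))))%C) with (2 * n * PI * x) by (creim; unfold l; ring).
        rewrite exp_0, cos_neg, sin_neg. apply Ceq; simpl; ring. }
      rewrite X. unfold k. rewrite <- RtoC_mult. f_equal. field. split; lra. }
    pose proof (meldom_plus _ _ _ _ HM G) as HS.
    split.
    { eexists. destruct HS as (A & B & D & E'). split; [exact A|]. split; [|split].
      - intros x Hx. eapply ccont_ext; [|apply (B x Hx)]. intros u. cbv beta. now rewrite E.
      - intros x Hx. rewrite E. now apply D.
      - intros x Hx. rewrite E. now apply E'. }
    rewrite (mel_ext _ _ s (fun x _ => E x)).
    rewrite (mel_plus _ _ _ _ _ HM G Hs).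
    rewrite (mel_scal k _ _ _ (meldom_plus _ _ _ _ F1 F2) Hs).
    rewrite (mel_plus _ _ _ _ _ F1 F2 Hs).
    assert (H4 : forall e, e = 1 \/ e = -1 -> meldom (Fe e) 4).
    { intros e He. destruct (meldom_Fe e 1 ltac:(lra) He) as (A & B & D & E').
      replace (2 + 2 * 1) with 4 in * by ring. split; auto.
      split; [|split]; intros x Hx; specialize (B x); specialize (D x); specialize (E' x);
        rewrite Rmult_1_l in *; auto.
      eapply ccont_ext; [|apply B; exact Hx]. intros u. cbv beta. now rewrite Rmult_1_l. }
    rewrite (mel_dilate (Fe 1) 4 _ l s (H4 1 ltac:(auto)) F1 l0 Hs).
    rewrite (mel_dilate (Fe (-1)) 4 _ l s (H4 (-1) ltac:(auto)) F2 l0 Hs).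
    change (zsum s (S N)) with (zsum s N + Rpower_C n (- s))%C.
    assert (K : (k * Rpower_C l (2 - s))%C = (Rpower_C (2 * PI) (- s) * Rpower_C n (- s))%C).
    { replace (2 - s)%C with (RtoC 1 + RtoC 1 + - s)%C by cring.
      rewrite !Rpower_C_plus, Rpower_C_1 by auto. unfold l.
      rewrite <- Rpower_C_mult by lra. unfold k.
      replace (RtoC (/ (4 * PI ^ 2 * n ^ 2))) with (/ (RtoC (2 * PI * n) * RtoC (2 * PI * n)))%C.
      - field. intros X. apply (f_equal fst) in X. simpl in X. unfold l in l0. lra.
      - rewrite <- RtoC_mult, <- RtoC_inv by (fold l; nra). f_equal. field. split; lra. }
    transitivity (- (s - 1) * (s - 2) * mel (fun x => RtoC (fN N x)) s + (k * Rpower_C l (2 - s)) *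
      (- (s - 1) * (s - 2) * mel (Fe 1) s + - (s - 1) * (s - 2) * mel (Fe (-1)) s))%C; [ring|].
    rewrite IH, K, !mel_Fe by auto. ring.
Qed.

(** The limit of [mel_fN]: the bound for [bt - fN N] in [meldom] tends to 0 and controls the Mellin
    integral at both ends. *)
Lemma functional_equation s : c98 s ->
  Zx (1 - s) = (Rpower_C (2 * PI) (- s) * (Em 1 s + Em (-1) s) * Zx s)%C.
Proof.
  intros Hs. set (X := (Rpower_C (2 * PI) (- s) * (Em 1 s + Em (-1) s))%C).
  assert (L1 : clim (fun N => X * zsum s N)%C (X * Zx s)%C).
  { apply clim_mult; [apply clim_const|]. apply zsum_Zx. unfold c98 in Hs. lra. }
  assert (L2 : clim (fun N => X * zsum s N)%C (Zx (1 - s))).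
  { intros eps He. set (K := Cmod (- (s - 1) * (s - 2))%C * 18 * (8 / 5)).
    destruct (exp_small (1 / 16) K eps ltac:(lra) He) as (U & HU0 & HU).
    destruct (INR_unbounded (exp U)) as [N0 HN0]. exists N0. intros N HN. apply le_INR in HN.
    destruct (mel_fN N s Hs) as [[M HM] E]. fold X in E. rewrite <- E.
    rewrite <- mel_bt by exact Hs. rewrite Cmod_minus_sym.
    pose proof (meldom_bt_fN N) as D.
    rewrite (mel_ext (fun x => RtoC (bt x)) (fun x => RtoC (fN N x) + RtoC (bt x - fN N x))%C)
      by (intros; rewrite <- RtoC_plus; f_equal; ring).
    rewrite (mel_plus _ _ _ _ _ HM D Hs).
    match goal with |- Cmod ?z <= _ => replace z with
      (- (s - 1) * (s - 2) * mel (fun x => RtoC (bt x - fN N x)) s)%C by ring end.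
    rewrite Cmod_mult. pose proof (mel_bound _ _ s D Hs) as B.
    eapply Rle_trans; [apply Rmult_le_compat_l; [apply Cmod_ge_0 | exact B]|].
    eapply Rle_trans; [|apply (HU (ln (2 * INR N + 1)))].
    - right. unfold K, Rpower. ring.
    - rewrite <- (ln_exp U). pose proof (pos_INR N). pose proof (exp_pos U). apply ln_le; lra. }
  symmetry. exact (clim_unique _ _ _ L1 L2).
Qed.

(** * Van der Corput's second derivative test for exponential sums *)

Definition sumr (f : nat -> C) (a m : nat) : C := Csum (fun i => f (a + i)%nat) m.

Lemma Csum_split f a b : Csum f (a + b) = (Csum f a + Csum (fun i => f (a + i)%nat) b)%C.
Proof.
  induction b as [|b IH].
  - rewrite Nat.add_0_r. simpl. ring.
  - rewrite Nat.add_succ_r. simpl. rewrite IH. ring.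
Qed.

Lemma sumr_split f a m p : sumr f a (m + p) = (sumr f a m + sumr f (a + m) p)%C.
Proof.
  unfold sumr. rewrite Csum_split. f_equal. apply Csum_ext. intros k _. f_equal. lia.
Qed.

Lemma sumr_S f a m : sumr f a (S m) = (sumr f a m + f (a + m)%nat)%C.
Proof. reflexivity. Qed.

Lemma sumr_ext f g a m : (forall n, (a <= n < a + m)%nat -> f n = g n) -> sumr f a m = sumr g a m.
Proof. intros H. apply Csum_ext. intros k Hk. apply H. lia. Qed.

Lemma sumr_norm f a m : (forall n, Cmod (f n) <= 1) -> Cmod (sumr f a m) <= INR m.
Proof.
  intros H. induction m as [|m IH].
  - unfold sumr; simpl. rewrite Cmod_0. lra.
  - rewrite sumr_S, S_INR. eapply Rle_trans; [apply Cmod_triangle|]. specialize (H (a + m)%nat). lra.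
Qed.

Lemma cis_plus x y : cis (x + y) = (cis x * cis y)%C.
Proof. unfold cis. rewrite <- Cexp_plus. f_equal. cring. Qed.

Lemma cis_val x : cis x = (cos x, sin x).
Proof.
  unfold cis, Cexp. replace (Re (Ci * RtoC x)%C) with 0 by (creim; ring).
  replace (Im (Ci * RtoC x)%C) with x by (creim; ring). rewrite exp_0. apply Ceq; simpl; ring.
Qed.

Lemma sin_ge_delta d x : 0 < d <= PI -> d <= x <= 2 * PI - d -> sin (d / 2) <= sin (x / 2).
Proof.
  intros Hd Hx. pose proof PI_RGT_0. destruct (Rle_dec x PI).
  - apply sin_incr_1; lra.
  - rewrite <- (sin_PI_x (x / 2)). apply sin_incr_1; lra.
Qed.

(** Kusmin-Landau: with [c = 1 / (1 - e^(i d)) = (1 + i cot (d / 2)) / 2] one has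
    [z_n = c_n (z_n - z_(n+1))], and the sum of [|c_(n+1) - c_n|] telescopes since cot is monotone. *)
Lemma Kusmin_Landau (th : nat -> R) a m d : 0 < d <= PI ->
  (forall n, (a <= n < a + m)%nat -> d <= th (S n) - th n <= 2 * PI - d) ->
  (forall n, (a <= n)%nat -> (S n < a + m)%nat -> th (S (S n)) - th (S n) <= th (S n) - th n) ->
  Cmod (sumr (fun n => cis (th n)) a m) <= 3 / sin (d / 2).
Proof.
  intros Hd Hr Hm. pose proof PI_RGT_0 as Pp.
  set (D := fun n => th (S n) - th n).
  set (S0 := sin (d / 2)). assert (S0p : 0 < S0) by (apply sin_gt_0; lra).
  assert (S01 : S0 <= 1) by apply SIN_bound.
  set (q := fun n => cos (D n / 2) / sin (D n / 2)).
  set (c := fun n => (RtoC (1 / 2) + Ci * RtoC (q n / 2))%C).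
  assert (Sp : forall n, (a <= n < a + m)%nat -> S0 <= sin (D n / 2)).
  { intros n Hn. apply sin_ge_delta; auto. apply Hr, Hn. }
  assert (Q : forall n, (a <= n < a + m)%nat -> Rabs (q n) <= / S0).
  { intros n Hn. specialize (Sp n Hn). unfold q, Rdiv. rewrite Rabs_mult, Rabs_inv, (Rabs_pos_eq (sin _)) by lra.
    assert (Rabs (cos (D n * / 2)) <= 1) by (apply Rabs_le, COS_bound).
    assert (/ sin (D n * / 2) <= / S0) by (apply Rinv_le_contravar; auto).
    assert (0 < / sin (D n * / 2)) by (apply Rinv_0_lt_compat; unfold Rdiv in Sp; lra).
    pose proof (Rabs_pos (cos (D n * / 2))). nra. }
  assert (Cq : forall n, (a <= n < a + m)%nat -> Cmod (c n) <= / S0).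
  { intros n Hn. unfold c. eapply Rle_trans; [apply Cmod_triangle|].
    rewrite Cmod_mult, Cmod_Ci, !Cmod_R, Rmult_1_l. unfold Rdiv at 2. rewrite Rabs_mult.
    rewrite (Rabs_pos_eq (/ 2)), (Rabs_pos_eq (1 / 2)) by lra. specialize (Q n Hn).
    assert (1 <= / S0) by (rewrite <- Rinv_1; apply Rinv_le_contravar; lra). lra. }
  assert (Z : forall n, (a <= n < a + m)%nat -> cis (th n) = (c n * (cis (th n) - cis (th (S n))))%C).
  { intros n Hn. specialize (Sp n Hn).
    replace (th (S n)) with (th n + D n) by (unfold D; ring). rewrite cis_plus.
    replace (c n * (cis (th n) - cis (th n) * cis (D n)))%C with (cis (th n) * (c n * (1 - cis (D n))))%C by ring.
    replace (c n * (1 - cis (D n)))%C with (RtoC 1); [ring|].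
    rewrite cis_val. unfold c, q. set (x := D n / 2) in *.
    replace (D n) with (2 * x) by (unfold x; field). rewrite cos_2a_sin, sin_2a.
    pose proof (sin2_cos2 x) as I. unfold Rsqr in I.
    apply Ceq; simpl; [|field; lra].
    transitivity (sin x * sin x + cos x * cos x); [lra | field; lra]. }
  assert (M : forall n, (a <= n)%nat -> (S n < a + m)%nat -> 0 <= q (S n) - q n).
  { intros n Hn1 Hn2. pose proof (Sp n ltac:(lia)) as s1. pose proof (Sp (S n) ltac:(lia)) as s2.
    pose proof (Hm n Hn1 Hn2) as hm. fold (D (S n)) (D n) in hm.
    pose proof (Hr n ltac:(lia)) as r1. pose proof (Hr (S n) ltac:(lia)) as r2.
    fold (D n) in r1. fold (D (S n)) in r2. unfold q.
    replace (cos (D (S n) / 2) / sin (D (S n) / 2) - cos (D n / 2) / sin (D n / 2)) with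
      (sin (D n / 2 - D (S n) / 2) / (sin (D (S n) / 2) * sin (D n / 2))).
    - apply Rdiv_le_0_compat; [apply sin_ge_0; lra | nra].
    - rewrite sin_minus. field. split; lra. }
  assert (key : forall k, (k < m)%nat ->
    Cmod (sumr (fun n => cis (th n)) a (S k) + c (a + k)%nat * cis (th (S (a + k))) - c a * cis (th a))%C
      <= / 2 * (q (a + k)%nat - q a)).
  { induction k as [|k IH]; intros Hk.
    - rewrite Nat.add_0_r. unfold sumr; simpl. rewrite Nat.add_0_r.
      replace (RtoC 0 + cis (th a) + c a * cis (th (S a)) - c a * cis (th a))%C with
       (cis (th a) - c a * (cis (th a) - cis (th (S a))))%C by ring.
      rewrite <- (Z a) by lia. replace (cis (th a) - cis (th a))%C with (RtoC 0) by ring. rewrite Cmod_0. lra.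
    - specialize (IH ltac:(lia)). rewrite sumr_S.
      replace (a + S k)%nat with (S (a + k)) in * by lia.
      set (n := (a + k)%nat) in *.
      replace (sumr (fun n0 => cis (th n0)) a (S k) + cis (th (S n)) + c (S n) * cis (th (S (S n))) - c a * cis (th a))%C
       with ((sumr (fun n0 => cis (th n0)) a (S k) + c n * cis (th (S n)) - c a * cis (th a))
         + (c (S n) - c n) * cis (th (S n)))%C.
      2:{ rewrite (Z (S n)) at 3 by (unfold n in *; lia). 
          transitivity (sumr (fun n0 => cis (th n0)) a (S k) - c a * cis (th a) + c (S n) * cis (th (S n)))%C; ring. }
      eapply Rle_trans; [apply Cmod_triangle|]. rewrite Cmod_mult, Cmod_cis, Rmult_1_r.
      replace (c (S n) - c n)%C with (Ci * RtoC ((q (S n) - q n) / 2))%C by (unfold c; cring || (apply Ceq; simpl; field)).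
      rewrite Cmod_mult, Cmod_Ci, Rmult_1_l, Cmod_RtoC_pos.
      + lra.
      + pose proof (M n ltac:(unfold n; lia) ltac:(unfold n; lia)). lra. }
  destruct m as [|m].
  - unfold sumr; simpl. rewrite Cmod_0. apply Rdiv_le_0_compat; lra.
  - specialize (key m ltac:(lia)). set (X := sumr (fun n => cis (th n)) a (S m)) in *.
    replace X with ((X + c (a + m)%nat * cis (th (S (a + m))) - c a * cis (th a))
      - (c (a + m)%nat * cis (th (S (a + m))) - c a * cis (th a)))%C by ring.
    eapply Rle_trans; [apply Cmod_minus_le|].
    eapply Rle_trans; [apply Rplus_le_compat_l, Cmod_minus_le|]. rewrite !Cmod_mult, !Cmod_cis, !Rmult_1_r.
    pose proof (Cq a ltac:(lia)). pose proof (Cq (a + m)%nat ltac:(lia)).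
    pose proof (Q a ltac:(lia)) as Qa. pose proof (Q (a + m)%nat ltac:(lia)) as Qb.
    apply Rabs_le_between in Qa. apply Rabs_le_between in Qb.
    unfold Rdiv. lra.
Qed.

Lemma threshold (D : nat -> R) a m x :
  (forall n, (a <= n)%nat -> (S n < a + m)%nat -> D (S n) <= D n) ->
  exists j, (j <= m)%nat /\ (forall n, (a <= n < a + j)%nat -> x <= D n) /\
    (forall n, (a + j <= n < a + m)%nat -> D n < x).
Proof.
  induction m as [|m IH]; intros H.
  - exists O. repeat split; intros; lia.
  - destruct IH as (j & Hj & A & B). { intros; apply H; lia. }
    destruct (Nat.eq_dec j m) as [E|E].
    + subst j. destruct (Rle_lt_dec x (D (a + m)%nat)) as [L|L].
      * exists (S m). repeat split; auto; intros n Hn; [|lia].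
        destruct (Nat.eq_dec n (a + m)%nat); [subst; auto | apply A; lia].
      * exists m. repeat split; auto. intros n Hn. replace n with (a + m)%nat by lia. exact L.
    + exists j. repeat split; auto. intros n Hn.
      destruct (Nat.eq_dec n (a + m)%nat); [|apply B; lia]. subst n.
      specialize (B (a + m - 1)%nat ltac:(lia)). specialize (H (a + m - 1)%nat ltac:(lia)).
      replace (S (a + m - 1)) with (a + m)%nat in H by lia. specialize (H ltac:(lia)). lra.
Qed.

Lemma gap_count (D : nat -> R) a m mu x L : 0 < mu -> 0 <= L ->
  (forall n, (a <= n)%nat -> (S n < a + m)%nat -> D (S n) + mu <= D n) ->
  (forall n, (a <= n < a + m)%nat -> x <= D n <= x + L) -> INR m <= L / mu + 1.
Proof.
  intros Hmu HL H R. destruct m as [|m].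
  - simpl. assert (0 <= L / mu) by (apply Rdiv_le_0_compat; lra). lra.
  - assert (K : forall k, (k <= m)%nat -> D (a + k)%nat + INR k * mu <= D a).
    { induction k as [|k IH]; intros Hk.
      - rewrite Nat.add_0_r. simpl. lra.
      - specialize (IH ltac:(lia)). specialize (H (a + k)%nat ltac:(lia) ltac:(lia)).
        rewrite Nat.add_succ_r, S_INR. lra. }
    specialize (K m ltac:(lia)). pose proof (R a ltac:(lia)). pose proof (R (a + m)%nat ltac:(lia)).
    rewrite S_INR. apply Rplus_le_compat_r. apply le_div_mul; lra.
Qed.

Lemma cis_period_nat x k : cis (x - 2 * INR k * PI) = cis x.
Proof.
  rewrite !cis_val. rewrite <- (cos_period (x - 2 * INR k * PI) k), <- (sin_period (x - 2 * INR k * PI) k).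
  do 2 f_equal; ring.
Qed.

(** The phase differences sweep one period. Those within [d = sqrt mu] of either end number at most
    [1/d + 1 <= 2/d] each, by the gaps [mu], and are bounded trivially; the others fall to
    [Kusmin_Landau] with [18/d]. *)
Lemma exp_sum_unit (th : nat -> R) a m mu k : 0 < mu <= 1 ->
  (forall n, (a <= n)%nat -> (S n < a + m)%nat -> th (S (S n)) - th (S n) + mu <= th (S n) - th n) ->
  (forall n, (a <= n < a + m)%nat -> 2 * INR k * PI <= th (S n) - th n <= 2 * INR k * PI + 2 * PI) ->
  Cmod (sumr (fun n => cis (th n)) a m) <= 22 / sqrt mu.
Proof.
  intros Hmu Hg Hr. pose proof PI2_3_2 as P3.
  (* Removing [2 pi k n] changes no exponential and moves all differences into [[0, 2 pi]]. *)
  set (th' := fun n => th n - 2 * INR (k * n) * PI).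
  set (D := fun n => th' (S n) - th' n).
  assert (DE : forall n, D n = th (S n) - th n - 2 * INR k * PI).
  { intros n. unfold D, th'. rewrite Nat.mul_succ_r, plus_INR. ring. }
  rewrite (sumr_ext _ (fun n => cis (th' n))) by (intros; unfold th'; now rewrite cis_period_nat).
  assert (Hg' : forall n, (a <= n)%nat -> (S n < a + m)%nat -> D (S n) + mu <= D n).
  { intros n H1 H2. rewrite !DE. specialize (Hg n H1 H2). lra. }
  assert (Hr' : forall n, (a <= n < a + m)%nat -> 0 <= D n <= 2 * PI).
  { intros n Hn. rewrite DE. specialize (Hr n Hn). lra. }
  set (d := sqrt mu). assert (d0 : 0 < d) by (apply sqrt_lt_R0; lra).
  assert (dd : d * d = mu) by (apply sqrt_sqrt; lra). assert (d1 : d <= 1) by nra.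
  destruct (threshold D a m (2 * PI - d)) as (j & Hj & A1 & B1).
  { intros n H1 H2. specialize (Hg' n H1 H2). lra. }
  destruct (threshold D (a + j) (m - j) d) as (i & Hi & A2 & B2).
  { intros n H1 H2. specialize (Hg' n ltac:(lia) ltac:(lia)). lra. }
  assert (C1 : INR j <= d / mu + 1).
  { apply (gap_count D a j mu (2 * PI - d) d); try lra.
    - intros n H1 H2. apply Hg'; lia.
    - intros n Hn. specialize (A1 n Hn). specialize (Hr' n ltac:(lia)). lra. }
  assert (C3 : INR (m - j - i) <= d / mu + 1).
  { apply (gap_count D (a + j + i) (m - j - i) mu 0 d); try lra.
    - intros n H1 H2. apply Hg'; lia.
    - intros n Hn. specialize (B2 n ltac:(lia)). specialize (Hr' n ltac:(lia)). lra. }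
  assert (C2 : Cmod (sumr (fun n => cis (th' n)) (a + j) i) <= 18 / d).
  { eapply Rle_trans; [apply (Kusmin_Landau th' (a + j) i d)|].
    - lra.
    - intros n Hn. specialize (A2 n Hn). specialize (B1 n ltac:(lia)). fold (D n). lra.
    - intros n H1 H2. fold (D (S n)) (D n). specialize (Hg' n ltac:(lia) ltac:(lia)). lra.
    - pose proof (sin_lower (d / 2) ltac:(lra)) as S. 
      replace (18 / d) with (3 * / (d / 2 / 3)) by (field; lra). unfold Rdiv at 1.
      apply Rmult_le_compat_l; [lra|]. apply Rinv_le_contravar; lra. }
  replace m with (j + (i + (m - j - i)))%nat by lia. rewrite !sumr_split.
  eapply Rle_trans; [apply Cmod_triangle|]. eapply Rle_trans; [apply Rplus_le_compat_l, Cmod_triangle|].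
  assert (N1 : forall b p, Cmod (sumr (fun n => cis (th' n)) b p) <= INR p)
    by (intros; apply sumr_norm; intros; rewrite Cmod_cis; lra).
  pose proof (N1 a j). pose proof (N1 (a + j + i)%nat (m - j - i)%nat).
  assert (dm : d / mu = 1 / d) by (rewrite <- dd; field; lra).
  rewrite dm in *.
  assert (1 <= 1 / d) by (apply le_div_mul; lra).
  replace (22 / d) with (22 * (1 / d)) by (field; lra). replace (18 / d) with (18 * (1 / d)) in C2 by (field; lra).
  lra.
Qed.

Lemma exp_sum_units (th : nat -> R) mu K : 0 < mu <= 1 -> forall a m,
  (forall n, (a <= n)%nat -> (S n < a + m)%nat -> th (S (S n)) - th (S n) + mu <= th (S n) - th n) ->
  (forall n, (a <= n < a + m)%nat -> 0 <= th (S n) - th n < 2 * INR K * PI) ->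
  Cmod (sumr (fun n => cis (th n)) a m) <= INR K * (22 / sqrt mu).
Proof.
  intros Hmu. induction K as [|K IH]; intros a m Hg Hr.
  - destruct m as [|m].
    + unfold sumr; simpl. rewrite Cmod_0. lra.
    + specialize (Hr a ltac:(lia)). simpl in Hr. lra.
  - destruct (threshold (fun n => th (S n) - th n) a m (2 * INR K * PI)) as (j & Hj & A & B).
    { intros n H1 H2. specialize (Hg n H1 H2). lra. }
    replace m with (j + (m - j))%nat by lia. rewrite sumr_split.
    eapply Rle_trans; [apply Cmod_triangle|]. rewrite S_INR, Rmult_plus_distr_r, Rmult_1_l, Rplus_comm.
    apply Rplus_le_compat.
    + apply IH.
      * intros n H1 H2. apply Hg; lia.
      * intros n Hn. specialize (B n ltac:(lia)). specialize (Hr n ltac:(lia)). cbv beta in B. lra.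
    + apply (exp_sum_unit th a j mu K); auto.
      * intros n H1 H2. apply Hg; lia.
      * intros n Hn. specialize (A n Hn). specialize (Hr n ltac:(lia)). cbv beta in A.
        rewrite S_INR in Hr. lra.
Qed.

Lemma Cconj_sumr f a m : Cconj (sumr f a m) = sumr (fun n => Cconj (f n)) a m.
Proof.
  induction m as [|m IH].
  - unfold sumr; simpl. apply Ceq; simpl; ring.
  - rewrite !sumr_S, <- IH. apply Ceq; simpl; ring.
Qed.

(** Conjugation makes the phases [t ln n] increasing with decreasing differences. The second
    differences are at least [mu = t / (9 A^2)], and since [2 pi > 6] the first differences, at most
    [t / A], lie within [t / (6 A) + 1] periods. *)
Lemma zeta_block t a m : 4 <= t -> (0 < a)%nat -> (m <= a)%nat -> sqrt t <= INR a ->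
  Cmod (sumr (fun n => cis (- (t * ln (INR n)))) a m) <= 11 * sqrt t + 66 * INR a / sqrt t.
Proof.
  intros Ht Ha Hm Hs. destruct (sqrt_facts t Ht) as [Q2 Q]. set (r := sqrt t) in *.
  set (A := INR a) in *. assert (A1 : 1 <= A) by (unfold A; change 1 with (INR 1); apply le_INR; lia).
  rewrite <- Cmod_conj, Cconj_sumr.
  rewrite (sumr_ext _ (fun n => cis (t * ln (INR n)))).
  2:{ intros n _. rewrite !cis_val, cos_neg, sin_neg. apply Ceq; simpl; ring. }
  set (mu := t / (9 * A ^ 2)).
  assert (A2 : 0 < 9 * A ^ 2) by nra.
  assert (mu0 : 0 < mu) by (apply Rdiv_lt_0_compat; lra).
  assert (mu1 : mu <= 1) by (apply div_le_mul; [lra|]; nra).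
  assert (sq : sqrt mu = r / (3 * A)).
  { replace mu with (Rsqr (r / (3 * A))).
    - apply sqrt_Rsqr. apply Rdiv_le_0_compat; lra.
    - unfold mu, Rsqr. rewrite <- Q. field. lra. }
  destruct (archimed (t / (6 * A))) as [U1 U2].
  assert (T0 : 0 < t / (6 * A)) by (apply Rdiv_lt_0_compat; lra).
  set (K := Z.to_nat (up (t / (6 * A)))).
  assert (KE : INR K = IZR (up (t / (6 * A)))).
  { unfold K. rewrite INR_IZR_INZ, Z2Nat.id; auto. apply le_IZR. lra. }
  assert (lnd : forall n, (a <= n)%nat -> 0 <= t * ln (INR (S n)) - t * ln (INR n) <= t / A).
  { intros n Hn. assert (N : A <= INR n) by (apply le_INR; lia). rewrite S_INR.
    assert (L : 0 <= ln (INR n + 1) - ln (INR n)).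
    { assert (ln (INR n) <= ln (INR n + 1)) by (apply ln_le; lra). lra. }
    split; [nra|]. rewrite <- Rmult_minus_distr_l. unfold Rdiv. apply Rmult_le_compat_l; [lra|].
    rewrite <- ln_div by lra. eapply Rle_trans; [apply ln_le_sub1, Rdiv_lt_0_compat; lra|].
    replace ((INR n + 1) / INR n - 1) with (/ INR n) by (field; lra). apply Rinv_le_contravar; lra. }
  eapply Rle_trans; [apply (exp_sum_units (fun n => t * ln (INR n)) mu K)|].
  - lra.
  - intros n H1 H2. assert (N : A <= INR n) by (apply le_INR; lia).
    assert (N2 : INR n + 2 <= 2 * A).
    { unfold A. replace (INR n + 2) with (INR (n + 2)) by (rewrite plus_INR; simpl; lra).
      replace (2 * INR a) with (INR (2 * a)) by (rewrite mult_INR; simpl; lra). apply le_INR. lia. }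
    rewrite !S_INR. set (x := INR n) in *.
    assert (E : t * ln (x + 1) - t * ln x - (t * ln (x + 1 + 1) - t * ln (x + 1)) =
       - (t * ln (x * (x + 2) / ((x + 1) * (x + 1))))).
    { rewrite ln_div, !ln_mult by nra. replace (x + 1 + 1) with (x + 2) by ring. ring. }
    assert (L : ln (x * (x + 2) / ((x + 1) * (x + 1))) <= - (/ ((x + 1) * (x + 1)))).
    { eapply Rle_trans; [apply ln_le_sub1, Rdiv_lt_0_compat; nra|]. right. field. lra. }
    assert (M : mu <= t * / ((x + 1) * (x + 1))).
    { unfold mu, Rdiv. apply Rmult_le_compat_l; [lra|]. apply Rinv_le_contravar; nra. }
    assert (t * ln (x * (x + 2) / ((x + 1) * (x + 1))) <= t * - / ((x + 1) * (x + 1)))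
      by (apply Rmult_le_compat_l; lra).
    lra.
  - intros n Hn. specialize (lnd n ltac:(lia)). split; [lra|].
    eapply Rle_lt_trans; [apply lnd|]. rewrite KE. pose proof PI2_3_2.
    replace (t / A) with (6 * (t / (6 * A))) by (field; lra). nra.
  - rewrite sq. replace (22 / (r / (3 * A))) with (66 * A / r) by (field; lra).
    apply Rle_trans with ((t / (6 * A) + 1) * (66 * A / r)).
    + apply Rmult_le_compat_r; [apply Rdiv_le_0_compat; lra | lra].
    + right. rewrite <- Q. field. lra.
Qed.

(** Abel summation. Both directions of monotonicity occur because the abscissa [al] may have either
    sign. *)
Lemma sumr_monotone_weight (w : nat -> R) f a m B :
  (forall n, w (S n) <= w n) \/ (forall n, w n <= w (S n)) ->
  (forall k, (k <= m)%nat -> Cmod (sumr f a k) <= B) ->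
  Cmod (sumr (fun n => RtoC (w n) * f n)%C a m) <= B * (2 * Rabs (w (a + m)%nat) + Rabs (w a)).
Proof.
  intros Hw HB.
  assert (B0 : 0 <= B) by (eapply Rle_trans; [apply Cmod_ge_0 | apply (HB 0%nat); lia]).
  assert (K : forall k, (k <= m)%nat ->
    Cmod (sumr (fun n => RtoC (w n) * f n)%C a k - RtoC (w (a + k)%nat) * sumr f a k)%C
      <= B * Rabs (w (a + k)%nat - w a)).
  { induction k as [|k IH]; intros Hk.
    - unfold sumr; simpl. rewrite Nat.add_0_r.
      replace (RtoC 0 - RtoC (w a) * RtoC 0)%C with (RtoC 0) by ring. rewrite Cmod_0.
      apply Rmult_le_pos; auto. apply Rabs_pos.
    - specialize (IH ltac:(lia)). rewrite !sumr_S.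
      replace (a + S k)%nat with (S (a + k)) by lia. set (n := (a + k)%nat) in *.
      replace (sumr (fun n0 => RtoC (w n0) * f n0) a k + RtoC (w n) * f n - RtoC (w (S n)) * (sumr f a k + f n))%C
       with ((sumr (fun n0 => RtoC (w n0) * f n0) a k - RtoC (w n) * sumr f a k)
        + RtoC (w n - w (S n)) * (sumr f a k + f n))%C by (rewrite RtoC_minus; ring).
      eapply Rle_trans; [apply Cmod_triangle|]. rewrite Cmod_mult, Cmod_R.
      pose proof (HB (S k) Hk) as HS. rewrite sumr_S in HS. fold n in HS.
      assert (T : Rabs (w n - w a) + Rabs (w n - w (S n)) = Rabs (w (S n) - w a)).
      { assert (Mo : forall p q, (p <= q)%nat -> (forall n, w (S n) <= w n) -> w q <= w p).
        { intros p q Hpq H. induction Hpq; [lra|]. specialize (H m0). lra. }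
        assert (Mo' : forall p q, (p <= q)%nat -> (forall n, w n <= w (S n)) -> w p <= w q).
        { intros p q Hpq H. induction Hpq; [lra|]. specialize (H m0). lra. }
        destruct Hw as [H|H].
        - pose proof (H n). pose proof (Mo a n ltac:(unfold n; lia) H).
          rewrite (Rabs_left1 (w n - w a)), (Rabs_pos_eq (w n - w (S n))), (Rabs_left1 (w (S n) - w a)); lra.
        - pose proof (H n). pose proof (Mo' a n ltac:(unfold n; lia) H).
          rewrite (Rabs_pos_eq (w n - w a)), (Rabs_left1 (w n - w (S n))), (Rabs_pos_eq (w (S n) - w a)); lra. }
      rewrite <- T, Rmult_plus_distr_l. apply Rplus_le_compat; auto.
      rewrite Rmult_comm. apply Rmult_le_compat_r; [apply Rabs_pos | exact HS]. }
  specialize (K m ltac:(lia)). specialize (HB m ltac:(lia)).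
  replace (sumr (fun n => RtoC (w n) * f n)%C a m) with
   ((sumr (fun n => RtoC (w n) * f n) a m - RtoC (w (a + m)%nat) * sumr f a m)
     + RtoC (w (a + m)%nat) * sumr f a m)%C by ring.
  eapply Rle_trans; [apply Cmod_triangle|]. rewrite Cmod_mult, Cmod_R.
  assert (T : Rabs (w (a + m)%nat - w a) <= Rabs (w (a + m)%nat) + Rabs (w a)).
  { unfold Rminus. eapply Rle_trans; [apply Rabs_triang|]. rewrite Rabs_Ropp. lra. }
  pose proof (Rabs_pos (w (a + m)%nat)).
  assert (B * Rabs (w (a + m)%nat - w a) <= B * (Rabs (w (a + m)%nat) + Rabs (w a)))
    by (apply Rmult_le_compat_l; lra).
  assert (Rabs (w (a + m)%nat) * Cmod (sumr f a m) <= Rabs (w (a + m)%nat) * B)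
    by (apply Rmult_le_compat_l; lra).
  lra.
Qed.

(** * Bounds for zeta in the strip [-1/8 <= Re s <= 9/8] *)

Fixpoint Rsum (a : nat -> R) (n : nat) : R :=
  match n with O => 0 | S k => Rsum a k + a k end.

Lemma Rsum_le a b n : (forall k, (k < n)%nat -> a k <= b k) -> Rsum a n <= Rsum b n.
Proof.
  induction n as [|n IH]; intros H; simpl; [lra|].
  pose proof (H n ltac:(lia)). assert (Rsum a n <= Rsum b n) by (apply IH; intros; apply H; lia). lra.
Qed.

Lemma Rsum_ext a b n : (forall k, (k < n)%nat -> a k = b k) -> Rsum a n = Rsum b n.
Proof. intros H. apply Rle_antisym; apply Rsum_le; intros k Hk; rewrite (H k Hk); lra. Qed.

Lemma Rsum_scal c a n : Rsum (fun k => c * a k) n = c * Rsum a n.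
Proof. induction n as [|n IH]; simpl; [ring|]. rewrite IH. ring. Qed.

Lemma Rsum_plus a b n : Rsum (fun k => a k + b k) n = Rsum a n + Rsum b n.
Proof. induction n as [|n IH]; simpl; [ring|]. rewrite IH. ring. Qed.

Lemma Rsum_nonneg a n : (forall k, (k < n)%nat -> 0 <= a k) -> 0 <= Rsum a n.
Proof.
  induction n as [|n IH]; intros H; simpl; [lra|].
  pose proof (H n ltac:(lia)). assert (0 <= Rsum a n) by (apply IH; intros; apply H; lia). lra.
Qed.

Lemma Cmod_Csum a n : Cmod (Csum a n) <= Rsum (fun k => Cmod (a k)) n.
Proof.
  induction n as [|n IH]; simpl; [rewrite Cmod_0; lra|].
  eapply Rle_trans; [apply Cmod_triangle|]. lra.
Qed.

Lemma exp_neg_upper y : 0 <= y <= 1 -> exp (- y) <= 1 - y / 2.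
Proof.
  intros Hy. rewrite exp_Ropp. pose proof (exp_ineq1_le y).
  apply Rle_trans with (/ (1 + y)); [apply Rinv_le_contravar; lra|].
  apply (Rmult_le_reg_r (1 + y)); [lra|]. rewrite Rinv_l by lra. nra.
Qed.

Lemma ln_INR_S_lower n : (0 < n)%nat -> / INR (S n) <= ln (INR (S n)) - ln (INR n).
Proof.
  intros Hn. assert (0 < INR n) by (apply lt_0_INR; lia). rewrite S_INR.
  rewrite <- (Ropp_involutive (ln (INR n + 1) - _)), Ropp_minus_distr, <- ln_div by lra.
  pose proof (ln_le_sub1 (INR n / (INR n + 1)) ltac:(apply Rdiv_lt_0_compat; lra)).
  replace (INR n / (INR n + 1) - 1) with (- / (INR n + 1)) in H0 by (field; lra). lra.
Qed.

Lemma ln_INR_S_upper n : (0 < n)%nat -> ln (INR (S n)) - ln (INR n) <= / INR n.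
Proof.
  intros Hn. assert (0 < INR n) by (apply lt_0_INR; lia). rewrite S_INR, <- ln_div by lra.
  eapply Rle_trans; [apply ln_le_sub1, Rdiv_lt_0_compat; lra|]. right. field. lra.
Qed.

Lemma Rpower_ln x a : Rpower x a = exp (a * ln x). Proof. reflexivity. Qed.

Lemma pow_step p n : 0 < p <= 1 -> (0 < n)%nat ->
  p / 2 * Rpower (INR (S n)) (p - 1) <= Rpower (INR (S n)) p - Rpower (INR n) p.
Proof.
  intros Hp Hn. set (N := INR (S n)). assert (N1 : 1 <= N) by (unfold N; rewrite S_INR; pose proof (pos_INR n); lra).
  assert (E : Rpower N (p - 1) = Rpower N p / N).
  { unfold Rminus. rewrite Rpower_plus, Rpower_Ropp, Rpower_1 by lra. reflexivity. }
  rewrite E. assert (L : Rpower (INR n) p <= Rpower N p * (1 - p / N / 2)).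
  { unfold Rpower at 1. pose proof (ln_INR_S_lower n Hn) as H. fold N in H.
    apply Rle_trans with (exp (p * ln N + - (p / N))).
    - apply exp_le. unfold Rdiv. nra.
    - rewrite exp_plus. fold (Rpower N p). apply Rmult_le_compat_l; [left; apply Rpower_pos|].
      apply exp_neg_upper. split; [apply Rdiv_le_0_compat; lra | apply div_le_mul; lra]. }
  replace (p / 2 * (Rpower N p / N)) with (Rpower N p * (p / N / 2)) by (field; lra). lra.
Qed.

Lemma Rpower_base1 a : Rpower 1 a = 1.
Proof. unfold Rpower. rewrite ln_1, Rmult_0_r. apply exp_0. Qed.

Lemma sum_pow_le p n : 0 < p <= 1 -> (0 < n)%nat ->
  Rsum (fun k => Rpower (INR (S k)) (p - 1)) n <= 2 / p * Rpower (INR n) p.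
Proof.
  intros Hp Hn. induction n as [|n IH]; [lia|]. destruct n as [|n].
  - simpl. rewrite !Rpower_base1. assert (2 <= 2 / p) by (apply le_div_mul; lra). lra.
  - specialize (IH ltac:(lia)). cbn [Rsum] in *. pose proof (pow_step p (S n) Hp ltac:(lia)) as P.
    assert (Q : Rpower (INR (S (S n))) (p - 1) <= 2 / p * (Rpower (INR (S (S n))) p - Rpower (INR (S n)) p)).
    { apply (Rmult_le_reg_l (p / 2)); [lra|].
      eapply Rle_trans; [exact P|]. right. field. lra. }
    lra.
Qed.

Lemma nat_ceil x : 0 < x -> exists n, (0 < n)%nat /\ x <= INR n < x + 1.
Proof.
  intros Hx. destruct (archimed (x - 1)) as [A B]. 
  destruct (Req_dec (IZR (up (x - 1))) x) as [E|E].
  - exists (Z.to_nat (up (x - 1))).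
    assert (Z0 : (0 < up (x - 1))%Z) by (apply lt_IZR; lra).
    rewrite INR_IZR_INZ, Z2Nat.id by lia. split; [lia | lra].
  - destruct (Rle_lt_dec x (IZR (up (x - 1)))) as [L|L].
    + exists (Z.to_nat (up (x - 1))).
      assert (Z0 : (0 < up (x - 1))%Z) by (apply lt_IZR; lra).
      rewrite INR_IZR_INZ, Z2Nat.id by lia. split; [lia | lra].
    + exists (Z.to_nat (up (x - 1) + 1)).
      assert (Z0 : (-1 < up (x - 1))%Z) by (apply lt_IZR; lra).
      rewrite INR_IZR_INZ, Z2Nat.id, plus_IZR by lia. split; [lia | lra].
Qed.

(** Once [A >= t], all phase differences lie between [t / (2 A)] and 1, inside a single period, so
    [Kusmin_Landau] applies directly and is stronger than the second derivative test. *)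
Lemma zeta_block_far t a m : 4 <= t -> t <= INR a -> (m <= a)%nat ->
  Cmod (sumr (fun n => cis (- (t * ln (INR n)))) a m) <= 36 * INR a / t.
Proof.
  intros Ht Ha Hm.
  rewrite <- Cmod_conj, Cconj_sumr.
  rewrite (sumr_ext _ (fun n => cis (t * ln (INR n)))).
  2:{ intros n _. rewrite !cis_val, cos_neg, sin_neg. apply Ceq; simpl; ring. }
  set (A := INR a) in *. set (d := t / (2 * A)).
  assert (a0 : (0 < a)%nat) by (apply INR_lt; simpl; fold A; lra).
  assert (d0 : 0 < d) by (apply Rdiv_lt_0_compat; lra).
  assert (d1 : d <= 1 / 2) by (apply div_le_mul; lra).
  pose proof PI2_3_2.
  eapply Rle_trans; [apply (Kusmin_Landau _ a m d)|].
  - lra.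
  - intros n Hn. assert (N1 : A <= INR n) by (apply le_INR; lia).
    assert (N2 : INR (S n) <= 2 * A).
    { unfold A. replace (2 * INR a) with (INR (2 * a)) by (rewrite mult_INR; simpl; lra). apply le_INR. lia. }
    assert (N3 : 0 < INR (S n)) by (apply lt_0_INR; lia).
    pose proof (ln_INR_S_lower n ltac:(lia)). pose proof (ln_INR_S_upper n ltac:(lia)).
    assert (/ (2 * A) <= / INR (S n)) by (apply Rinv_le_contravar; lra).
    assert (/ INR n <= / A) by (apply Rinv_le_contravar; lra).
    rewrite <- Rmult_minus_distr_l. split.
    + unfold d, Rdiv. apply Rmult_le_compat_l; lra.
    + apply Rle_trans with (t * / A); [apply Rmult_le_compat_l; lra|].
      assert (t / A <= 1) by (apply div_le_mul; lra). unfold Rdiv in *. lra.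
  - intros n H1 H2. assert (N : A <= INR n) by (apply le_INR; lia). rewrite !S_INR. set (x := INR n) in *.
    assert (E : t * ln (x + 1) - t * ln x - (t * ln (x + 1 + 1) - t * ln (x + 1)) =
       - (t * ln (x * (x + 2) / ((x + 1) * (x + 1))))).
    { rewrite ln_div, !ln_mult by nra. replace (x + 1 + 1) with (x + 2) by ring. ring. }
    assert (L : ln (x * (x + 2) / ((x + 1) * (x + 1))) <= 0).
    { eapply Rle_trans; [apply ln_le_sub1, Rdiv_lt_0_compat; nra|].
      replace (x * (x + 2) / ((x + 1) * (x + 1)) - 1) with (- / ((x + 1) * (x + 1))) by (field; lra).
      assert (0 < / ((x + 1) * (x + 1))) by (apply Rinv_0_lt_compat; nra). lra. }
    nra.
  - pose proof (sin_lower (d / 2) ltac:(lra)) as S.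
    replace (36 * A / t) with (3 * / (d / 2 / 3)) by (unfold d; field; lra). unfold Rdiv at 1.
    apply Rmult_le_compat_l; [lra|]. apply Rinv_le_contravar; lra.
Qed.

(** A piecewise linear exponent, chosen such that [ez (1-x) + 2 ez x = 3/4] for [1/2 <= x <= 9/8], and far enough
    above the truth elsewhere for all dyadic sums to be geometric. *)
Definition ez (al : R) : R := Rmax (5 / 8 - 3 * al / 4) (7 / 16 - 3 * al / 8).

Section ZetaBound.
Variables (al t : R).
Hypothesis (Hal : - (1 / 8) <= al <= 9 / 8) (Ht : 4 <= t).

Let e := ez al.
Let L := ln t.

Lemma ez_facts : 5 / 8 - 3 * al / 4 <= e /\ 7 / 16 - 3 * al / 8 <= e /\ 1 / 64 <= e /\ 0 <= L.
Proof.
  repeat split; [apply Rmax_l | apply Rmax_r | |].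
  - eapply Rle_trans; [|apply Rmax_r]. lra.
  - unfold L. rewrite <- ln_1. apply ln_le; lra.
Qed.

Let f := fun n : nat => (RtoC (Rpower (INR n) (- al)) * cis (- (t * ln (INR n))))%C.

(** The term [(ln A - L/2) / 32] is the surplus of [ez] over the true exponent of the block; it
    makes dyadic blocks summable without a logarithm. *)
Lemma zeta_weighted_block a m : (0 < a)%nat -> (m <= a)%nat -> sqrt t <= INR a -> ln (INR a) <= 3 / 2 * L ->
  Cmod (sumr f a m) <= 385 * exp (e * L - (ln (INR a) - L / 2) / 32).
Proof.
  intros Ha Hm Hs HN. destruct ez_facts as (E1 & E2 & E3 & L0).
  destruct (sqrt_facts t Ht) as [Q2 Q].
  set (A := INR a) in *. assert (A1 : 1 <= A) by (unfold A; change 1 with (INR 1); apply le_INR; lia).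
  set (x := ln A) in *.
  assert (xL : L / 2 <= x).
  { unfold L, x. replace (ln t / 2) with (ln (sqrt t)).
    - apply ln_le; lra.
    - rewrite <- Q at 2. rewrite ln_mult by lra. field. }
  assert (W : forall G, 0 <= G -> (forall k, (k <= m)%nat ->
     Cmod (sumr (fun n => cis (- (t * ln (INR n)))) a k) <= G) ->
     Cmod (sumr f a m) <= 5 * (G * exp (- al * x))).
  { intros G HG H. eapply Rle_trans; [apply (sumr_monotone_weight (fun n => Rpower (INR n) (- al)) _ a m G)|].
    - destruct (Rle_dec 0 al) as [P|P]; [left | right]; intros n.
      (* Monotonicity is also demanded at [n = 0], where the convention [ln 0 = 0] gives the weight
         1, the same as at [n = 1]. *)
      + destruct n as [|n].
        * simpl. rewrite Rpower_base1. unfold Rpower. 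
          replace (ln 0) with 0; [rewrite Rmult_0_r, exp_0; apply Rle_refl|].
          unfold ln. now destruct (Rlt_dec 0 0) as [F|F]; [destruct (Rlt_irrefl 0 F)|].
        * unfold Rpower. apply exp_le. assert (ln (INR (S n)) <= ln (INR (S (S n)))).
          { apply ln_le; [apply lt_0_INR; lia | apply le_INR; lia]. } nra.
      + destruct n as [|n].
        * simpl. rewrite Rpower_base1. unfold Rpower. 
          replace (ln 0) with 0; [rewrite Rmult_0_r, exp_0; apply Rle_refl|].
          unfold ln. now destruct (Rlt_dec 0 0) as [F|F]; [destruct (Rlt_irrefl 0 F)|].
        * unfold Rpower. apply exp_le. assert (ln (INR (S n)) <= ln (INR (S (S n)))).
          { apply ln_le; [apply lt_0_INR; lia | apply le_INR; lia]. } nra.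
    - exact H.
    - rewrite !Rabs_pos_eq by (left; apply Rpower_pos).
      assert (B1 : Rpower (INR a) (- al) = exp (- al * x)) by reflexivity. rewrite B1.
      assert (B2 : Rpower (INR (a + m)) (- al) <= 2 * exp (- al * x)).
      { rewrite Rpower_ln. assert (M1 : A <= INR (a + m)) by (apply le_INR; lia).
        assert (M2 : INR (a + m) <= 2 * A).
        { unfold A. replace (2 * INR a) with (INR (2 * a)) by (rewrite mult_INR; simpl; lra). apply le_INR. lia. }
        assert (l1 : x <= ln (INR (a + m))) by (apply ln_le; lra).
        assert (l2 : ln (INR (a + m)) <= ln 2 + x).
        { unfold x. rewrite <- ln_mult by lra. apply ln_le; lra. }
        assert (l3 : 0 < ln 2) by (rewrite <- ln_1; apply ln_increasing; lra).
        rewrite <- (exp_ln 2) at 1 by lra. rewrite <- exp_plus. apply exp_le.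
        destruct (Rle_dec 0 al); nra. }
      pose proof (exp_pos (- al * x)). nra. }
  destruct (Rle_dec A t) as [C|C].
  - assert (xl : x <= L) by (apply ln_le; lra).
    eapply Rle_trans; [apply (W (77 * sqrt t))|].
    + lra.
    + intros k Hk. eapply Rle_trans; [apply zeta_block; auto; lia|]. fold A.
      assert (A / sqrt t <= sqrt t) by (apply div_le_mul; lra). unfold Rdiv in *. lra.
    + replace (5 * (77 * sqrt t * exp (- al * x))) with (385 * (sqrt t * exp (- al * x))) by ring.
      apply Rmult_le_compat_l; [lra|].
      rewrite <- (exp_ln (sqrt t)) by lra. rewrite <- exp_plus. apply exp_le.
      replace (ln (sqrt t)) with (L / 2).
      * clear - E1 E2 E3 L0 xl xL Hal. nra.
      * unfold L. rewrite <- Q at 1. rewrite ln_mult by lra. field.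
  - assert (xl : L <= x) by (apply ln_le; lra).
    eapply Rle_trans; [apply (W (36 * A / t))|].
    + apply Rdiv_le_0_compat; lra.
    + intros k Hk. apply zeta_block_far; auto; [fold A; lra | lia].
    + replace (5 * (36 * A / t * exp (- al * x))) with (180 * (A / t * exp (- al * x))) by (field; lra).
      apply Rle_trans with (180 * exp (e * L - (x - L / 2) / 32)).
      2:{ apply Rmult_le_compat_r; [left; apply exp_pos | lra]. }
      apply Rmult_le_compat_l; [lra|].
      rewrite <- (exp_ln (A / t)) by (apply Rdiv_lt_0_compat; lra). rewrite <- exp_plus. apply exp_le.
      rewrite ln_div by lra. fold x L.
      clear - E1 E2 E3 L0 xl xL HN Hal. nra.
Qed.

(** [65 = 1 / (1 - 64/65)]: successive dyadic blocks decrease by a factor [2^(-1/32) <= 64/65]. *)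
Lemma zeta_dyadic m : forall a, (0 < a)%nat -> sqrt t <= INR a ->
  ln (INR (a + m)) <= 3 / 2 * L ->
  Cmod (sumr f a m) <= 65 * 385 * exp (e * L - (ln (INR a) - L / 2) / 32).
Proof.
  induction m as [m IH] using (well_founded_induction Wf_nat.lt_wf). intros a Ha Hs HN.
  assert (a0 : 0 < INR a) by (apply lt_0_INR; lia).
  assert (LN : ln (INR a) <= 3 / 2 * L).
  { eapply Rle_trans; [apply ln_le; [lra | apply le_INR]|exact HN]. lia. }
  set (g := exp (e * L - (ln (INR a) - L / 2) / 32)). assert (g0 : 0 < g) by apply exp_pos.
  destruct (Nat.le_ge_cases m a) as [C|C].
  - eapply Rle_trans; [apply zeta_weighted_block; auto|]. fold g. lra.
  - replace m with (a + (m - a))%nat by lia. rewrite sumr_split.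
    eapply Rle_trans; [apply Cmod_triangle|].
    pose proof (zeta_weighted_block a a Ha (Nat.le_refl _) Hs LN) as B1. fold g in B1.
    assert (A2 : INR (a + a) = 2 * INR a) by (rewrite plus_INR; ring).
    pose proof (IH (m - a)%nat ltac:(lia) (a + a)%nat ltac:(lia)) as B2.
    rewrite A2 in B2. specialize (B2 ltac:(lra)).
    replace (a + a + (m - a))%nat with (a + m)%nat in B2 by lia. specialize (B2 HN).
    rewrite ln_mult in B2 by lra.
    assert (G : exp (e * L - (ln 2 + ln (INR a) - L / 2) / 32) <= 64 / 65 * g).
    { replace (e * L - (ln 2 + ln (INR a) - L / 2) / 32) with
        (- (ln 2 / 32) + (e * L - (ln (INR a) - L / 2) / 32)) by field.
      rewrite exp_plus. fold g. apply Rmult_le_compat_r; [lra|]. rewrite exp_Ropp.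
      pose proof ln_lt_2. pose proof (exp_ineq1_le (ln 2 / 32)).
      replace (64 / 65) with (/ (65 / 64)) by field. apply Rinv_le_contravar; lra. }
    lra.
Qed.

Lemma zeta_initial n : (0 < n)%nat -> INR n <= sqrt t ->
  Cmod (sumr f 1 n) <= 64 * exp (e * L).
Proof.
  intros Hn Hs. destruct ez_facts as (E1 & E2 & E3 & L0). destruct (sqrt_facts t Ht) as [Q2 Q].
  assert (sL : ln (sqrt t) = L / 2) by (unfold L; rewrite <- Q at 2; rewrite ln_mult by lra; field).
  unfold sumr. eapply Rle_trans; [apply Cmod_Csum|].
  (* The sum of [n^(1/32 - 1)] up to [sqrt t] is [O(t^(1/64))], which restores the [t^(-1/64)] split
     off here; comparing with this power avoids a logarithm. *)
  apply Rle_trans with (exp ((e - 1 / 64) * L) * Rsum (fun k => Rpower (INR (S k)) (1 / 32 - 1)) n).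
  - rewrite <- Rsum_scal. apply Rsum_le. intros k Hk. unfold f.
    replace (1 + k)%nat with (S k) by lia.
    rewrite Cmod_mult, Cmod_cis, Rmult_1_r, Cmod_RtoC_pos by (left; apply Rpower_pos).
    rewrite !Rpower_ln, <- exp_plus. apply exp_le.
    assert (k1 : 1 <= INR (S k)) by (change 1 with (INR 1); apply le_INR; lia).
    assert (x0 : 0 <= ln (INR (S k))) by (rewrite <- ln_1; apply ln_le; lra).
    assert (x1 : ln (INR (S k)) <= L / 2).
    { rewrite <- sL. apply ln_le; [lra|]. apply Rle_trans with (INR n); auto. apply le_INR; lia. }
    set (x := ln (INR (S k))) in *. clear - E1 E2 E3 L0 x0 x1 Hal. nra.
  - eapply Rle_trans; [apply Rmult_le_compat_l; [left; apply exp_pos | apply sum_pow_le; auto; lra]|].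
    replace (2 / (1 / 32)) with 64 by field.
    replace (e * L) with ((e - 1 / 64) * L + 1 / 32 * (L / 2)) by field. rewrite exp_plus.
    assert (Rpower (INR n) (1 / 32) <= exp (1 / 32 * (L / 2))).
    { unfold Rpower. apply exp_le. apply Rmult_le_compat_l; [lra|]. rewrite <- sL. apply ln_le; auto.
      apply lt_0_INR; lia. }
    pose proof (exp_pos ((e - 1 / 64) * L)). nra.
Qed.

Lemma Rpower_C_Cpt_neg n : (0 < n)%nat -> Rpower_C (INR n) (- Cpt al t)%C = f n.
Proof.
  intros Hn. unfold f, cis, Rpower. rewrite <- Cexp_RtoC, <- Cexp_plus. unfold Rpower_C. f_equal.
  apply Ceq; simpl; ring.
Qed.

(** Euler-Maclaurin with about [t^(3/2)] terms: the two remainder terms are then both [O(t^(1/2 - 3 al / 2))]. *)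
Lemma zeta_bound : Cmod (Zx (Cpt al t)) <= 26000 * Rpower t (ez al).
Proof.
  destruct ez_facts as (E1 & E2 & E3 & L0). destruct (sqrt_facts t Ht) as [Q2 Q].
  assert (sL : ln (sqrt t) = L / 2) by (unfold L; rewrite <- Q at 2; rewrite ln_mult by lra; field).
  set (P := Rpower t (ez al)). assert (PE : P = exp (e * L)) by reflexivity.
  assert (P0 : 0 < P) by apply Rpower_pos.
  assert (Y : 8 <= exp (3 / 2 * L)).
  { replace (3 / 2 * L) with (L + ln (sqrt t)) by (rewrite sL; field).
    rewrite exp_plus. unfold L. rewrite !exp_ln by lra. nra. }
  (* Halving leaves room for [N + 1 <= t^(3/2)], which [zeta_dyadic] needs for the index just past
     the last term. *)
  destruct (nat_ceil (exp (3 / 2 * L) / 2)) as (N & HN0 & HN1 & HN2); [lra|].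
  destruct (nat_ceil (sqrt t)) as (a & Ha0 & Ha1 & Ha2); [lra|].
  assert (aN : (a <= N)%nat).
  { apply INR_le. apply Rle_trans with (exp (3 / 2 * L) / 2); auto. 
    replace (3 / 2 * L) with (L + ln (sqrt t)) by (rewrite sL; field).
    rewrite exp_plus. unfold L. rewrite !exp_ln by lra. nra. }
  assert (l3 : 1 / 2 < ln 2 < 1).
  { split; [pose proof ln_lt_2; lra|]. pose proof (ln_le_sub1 (sqrt 2) ltac:(apply sqrt_lt_R0; lra)).
    assert (sqrt 2 < 3 / 2). { rewrite <- (sqrt_Rsqr (3 / 2)) by lra. apply sqrt_lt_1_alt. unfold Rsqr; lra. }
    rewrite <- (sqrt_sqrt 2) by lra. rewrite ln_mult by (apply sqrt_lt_R0; lra). lra. }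
  set (x := ln (INR N)).
  assert (x1 : 3 / 2 * L - ln 2 <= x).
  { unfold x. rewrite <- (ln_exp (3 / 2 * L)), <- ln_div by lra. apply ln_le; lra. }
  assert (x2 : x <= 3 / 2 * L). { unfold x. rewrite <- (ln_exp (3 / 2 * L)). apply ln_le; lra. }
  assert (s1 : Cpt al t <> RtoC 1). { intros E. apply (f_equal snd) in E. simpl in E. lra. }
  rewrite (Zx_zsum (Cpt al t) N HN0 s1).
  assert (S1 : Cmod (zsum (Cpt al t) N) <= 25100 * P).
  { assert (Ez : zsum (Cpt al t) N = sumr f 1 N).
    { unfold zsum, sumr. apply Csum_ext. intros k _. rewrite Rpower_C_Cpt_neg by lia. reflexivity. }
    rewrite Ez. replace N with ((a - 1) + (N + 1 - a))%nat by lia. rewrite sumr_split.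
    eapply Rle_trans; [apply Cmod_triangle|].
    replace (1 + (a - 1))%nat with a by lia.
    assert (I : Cmod (sumr f 1 (a - 1)) <= 64 * P).
    { rewrite PE. destruct (Nat.eq_dec a 1) as [E|E].
      - subst a. unfold sumr; simpl. rewrite Cmod_0. pose proof (exp_pos (e * L)); lra.
      - apply zeta_initial; [lia|]. rewrite minus_INR by lia. simpl. lra. }
    assert (J : Cmod (sumr f a (N + 1 - a)) <= 65 * 385 * P).
    { eapply Rle_trans; [apply zeta_dyadic; auto|].
      - replace (a + (N + 1 - a))%nat with (S N) by lia. rewrite S_INR.
        rewrite <- (ln_exp (3 / 2 * L)). apply ln_le; lra.
      - rewrite PE. apply Rmult_le_compat_l; [lra|]. apply exp_le.
        assert (L / 2 <= ln (INR a)) by (rewrite <- sL; apply ln_le; lra). lra. }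
    lra. }
  assert (S2 : Cmod (Rpower_C (INR N) (1 - Cpt al t) / (Cpt al t - 1))%C <= 2 * P).
  { unfold Cdiv. rewrite Cmod_mult, Cmod_inv.
    2:{ intros E. apply (f_equal snd) in E. simpl in E. lra. }
    assert (M : t <= Cmod (Cpt al t - 1)%C).
    { eapply Rle_trans; [|apply Rmax_Cmod]. eapply Rle_trans; [|apply Rmax_r]. simpl. 
      eapply Rle_trans; [|apply Rle_abs]. lra. }
    rewrite Cmod_Rpower_C, Rpower_ln. fold x. simpl.
    apply Rle_trans with (exp ((1 + - al) * x) * / t).
    { apply Rmult_le_compat_l; [left; apply exp_pos|]. apply Rinv_le_contravar; lra. }
    rewrite <- (exp_ln (/ t)) by (apply Rinv_0_lt_compat; lra). rewrite ln_Rinv by lra. fold L.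
    rewrite PE. rewrite <- (exp_ln 2) at 1 by lra. rewrite <- !exp_plus. apply exp_le.
    clear - E1 E2 E3 L0 Hal x1 x2 l3. nra. }
  assert (S3 : Cmod (RtoC (1 / 2) * Rpower_C (INR N) (- Cpt al t))%C <= 2 * P).
  { rewrite Cmod_mult, Cmod_RtoC_pos, Cmod_Rpower_C, Rpower_ln by lra. fold x. simpl.
    rewrite PE. assert (exp (- al * x) <= exp (ln 2 * 2 + e * L)).
    { apply exp_le. clear - E1 E2 E3 L0 Hal x1 x2 l3. nra. }
    rewrite exp_plus in H. replace (exp (ln 2 * 2)) with 4 in H.
    - pose proof (exp_pos (e * L)). lra.
    - replace (ln 2 * 2) with (ln 2 + ln 2) by ring. rewrite exp_plus, exp_ln by lra. ring. }
  assert (S4 : Cmod (Cpt al t * (Cpt al t + 1) *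
     (Lap gb (Cpt al t + 1) - CI (lint gb (Cpt al t + 1)) 0 (ln (INR N))))%C <= 100 * P).
  { rewrite !Cmod_mult.
    assert (M1 : Cmod (Cpt al t) <= 2 * t).
    { eapply Rle_trans; [apply Cmod_le_ReIm|]. simpl. rewrite (Rabs_pos_eq t) by lra.
      assert (Rabs al <= 2) by (apply Rabs_le; lra). lra. }
    assert (M2 : Cmod (Cpt al t + 1)%C <= 2 * t).
    { eapply Rle_trans; [apply Cmod_le_ReIm|]. simpl. rewrite Rplus_0_r, (Rabs_pos_eq t) by lra.
      assert (Rabs (al + 1) <= 3) by (apply Rabs_le; lra). lra. }
    pose proof (Zx_tail (Cpt al t) N HN0 ltac:(simpl; lra)) as M3. simpl Re in M3.
    rewrite Rpower_ln in M3. fold x in M3. 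
    assert (M4 : 1 / 8 / (al + 1) <= 1) by (apply div_le_mul; lra).
    assert (M5 : 0 < 1 / 8 / (al + 1)) by (apply Rdiv_lt_0_compat; lra).
    assert (M6 : exp (- (al + 1) * x) * (t * t) <= 8 * P).
    { rewrite PE. rewrite <- (exp_ln t) by lra. fold L. replace 8 with (exp (3 * ln 2)).
      - rewrite <- !exp_plus. apply exp_le. clear - E1 E2 E3 L0 Hal x1 x2 l3. nra.
      - replace (3 * ln 2) with (ln 2 + (ln 2 + ln 2)) by ring. rewrite !exp_plus, exp_ln by lra. ring. }
    set (z := Cmod (Lap gb (Cpt al t + 1) - CI (lint gb (Cpt al t + 1)) 0 (ln (INR N)))%C) in *.
    pose proof (exp_pos (- (al + 1) * x)) as ep. set (E := exp (- (al + 1) * x)) in *.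
    assert (M7 : z <= E).
    { eapply Rle_trans; [exact M3|]. rewrite <- (Rmult_1_l E) at 2. apply Rmult_le_compat_r; lra. }
    pose proof (Cmod_ge_0 (Cpt al t)). pose proof (Cmod_ge_0 (Cpt al t + 1)%C).
    assert (z0 : 0 <= z) by apply Cmod_ge_0.
    apply Rle_trans with (2 * t * (2 * t) * E).
    - apply Rmult_le_compat; auto; [nra|]. apply Rmult_le_compat; lra.
    - nra. }
  eapply Rle_trans; [apply Cmod_minus_le|]. 
  eapply Rle_trans; [apply Rplus_le_compat_r; eapply Rle_trans; [apply Cmod_minus_le|apply Rplus_le_compat_r, Cmod_triangle]|].
  lra.
Qed.
End ZetaBound.

(** * Finite Dirichlet polynomials on the line [Re s = 9/8] *)

(** Weights attached to integers, repetitions allowed: a product of Dirichlet polynomials is then a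
    list of pairs, and equal products never have to be collected. *)
Definition wlist := list (R * nat).

Fixpoint lsum (F : nat -> R) (l : wlist) : R :=
  match l with nil => 0 | (w, n) :: r => w * F n + lsum F r end.

Fixpoint Dir (l : wlist) (s : C) : C :=
  match l with nil => RtoC 0 | (w, n) :: r => (RtoC w * Rpower_C (INR n) (- s) + Dir r s)%C end.

Definition lpos (l : wlist) : Prop := forall w n, In (w, n) l -> 0 <= w /\ (0 < n)%nat.

Definition ind_le (x : R) (n : nat) : R := if Rle_dec (INR n) x then 1 else 0.
Definition Sl (l : wlist) (x : R) : R := lsum (ind_le x) l.

Lemma lpos_cons w n l : lpos ((w, n) :: l) -> (0 <= w /\ (0 < n)%nat) /\ lpos l.
Proof. intros H. split; [apply H; left; auto|]. intros v k Hk. apply H. right; auto. Qed.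

Lemma lsum_le F G l : lpos l -> (forall n, (0 < n)%nat -> F n <= G n) -> lsum F l <= lsum G l.
Proof.
  intros Hl H. induction l as [|[w n] l IH]; simpl; [lra|].
  destruct (lpos_cons _ _ _ Hl) as [[W N] L]. specialize (IH L). specialize (H n N). nra.
Qed.

Lemma lsum_ext F G l : lpos l -> (forall n, (0 < n)%nat -> F n = G n) -> lsum F l = lsum G l.
Proof. intros Hl H. apply Rle_antisym; apply lsum_le; auto; intros n Hn; rewrite (H n Hn); lra. Qed.

Lemma lsum_plus F G l : lsum (fun n => F n + G n) l = lsum F l + lsum G l.
Proof. induction l as [|[w n] l IH]; simpl; [ring|]. rewrite IH. ring. Qed.

Lemma lsum_scal c F l : lsum (fun n => c * F n) l = c * lsum F l.
Proof. induction l as [|[w n] l IH]; simpl; [ring|]. rewrite IH. ring. Qed.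

Lemma lsum_nonneg F l : lpos l -> (forall n, (0 < n)%nat -> 0 <= F n) -> 0 <= lsum F l.
Proof.
  intros Hl H. induction l as [|[w n] l IH]; simpl; [lra|].
  destruct (lpos_cons _ _ _ Hl) as [[W N] L]. specialize (IH L). specialize (H n N). nra.
Qed.

Lemma Sl_diff l a b : a <= b ->
  lsum (fun n => ind_le b n - ind_le a n) l = Sl l b - Sl l a.
Proof.
  intros Hab. unfold Sl. induction l as [|[w n] l IH]; simpl; [ring|]. rewrite IH. ring.
Qed.

Lemma Sl_mono l a b : lpos l -> a <= b -> Sl l a <= Sl l b.
Proof.
  intros Hl Hab. apply lsum_le; auto. intros n _. unfold ind_le.
  destruct (Rle_dec (INR n) a), (Rle_dec (INR n) b); lra.
Qed.

Lemma Sl_nonneg l a : lpos l -> 0 <= Sl l a.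
Proof. intros Hl. apply lsum_nonneg; auto. intros n _. unfold ind_le. destruct (Rle_dec (INR n) a); lra. Qed.

(** The integrand on the line [c0] after the functional equation, with a Dirichlet polynomial in
    place of the zeta factors. *)
Definition EE (l : wlist) (s : C) : C :=
  ((Em 1 s + Em (-1) s) * (Rpower_C (2 * PI) (- s) * Dir l s))%C.

Lemma ccont_Rpower_C_line x sg t : 0 < x -> ccont (fun v => Rpower_C x (- Cpt sg v)) t.
Proof.
  intros Hx. unfold Rpower_C. apply ccont_Cexp, ccont_mult; [|apply ccont_const].
  apply ccont_opp, ccont_Cpt_im.
Qed.

Lemma ccont_Dir l sg t : lpos l -> ccont (fun v => Dir l (Cpt sg v)) t.
Proof.
  intros Hl. induction l as [|[w n] l IH]; simpl; [apply ccont_const|].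
  destruct (lpos_cons _ _ _ Hl) as [[W N] L]. apply ccont_plus; auto.
  apply ccont_mult; [apply ccont_const|]. apply ccont_Rpower_C_line, lt_0_INR. lia.
Qed.

Lemma ccont_EE l t : lpos l -> ccont (fun v => EE l (Cpt c0 v)) t.
Proof.
  intros Hl. pose proof PI_RGT_0. apply ccont_mult; [|apply ccont_mult].
  - apply ccont_plus; apply Em_ccont_im; unfold c0; lra.
  - apply ccont_Rpower_C_line. lra.
  - now apply ccont_Dir.
Qed.

Lemma exCI_EE l T : lpos l -> 4 <= T -> exCI (fun v => EE l (Cpt c0 v)) 4 T.
Proof. intros. apply exCI_cont; auto. intros; now apply ccont_EE. Qed.

Lemma cis_2PI_INR n : cis (2 * PI * INR n) = RtoC 1.
Proof.
  rewrite <- (cis_period_nat _ n). replace (2 * PI * INR n - 2 * INR n * PI) with 0 by ring.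
  rewrite cis_val, cos_0, sin_0. reflexivity.
Qed.

Lemma VE_exCI e n T : (0 < n)%nat -> 4 <= T ->
  exCI (fun t => Em e (Cpt c0 t) * Rpower_C (2 * PI * INR n) (- Cpt c0 t))%C 4 T.
Proof. intros. apply exCI_cont; auto. intros; apply Em_line_ccont. unfold c0; lra. Qed.

Lemma CI_EE_cons w n l T : lpos ((w, n) :: l) -> 4 <= T ->
  CI (fun v => EE ((w, n) :: l) (Cpt c0 v)) 4 T =
  (RtoC w * (VE 1 (2 * PI * INR n) T + VE (-1) (2 * PI * INR n) T) + CI (fun v => EE l (Cpt c0 v)) 4 T)%C.
Proof.
  intros Hl HT. destruct (lpos_cons _ _ _ Hl) as [[W N] L].
  assert (n0 : 0 < INR n) by (apply lt_0_INR; lia). pose proof PI_RGT_0.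
  pose proof (VE_exCI 1 n T N HT) as E1. pose proof (VE_exCI (-1) n T N HT) as E2.
  unfold VE. rewrite <- CI_plus by assumption.
  rewrite <- CI_scal by (apply exCI_plus; assumption).
  rewrite <- CI_plus.
  - apply CI_ext; auto. intros t _. unfold EE. cbn [Dir]. rewrite !(Rpower_C_mult (2 * PI)) by lra. ring.
  - apply exCI_scal, exCI_plus; assumption.
  - now apply exCI_EE.
Qed.

(** Because [cis (2 pi n) = 1], the estimates of [cis l * VE] become estimates of [VE] itself, and
    every term with [2 pi n <= T] contributes the same [Mmain T] times its weight. *)
Lemma CI_EE_main l T : lpos l -> 12 <= T ->
  Cmod (CI (fun v => EE l (Cpt c0 v)) 4 T - Mmain T * RtoC (Sl l (T / (2 * PI))))%C
   <= lsum (fun n => 30000 * Bq T (2 * PI * INR n) + 70000 * near T (2 * PI * INR n)) l.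
Proof.
  intros Hl HT. pose proof PI2_3_2 as P. induction l as [|[w n] l IH].
  - unfold EE, Sl. cbn [Dir lsum].
    rewrite (CI_ext _ (fun _ => RtoC 0 * RtoC 0)%C) by (try lra; intros; ring).
    rewrite CI_scal by (apply exCI_cont; [lra | intros; apply ccont_const]).
    replace (RtoC 0 * _ - _)%C with (RtoC 0) by ring. rewrite Cmod_0. lra.
  - destruct (lpos_cons _ _ _ Hl) as [[W N] L]. specialize (IH L).
    rewrite CI_EE_cons by (auto; lra). unfold Sl in *. cbn [lsum]. 
    assert (n1 : 1 <= INR n) by (change 1 with (INR 1); apply le_INR; lia).
    set (lam := 2 * PI * INR n). assert (l6 : 6 <= lam) by (unfold lam; nra).
    set (I := CI (fun v => EE l (Cpt c0 v)) 4 T) in *.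
    set (S := lsum (ind_le (T / (2 * PI))) l) in *.
    set (i := ind_le (T / (2 * PI)) n).
    replace (RtoC w * (VE 1 lam T + VE (-1) lam T) + I - Mmain T * RtoC (w * i + S))%C with
      (RtoC w * ((VE 1 lam T - Mmain T * RtoC i) + VE (-1) lam T) + (I - Mmain T * RtoC S))%C
      by (rewrite RtoC_plus, RtoC_mult; ring).
    eapply Rle_trans; [apply Cmod_triangle|]. apply Rplus_le_compat; [|exact IH].
    rewrite Cmod_mult, Cmod_RtoC_pos by lra. apply Rmult_le_compat_l; [lra|].
    eapply Rle_trans; [apply Cmod_triangle|].
    pose proof (VE_neg T lam ltac:(lra) l6) as V1.
    assert (V2 : Cmod (VE 1 lam T - Mmain T * RtoC i)%C <= 16500 * Bq T lam + 70000 * near T lam).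
    { unfold i, ind_le. destruct (Rle_dec (INR n) (T / (2 * PI))) as [C|C].
      - assert (lT : lam <= T).
        { unfold lam. apply (Rmult_le_compat_l (2 * PI)) in C; [|lra].
          replace (2 * PI * (T / (2 * PI))) with T in C by (field; lra). lra. }
        pose proof (VE_pos_below T lam HT ltac:(lra)) as V. unfold lam at 1 in V. rewrite cis_2PI_INR in V.
        replace (VE 1 lam T - Mmain T * RtoC 1)%C with (RtoC 1 * VE 1 lam T - Mmain T)%C by ring. exact V.
      - assert (lT : T <= lam).
        { apply Rnot_le_lt in C. unfold lam. apply Rlt_le, (Rmult_le_compat_l (2 * PI)) in C; [|lra].
          replace (2 * PI * (T / (2 * PI))) with T in C by (field; lra). lra. }
        pose proof (VE_pos_above T lam HT lT) as V.
        replace (VE 1 lam T - Mmain T * RtoC 0)%C with (VE 1 lam T) by ring.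
        pose proof (Bq_pos T lam). lra. }
    pose proof (Bq_pos T lam). lra.
Qed.

(** [near] is compared with three intervals around [X], of lengths [X^(5/8)], [X^(13/16)], [X]. *)
Lemma near_level X n : 1 <= X -> (0 < n)%nat ->
  near (2 * PI * X) (2 * PI * INR n) <=
   (ind_le (X + Rpower X (5 / 8)) n - ind_le (X - Rpower X (5 / 8)) n)
   + Rpower X (- (1 / 8)) * (ind_le (X + Rpower X (13 / 16)) n - ind_le (X - Rpower X (13 / 16)) n)
   + Rpower X (- (5 / 16)) * (ind_le (X + X) n - ind_le (X - X) n).
Proof.
  intros HX Hn. pose proof PI2_3_2 as P.
  assert (n0 : 0 < INR n) by (apply lt_0_INR; lia).
  assert (I : forall u, 0 <= u -> 0 <= ind_le (X + u) n - ind_le (X - u) n).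
  { intros u Hu. unfold ind_le. destruct (Rle_dec (INR n) (X + u)), (Rle_dec (INR n) (X - u)); lra. }
  pose proof (Rpower_pos X (5 / 8)) as u1. pose proof (Rpower_pos X (13 / 16)) as u2.
  pose proof (Rpower_pos X (- (1 / 8))) as v1. pose proof (Rpower_pos X (- (5 / 16))) as v2.
  pose proof (I (Rpower X (5 / 8)) ltac:(lra)) as I1. pose proof (I (Rpower X (13 / 16)) ltac:(lra)) as I2.
  pose proof (I X ltac:(lra)) as I3.
  unfold near. destruct (Rle_dec (2 * PI * INR n) (2 * (2 * PI * X))) as [C|C]; [|nra].
  assert (nX : INR n <= X + X) by nra.
  assert (i3 : ind_le (X + X) n - ind_le (X - X) n = 1).
  { unfold ind_le. destruct (Rle_dec (INR n) (X + X)), (Rle_dec (INR n) (X - X)); lra. }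
  set (r := sqrt (2 * PI * X)). set (d := Rabs (2 * PI * INR n - 2 * PI * X)).
  assert (r0 : 0 < r) by (apply sqrt_lt_R0; nra).
  assert (d0 : 0 <= d) by apply Rabs_pos.
  assert (rX : r <= 2 * PI * Rpower X (1 / 2)).
  { unfold r. replace (1 / 2) with (/ 2) by field. rewrite Rpower_sqrt by lra.
    apply Rsqr_incr_0; [| apply sqrt_pos | pose proof (sqrt_pos X); apply Rmult_le_pos; lra].
    rewrite Rsqr_sqrt by nra. rewrite Rsqr_mult, Rsqr_sqrt by lra. unfold Rsqr. apply Rmult_le_compat_r; nra. }
  assert (le1 : r / (r + d) <= 1) by (apply div_le_mul; lra).
  assert (key : forall p, ~ (ind_le (X + Rpower X p) n - ind_le (X - Rpower X p) n = 1) ->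
     r / (r + d) <= Rpower X (1 / 2 - p)).
  { intros p Hp. assert (D : 2 * PI * Rpower X p <= d).
    { unfold d. rewrite <- Rmult_minus_distr_l, Rabs_mult, (Rabs_pos_eq (2 * PI)) by lra.
      apply Rmult_le_compat_l; [lra|]. unfold ind_le in Hp. pose proof (Rpower_pos X p).
      destruct (Rle_dec (INR n) (X + Rpower X p)), (Rle_dec (INR n) (X - Rpower X p)).
      - rewrite Rabs_left1; lra.
      - exfalso; apply Hp; lra.
      - exfalso; lra.
      - rewrite Rabs_pos_eq; lra. }
    apply div_le_mul; [lra|]. pose proof (Rpower_pos X (1 / 2 - p)).
    assert (E : Rpower X (1 / 2 - p) * Rpower X p = Rpower X (1 / 2)).
    { rewrite <- Rpower_plus. f_equal. ring. }
    apply Rle_trans with (Rpower X (1 / 2 - p) * d); [|nra].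
    apply Rle_trans with (Rpower X (1 / 2 - p) * (2 * PI * Rpower X p)).
    - replace (Rpower X (1 / 2 - p) * (2 * PI * Rpower X p)) with (2 * PI * (Rpower X (1 / 2 - p) * Rpower X p)) by ring.
      rewrite E. exact rX.
    - apply Rmult_le_compat_l; lra. }
  rewrite i3, Rmult_1_r.
  destruct (Req_dec (ind_le (X + Rpower X (5 / 8)) n - ind_le (X - Rpower X (5 / 8)) n) 1) as [i1|i1].
  - rewrite i1. nra.
  - apply key in i1. replace (1 / 2 - 5 / 8) with (- (1 / 8)) in i1 by field.
    destruct (Req_dec (ind_le (X + Rpower X (13 / 16)) n - ind_le (X - Rpower X (13 / 16)) n) 1) as [i2|i2].
    + rewrite i2. lra.
    + apply key in i2. replace (1 / 2 - 13 / 16) with (- (5 / 16)) in i2 by field. nra.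
Qed.

Lemma Rpower_le_1 X p : 1 <= X -> 0 <= p -> Rpower X (- p) <= 1.
Proof. intros. rewrite <- (Rpower_O X) by lra. apply Rle_Rpower; lra. Qed.

(** The lengths and factors of [near_level] are balanced: the two longer intervals give
    [13/16 + 1/32 - 1/8 = 23/32] and [33/32 - 5/16 = 23/32], and the shortest gives less. *)
Lemma near_sum l X K E : lpos l -> 1 <= X -> 0 <= K -> 0 <= E ->
  (forall u, 0 <= u <= X -> Sl l (X + u) - Sl l (X - u) <= K * (u * Rpower X (1 / 32) + E)) ->
  lsum (fun n => near (2 * PI * X) (2 * PI * INR n)) l <= 3 * K * (Rpower X (23 / 32) + E).
Proof.
  intros Hl HX HK HE H.
  eapply Rle_trans; [apply lsum_le; [auto | intros n Hn; apply near_level; auto]|].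
  rewrite !lsum_plus, !lsum_scal.
  assert (U : forall p, 0 <= p <= 1 -> 0 <= Rpower X p <= X).
  { intros p Hp. split; [left; apply Rpower_pos|]. rewrite <- (Rpower_1 X) at 2 by lra. apply Rle_Rpower; lra. }
  rewrite !Sl_diff by (try lra; match goal with |- context [Rpower X ?p] => pose proof (Rpower_pos X p) end; lra).
  pose proof (H _ (U (5 / 8) ltac:(lra))) as H1. pose proof (H _ (U (13 / 16) ltac:(lra))) as H2.
  pose proof (H X ltac:(lra)) as H3.
  rewrite <- Rpower_plus in H1, H2.
  assert (e3 : X * Rpower X (1 / 32) = Rpower X (33 / 32)).
  { rewrite <- (Rpower_1 X) at 1 by lra. rewrite <- Rpower_plus. f_equal. field. }
  rewrite e3 in H3.
  pose proof (Rpower_pos X (- (1 / 8))) as v1. pose proof (Rpower_pos X (- (5 / 16))) as v2.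
  pose proof (Rpower_le_1 X (1 / 8) HX ltac:(lra)) as w1. pose proof (Rpower_le_1 X (5 / 16) HX ltac:(lra)) as w2.
  apply (Rmult_le_compat_l (Rpower X (- (1 / 8)))) in H2; [|lra].
  apply (Rmult_le_compat_l (Rpower X (- (5 / 16)))) in H3; [|lra].
  set (B := Rpower X (23 / 32)).
  assert (B1 : Rpower X (5 / 8 + 1 / 32) <= B) by (apply Rle_Rpower; lra).
  assert (B2 : Rpower X (- (1 / 8)) * Rpower X (13 / 16 + 1 / 32) = B).
  { rewrite <- Rpower_plus. unfold B. f_equal. field. }
  assert (B3 : Rpower X (- (5 / 16)) * Rpower X (33 / 32) = B).
  { rewrite <- Rpower_plus. unfold B. f_equal. field. }
  replace (Rpower X (- (1 / 8)) * (K * (Rpower X (13 / 16 + 1 / 32) + E))) with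
    (K * (B + Rpower X (- (1 / 8)) * E)) in H2 by (rewrite <- B2; ring).
  replace (Rpower X (- (5 / 16)) * (K * (Rpower X (33 / 32) + E))) with
    (K * (B + Rpower X (- (5 / 16)) * E)) in H3 by (rewrite <- B3; ring).
  assert (K * (Rpower X (5 / 8 + 1 / 32) + E) <= K * (B + E)) by (apply Rmult_le_compat_l; lra).
  assert (K * (B + Rpower X (- (1 / 8)) * E) <= K * (B + E)) by (apply Rmult_le_compat_l; nra).
  assert (K * (B + Rpower X (- (5 / 16)) * E) <= K * (B + E)) by (apply Rmult_le_compat_l; nra).
  replace (X - X) with 0 in * by ring. lra.
Qed.

(** One shape for all counts: degree 2 in the logarithm for [b = 1], degree 1 for [b >= 2], degree 0
    for the integers themselves. *)
Definition Pm (a b c x : R) : R := x * (a * ln x ^ 2 + b * ln x + c).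

Lemma ln_le_Rpower x d : 0 < d -> 1 <= x -> ln x <= / d * Rpower x d.
Proof.
  intros Hd Hx. pose proof (exp_ineq1_le (d * ln x)). unfold Rpower.
  apply (Rmult_le_reg_l d); auto. rewrite <- Rmult_assoc, Rinv_r, Rmult_1_l by lra. lra.
Qed.

(** An asymptotic formula for the count bounds it in short intervals, by the size of the derivative
    of [Pm]. Its [log^2] is absorbed in [X^(1/32)] through [1 + M <= 66 X^(1/64)]. *)
Lemma Pm_increment l X K E a b c : lpos l -> 2 <= X -> 1 <= K -> 0 <= E ->
  Rabs a <= K -> Rabs b <= K -> Rabs c <= K ->
  (forall x, 1 <= x <= 2 * X -> Rabs (Sl l x - Pm a b c x) <= E) ->
  forall u, 0 <= u <= X -> Sl l (X + u) - Sl l (X - u) <= 18000 * K * (u * Rpower X (1 / 32) + E).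
Proof.
  intros Hl HX HK HE Ha Hb Hc H u Hu.
  set (M := ln (2 * X)). assert (M0 : 0 <= M) by (unfold M; rewrite <- ln_1; apply ln_le; lra).
  assert (ML : 1 + M <= 66 * Rpower X (1 / 64)).
  { unfold M. rewrite ln_mult by lra. pose proof (ln_le_Rpower X (1 / 64) ltac:(lra) ltac:(lra)).
    pose proof (ln_le_sub1 2 ltac:(lra)).
    assert (1 <= Rpower X (1 / 64)) by (rewrite <- (Rpower_O X) at 1 by lra; apply Rle_Rpower; lra).
    replace (/ (1 / 64)) with 64 in H0 by field. lra. }
  set (V := Rpower X (1 / 32)).
  assert (V1 : (1 + M) ^ 2 <= 4356 * V).
  { assert (E1 : V = Rpower X (1 / 64) * Rpower X (1 / 64)) by (unfold V; rewrite <- Rpower_plus; f_equal; field).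
    rewrite E1. pose proof (Rpower_pos X (1 / 64)). nra. }
  assert (lnb : forall x, 1 <= x <= 2 * X -> 0 <= ln x <= M).
  { intros x Hx. split; [rewrite <- ln_1 |]; apply ln_le; lra. }
  apply Rabs_le_between in Ha. apply Rabs_le_between in Hb. apply Rabs_le_between in Hc.
  assert (KV : 4 * u * K * (1 + M) ^ 2 <= 17424 * K * (u * V)).
  { replace (17424 * K * (u * V)) with (4 * u * K * (4356 * V)) by ring.
    apply Rmult_le_compat_l; [nra | exact V1]. }
  apply Rle_trans with (4 * u * K * (1 + M) ^ 2 + 2 * E).
  2:{ assert (0 <= u * V) by (apply Rmult_le_pos; [lra | left; apply Rpower_pos]).
      assert (0 <= K * (u * V)) by nra. assert (E <= K * E) by nra. lra. }
  destruct (Rle_dec u (X / 2)) as [C|C].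
  - pose proof (H (X + u) ltac:(lra)) as H1. pose proof (H (X - u) ltac:(lra)) as H2.
    apply Rabs_le_between in H1. apply Rabs_le_between in H2.
    set (D := 2 * K * (1 + M) ^ 2).
    assert (Q : Pm a b c (X + u) - D * (X + u) <= Pm a b c (X - u) - D * (X - u)).
    { apply (deriv_nonpos_decr (fun y => Pm a b c y - D * y)
        (fun y => a * ln y ^ 2 + (2 * a + b) * ln y + (b + c) - D)); [lra| |].
      - intros y Hy. unfold Pm. auto_derive; [lra|]. field. lra.
      - intros y Hy. destruct (lnb y ltac:(lra)) as [l0 l1].
        assert (ln y ^ 2 <= M ^ 2) by nra.
        assert (a * ln y ^ 2 <= K * M ^ 2) by nra.
        assert ((2 * a + b) * ln y <= 3 * K * M) by nra. unfold D. nra. }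
    unfold D in Q. nra.
  (* For [u > X / 2] the lower end may leave the range of the asymptotics; positivity and the total
     count up to [2 X] suffice, since [u] is then comparable to [X]. *)
  - pose proof (Sl_nonneg l (X - u) Hl). pose proof (Sl_mono l (X + u) (2 * X) Hl ltac:(lra)).
    pose proof (H (2 * X) ltac:(lra)) as H4. apply Rabs_le_between in H4. unfold Pm in H4. fold M in H4.
    assert (a * M ^ 2 + b * M + c <= K * (1 + M) ^ 2) by nra.
    assert (2 * X * (a * M ^ 2 + b * M + c) <= 2 * X * (K * (1 + M) ^ 2)) by (apply Rmult_le_compat_l; lra).
    assert (0 <= K * (1 + M) ^ 2) by (assert (0 <= (1 + M) ^ 2) by apply pow2_ge_0; nra).
    assert (2 * X * (K * (1 + M) ^ 2) <= 4 * u * (K * (1 + M) ^ 2)) by (apply Rmult_le_compat_r; lra).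
    lra.
Qed.

Lemma CI_EE_asymp l T K E a b c : lpos l -> 20 <= T -> 1 <= K -> 0 <= E ->
  lsum (fun n => Rpower (INR n) (- (9 / 8))) l <= K ->
  Rabs a <= K -> Rabs b <= K -> Rabs c <= K ->
  (forall x, 1 <= x <= 2 * (T / (2 * PI)) -> Rabs (Sl l x - Pm a b c x) <= E) ->
  Cmod (CI (fun v => EE l (Cpt c0 v)) 4 T - Mmain T * RtoC (Sl l (T / (2 * PI))))%C
    <= 4000000000 * K * (Rpower T (23 / 32) + E).
Proof.
  intros Hl HT HK HE Hs Ha Hb Hc H. pose proof PI2_3_2 as P. pose proof PI_4 as P4.
  set (X := T / (2 * PI)) in *.
  assert (TX : T = 2 * PI * X) by (unfold X; field; lra).
  assert (HX : 2 <= X) by (unfold X; apply le_div_mul; lra).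
  assert (XT : X <= T) by (rewrite TX; nra).
  eapply Rle_trans; [apply CI_EE_main; auto; lra|]. rewrite lsum_plus, !lsum_scal.
  assert (S1 : lsum (fun n => Bq T (2 * PI * INR n)) l <= Rpower T (23 / 32) * K).
  { apply Rle_trans with (Rpower T (23 / 32) * lsum (fun n => Rpower (INR n) (- (9 / 8))) l).
    - rewrite <- lsum_scal. apply lsum_le; auto. intros n Hn.
      assert (n0 : 0 < INR n) by (apply lt_0_INR; lia). unfold Bq.
      apply Rmult_le_compat; try (left; apply Rpower_pos).
      + apply Rle_Rpower; lra.
      + apply Rpower_neg_le; [|lra]. nra.
    - apply Rmult_le_compat_l; auto. left; apply Rpower_pos. }
  assert (S2 : lsum (fun n => near T (2 * PI * INR n)) l <= 3 * (18000 * K) * (Rpower T (23 / 32) + E)).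
  { replace (lsum (fun n => near T (2 * PI * INR n)) l) with
      (lsum (fun n => near (2 * PI * X) (2 * PI * INR n)) l) by (now rewrite <- TX).
    eapply Rle_trans; [apply (near_sum l X (18000 * K) E); auto; try lra|].
    - now apply (Pm_increment l X K E a b c).
    - apply Rmult_le_compat_l; [lra|]. apply Rplus_le_compat_r, Rpower_le_base; lra. }
  pose proof (Rpower_pos T (23 / 32)).
  assert (0 <= K * E) by nra. assert (0 <= K * Rpower T (23 / 32)) by nra. lra.
Qed.

(** * Conjugation symmetry and holomorphy of zeta *)

Lemma Cexp_conj z : Cexp (Cconj z) = Cconj (Cexp z).
Proof. unfold Cexp, Cconj, Re, Im. apply Ceq; unfold Re, Im; cbn [fst snd]; rewrite ?cos_neg, ?sin_neg; ring. Qed.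

Lemma CI_conj f a b : exCI f a b -> CI (fun u => Cconj (f u)) a b = Cconj (CI f a b).
Proof.
  intros [_ H]. apply Ceq; [reflexivity|].
  transitivity (RInt (fun u => - (1) * Im (f u)) a b).
  - apply RInt_ext. intros x _. unfold Im. simpl. ring.
  - rewrite (RInt_Rscal _ (- (1)) a b H). unfold CI, Cconj, Im. cbn [fst snd]. ring.
Qed.

Lemma Lap_gb_conj p : 0 < Re p -> Lap gb (Cconj p) = Cconj (Lap gb p).
Proof.
  intros Hp. pose proof (Lap_clim gb _ _ p lapdom_gb Hp) as H1.
  pose proof (Lap_clim gb _ _ (Cconj p) lapdom_gb Hp) as H2.
  apply (clim_unique _ _ _ H2). intros eps He. destruct (H1 eps He) as [N HN]. exists N. intros n Hn.
  specialize (HN n Hn). rewrite <- Cmod_conj in HN.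
  eapply Rle_trans; [right|exact HN]. f_equal. rewrite Cminus_conj. f_equal.
  rewrite <- CI_conj by (apply (exCI_lint gb _ _ p _ _ lapdom_gb); pose proof (pos_INR n); lra).
  apply CI_ext; [apply pos_INR|]. intros u _. unfold lint. rewrite Cmult_conj, <- Cexp_conj.
  f_equal; [f_equal; apply Ceq; simpl; ring | unfold gb; apply Ceq; simpl; ring].
Qed.

(** The bounds are proved at positive heights only, while [1 - s] lies below the real axis;
    conjugation also turns the integral of the theorem into the one of [fb]. *)
Lemma Zx_conj s : -1 < Re s -> s <> RtoC 1 -> Zx (Cconj s) = Cconj (Zx s).
Proof.
  intros Hs Hn. unfold Zx. assert (E : (s - 1)%C <> RtoC 0).
  { intros E. apply Hn. replace s with ((s - 1) + 1)%C by ring. rewrite E. ring. }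
  rewrite Cminus_conj, Cplus_conj, !Cmult_conj, Cinv_conj by exact E.
  rewrite Cminus_conj, !Cplus_conj. rewrite <- Lap_gb_conj by (creim; lra). rewrite Cplus_conj.
  replace (Cconj 1) with (RtoC 1) by (apply Ceq; simpl; ring).
  replace (Cconj (RtoC (1 / 2))) with (RtoC (1 / 2)) by (apply Ceq; simpl; ring). reflexivity.
Qed.

Definition Zdom (s : C) : Prop := -1 < Re s /\ s <> RtoC 1.

Lemma holo_Zx : holo Zdom Zx.
Proof.
  assert (A : holo Zdom (fun s => / (s - 1))%C).
  { apply (holo_weaken (fun s => RtoC 1 * s + - (1) <> RtoC 0)%C).
    - intros s [_ H] E. apply H. replace s with ((RtoC 1 * s + - (1)) + 1)%C by ring. rewrite E. ring.
    - apply holo_ext with (fun s => / (RtoC 1 * s + - (1)))%C; [intros; f_equal; ring|].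
      apply (holo_affine (fun z => z <> RtoC 0) (fun z => / z)%C), holo_inv. }
  assert (B : holo Zdom (fun s => Lap gb (s + 1))).
  { apply (holo_weaken (fun s => 0 < Re (RtoC 1 * s + 1)%C)).
    - intros s [H _]. creim. lra.
    - apply holo_ext with (fun s => Lap gb (RtoC 1 * s + 1)); [intros; f_equal; ring|].
      apply (holo_affine (fun z => 0 < Re z) (Lap gb)), (holo_Lap gb (1 / 8) 0), lapdom_gb. }
  apply holo_minus.
  - apply holo_plus; [exact A | apply holo_const].
  - apply holo_mult; [|exact B]. apply holo_mult; [apply holo_id|].
    apply holo_plus; [apply holo_id | apply holo_const].
Qed.

Lemma holo_ccont_line D f x t : holo D f -> D (Cpt x t) -> ccont (fun v => f (Cpt x v)) t.
Proof. intros (f' & f'' & F) H. destruct (F _ H) as [F1 _]. eapply cder_ccont, chol_cder_im, F1. Qed.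

Lemma holo_ccont_hor D f x t : holo D f -> D (Cpt x t) -> ccont (fun v => f (Cpt v t)) x.
Proof. intros (f' & f'' & F) H. destruct (F _ H) as [F1 _]. eapply cder_ccont, chol_cder_re, F1. Qed.

(** * Tails of Dirichlet series and limits under the integral *)

Lemma pow_step_neg p n : 0 < p -> (0 < n)%nat ->
  p * Rpower (INR (S n)) (- (1 + p)) <= Rpower (INR n) (- p) - Rpower (INR (S n)) (- p).
Proof.
  intros Hp Hn. set (N := INR (S n)). assert (N1 : 1 <= N) by (unfold N; rewrite S_INR; pose proof (pos_INR n); lra).
  pose proof (ln_INR_S_lower n Hn) as H. fold N in H.
  assert (E : Rpower N (- (1 + p)) = Rpower N (- p) * / N).
  { replace (- (1 + p)) with (- p + - (1)) by ring. rewrite Rpower_plus, Rpower_Ropp, (Rpower_Ropp N 1), Rpower_1 by lra. reflexivity. }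
  assert (L : Rpower N (- p) * (1 + p * / N) <= Rpower (INR n) (- p)).
  { unfold Rpower at 2. apply Rle_trans with (exp (- p * ln N + p * / N)).
    - rewrite exp_plus. fold (Rpower N (- p)). apply Rmult_le_compat_l; [left; apply Rpower_pos|].
      apply exp_ineq1_le.
    - apply exp_le. nra. }
  rewrite E. lra.
Qed.

Lemma sum_neg_tail p N m : 0 < p -> (0 < N)%nat ->
  p * Rsum (fun k => Rpower (INR (S (N + k))) (- (1 + p))) m <= Rpower (INR N) (- p) - Rpower (INR (N + m)) (- p).
Proof.
  intros Hp HN. induction m as [|m IH].
  - simpl. rewrite Nat.add_0_r. lra.
  - cbn [Rsum]. pose proof (pow_step_neg p (N + m) Hp ltac:(lia)). rewrite Nat.add_succ_r. lra.
Qed.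

Lemma Rsum_split a n m : Rsum a (n + m) = Rsum a n + Rsum (fun k => a (n + k)%nat) m.
Proof.
  induction m as [|m IH]; [rewrite Nat.add_0_r; simpl; ring|].
  rewrite Nat.add_succ_r. simpl. rewrite IH. ring.
Qed.

Lemma sum_neg_le p n : 0 < p -> Rsum (fun k => Rpower (INR (S k)) (- (1 + p))) n <= 1 + / p.
Proof.
  intros Hp. assert (0 < / p) by (apply Rinv_0_lt_compat; lra). destruct n as [|n]; [simpl; lra|].
  replace (S n) with (1 + n)%nat by lia. rewrite Rsum_split.
  pose proof (sum_neg_tail p 1 n Hp ltac:(lia)) as H0. 
  replace (Rsum (fun k => Rpower (INR (S k)) (- (1 + p))) 1) with 1 by (simpl; rewrite Rpower_base1; ring).
  apply Rplus_le_compat_l. apply (Rmult_le_reg_l p); auto. rewrite Rinv_r by lra.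
  eapply Rle_trans; [exact H0|]. change (INR 1) with 1. rewrite Rpower_base1.
  pose proof (Rpower_pos (INR (1 + n)) (- p)). lra.
Qed.

Lemma Csum_tail_bound s N m : 9 / 8 <= Re s -> (0 < N)%nat ->
  Cmod (zsum s (N + m) - zsum s N)%C <= 8 * Rpower (INR N) (- (1 / 8)).
Proof.
  intros Hs HN. unfold zsum. rewrite Csum_split.
  match goal with |- Cmod (?a + ?b - ?a)%C <= _ => replace (a + b - a)%C with b by ring end.
  eapply Rle_trans; [apply Cmod_Csum|].
  pose proof (sum_neg_tail (1 / 8) N m ltac:(lra) HN) as H. pose proof (Rpower_pos (INR (N + m)) (- (1 / 8))).
  eapply Rle_trans; [apply (Rsum_le _ (fun k => Rpower (INR (S (N + k))) (- (1 + 1 / 8))))|lra].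
  intros k _. rewrite Cmod_Rpower_C. creim. apply Rle_Rpower; [|lra].
  change 1 with (INR 1). apply le_INR; lia.
Qed.

Lemma zsum_rate s N : 9 / 8 <= Re s -> (0 < N)%nat ->
  Cmod (zsum s N - Zx s)%C <= 8 * Rpower (INR N) (- (1 / 8)).
Proof.
  intros Hs HN. rewrite Cmod_minus_sym. apply (clim_bound (zsum s)); [apply zsum_Zx; lra|].
  exists N. intros n Hn. replace n with (N + (n - N))%nat by lia. now apply Csum_tail_bound.
Qed.

Lemma Zx_right_bound s : 9 / 8 <= Re s -> Cmod (Zx s) <= 9.
Proof.
  intros Hs. pose proof (zsum_rate s 1 Hs ltac:(lia)) as H. change (INR 1) with 1 in H. rewrite Rpower_base1 in H.
  replace (zsum s 1) with (RtoC 1) in H.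
  - rewrite Cmod_minus_sym in H. pose proof (Cmod_triangle_inv (Zx s) (RtoC 1)). rewrite Cmod_1 in H0. lra.
  - unfold zsum. simpl. rewrite Rpower_C_base1. ring.
Qed.

Lemma CI_clim (f : nat -> R -> C) F K a b : a <= b -> (forall N, exCI (f N) a b) -> exCI F a b ->
  (forall N t, (0 < N)%nat -> a <= t <= b -> Cmod (f N t - F t)%C <= K * Rpower (INR N) (- (1 / 8))) ->
  clim (fun N => CI (f N) a b) (CI F a b).
Proof.
  intros Hab Hf HF H eps He.
  set (L := Rmax 0 (K * (b - a)) + 1).
  assert (L1 : 1 <= L) by (unfold L; pose proof (Rmax_l 0 (K * (b - a))); lra).
  assert (L2 : K * (b - a) <= L) by (unfold L; pose proof (Rmax_r 0 (K * (b - a))); lra).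
  destruct (Rpower_small (1 / 8) (eps / L) ltac:(lra) ltac:(apply Rdiv_lt_0_compat; lra)) as [N0 HN0].
  exists (S N0). intros N HN. specialize (HN0 N ltac:(lia)). rewrite <- CI_minus by auto.
  eapply Rle_trans; [apply (CI_norm_const _ (K * Rpower (INR N) (- (1 / 8)))); auto|].
  - now apply exCI_minus.
  - intros t Ht. apply H; auto; lia.
  - pose proof (Rpower_pos (INR N) (- (1 / 8))) as P. set (x := Rpower (INR N) (- (1 / 8))) in *.
    replace (K * x * (b - a)) with (K * (b - a) * x) by ring.
    apply Rle_trans with (L * x); [apply Rmult_le_compat_r; lra|].
    apply Rle_trans with (L * (eps / L)); [apply Rmult_le_compat_l; lra|]. right. field. lra.
Qed.

(** * Truncated Dirichlet series and their counting functions *)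

Fixpoint wl (w : nat -> R) (nn : nat -> nat) (Y : nat) : wlist :=
  match Y with O => nil | S k => (w (S k), nn (S k)) :: wl w nn k end.

Lemma lpos_wl w nn Y : (forall k, (0 < k)%nat -> 0 <= w k /\ (0 < nn k)%nat) -> lpos (wl w nn Y).
Proof.
  intros H. induction Y as [|Y IH]; intros v n Hin; simpl in Hin; [contradiction|].
  destruct Hin as [E|Hin]; [|now apply IH]. injection E as <- <-. apply H; lia.
Qed.

Lemma lsum_wl F w nn Y : lsum F (wl w nn Y) = Rsum (fun k => w (S k) * F (nn (S k))) Y.
Proof. induction Y as [|Y IH]; simpl; [reflexivity|]. rewrite IH. ring. Qed.

Lemma Dir_wl w nn Y s :
  Dir (wl w nn Y) s = Csum (fun k => RtoC (w (S k)) * Rpower_C (INR (nn (S k))) (- s))%C Y.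
Proof. induction Y as [|Y IH]; cbn [wl Dir Csum]; [reflexivity|]. rewrite IH. ring. Qed.

Definition l1 (Y : nat) : wlist := wl (fun _ => 1) (fun k => k) Y.

Lemma lpos_l1 Y : lpos (l1 Y).
Proof. apply lpos_wl. intros; split; [lra | auto]. Qed.

Lemma Dir_l1 Y s : Dir (l1 Y) s = zsum s Y.
Proof. unfold l1. rewrite Dir_wl. apply Csum_ext. intros; ring. Qed.

Definition flr (x : R) : nat := Z.to_nat (Int_part x).

Lemma flr_spec x : 0 <= x -> INR (flr x) <= x < INR (flr x) + 1.
Proof.
  intros Hx. pose proof (base_fp x) as [F0 F1]. pose proof (Rplus_Int_part_frac_part x) as E.
  assert (I0 : (0 <= Int_part x)%Z) by (apply Z.lt_succ_r, lt_IZR; unfold Z.succ; rewrite plus_IZR; simpl; lra).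
  unfold flr. rewrite INR_IZR_INZ, Z2Nat.id by auto. lra.
Qed.

Lemma flr_le x n : 0 <= x -> x <= INR n -> (flr x <= n)%nat.
Proof. intros H0 H. pose proof (flr_spec x H0). apply INR_le. lra. Qed.

Lemma ind_le_flr x k : 0 <= x -> ind_le x (S k) = if Nat.leb (S k) (flr x) then 1 else 0.
Proof.
  intros Hx. pose proof (flr_spec x Hx) as [A B]. unfold ind_le.
  destruct (Nat.leb_spec (S k) (flr x)) as [L|L]; destruct (Rle_dec (INR (S k)) x) as [C|C]; auto; exfalso.
  - apply C. apply le_INR in L. lra.
  - apply le_INR in L. rewrite S_INR in L. lra.
Qed.

Lemma Rsum_ind g x Y : 0 <= x -> (flr x <= Y)%nat ->
  Rsum (fun k => g k * ind_le x (S k)) Y = Rsum g (flr x).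
Proof.
  intros Hx HY. replace Y with (flr x + (Y - flr x))%nat by lia. rewrite Rsum_split.
  rewrite (Rsum_ext _ g (flr x)).
  - rewrite (Rsum_ext _ (fun _ => 0 * 0) (Y - flr x)).
    + rewrite Rsum_scal. ring.
    + intros k _. rewrite ind_le_flr by auto. destruct (Nat.leb_spec (S (flr x + k)) (flr x)); [lia | ring].
  - intros k Hk. rewrite ind_le_flr by auto. destruct (Nat.leb_spec (S k) (flr x)); [ring | lia].
Qed.

Lemma Rsum_1 n : Rsum (fun _ => 1) n = INR n.
Proof. induction n as [|n IH]; [reflexivity|]. rewrite S_INR, <- IH. reflexivity. Qed.

Lemma Sl_wl_id w x Y : 0 <= x <= INR Y -> Sl (wl w (fun k => k) Y) x = Rsum (fun k => w (S k)) (flr x).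
Proof. intros Hx. unfold Sl. rewrite lsum_wl. apply (Rsum_ind (fun k => w (S k))); [lra | apply flr_le; lra]. Qed.

Lemma Sl_l1 x Y : 0 <= x <= INR Y -> Sl (l1 Y) x = INR (flr x).
Proof. intros Hx. unfold l1. rewrite Sl_wl_id by auto. apply Rsum_1. Qed.

(** Crude on purpose: it only serves the limit in the truncation, during which [T] is fixed. *)
Lemma EE_head_bound T t : 4 <= t <= T ->
  Cmod ((Em 1 (Cpt c0 t) + Em (-1) (Cpt c0 t)) * Rpower_C (2 * PI) (- Cpt c0 t))%C <= 176 * T.
Proof.
  intros Ht. pose proof PI2_3_2. rewrite Cmod_mult.
  assert (A : forall e, e = 1 \/ e = -1 -> Cmod (Em e (Cpt c0 t)) <= 88 * T).
  { intros e He. eapply Rle_trans; [apply Em_bound; auto; unfold c0; lra|]. apply Rmult_le_compat_l; [lra|].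
    apply Rle_trans with (Rpower t 1); [apply Rle_Rpower; unfold c0; lra | rewrite Rpower_1; lra]. }
  assert (B : Cmod (Rpower_C (2 * PI) (- Cpt c0 t)) <= 1).
  { rewrite Cmod_Rpower_C. simpl. apply Rpower_le_1; unfold c0; lra. }
  pose proof (A 1 ltac:(auto)). pose proof (A (-1) ltac:(auto)).
  pose proof (Cmod_triangle (Em 1 (Cpt c0 t)) (Em (-1) (Cpt c0 t))).
  pose proof (Cmod_ge_0 (Rpower_C (2 * PI) (- Cpt c0 t))).
  pose proof (Cmod_ge_0 (Em 1 (Cpt c0 t) + Em (-1) (Cpt c0 t))%C). nra.
Qed.

Lemma FE_line t : Zx (1 - Cpt c0 t) =
  ((Em 1 (Cpt c0 t) + Em (-1) (Cpt c0 t)) * Rpower_C (2 * PI) (- Cpt c0 t) * Zx (Cpt c0 t))%C.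
Proof. rewrite functional_equation by reflexivity. ring. Qed.

Lemma CI_EE_clim (l : nat -> wlist) F K T : 4 <= T -> (forall N, lpos (l N)) ->
  (forall t, 4 <= t <= T -> ccont (fun v => F (Cpt c0 v)) t) ->
  (forall N t, (0 < N)%nat -> 4 <= t <= T -> Cmod (Dir (l N) (Cpt c0 t) - F (Cpt c0 t))%C <= K * Rpower (INR N) (- (1 / 8))) ->
  clim (fun N => CI (fun t => EE (l N) (Cpt c0 t)) 4 T)
    (CI (fun t => (Em 1 (Cpt c0 t) + Em (-1) (Cpt c0 t)) * Rpower_C (2 * PI) (- Cpt c0 t) * F (Cpt c0 t))%C 4 T).
Proof.
  intros HT Hl HF H. pose proof PI_RGT_0. apply (CI_clim _ _ (176 * T * K)); auto.
  - intros N. now apply exCI_EE.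
  - apply exCI_cont; auto. intros t Ht. apply ccont_mult; [apply ccont_mult|]; auto.
    + apply ccont_plus; apply Em_ccont_im; unfold c0; lra.
    + apply ccont_Rpower_C_line. lra.
  - intros N t HN Ht. unfold EE.
    replace ((Em 1 (Cpt c0 t) + Em (-1) (Cpt c0 t)) * (Rpower_C (2 * PI) (- Cpt c0 t) * Dir (l N) (Cpt c0 t))
      - (Em 1 (Cpt c0 t) + Em (-1) (Cpt c0 t)) * Rpower_C (2 * PI) (- Cpt c0 t) * F (Cpt c0 t))%C
     with ((Em 1 (Cpt c0 t) + Em (-1) (Cpt c0 t)) * Rpower_C (2 * PI) (- Cpt c0 t) *
       (Dir (l N) (Cpt c0 t) - F (Cpt c0 t)))%C by ring.
    rewrite Cmod_mult, (Rmult_assoc (176 * T)). 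
    apply Rmult_le_compat; auto using Cmod_ge_0. now apply EE_head_bound.
Qed.

(** * The limit of [Mmain] *)

Lemma Cmod_Zx_reflect x t : 0 < t -> -1 < x -> Cmod (Zx (Cpt x (- t))) = Cmod (Zx (Cpt x t)).
Proof.
  intros Ht Hx. replace (Cpt x (- t)) with (Cconj (Cpt x t)) by reflexivity.
  rewrite Zx_conj, Cmod_conj; auto. intros E. apply (f_equal snd) in E. simpl in E. lra.
Qed.

Lemma one_minus_Cpt x t : (1 - Cpt x t)%C = Cpt (1 - x) (- t).
Proof. apply Ceq; simpl; ring. Qed.

Lemma CI_const z a b : a <= b -> CI (fun _ => z) a b = (RtoC (b - a) * z)%C.
Proof.
  intros Hab. rewrite (CI_FTC (fun t => z * RtoC t)%C); auto.
  - rewrite RtoC_minus. ring.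
  - intros t _. eapply cder_eq; [apply cder_scal, cder_RtoC, is_derive_id|]. unfold one; simpl. ring.
  - intros; apply ccont_const.
Qed.

Lemma CI_cis_bound l a b : 0 < l -> a <= b -> Cmod (CI (fun t => cis (t * l)) a b) <= 2 / l.
Proof.
  intros Hl Hab. assert (N : (Ci * RtoC l)%C <> RtoC 0).
  { intros E. apply (f_equal snd) in E. simpl in E. lra. }
  rewrite (CI_FTC (fun t => / (Ci * RtoC l) * cis (t * l))%C); auto.
  - replace (/ (Ci * RtoC l) * cis (b * l) - / (Ci * RtoC l) * cis (a * l))%C with
      (/ (Ci * RtoC l) * (cis (b * l) - cis (a * l)))%C by ring.
    rewrite Cmod_mult, Cmod_inv, Cmod_mult, Cmod_Ci, Rmult_1_l, Cmod_RtoC_pos by (auto; lra).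
    unfold Rdiv. rewrite (Rmult_comm 2). apply Rmult_le_compat_l; [left; apply Rinv_0_lt_compat; lra|].
    eapply Rle_trans; [apply Cmod_minus_le|]. rewrite !Cmod_cis. lra.
  - intros t _. eapply cder_eq.
    + apply cder_scal, (cder_cis (fun t => t * l)). auto_derive; [auto|reflexivity].
    + rewrite Rmult_1_l. set (w := (Ci * RtoC l)%C) in *. field. exact N.
  - intros t _. eapply cder_ccont, (cder_cis (fun t => t * l)). auto_derive; [auto|reflexivity].
Qed.

(** The term [n = 1] is constant and integrates to [T - 4]. The others oscillate with frequency
    [ln n >= 1/2], so each integral is at most 4 and the weights [n^(-9/8)] are summable. *)
Lemma CI_zsum_98 N T : 4 <= T -> exCI (fun t => zsum (Cpt (9 / 8) (- t)) (S N)) 4 T /\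
  Cmod (CI (fun t => zsum (Cpt (9 / 8) (- t)) (S N)) 4 T - RtoC (T - 4))%C
   <= 4 * Rsum (fun k => Rpower (INR (S k)) (- (1 + 1 / 8))) (S N).
Proof.
  intros HT.
  assert (TE : forall k t, Rpower_C (INR (S k)) (- Cpt (9 / 8) (- t)) =
    (RtoC (Rpower (INR (S k)) (- (1 + 1 / 8))) * cis (t * ln (INR (S k))))%C).
  { intros k t. rewrite Rpower_C_Cpt. f_equal; [do 2 f_equal; field | f_equal; ring]. }
  assert (EX : forall k, exCI (fun t => Rpower_C (INR (S k)) (- Cpt (9 / 8) (- t))) 4 T).
  { intros k. apply exCI_ext with (fun t => RtoC (Rpower (INR (S k)) (- (1 + 1 / 8))) * cis (t * ln (INR (S k))))%C; auto.
    apply exCI_scal, exCI_cont; auto. intros t _. eapply cder_ccont, (cder_cis (fun t => t * ln (INR (S k)))).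
    auto_derive; auto. }
  induction N as [|N [IH1 IH2]].
  - assert (E : forall t, zsum (Cpt (9 / 8) (- t)) 1 = RtoC 1).
    { intros t. unfold zsum. simpl. rewrite Rpower_C_base1. ring. }
    split.
    + apply exCI_ext with (fun _ => RtoC 1); auto. apply exCI_cont; auto. intros; apply ccont_const.
    + rewrite (CI_ext _ (fun _ => RtoC 1)) by auto. rewrite CI_const by auto.
      replace (RtoC (T - 4) * RtoC 1 - RtoC (T - 4))%C with (RtoC 0) by ring. rewrite Cmod_0.
      apply Rmult_le_pos; [lra|]. apply Rsum_nonneg. intros. left; apply Rpower_pos.
  - split.
    + apply exCI_plus; auto.
    + change (fun t => zsum (Cpt (9 / 8) (- t)) (S (S N))) with
        (fun t => zsum (Cpt (9 / 8) (- t)) (S N) + Rpower_C (INR (S (S N))) (- Cpt (9 / 8) (- t)))%C.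
      rewrite CI_plus by auto. cbn [Rsum] in *. 
      match goal with |- Cmod (?a + ?b - ?c)%C <= _ => replace (a + b - c)%C with ((a - c) + b)%C by ring end.
      eapply Rle_trans; [apply Cmod_triangle|].
      rewrite Rmult_plus_distr_l. apply Rplus_le_compat; [exact IH2|].
      rewrite (CI_ext _ (fun t => RtoC (Rpower (INR (S (S N))) (- (1 + 1 / 8))) * cis (t * ln (INR (S (S N)))))%C) by auto.
      assert (L : 1 / 2 <= ln (INR (S (S N)))).
      { apply Rle_trans with (ln 2); [pose proof ln_lt_2; lra|]. apply ln_le; [lra|].
        rewrite !S_INR. pose proof (pos_INR N). lra. }
      rewrite CI_scal.
      2:{ apply exCI_cont; auto. intros t _. eapply cder_ccont, (cder_cis (fun t => t * ln (INR (S (S N))))).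
          auto_derive; auto. }
      rewrite Cmod_mult, Cmod_RtoC_pos by (left; apply Rpower_pos). rewrite Rmult_comm.
      apply Rmult_le_compat_r; [left; apply Rpower_pos|].
      eapply Rle_trans; [apply CI_cis_bound; lra|]. apply div_le_mul; lra.
Qed.

Lemma ez_max al : - (1 / 8) <= al <= 9 / 8 -> ez al <= 23 / 32.
Proof. intros. apply Rmax_lub; lra. Qed.

Lemma Zx_reflected_ccont x t : x < 2 -> 0 < t -> ccont (fun v => Zx (1 - Cpt x v)) t.
Proof.
  intros Hx Ht.
  apply (holo_ccont_line (fun z => Zdom (- (1) * z + 1)%C) (fun z => Zx (1 - z))).
  - apply holo_ext with (fun z => Zx (- (1) * z + 1)%C); [intros; f_equal; ring|].
    apply (holo_affine Zdom Zx), holo_Zx.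
  - split; [simpl; lra|]. intros E. apply (f_equal snd) in E. simpl in E. lra.
Qed.

Lemma CI_Zx_98 T : 4 <= T ->
  Cmod (CI (fun t => Zx (1 - Cpt (- (1 / 8)) t)) 4 T - RtoC (T - 4))%C <= 37.
Proof.
  intros HT.
  assert (C : clim (fun N => CI (fun t => zsum (Cpt (9 / 8) (- t)) (S N)) 4 T)
    (CI (fun t => Zx (1 - Cpt (- (1 / 8)) t)) 4 T)).
  { intros eps He.
    destruct (CI_clim (fun N t => zsum (Cpt (9 / 8) (- t)) (S (pred N))) (fun t => Zx (1 - Cpt (- (1 / 8)) t)) 8 4 T)
      with (eps := eps) as [N HN]; auto.
    - intros N. now apply CI_zsum_98.
    - apply exCI_cont; auto. intros t Ht. apply Zx_reflected_ccont; lra.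
    - intros N t HN Ht. replace (S (pred N)) with N by lia. rewrite one_minus_Cpt.
      replace (1 - - (1 / 8)) with (9 / 8) by field. apply zsum_rate; auto. simpl. lra.
    - exists N. intros n Hn. apply (HN (S n)). lia. }
  apply (clim_bound _ _ _ _ C). exists O. intros n _. destruct (CI_zsum_98 n T HT) as [_ B].
  pose proof (sum_neg_le (1 / 8) (S n) ltac:(lra)). replace (/ (1 / 8)) with 8 in H by field. lra.
Qed.

(** Between the lines -1/8 and [c0] the argument [1 - s] ranges over the strip of [zeta_bound],
    where [ez] is largest at the left edge: [ez (-1/8) = 23/32]. *)
Lemma CI_Zx_neg T : 4 <= T ->
  Cmod (CI (fun t => Zx (1 - Cpt c0 t)) 4 T - RtoC T)%C <= 70000 * Rpower T (23 / 32).
Proof.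
  intros HT.
  assert (HO : holo (fun z => Zdom (- (1) * z + 1)%C) (fun z => Zx (1 - z))).
  { apply holo_ext with (fun z => Zx (- (1) * z + 1)%C); [intros; f_equal; ring|].
    apply (holo_affine Zdom Zx), holo_Zx. }
  pose proof (Cauchy_holo _ _ (- (1 / 8)) c0 4 T (1 / 2) HO ltac:(unfold c0; lra) HT ltac:(lra)) as Cau.
  assert (Cau' := Cau ltac:(intros x y Hx Hy; split; [unfold c0 in Hx; simpl; lra |
    intros E; apply (f_equal snd) in E; simpl in E; lra])). clear Cau.
  assert (B : forall t, 4 <= t <= T -> Cmod (CI (fun u => Zx (1 - Cpt u t)) (- (1 / 8)) c0) <= 33000 * Rpower T (23 / 32)).
  { intros t Ht. eapply Rle_trans; [apply (CI_norm_const _ (26000 * Rpower T (23 / 32)))|].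
    - unfold c0; lra.
    - apply exCI_cont; [unfold c0; lra|]. intros u Hu. unfold c0 in Hu.
      eapply (holo_ccont_hor _ (fun z => Zx (1 - z))); [exact HO|].
      split; [simpl; lra | intros E; apply (f_equal snd) in E; simpl in E; lra].
    - intros u Hu. unfold c0 in Hu. rewrite one_minus_Cpt, Cmod_Zx_reflect by lra.
      eapply Rle_trans; [apply zeta_bound; lra|]. apply Rmult_le_compat_l; [lra|].
      apply Rle_trans with (Rpower t (23 / 32)); [apply Rle_Rpower; [lra | apply ez_max; lra] | apply Rpower_le_base; lra].
    - unfold c0. pose proof (Rpower_pos T (23 / 32)). lra. }
  pose proof (B T ltac:(lra)) as B1. pose proof (B 4 ltac:(lra)) as B2. pose proof (CI_Zx_98 T HT) as B3.
  set (I1 := CI (fun v => Zx (1 - Cpt c0 v)) 4 T) in *.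
  set (I2 := CI (fun v => Zx (1 - Cpt (- (1 / 8)) v)) 4 T) in *.
  apply (f_equal Cmod) in Cau'. rewrite Cmod_mult, Cmod_Ci, Rmult_1_l in Cau'.
  replace (I1 - RtoC T)%C with ((I1 - I2) + (I2 - RtoC (T - 4)) - RtoC 4)%C by (rewrite RtoC_minus; ring).
  eapply Rle_trans; [apply Cmod_minus_le|]. rewrite (Cmod_RtoC_pos 4) by lra.
  eapply Rle_trans; [apply Rplus_le_compat_r, Cmod_triangle|]. rewrite Cau'.
  eapply Rle_trans; [apply Rplus_le_compat_r, Rplus_le_compat_r, Cmod_minus_le|].
  assert (1 <= Rpower T (23 / 32)) by (rewrite <- (Rpower_O T) at 1 by lra; apply Rle_Rpower; lra). lra.
Qed.

Lemma Mmain_asymp T : 20 <= T -> Cmod (Mmain T - RtoC (2 * PI))%C <= 5000000000000 * Rpower T (- (9 / 32)).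
Proof.
  intros HT. pose proof PI2_3_2 as P. pose proof PI_4 as P4.
  set (X := T / (2 * PI)). assert (TX : T = 2 * PI * X) by (unfold X; field; lra).
  assert (HX : 2 <= X) by (unfold X; apply le_div_mul; lra).
  assert (C : clim (fun N => CI (fun t => EE (l1 N) (Cpt c0 t)) 4 T) (CI (fun t => Zx (1 - Cpt c0 t)) 4 T)).
  { rewrite (CI_ext _ (fun t => (Em 1 (Cpt c0 t) + Em (-1) (Cpt c0 t)) * Rpower_C (2 * PI) (- Cpt c0 t) * Zx (Cpt c0 t))%C)
      by (try lra; intros; apply FE_line).
    apply (CI_EE_clim l1 Zx 8); [lra | apply lpos_l1 | |].
    - intros t Ht. apply (holo_ccont_line Zdom Zx); [apply holo_Zx|].
      split; [unfold c0; simpl; lra | intros E; apply (f_equal snd) in E; simpl in E; lra].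
    - intros N t HN Ht. rewrite Dir_l1. apply zsum_rate; auto. unfold c0; simpl; lra. }
  (* One truncation serves two needs: the integral is within 1 of its limit, and the list contains
     all integers up to [2 X], so that its count is the floor function. *)
  destruct (C 1 ltac:(lra)) as [N0 HN0]. destruct (INR_unbounded (2 * X)) as [N1 HN1].
  set (N := (N0 + N1)%nat). assert (NX : 2 * X <= INR N) by (unfold N; rewrite plus_INR; pose proof (pos_INR N0); lra).
  specialize (HN0 N ltac:(unfold N; lia)).
  pose proof (CI_EE_asymp (l1 N) T 9 1 0 0 1 (lpos_l1 N) HT ltac:(lra) ltac:(lra)) as A. fold X in A.
  rewrite (Sl_l1 X N) in A by lra.
  assert (A' := A ltac:(unfold l1; rewrite lsum_wl;
     rewrite (Rsum_ext _ (fun k => Rpower (INR (S k)) (- (1 + 1 / 8)))) by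
       (intros; rewrite Rmult_1_l; f_equal; field);
     pose proof (sum_neg_le (1 / 8) N ltac:(lra)); lra)
    ltac:(rewrite Rabs_R0; lra) ltac:(rewrite Rabs_R0; lra) ltac:(rewrite Rabs_R1; lra)
    ltac:(intros x Hx; rewrite Sl_l1 by lra; unfold Pm; pose proof (flr_spec x ltac:(lra)); apply Rabs_le; lra)).
  clear A. pose proof (CI_Zx_neg T ltac:(lra)) as Z.
  set (I1 := CI (fun v => EE (l1 N) (Cpt c0 v)) 4 T) in *. set (I2 := CI (fun t => Zx (1 - Cpt c0 t)) 4 T) in *.
  pose proof (flr_spec X ltac:(lra)) as [F1 F2]. set (F := INR (flr X)) in *.
  set (V := Rpower T (23 / 32)) in *.
  assert (V1 : 1 <= V) by (unfold V; rewrite <- (Rpower_O T) at 1 by lra; apply Rle_Rpower; lra).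
  assert (D : Cmod ((Mmain T - RtoC (2 * PI)) * RtoC F)%C <= 73000000000 * V).
  { replace ((Mmain T - RtoC (2 * PI)) * RtoC F)%C with
      (- (I1 - Mmain T * RtoC F) + (I1 - I2) + (I2 - RtoC T) + RtoC (T - 2 * PI * F))%C
      by (rewrite RtoC_minus, !RtoC_mult; ring).
    eapply Rle_trans; [apply Cmod_triangle|]. eapply Rle_trans; [apply Rplus_le_compat_r, Cmod_triangle|].
    eapply Rle_trans; [apply Rplus_le_compat_r, Rplus_le_compat_r, Cmod_triangle|]. rewrite Cmod_opp.
    rewrite (Cmod_RtoC_pos (T - 2 * PI * F)) by nra.
    assert (T - 2 * PI * F <= 8) by nra. lra. }
  rewrite Cmod_mult, Cmod_RtoC_pos in D by apply pos_INR.
  assert (F3 : T <= 16 * F) by nra.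
  assert (VE : V = T * Rpower T (- (9 / 32))).
  { unfold V. rewrite <- (Rpower_1 T) at 2 by lra. rewrite <- Rpower_plus. f_equal. field. }
  pose proof (Rpower_pos T (- (9 / 32))) as W. set (w := Rpower T (- (9 / 32))) in *.
  pose proof (Cmod_ge_0 (Mmain T - RtoC (2 * PI))%C) as m0. set (m := Cmod (Mmain T - RtoC (2 * PI))%C) in *.
  rewrite VE in D.
  apply (Rmult_le_reg_r F); [lra|]. nra.
Qed.

(** * Moving the line of integration from [1/2] to [9/8] *)

Definition third (b : nat) (s : C) : C := (RtoC (INR b) * s + RtoC ((1 - INR b) / 2))%C.
Definition fb (b : nat) (s : C) : C := (Zx (1 - s) * Zx s * Zx (third b s))%C.
Definition fdom (b : nat) (s : C) : Prop := Zdom (- (1) * s + 1)%C /\ Zdom s /\ Zdom (third b s).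

Lemma holo_fb b : holo (fdom b) (fb b).
Proof.
  apply holo_mult; [apply holo_mult|].
  - apply (holo_weaken (fun s => Zdom (- (1) * s + 1)%C)); [intros s H; apply H|].
    apply holo_ext with (fun z => Zx (- (1) * z + 1)%C); [intros; f_equal; ring|].
    apply (holo_affine Zdom Zx), holo_Zx.
  - apply (holo_weaken Zdom); [intros s H; apply H | apply holo_Zx].
  - apply (holo_weaken (fun s => Zdom (third b s))); [intros s H; apply H|].
    apply (holo_affine Zdom Zx), holo_Zx.
Qed.

Lemma third_Cpt b x t : third b (Cpt x t) = Cpt (INR b * x + (1 - INR b) / 2) (INR b * t).
Proof. unfold third. apply Ceq; simpl; ring. Qed.

Lemma INR_ge_1 b : (0 < b)%nat -> 1 <= INR b.
Proof. intros. change 1 with (INR 1). apply le_INR. lia. Qed.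

Lemma fdom_Cpt b x t : (0 < b)%nat -> 0 < x < 2 -> - (3 / 2) < INR b * (x - 1 / 2) -> 0 < t -> fdom b (Cpt x t).
Proof.
  intros Hb Hx H Ht. pose proof (INR_ge_1 b Hb). split; [|split].
  - split; [simpl; lra|]. intros E; apply (f_equal snd) in E; simpl in E; lra.
  - split; [simpl; lra|]. intros E; apply (f_equal snd) in E; simpl in E; lra.
  - rewrite third_Cpt. split; [simpl; lra|]. intros E; apply (f_equal snd) in E; simpl in E; nra.
Qed.

Lemma ez_mono x y : x <= y -> ez y <= ez x.
Proof. intros H. apply Rmax_lub; [eapply Rle_trans; [|apply Rmax_l] | eapply Rle_trans; [|apply Rmax_r]]; lra. Qed.

Lemma ez_pos x : x <= 9 / 8 -> 0 <= ez x.
Proof. intros. eapply Rle_trans; [|apply Rmax_r]. lra. Qed.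

(** For [x >= 1/2] the third factor sits at an abscissa at least [x], where the bound is no worse,
    and past 9/8 it is bounded. Its height [b t] costs at most a factor [b], as [ez <= 1] in the
    strip. *)
Lemma third_bound b x t : (0 < b)%nat -> 1 / 2 <= x <= 9 / 8 -> 4 <= t ->
  Cmod (Zx (third b (Cpt x t))) <= 26000 * (INR b * Rpower t (ez x)).
Proof.
  intros Hb Hx Ht. pose proof (INR_ge_1 b Hb) as b1. rewrite third_Cpt.
  assert (e0 : 1 <= Rpower t (ez x)).
  { rewrite <- (Rpower_O t) at 1 by lra. apply Rle_Rpower; [lra | apply ez_pos; lra]. }
  assert (G : x <= INR b * x + (1 - INR b) / 2) by nra.
  destruct (Rle_dec (INR b * x + (1 - INR b) / 2) (9 / 8)) as [C|C].
  - eapply Rle_trans; [apply zeta_bound; [lra | nra]|]. apply Rmult_le_compat_l; [lra|].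
    set (y := INR b * x + (1 - INR b) / 2) in *.
    rewrite <- Rpower_mult_distr by lra. apply Rmult_le_compat; try (left; apply Rpower_pos).
    + rewrite <- (Rpower_1 (INR b)) at 2 by lra. apply Rle_Rpower; auto.
      pose proof (ez_max y ltac:(lra)). lra.
    + apply Rle_Rpower; [lra|]. now apply ez_mono.
  - eapply Rle_trans; [apply Zx_right_bound; simpl; lra|].
    apply Rle_trans with (26000 * (1 * 1)); [lra|]. apply Rmult_le_compat_l; [lra|].
    apply Rmult_le_compat; lra.
Qed.

Lemma fb_bound b x t : (0 < b)%nat -> 1 / 2 <= x <= 9 / 8 -> 4 <= t ->
  Cmod (fb b (Cpt x t)) <= 26000 ^ 3 * INR b * Rpower t (3 / 4).
Proof.
  intros Hb Hx Ht. unfold fb. rewrite !Cmod_mult, one_minus_Cpt, Cmod_Zx_reflect by lra.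
  pose proof (zeta_bound (1 - x) t ltac:(lra) Ht) as B1. pose proof (zeta_bound x t ltac:(lra) Ht) as B2.
  pose proof (third_bound b x t Hb Hx Ht) as B3.
  assert (E : Rpower t (3 / 4) = Rpower t (ez (1 - x)) * Rpower t (ez x) * Rpower t (ez x)).
  { rewrite <- !Rpower_plus. f_equal. unfold ez. rewrite (Rmax_left (5 / 8 - 3 * (1 - x) / 4)) by lra.
    rewrite Rmax_right by lra. field. }
  rewrite E.
  replace (26000 ^ 3 * INR b * (Rpower t (ez (1 - x)) * Rpower t (ez x) * Rpower t (ez x)))
   with ((26000 * Rpower t (ez (1 - x))) * (26000 * Rpower t (ez x)) * (26000 * (INR b * Rpower t (ez x)))) by ring.
  apply Rmult_le_compat; auto using Cmod_ge_0.
  - apply Rmult_le_pos; apply Cmod_ge_0.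
  - apply Rmult_le_compat; auto using Cmod_ge_0.
Qed.

Lemma fb_shift b T : (0 < b)%nat -> 4 <= T ->
  Cmod (CI (fun t => fb b (Cpt (1 / 2) t)) 4 T - CI (fun t => fb b (Cpt c0 t)) 4 T)%C
   <= 2 * 26000 ^ 3 * INR b * Rpower T (3 / 4).
Proof.
  intros Hb HT. pose proof (INR_ge_1 b Hb) as b1.
  (* The abscissa of the third factor moves [b] times as fast, so a margin of [1 / (2 b)] to the
     left of 1/2 keeps its real part positive. *)
  set (r := / (2 * INR b)). assert (r0 : 0 < r) by (apply Rinv_0_lt_compat; lra).
  assert (rb : INR b * r = 1 / 2) by (unfold r; field; lra).
  assert (r1 : r <= 1 / 2) by nra.
  pose proof (Cauchy_holo _ _ (1 / 2) c0 4 T r (holo_fb b) ltac:(unfold c0; lra) HT r0) as Cau.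
  assert (Cau' := Cau ltac:(unfold c0; intros x y Hx Hy; apply fdom_Cpt; auto; [lra | nra | lra])). clear Cau.
  apply (f_equal Cmod) in Cau'. rewrite Cmod_mult, Cmod_Ci, Rmult_1_l in Cau'.
  rewrite Cmod_minus_sym, Cau'.
  assert (B : forall t, 4 <= t <= T ->
     Cmod (CI (fun u => fb b (Cpt u t)) (1 / 2) c0) <= 26000 ^ 3 * INR b * Rpower T (3 / 4)).
  { intros t Ht. assert (V : Rpower t (3 / 4) <= Rpower T (3 / 4)) by (apply Rpower_le_base; lra).
    eapply Rle_trans; [apply (CI_norm_const _ (26000 ^ 3 * INR b * Rpower T (3 / 4)))|].
    - unfold c0; lra.
    - apply exCI_cont; [unfold c0; lra|]. intros u Hu. unfold c0 in Hu.
      apply (holo_ccont_hor (fdom b)); [apply holo_fb|]. apply fdom_Cpt; auto; [lra | nra | lra].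
    - intros u Hu. unfold c0 in Hu. eapply Rle_trans; [apply fb_bound; auto; lra|].
      apply Rmult_le_compat_l; [lra | exact V].
    - rewrite <- (Rmult_1_r (26000 ^ 3 * INR b * Rpower T (3 / 4))) at 2. apply Rmult_le_compat_l.
      + apply Rmult_le_pos; [lra | left; apply Rpower_pos].
      + unfold c0; lra. }
  eapply Rle_trans; [apply Cmod_minus_le|]. pose proof (B T ltac:(lra)). pose proof (B 4 ltac:(lra)). lra.
Qed.

(** * The weighted list of triples *)

Fixpoint lprod (la lb : wlist) : wlist :=
  match la with
  | nil => nil
  | (w, n) :: r => map (fun p => (w * fst p, (n * snd p)%nat)) lb ++ lprod r lb
  end.

Lemma lsum_app F la lb : lsum F (la ++ lb) = lsum F la + lsum F lb.
Proof. induction la as [|[w n] la IH]; simpl; [ring|]. rewrite IH. ring. Qed.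

Lemma lsum_lprod F la lb : lsum F (lprod la lb) = lsum (fun n => lsum (fun m => F (n * m)%nat) lb) la.
Proof.
  induction la as [|[w n] la IH]; simpl; auto. rewrite lsum_app, IH. f_equal.
  clear IH. induction lb as [|[v m] lb IHb]; simpl; [ring|]. rewrite IHb. ring.
Qed.

Lemma lpos_lprod la lb : lpos la -> lpos lb -> lpos (lprod la lb).
Proof.
  intros Ha Hb. induction la as [|[w n] la IH]; simpl; [intros ? ? []|].
  destruct (lpos_cons _ _ _ Ha) as [[W N] L]. intros v m Hin. apply in_app_or in Hin. destruct Hin as [Hin|Hin].
  - apply in_map_iff in Hin. destruct Hin as ([v' m'] & E & Hin). injection E as <- <-. simpl.
    destruct (Hb _ _ Hin). split; [now apply Rmult_le_pos | lia].
  - now apply IH.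
Qed.

Lemma Dir_lprod la lb s : lpos la -> lpos lb -> Dir (lprod la lb) s = (Dir la s * Dir lb s)%C.
Proof.
  intros Ha Hb. induction la as [|[w n] la IH]; simpl; [ring|].
  destruct (lpos_cons _ _ _ Ha) as [[W N] L].
  assert (A : forall u v, Dir (u ++ v) s = (Dir u s + Dir v s)%C).
  { intros u v. induction u as [|[x k] u IHu]; simpl; [ring|]. rewrite IHu. ring. }
  assert (M : Dir (map (fun p => (w * fst p, (n * snd p)%nat)) lb) s = (RtoC w * Rpower_C (INR n) (- s) * Dir lb s)%C).
  { clear - Hb N. induction lb as [|[v m] lb IHb]; cbn [map Dir]; [ring|].
    destruct (lpos_cons _ _ _ Hb) as [[V M] L]. rewrite IHb by auto. cbn [fst snd].
    rewrite mult_INR, Rpower_C_mult, RtoC_mult by (apply lt_0_INR; lia). ring. }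
  rewrite A, M, IH by auto. ring.
Qed.

(** Weighted by [k^((b-1)/2)], the numbers [k^b] have the Dirichlet series [zeta(bs + (1-b)/2)]. *)
Definition lb (b Y : nat) : wlist := wl (fun k => Rpower (INR k) ((INR b - 1) / 2)) (fun k => (k ^ b)%nat) Y.
Definition l3 (b Y : nat) : wlist := lprod (lb b Y) (lprod (l1 Y) (l1 Y)).

Lemma lpos_lb b Y : lpos (lb b Y).
Proof. apply lpos_wl. intros k Hk. split; [left; apply Rpower_pos|]. pose proof (Nat.pow_nonzero k b). lia. Qed.

Lemma lpos_l3 b Y : lpos (l3 b Y).
Proof. apply lpos_lprod; [apply lpos_lb | apply lpos_lprod; apply lpos_l1]. Qed.

Lemma ln_pow_INR k b : (0 < k)%nat -> ln (INR (k ^ b)) = INR b * ln (INR k).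
Proof.
  intros Hk. assert (0 < INR k) by (apply lt_0_INR; lia). induction b as [|b IH].
  - simpl. rewrite ln_1. ring.
  - rewrite Nat.pow_succ_r', mult_INR, ln_mult, IH, S_INR; auto; [ring|].
    apply lt_0_INR. pose proof (Nat.pow_nonzero k b). lia.
Qed.

Lemma Dir_lb b Y s : Dir (lb b Y) s = zsum (third b s) Y.
Proof.
  unfold lb. rewrite Dir_wl. apply Csum_ext. intros k _. unfold Rpower.
  rewrite <- Cexp_RtoC. unfold Rpower_C. rewrite <- Cexp_plus. f_equal.
  rewrite ln_pow_INR by lia. unfold third. apply Ceq; simpl; field.
Qed.

Lemma Dir_l3_rate b Y s : (0 < b)%nat -> (0 < Y)%nat -> Re s = 9 / 8 ->
  Cmod (Dir (l3 b Y) s - Zx s * Zx s * Zx (third b s))%C <= 10000 * Rpower (INR Y) (- (1 / 8)).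
Proof.
  intros Hb HY Hs. pose proof (INR_ge_1 b Hb) as b1. unfold l3.
  rewrite !Dir_lprod by auto using lpos_lb, lpos_l1, lpos_lprod. rewrite Dir_lb, Dir_l1.
  assert (H3 : 9 / 8 <= Re (third b s)) by (unfold third; creim; rewrite Hs; lra).
  pose proof (zsum_rate s Y ltac:(lra) HY) as A1. pose proof (zsum_rate _ Y H3 HY) as A2.
  pose proof (Zx_right_bound s ltac:(lra)) as B1. pose proof (Zx_right_bound _ H3) as B2.
  set (q := Rpower (INR Y) (- (1 / 8))) in *. assert (q0 : 0 < q) by apply Rpower_pos.
  assert (q1 : q <= 1) by (apply Rpower_le_1; [now apply INR_ge_1 | lra]).
  set (x := zsum s Y) in *. set (y := zsum (third b s) Y) in *. set (X := Zx s) in *. set (Z := Zx (third b s)) in *.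
  assert (Bx : Cmod x <= 17).
  { replace x with ((x - X) + X)%C by ring. eapply Rle_trans; [apply Cmod_triangle|]. lra. }
  replace (y * (x * x) - X * X * Z)%C with ((y - Z) * (x * x) + Z * ((x - X) * (x + X)))%C by ring.
  eapply Rle_trans; [apply Cmod_triangle|]. rewrite !Cmod_mult.
  assert (Bs : Cmod (x + X)%C <= 26) by (eapply Rle_trans; [apply Cmod_triangle|]; lra).
  apply Rle_trans with (8 * q * (17 * 17) + 9 * (8 * q * 26)); [|lra].
  apply Rplus_le_compat; repeat (apply Rmult_le_compat; auto using Cmod_ge_0, Rmult_le_pos).
Qed.

Lemma Rpower_98_mult n m : (0 < n)%nat -> (0 < m)%nat ->
  Rpower (INR (n * m)) (- (9 / 8)) = Rpower (INR n) (- (9 / 8)) * Rpower (INR m) (- (9 / 8)).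
Proof. intros. rewrite mult_INR, Rpower_mult_distr; auto; apply lt_0_INR; lia. Qed.

Lemma lsum_98_lprod la lb : lpos la -> lpos lb ->
  lsum (fun n => Rpower (INR n) (- (9 / 8))) (lprod la lb) =
  lsum (fun n => Rpower (INR n) (- (9 / 8))) la * lsum (fun n => Rpower (INR n) (- (9 / 8))) lb.
Proof.
  intros Ha Hb. rewrite lsum_lprod.
  rewrite (lsum_ext _ (fun n => lsum (fun m => Rpower (INR m) (- (9 / 8))) lb * Rpower (INR n) (- (9 / 8)))); auto.
  - rewrite lsum_scal. ring.
  - intros n Hn. rewrite <- (Rmult_comm (Rpower (INR n) _)), <- lsum_scal. apply lsum_ext; auto.
    intros m Hm. now apply Rpower_98_mult.
Qed.

Lemma lsum_98_l1 Y : lsum (fun n => Rpower (INR n) (- (9 / 8))) (l1 Y) <= 9.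
Proof.
  unfold l1. rewrite lsum_wl. pose proof (sum_neg_le (1 / 8) Y ltac:(lra)).
  rewrite (Rsum_ext _ (fun k => Rpower (INR (S k)) (- (1 + 1 / 8)))); [lra|].
  intros; rewrite Rmult_1_l; f_equal; field.
Qed.

Lemma lsum_98_l3 b Y : (0 < b)%nat -> lsum (fun n => Rpower (INR n) (- (9 / 8))) (l3 b Y) <= 729.
Proof.
  intros Hb. pose proof (INR_ge_1 b Hb) as b1. unfold l3.
  rewrite !lsum_98_lprod by auto using lpos_lb, lpos_l1, lpos_lprod.
  pose proof (lsum_98_l1 Y) as A.
  assert (A0 : forall l, lpos l -> 0 <= lsum (fun n => Rpower (INR n) (- (9 / 8))) l).
  { intros l Hl. apply lsum_nonneg; auto. intros; left; apply Rpower_pos. }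
  pose proof (A0 _ (lpos_l1 Y)). pose proof (A0 _ (lpos_lb b Y)).
  assert (B : lsum (fun n => Rpower (INR n) (- (9 / 8))) (lb b Y) <= 9).
  { unfold lb. rewrite lsum_wl. pose proof (sum_neg_le (1 / 8) Y ltac:(lra)).
    eapply Rle_trans; [apply (Rsum_le _ (fun k => Rpower (INR (S k)) (- (1 + 1 / 8))))|lra].
    intros k _. unfold Rpower at 2. rewrite ln_pow_INR by lia.
    unfold Rpower. rewrite <- exp_plus. apply exp_le.
    assert (0 <= ln (INR (S k))).
    { rewrite <- ln_1. apply ln_le; [lra|]. apply INR_ge_1; lia. } nra. }
  replace 729 with (9 * (9 * 9)) by ring. apply Rmult_le_compat; auto; [nra|]. apply Rmult_le_compat; auto.
Qed.

(** The coefficients [p], [q], [r] may depend on the truncation [N], because cutting the sum over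
    [k] leaves partial sums of zeta values in them; only the value of the main term at [T / (2 pi)]
    has to converge. The error [E] must hold uniformly in [N], and [C] depends on neither. *)
Lemma fb_asymp b K : (0 < b)%nat -> 1 <= K -> exists C, 0 <= C /\
  forall T E (p q r : nat -> R) M, 20 <= T -> 0 <= E ->
  (forall N, Rabs (p N) <= K /\ Rabs (q N) <= K /\ Rabs (r N) <= K) ->
  (forall N x, 1 <= x <= 2 * (T / (2 * PI)) -> 2 * (T / (2 * PI)) <= INR N ->
     Rabs (Sl (l3 b N) x - Pm (p N) (q N) (r N) x) <= E) ->
  clim (fun N => RtoC (Pm (p N) (q N) (r N) (T / (2 * PI)))) (RtoC M) ->
  Cmod (CI (fun t => fb b (Cpt (1 / 2) t)) 4 T - RtoC (2 * PI * M))%C <= C * (Rpower T (3 / 4) + E).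
Proof.
  intros Hb HK. pose proof (INR_ge_1 b Hb) as b1. pose proof PI2_3_2 as P. pose proof PI_4 as P4.
  set (K' := 729 * K).
  set (C := 2 * 26000 ^ 3 * INR b + (4000000000 * K' + 5000000000000 * (4225 * K + 1) + 8)).
  assert (C1 : 0 <= 2 * 26000 ^ 3 * INR b) by lra.
  exists C. split; [unfold C, K'; lra|]. intros T E p q r M HT HE HB HS HM.
  set (X := T / (2 * PI)) in *. assert (TX : T = 2 * PI * X) by (unfold X; field; lra).
  assert (HX : 2 <= X) by (unfold X; apply le_div_mul; lra). assert (XT : X <= T) by (rewrite TX; nra).
  set (V := Rpower T (3 / 4)). set (J := CI (fun t => fb b (Cpt c0 t)) 4 T).
  pose proof (fb_shift b T Hb ltac:(lra)) as Sh. fold V J in Sh.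
  assert (lim : clim (fun N => CI (fun t => EE (l3 b N) (Cpt c0 t)) 4 T) J).
  { unfold J. rewrite (CI_ext _ (fun t => (Em 1 (Cpt c0 t) + Em (-1) (Cpt c0 t)) * Rpower_C (2 * PI) (- Cpt c0 t)
      * (Zx (Cpt c0 t) * Zx (Cpt c0 t) * Zx (third b (Cpt c0 t))))%C)
      by (try lra; intros; unfold fb; rewrite FE_line; ring).
    apply (CI_EE_clim (l3 b) (fun s => Zx s * Zx s * Zx (third b s))%C 10000); [lra | apply lpos_l3 | |].
    - intros t Ht. apply (holo_ccont_line (fdom b) (fun s => Zx s * Zx s * Zx (third b s))%C).
      + apply holo_mult; [apply holo_mult; apply (holo_weaken Zdom); auto using holo_Zx; intros s H; apply H|].
        apply (holo_weaken (fun s => Zdom (third b s))); [intros s H; apply H|].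
        apply (holo_affine Zdom Zx), holo_Zx.
      + apply fdom_Cpt; auto; unfold c0; lra.
    - intros N t HN _. apply Dir_l3_rate; auto. }
  assert (B : Cmod (J - RtoC (2 * PI * M))%C <= (4000000000 * K' + 5000000000000 * (4225 * K + 1) + 8) * (V + E)).
  { replace (J - RtoC (2 * PI * M))%C with ((J + RtoC (- (2 * PI)) * RtoC M) - RtoC 0)%C
      by (rewrite (RtoC_mult (2 * PI)), RtoC_opp; ring).
    apply (clim_bound (fun N => CI (fun t => EE (l3 b N) (Cpt c0 t)) 4 T
       + RtoC (- (2 * PI)) * RtoC (Pm (p N) (q N) (r N) X))%C).
    { apply clim_plus; [exact lim|]. apply clim_mult; [apply clim_const | exact HM]. }
    destruct (INR_unbounded (2 * X)) as [N1 HN1]. exists N1. intros N HN. apply le_INR in HN.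
    destruct (HB N) as (Hp & Hq & Hr).
    pose proof (CI_EE_asymp (l3 b N) T K' E (p N) (q N) (r N) (lpos_l3 b N) HT ltac:(unfold K'; lra) HE
      ltac:(eapply Rle_trans; [now apply lsum_98_l3 | unfold K'; lra])
      ltac:(unfold K'; lra) ltac:(unfold K'; lra) ltac:(unfold K'; lra)
      ltac:(intros x Hx; apply HS; [exact Hx | fold X; lra])) as A. fold X in A.
    pose proof (Mmain_asymp T HT) as Mm. pose proof (HS N X ltac:(lra) ltac:(lra)) as SX.
    pose proof (Sl_nonneg (l3 b N) X (lpos_l3 b N)) as S0.
    set (I := CI (fun t => EE (l3 b N) (Cpt c0 t)) 4 T) in *. set (Sv := Sl (l3 b N) X) in *.
    set (Pv := Pm (p N) (q N) (r N) X) in *.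
    replace (I + RtoC (- (2 * PI)) * RtoC Pv - RtoC 0)%C with
      ((I - Mmain T * RtoC Sv) + (Mmain T - RtoC (2 * PI)) * RtoC Sv + RtoC (2 * PI) * RtoC (Sv - Pv))%C
      by (rewrite RtoC_minus, RtoC_opp; ring).
    eapply Rle_trans; [apply Cmod_triangle|]. eapply Rle_trans; [apply Rplus_le_compat_r, Cmod_triangle|].
    rewrite !Cmod_mult, (Cmod_RtoC_pos (2 * PI)), (Cmod_RtoC_pos Sv), (Cmod_R (Sv - Pv)) by lra.
    set (w := Rpower T (- (9 / 32))) in *. assert (w0 : 0 < w) by apply Rpower_pos.
    assert (w1 : w <= 1) by (apply Rpower_le_1; lra).
    (* The squared logarithm is absorbed by [1 + ln X <= 65 X^(1/64)], with [4225 = 65^2]. The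
       exponent 33/32 is what the error [T^(-9/32)] of [Mmain] tolerates. *)
    assert (SvB : Sv <= 4225 * K * Rpower T (33 / 32) + E).
    { apply Rabs_le_between in SX.
      assert (Pv <= X * (K * (1 + ln X) ^ 2)).
      { unfold Pv, Pm. apply Rmult_le_compat_l; [lra|].
        assert (l0 : 0 <= ln X) by (rewrite <- ln_1; apply ln_le; lra).
        apply Rabs_le_between in Hp. apply Rabs_le_between in Hq. apply Rabs_le_between in Hr.
        assert (p N * ln X ^ 2 <= K * ln X ^ 2) by (apply Rmult_le_compat_r; [apply pow2_ge_0 | lra]). nra. }
      assert (L : (1 + ln X) ^ 2 <= 4225 * Rpower X (1 / 32)).
      { pose proof (ln_le_Rpower X (1 / 64) ltac:(lra) ltac:(lra)) as Lx. replace (/ (1 / 64)) with 64 in Lx by field.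
        assert (1 <= Rpower X (1 / 64)) by (rewrite <- (Rpower_O X) at 1 by lra; apply Rle_Rpower; lra).
        replace (Rpower X (1 / 32)) with (Rpower X (1 / 64) * Rpower X (1 / 64)) by (rewrite <- Rpower_plus; f_equal; field).
        assert (l0 : 0 <= ln X) by (rewrite <- ln_1; apply ln_le; lra). nra. }
      assert (G : X * (K * (1 + ln X) ^ 2) <= 4225 * K * Rpower T (33 / 32)).
      { replace (Rpower T (33 / 32)) with (T * Rpower T (1 / 32)).
        - assert (Rpower X (1 / 32) <= Rpower T (1 / 32)) by (apply Rpower_le_base; lra).
          pose proof (Rpower_pos T (1 / 32)). replace (4225 * K * (T * Rpower T (1 / 32))) with
            (T * (K * (4225 * Rpower T (1 / 32)))) by ring.
          apply Rmult_le_compat; [lra | | lra |].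
          + apply Rmult_le_pos; [lra | apply pow2_ge_0].
          + apply Rmult_le_compat_l; lra.
        - rewrite <- (Rpower_1 T) at 1 by lra. rewrite <- Rpower_plus. f_equal. field. }
      lra. }
    assert (VE : w * Rpower T (33 / 32) = V) by (unfold w, V; rewrite <- Rpower_plus; f_equal; field).
    assert (V0 : 0 < V) by apply Rpower_pos.
    assert (T1 : Cmod (Mmain T - RtoC (2 * PI)) * Sv <= 5000000000000 * (4225 * K + 1) * (V + E)).
    { apply Rle_trans with (5000000000000 * w * (4225 * K * Rpower T (33 / 32) + E)).
      - apply Rmult_le_compat; auto using Cmod_ge_0.
      - replace (5000000000000 * w * (4225 * K * Rpower T (33 / 32) + E)) with
          (5000000000000 * (4225 * K * (w * Rpower T (33 / 32)) + w * E)) by ring. rewrite VE.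
        assert (w * E <= E) by nra. assert (0 <= K * E) by nra. assert (0 <= K * V) by nra. lra. }
    assert (T2 : 2 * PI * Rabs (Sv - Pv) <= 8 * (V + E)).
    { apply Rle_trans with (8 * E); [apply Rmult_le_compat; try lra; apply Rabs_pos | lra]. }
    assert (T3 : 4000000000 * K' * (Rpower T (23 / 32) + E) <= 4000000000 * K' * (V + E)).
    { apply Rmult_le_compat_l; [unfold K'; lra|]. apply Rplus_le_compat_r. apply Rle_Rpower; lra. }
    lra. }
  replace (CI (fun t => fb b (Cpt (1 / 2) t)) 4 T - RtoC (2 * PI * M))%C with
    ((CI (fun t => fb b (Cpt (1 / 2) t)) 4 T - J) + (J - RtoC (2 * PI * M)))%C by ring.
  eapply Rle_trans; [apply Cmod_triangle|]. unfold C. 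
  assert (0 <= 2 * 26000 ^ 3 * INR b * E) by (apply Rmult_le_pos; lra). lra.
Qed.

(** The range from 0 to 4 contributes a constant: none of the three factors has its pole on the line
    [Re s = 1/2], so [fb] is continuous there down to height 0. *)
Lemma zeta_integral_fb zeta b : is_riemann_zeta zeta -> (0 < b)%nat ->
  exists C, 0 <= C /\ forall T M, 4 <= T ->
  Cmod (zeta_integral zeta 1 (INR b) 1 T - RtoC M)%C <=
    Cmod (CI (fun t => fb b (Cpt (1 / 2) t)) 4 T - RtoC M)%C + C.
Proof.
  intros Hz Hb. pose proof (INR_ge_1 b Hb) as b1.
  set (F := fun t => fb b (Cpt (1 / 2) t)).
  exists (Cmod (CI F 0 4)). split; [apply Cmod_ge_0|]. intros T M HT.
  assert (ne : forall x t, x <> 1 -> Cpt x t <> RtoC 1) by (intros x t H E; apply (f_equal fst) in E; simpl in E; lra).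
  assert (ex : forall u v, u <= v -> exCI F u v).
  { intros u v Huv. apply exCI_cont; auto. intros t _. apply (holo_ccont_line (fdom b)); [apply holo_fb|].
    split; [|split].
    - replace (- (1) * Cpt (1 / 2) t + 1)%C with (Cpt (1 / 2) (- t)) by (apply Ceq; simpl; field).
      split; [simpl; lra | apply ne; lra].
    - split; [simpl; lra | apply ne; lra].
    - rewrite third_Cpt. split; [simpl; lra | apply ne; lra]. }
  set (f := fun t : R => (zeta (RtoC (1 / 2) + Ci * RtoC (1 * t)) * zeta (RtoC (1 / 2) - Ci * RtoC (INR b * t))
     * zeta (RtoC (1 / 2) - Ci * RtoC (1 * t)))%C).
  (* Only [t > 0] is covered, since [zeta] is identified with [Zx] off the real axis; the end point
     does not affect the integral. *)
  assert (E : forall t, 0 < t < T -> Cconj (F t) = f t).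
  { intros t Ht. unfold F, f, fb. rewrite third_Cpt, one_minus_Cpt, !Cmult_conj.
    rewrite <- !Zx_conj by (try (simpl; lra); apply ne; lra).
    rewrite !(zeta_Zx zeta); auto; try (simpl; lra).
    - replace (Cconj (Cpt (1 - 1 / 2) (- t))) with (RtoC (1 / 2) + Ci * RtoC (1 * t))%C by (apply Ceq; simpl; field).
      replace (Cconj (Cpt (1 / 2) t)) with (RtoC (1 / 2) - Ci * RtoC (1 * t))%C by (apply Ceq; simpl; field).
      replace (Cconj (Cpt (INR b * (1 / 2) + (1 - INR b) / 2) (INR b * t))) with
        (RtoC (1 / 2) - Ci * RtoC (INR b * t))%C by (apply Ceq; simpl; field). ring.
    - simpl. nra. }
  assert (exc : exCI (fun t => Cconj (F t)) 0 T).
  { destruct (ex 0 T ltac:(lra)) as [A B]. split; [exact A|].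
    apply (ex_RInt_ext (fun t => - (1) * Im (F t))); [intros; unfold Im; simpl; ring | now apply ex_RInt_Rscal]. }
  assert (exf : exCI f 0 T) by (apply exCI_ext with (fun t => Cconj (F t)); auto; lra).
  unfold zeta_integral. fold f. rewrite CI_RInt by exact exf.
  rewrite <- (CI_ext _ _ 0 T ltac:(lra) E), CI_conj by (apply ex; lra).
  rewrite <- (CI_Chasles F 0 4 T) by (apply ex; lra).
  rewrite <- (Cmod_conj (Cconj _ - _)), Cminus_conj, Cconj_conj.
  replace (Cconj (RtoC M)) with (RtoC M) by (apply Ceq; simpl; ring).
  replace (CI F 0 4 + CI F 4 T - RtoC M)%C with ((CI F 4 T - RtoC M) + CI F 0 4)%C by ring.
  apply Cmod_triangle.
Qed.

(** * Laurent coefficients of zeta at 1 *)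

Definition gb1 (u : R) : C := (RtoC (- u) * gb u)%C.
Definition gb2 (u : R) : C := (RtoC (- u) * gb1 u)%C.
(** Writing [zeta s = 1/(s-1) + F s], these are [F 1] and [- F' 1]. *)
Definition gam : R := 1 / 2 - 2 * Re (Lap gb (RtoC 2)).
Definition stj : R := 3 * Re (Lap gb (RtoC 2)) + 2 * Re (Lap gb1 (RtoC 2)).

Lemma lapdom_gb1 d : 0 < d -> lapdom gb1 (1 / 8 / d) (0 + d).
Proof. intros Hd. apply lapdom_mul_u; auto using lapdom_gb. Qed.

Lemma lapdom_gb2 d : 0 < d -> lapdom gb2 (1 / 8 / d / d) (0 + d + d).
Proof. intros Hd. apply lapdom_mul_u; auto using lapdom_gb1. Qed.

Lemma Lap_real g p : (forall u, Im (lint g p u) = 0) -> Im (Lap g p) = 0.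
Proof.
  intros H. unfold Lap, Im. cbn [snd].
  rewrite (Lim_seq_ext _ (fun _ => 0)); [now rewrite Lim_seq_const|].
  intros n. unfold CI. cbn [snd]. rewrite (RInt_ext _ (fun _ => 0)) by (intros; apply H).
  rewrite RInt_const. unfold scal; simpl; unfold mult; simpl. ring.
Qed.

Lemma lint_gb_2 u : lint gb (RtoC 2) u = RtoC (exp (- (2 * u)) * bt (exp u)).
Proof. unfold lint, gb. rewrite RtoC_mult, <- Cexp_RtoC, RtoC_opp, RtoC_mult. reflexivity. Qed.

Lemma lint_gb1_2 u : lint gb1 (RtoC 2) u = RtoC (- u * (exp (- (2 * u)) * bt (exp u))).
Proof.
  unfold lint, gb1, gb. rewrite !RtoC_mult, <- Cexp_RtoC, RtoC_opp, RtoC_opp, RtoC_mult. ring.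
Qed.

Lemma bt_exp_poly n u : (0 < n)%nat -> ln (INR n) < u < ln (INR (S n)) ->
  exp (- (2 * u)) * bt (exp u) =
  / 2 * (1 - (2 * INR n + 1) * exp (- u) + INR n * (INR n + 1) * exp (- (2 * u))).
Proof.
  intros Hn Hu. assert (n0 : 0 < INR n) by (apply lt_0_INR; lia).
  assert (B : INR n <= exp u <= INR n + 1).
  { rewrite <- S_INR, <- (exp_ln (INR n)), <- (exp_ln (INR (S n))) by (apply lt_0_INR; lia).
    split; apply exp_le; lra. }
  rewrite (bt_unit (Z.of_nat n)) by (rewrite <- INR_IZR_INZ; exact B). rewrite <- INR_IZR_INZ.
  rewrite !exp_Ropp. replace (exp (2 * u)) with (exp u * exp u) by (rewrite <- exp_plus; f_equal; ring).
  pose proof (exp_pos u). field. lra.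
Qed.

(** [EM_sum] divides by [1 - s], so at [s = 1] the two integrals behind [gam] and [stj] are
    evaluated directly: on each unit interval [bt] is quadratic and both integrands have elementary
    primitives. *)
Lemma RInt_gb_unit n : (0 < n)%nat ->
  ex_RInt (fun u => exp (- (2 * u)) * bt (exp u)) (ln (INR n)) (ln (INR (S n))) /\
  @eq R (RInt (fun u => exp (- (2 * u)) * bt (exp u)) (ln (INR n)) (ln (INR (S n))))
   (/ 2 * (ln (INR (S n)) - ln (INR n)) - / 4 * (/ INR n + / INR (S n))) /\
  ex_RInt (fun u => - u * (exp (- (2 * u)) * bt (exp u))) (ln (INR n)) (ln (INR (S n))) /\
  @eq R (RInt (fun u => - u * (exp (- (2 * u)) * bt (exp u))) (ln (INR n)) (ln (INR (S n))))
   (- / 2 * (/ 2 * (ln (INR (S n)) ^ 2 - ln (INR n) ^ 2) + 3 / 2 * (ln (INR (S n)) - ln (INR n))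
      - / 2 * (ln (INR (S n)) / INR (S n) + ln (INR n) / INR n) - 3 / 4 * (/ INR n + / INR (S n)))).
Proof.
  intros Hn. assert (n0 : 0 < INR n) by (apply lt_0_INR; lia).
  assert (L : ln (INR n) <= ln (INR (S n))) by (apply ln_le; [lra | apply le_INR; lia]).
  assert (En : exp (- ln (INR n)) = / INR n) by (rewrite exp_Ropp, exp_ln; auto).
  assert (Em : exp (- ln (INR (S n))) = / INR (S n)) by (rewrite exp_Ropp, exp_ln; auto; apply lt_0_INR; lia).
  assert (En2 : exp (- (2 * ln (INR n))) = / INR n * / INR n).
  { rewrite <- En, <- exp_plus. f_equal. ring. }
  assert (Em2 : exp (- (2 * ln (INR (S n)))) = / INR (S n) * / INR (S n)).
  { rewrite <- Em, <- exp_plus. f_equal. ring. }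
  assert (C0 : forall x, continuous (fun u => exp (- (2 * u)) * bt (exp u)) x).
  { intros x. apply (continuous_mult (fun u => exp (- (2 * u))) (fun u => bt (exp u))).
    - apply (ex_derive_continuous (V := R_NormedModule)). auto_derive; auto.
    - apply continuous_comp; [apply continuous_exp | apply continuous_bt]. }
  assert (C1 : forall x, continuous (fun u => - u * (exp (- (2 * u)) * bt (exp u))) x).
  { intros x. apply (continuous_mult (fun u => - u) (fun u => exp (- (2 * u)) * bt (exp u))); auto.
    apply (ex_derive_continuous (V := R_NormedModule)). auto_derive; auto. }
  repeat split.
  - apply ex_RInt_cont; auto.
  - rewrite (RInt_ext _ (fun u => / 2 * (1 - (2 * INR n + 1) * exp (- u) + INR n * (INR n + 1) * exp (- (2 * u))))).
    2:{ intros u. rewrite Rmin_left, Rmax_right by auto. intros Hu. now apply bt_exp_poly. }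
    rewrite (RInt_FTC (fun u => / 2 * (u + (2 * INR n + 1) * exp (- u) - INR n * (INR n + 1) / 2 * exp (- (2 * u))))); auto.
    + rewrite En, Em, En2, Em2, S_INR. field. lra.
    + intros u _. generalize (INR n). intros N. auto_derive; auto. field.
    + intros u _. generalize (INR n). intros N. apply (ex_derive_continuous (V := R_NormedModule)). auto_derive; auto.
  - apply ex_RInt_cont; auto.
  - rewrite (RInt_ext _ (fun u => - u * (/ 2 * (1 - (2 * INR n + 1) * exp (- u) + INR n * (INR n + 1) * exp (- (2 * u)))))).
    2:{ intros u. rewrite Rmin_left, Rmax_right by auto. intros Hu. f_equal. now apply bt_exp_poly. }
    rewrite (RInt_FTC (fun u => - / 2 * (u ^ 2 / 2 + (2 * INR n + 1) * ((u + 1) * exp (- u))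
       - INR n * (INR n + 1) * ((u / 2 + / 4) * exp (- (2 * u)))))); auto.
    + rewrite En, Em, En2, Em2, S_INR. field. lra.
    + intros u _. generalize (INR n). intros N. auto_derive; auto. field.
    + intros u _. generalize (INR n). intros N. apply (ex_derive_continuous (V := R_NormedModule)). auto_derive; auto.
Qed.

(** * Harmonic sums and the Euler and Stieltjes constants *)

Definition harm (N : nat) : R := Rsum (fun k => / INR (S k)) N.
Definition lharm (N : nat) : R := Rsum (fun k => ln (INR (S k)) / INR (S k)) N.

Lemma RInt_gb_sum N : (0 < N)%nat ->
  ex_RInt (fun u => exp (- (2 * u)) * bt (exp u)) 0 (ln (INR N)) /\
  @eq R (RInt (fun u => exp (- (2 * u)) * bt (exp u)) 0 (ln (INR N)))
    (/ 2 * ln (INR N) - / 2 * harm N + / 4 + / 4 * / INR N) /\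
  ex_RInt (fun u => - u * (exp (- (2 * u)) * bt (exp u))) 0 (ln (INR N)) /\
  @eq R (RInt (fun u => - u * (exp (- (2 * u)) * bt (exp u))) 0 (ln (INR N)))
    (- / 2 * (/ 2 * ln (INR N) ^ 2 + 3 / 2 * ln (INR N) - lharm N + / 2 * (ln (INR N) / INR N)
      - 3 / 2 * harm N + 3 / 4 + 3 / 4 * / INR N)).
Proof.
  intros HN. induction N as [|N IH]; [lia|]. destruct N as [|N].
  - unfold harm, lharm. simpl. rewrite ln_1. repeat split.
    + apply ex_RInt_point.
    + rewrite RInt_point. unfold zero; simpl. field.
    + apply ex_RInt_point.
    + rewrite RInt_point. unfold zero; simpl. field.
  - destruct (IH ltac:(lia)) as (A1 & A2 & A3 & A4). destruct (RInt_gb_unit (S N) ltac:(lia)) as (B1 & B2 & B3 & B4).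
    set (m := S (S N)) in *.
    assert (H1 : harm m = harm (S N) + / INR m) by reflexivity.
    assert (H2 : lharm m = lharm (S N) + ln (INR m) / INR m) by reflexivity.
    assert (i1 : INR m <> 0) by (apply not_0_INR; unfold m; lia).
    assert (i2 : INR (S N) <> 0) by (apply not_0_INR; lia).
    repeat split.
    + eapply ex_RInt_Chasles; eauto.
    + transitivity (RInt (fun u => exp (- (2 * u)) * bt (exp u)) 0 (ln (INR (S N))) + RInt (fun u => exp (- (2 * u)) * bt (exp u)) (ln (INR (S N))) (ln (INR m)));
       [symmetry; apply (RInt_Chasles (V := R_CompleteNormedModule)); assumption|].
      rewrite A2, B2, H1. lra.
    + eapply ex_RInt_Chasles; eauto.
    + transitivity (RInt (fun u => - u * (exp (- (2 * u)) * bt (exp u))) 0 (ln (INR (S N))) + RInt (fun u => - u * (exp (- (2 * u)) * bt (exp u))) (ln (INR (S N))) (ln (INR m)));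
       [symmetry; apply (RInt_Chasles (V := R_CompleteNormedModule)); assumption|].
      rewrite A4, B4, H1, H2. field. auto.
Qed.

Lemma Lap_gb_tails N : (0 < N)%nat ->
  Rabs (Re (Lap gb (RtoC 2)) - RInt (fun u => exp (- (2 * u)) * bt (exp u)) 0 (ln (INR N))) <= / 16 * / INR N /\
  Rabs (Re (Lap gb1 (RtoC 2)) - RInt (fun u => - u * (exp (- (2 * u)) * bt (exp u))) 0 (ln (INR N))) <= / 8 * / INR N.
Proof.
  intros HN. assert (N1 : 1 <= INR N) by now apply INR_ge_1.
  assert (L : 0 <= ln (INR N)) by (rewrite <- ln_1; apply ln_le; lra).
  assert (E : exp (- ln (INR N)) = / INR N) by (rewrite exp_Ropp, exp_ln; lra).
  assert (E2 : exp (- 2 * ln (INR N)) <= / INR N) by (rewrite <- E; apply exp_le; lra).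
  split.
  - pose proof (Lap_tail gb _ _ (RtoC 2) _ lapdom_gb ltac:(simpl; lra) L) as T.
    simpl Re in T. eapply Rle_trans; [|eapply Rle_trans; [exact T|]].
    + replace (RInt (fun u => exp (- (2 * u)) * bt (exp u)) 0 (ln (INR N))) with (Re (CI (lint gb (RtoC 2)) 0 (ln (INR N)))).
      * rewrite <- Re_minus. apply re_le_Cmod.
      * apply (RInt_ext (V := R_CompleteNormedModule)). intros u _. now rewrite lint_gb_2.
    + replace (- (2 - 0) * ln (INR N)) with (- 2 * ln (INR N)) by ring. lra.
  - pose proof (Lap_tail gb1 _ _ (RtoC 2) _ (lapdom_gb1 1 ltac:(lra)) ltac:(simpl; lra) L) as T.
    simpl Re in T. eapply Rle_trans; [|eapply Rle_trans; [exact T|]].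
    + replace (RInt (fun u => - u * (exp (- (2 * u)) * bt (exp u))) 0 (ln (INR N))) with (Re (CI (lint gb1 (RtoC 2)) 0 (ln (INR N)))).
      * rewrite <- Re_minus. apply re_le_Cmod.
      * apply (RInt_ext (V := R_CompleteNormedModule)). intros u _. now rewrite lint_gb1_2.
    + replace (- (2 - (0 + 1)) * ln (INR N)) with (- ln (INR N)) by ring. rewrite E. lra.
Qed.

Lemma harm_asymp N : (0 < N)%nat -> Rabs (harm N - ln (INR N) - gam) <= / INR N.
Proof.
  intros HN. destruct (Lap_gb_tails N HN) as [A _]. destruct (RInt_gb_sum N HN) as (_ & B & _).
  rewrite B in A. assert (0 < / INR N) by (apply Rinv_0_lt_compat, lt_0_INR; lia).
  unfold gam. apply Rabs_le_between in A. apply Rabs_le. lra.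
Qed.

Lemma lharm_asymp N : (0 < N)%nat ->
  Rabs (lharm N - / 2 * ln (INR N) ^ 2 - stj) <= (1 + ln (INR N)) * / INR N.
Proof.
  intros HN. destruct (Lap_gb_tails N HN) as [A A']. destruct (RInt_gb_sum N HN) as (_ & B & _ & B').
  rewrite B in A. rewrite B' in A'. assert (i : 0 < / INR N) by (apply Rinv_0_lt_compat, lt_0_INR; lia).
  assert (L : 0 <= ln (INR N)) by (rewrite <- ln_1; apply ln_le; [lra | now apply INR_ge_1]).
  unfold stj. apply Rabs_le_between in A. apply Rabs_le_between in A'. unfold Rdiv in *.
  assert (0 <= ln (INR N) * / INR N) by nra. apply Rabs_le. lra.
Qed.

Lemma inv_INR_lim eps : 0 < eps -> exists N, forall n, (N <= n)%nat -> / (INR n + 1) <= eps.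
Proof.
  intros He. destruct (INR_unbounded (/ eps)) as [N HN]. exists N. intros n Hn. apply le_INR in Hn.
  assert (0 < / eps) by (apply Rinv_0_lt_compat; auto).
  rewrite <- (Rinv_inv eps). apply Rinv_le_contravar; lra.
Qed.

Lemma euler_gamma_gam : euler_gamma = gam.
Proof.
  unfold euler_gamma. assert (H : is_lim_seq (fun n => sum_n_m (fun k => / INR k) 1 n - ln (INR n)) gam).
  { apply is_lim_seq_spec. intros eps. destruct (inv_INR_lim (eps / 4)) as [N HN].
    { pose proof (cond_pos eps). lra. }
    exists (S N). intros n Hn. destruct n as [|n]; [lia|].
    assert (S1 : forall m, sum_n_m (fun k => / INR k) 1 (S m) = harm (S m)).
    { induction m as [|m IH].
      - rewrite sum_n_n. unfold harm. simpl. ring.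
      - rewrite sum_n_Sm by lia. rewrite IH. reflexivity. }
    rewrite S1. eapply Rle_lt_trans; [apply harm_asymp; lia|].
    specialize (HN n ltac:(lia)). rewrite <- S_INR in HN. pose proof (cond_pos eps). lra. }
  now rewrite (is_lim_seq_unique _ _ H).
Qed.

(** Coquelicot's limit at a point is taken along [x + 1/(n+1)], so a single sequence coming from the
    right decides the value of [C_lim]. *)
Lemma C_lim_clim f z l :
  clim (fun n => f (Cpt (fst z + / (INR n + 1)) (snd z))) l -> C_lim f z = l.
Proof.
  intros H. unfold C_lim, Lim.
  assert (A : is_lim_seq (fun n => fst (f (Cpt (fst z + / (INR n + 1)) (snd z)))) (fst l)).
  { apply is_lim_seq_spec. intros eps. destruct (H (eps / 2)) as [N HN]; [pose proof (cond_pos eps); lra|].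
    exists N. intros n Hn. specialize (HN n Hn). pose proof (re_le_Cmod (f (Cpt (fst z + / (INR n + 1)) (snd z)) - l)%C).
    pose proof (cond_pos eps). simpl in H0. unfold Rminus. lra. }
  assert (B : is_lim_seq (fun n => snd (f (Cpt (fst z + / (INR n + 1)) (snd z)))) (snd l)).
  { apply is_lim_seq_spec. intros eps. destruct (H (eps / 2)) as [N HN]; [pose proof (cond_pos eps); lra|].
    exists N. intros n Hn. specialize (HN n Hn). pose proof (im_le_Cmod (f (Cpt (fst z + / (INR n + 1)) (snd z)) - l)%C).
    pose proof (cond_pos eps). simpl in H0. unfold Rminus. lra. }
  apply Ceq; simpl.
  - exact (f_equal real (is_lim_seq_unique _ _ A)).
  - exact (f_equal real (is_lim_seq_unique _ _ B)).
Qed.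

(** Agreement to the right of [z] is enough, which matters for [zeta] near 1: on the real axis it is
    identified with [Zx] only beyond 1. *)
Lemma C_derive_chol f g z l : (forall h, 0 <= h -> f (z + RtoC h)%C = g (z + RtoC h)%C) ->
  chol g z l -> C_derive f z = l.
Proof.
  intros E (M & d & HM & Hd & H). unfold C_derive. apply C_lim_clim. intros eps He.
  destruct (inv_INR_lim (Rmin (d / 2) (eps / (M + 1)))) as [N HN].
  { apply Rmin_glb_lt; [lra | apply Rdiv_lt_0_compat; lra]. }
  exists N. intros n Hn. specialize (HN n Hn). set (h := / (INR n + 1)) in *.
  assert (h0 : 0 < h) by (apply Rinv_0_lt_compat; pose proof (pos_INR n); lra).
  pose proof (Rmin_l (d / 2) (eps / (M + 1))). pose proof (Rmin_r (d / 2) (eps / (M + 1))).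
  replace (Cpt (fst z + h) (snd z)) with (z + RtoC h)%C by (apply Ceq; simpl; ring).
  pose proof (E 0 ltac:(lra)) as E0. replace (z + RtoC 0)%C with z in E0 by ring.
  rewrite E, E0 by lra. replace (z + RtoC h - z)%C with (RtoC h) by ring.
  assert (hn : RtoC h <> RtoC 0) by (intros F; apply (f_equal fst) in F; simpl in F; lra).
  replace ((g (z + RtoC h)%C - g z) / RtoC h - l)%C with ((g (z + RtoC h)%C - g z - l * RtoC h) / RtoC h)%C by (field; exact hn).
  unfold Cdiv. rewrite Cmod_mult, Cmod_inv, Cmod_RtoC_pos by (auto; lra).
  assert (B := H (RtoC h) ltac:(rewrite Cmod_RtoC_pos; lra)). rewrite Cmod_RtoC_pos in B by lra.
  apply (Rmult_le_reg_r h); auto. rewrite Rmult_assoc, Rinv_l, Rmult_1_r by lra.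
  eapply Rle_trans; [exact B|]. simpl. rewrite Rmult_1_r, <- Rmult_assoc. apply Rmult_le_compat_r; [lra|].
  apply Rle_trans with (M * (eps / (M + 1))); [apply Rmult_le_compat_l; lra|].
  replace (M * (eps / (M + 1))) with (eps * (M / (M + 1))) by (field; lra).
  assert (M / (M + 1) <= 1) by (apply div_le_mul; lra). nra.
Qed.

Section Gamma1.

Let G (s : C) : C := Lap gb (s + 1).
Let G1 (s : C) : C := Lap gb1 (s + 1).
Let G2 (s : C) : C := Lap gb2 (s + 1).
(** [(s - 1) Zx s] multiplied out, hence regular at 1; [k1] and [k2] are its first two
    derivatives. *)
Let k0 (s : C) : C := (1 + (s - 1) * (RtoC (1 / 2) - s * (s + 1) * G s))%C.
Let k1 (s : C) : C := (RtoC (1 / 2) - s * (s + 1) * G s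
  - (s - 1) * ((RtoC 2 * s + 1) * G s + s * (s + 1) * G1 s))%C.
Let k2 (s : C) : C := (- (RtoC 2) * ((RtoC 2 * s + 1) * G s + s * (s + 1) * G1 s)
  - (s - 1) * (RtoC 2 * G s + RtoC 2 * (RtoC 2 * s + 1) * G1 s + s * (s + 1) * G2 s))%C.

Lemma chol_Lap_shift g M a s : lapdom g M a -> a < Re s + 1 ->
  chol (fun s => Lap g (s + 1)) s (Lap (fun u => RtoC (- u) * g u)%C (s + 1)).
Proof.
  intros Hg Hs. apply chol_ext with (fun s => Lap g (RtoC 1 * s + 1)%C); [intros; f_equal; ring|].
  eapply chol_eq.
  - apply chol_affine. apply (Lap_chol g M a); auto. creim; lra.
  - replace (RtoC 1 * s + 1)%C with (s + 1)%C by ring. ring.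
Qed.

Lemma chol_poly1 s : chol (fun s => s * (s + 1))%C s (RtoC 2 * s + 1)%C.
Proof.
  eapply chol_eq; [apply chol_mult; [apply chol_id | apply chol_plus; [apply chol_id | apply chol_const]]|]. replace (RtoC 2) with (1 + 1)%C by (apply Ceq; simpl; ring). ring.
Qed.

Lemma chol_lin c e s : chol (fun s => c * s + e)%C s c.
Proof.
  eapply chol_eq; [apply chol_plus; [apply chol_scal, chol_id | apply chol_const]|]. ring.
Qed.

Lemma chol_m1 s : chol (fun s => s - 1)%C s (RtoC 1).
Proof. eapply chol_eq; [apply chol_minus; [apply chol_id | apply chol_const]|]. ring. Qed.

Lemma G_chol s : 0 < Re s -> chol G s (G1 s) /\ chol G1 s (G2 s) /\ exists l, chol G2 s l.
Proof.
  intros Hs. split; [|split].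
  - apply (chol_Lap_shift gb _ _ s lapdom_gb). lra.
  - apply (chol_Lap_shift gb1 _ _ s (lapdom_gb1 (1 / 2) ltac:(lra))). lra.
  - eexists. apply (chol_Lap_shift gb2 _ _ s (lapdom_gb2 (1 / 4) ltac:(lra))). lra.
Qed.

Lemma k0_chol s : 0 < Re s -> chol k0 s (k1 s).
Proof.
  intros Hs. destruct (G_chol s Hs) as (A & _).
  eapply chol_eq.
  - apply chol_plus; [apply chol_const|]. apply chol_mult; [apply chol_m1|].
    apply chol_minus; [apply chol_const|]. apply chol_mult; [apply chol_poly1 | exact A].
  - unfold k1. replace (RtoC 2) with (1 + 1)%C by (apply Ceq; simpl; ring). ring.
Qed.

Lemma k1_chol s : 0 < Re s -> chol k1 s (k2 s).
Proof.
  intros Hs. destruct (G_chol s Hs) as (A & B & _).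
  eapply chol_eq.
  - apply chol_minus.
    + apply chol_minus; [apply chol_const|]. apply chol_mult; [apply chol_poly1 | exact A].
    + apply chol_mult; [apply chol_m1|]. apply chol_plus.
      * apply chol_mult; [apply chol_lin | exact A].
      * apply chol_mult; [apply chol_poly1 | exact B].
  - unfold k2. replace (RtoC 2) with (1 + 1)%C by (apply Ceq; simpl; ring). ring.
Qed.

Lemma k2_chol s : 0 < Re s -> exists l, chol k2 s l.
Proof.
  intros Hs. destruct (G_chol s Hs) as (A & B & l & D). eexists.
  apply chol_minus.
  - apply chol_scal, chol_plus.
    + apply chol_mult; [apply chol_lin | exact A].
    + apply chol_mult; [apply chol_poly1 | exact B].
  - apply chol_mult; [apply chol_m1|]. apply chol_plus; [apply chol_plus|].
    + apply chol_scal, A.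
    + apply chol_mult; [apply chol_scal, chol_lin | exact B].
    + apply chol_mult; [apply chol_poly1 | exact D].
Qed.

(** The derivatives are identified on the ray [x > 1] only, the value of [zeta] at 1 being
    arbitrary. The limit approaches 1 from that side, and continuity of [k2] evaluates it. *)
Lemma gamma1_stj zeta : is_riemann_zeta zeta -> gamma1 zeta = RtoC (- stj).
Proof.
  intros Hz. unfold gamma1.
  set (h := fun s : C => ((s - RtoC 1) * zeta s)%C).
  assert (h0 : forall x, 1 < x -> h (RtoC x) = k0 (RtoC x)).
  { intros x Hx. unfold h. rewrite (zeta_Zx_right zeta) by (auto; simpl; lra). unfold k0, G, Zx. field.
    intros E. apply (f_equal fst) in E. simpl in E. lra. }
  assert (d1 : forall x, 1 < x -> C_derive h (RtoC x) = k1 (RtoC x)).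
  { intros x Hx. apply (C_derive_chol h k0); [|apply k0_chol; simpl; lra].
    intros y Hy. rewrite <- RtoC_plus. apply h0. lra. }
  assert (d2 : forall x, 1 < x -> C_derive (C_derive h) (RtoC x) = k2 (RtoC x)).
  { intros x Hx. apply (C_derive_chol _ k1); [|apply k1_chol; simpl; lra].
    intros y Hy. rewrite <- RtoC_plus. apply d1. lra. }
  assert (L : C_lim (C_derive (C_derive h)) (RtoC 1) = k2 (RtoC 1)).
  { apply C_lim_clim. intros eps He. destruct (k2_chol (RtoC 1) ltac:(simpl; lra)) as [l Hl].
    destruct (chol_ball _ _ _ eps Hl He) as (d & Hd & HB).
    destruct (inv_INR_lim (d / 2) ltac:(lra)) as [N HN]. exists N. intros n Hn. specialize (HN n Hn).
    assert (n0 : 0 < / (INR n + 1)) by (apply Rinv_0_lt_compat; pose proof (pos_INR n); lra).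
    change (Cpt (fst (RtoC 1) + / (INR n + 1)) (snd (RtoC 1))) with (RtoC (1 + / (INR n + 1))).
    rewrite d2 by lra. left. apply HB. rewrite <- RtoC_minus, Cmod_RtoC_pos; lra. }
  fold h. rewrite L. unfold k2, G, G1.
  replace (RtoC 1 + 1)%C with (RtoC 2) by (apply Ceq; simpl; ring).
  replace (Lap gb (RtoC 2)) with (RtoC (Re (Lap gb (RtoC 2)))).
  2:{ apply Ceq; [reflexivity|]. rewrite (Lap_real gb); [reflexivity|]. intros u. now rewrite lint_gb_2. }
  replace (Lap gb1 (RtoC 2)) with (RtoC (Re (Lap gb1 (RtoC 2)))).
  2:{ apply Ceq; [reflexivity|]. rewrite (Lap_real gb1); [reflexivity|]. intros u. now rewrite lint_gb1_2. }
  unfold stj. apply Ceq; simpl; field.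
Qed.
End Gamma1.

(** * The values [zeta s] and [zeta' s] for real [s >= 3/2] *)

Lemma is_lim_seq_clim (u : nat -> R) (l : R) : is_lim_seq u l -> clim (fun n => RtoC (u n)) (RtoC l).
Proof. intros H. apply clim_ReIm; simpl; [exact H | apply is_lim_seq_const]. Qed.

(** From [ln k <= (16/3) k^(3/16)]: two logarithms cost [k^(3/8)], the gap between 3/2 and 9/8, and
    [29 >= (16/3)^2]. *)
Lemma ln_pow_le k j : (0 < k)%nat -> (j <= 2)%nat -> 0 <= ln (INR k) ^ j * Rpower (INR k) (- (3 / 2)) <= 29 * Rpower (INR k) (- (1 + 1 / 8)).
Proof.
  intros Hk Hj. assert (k1 : 1 <= INR k) by now apply INR_ge_1.
  assert (L0 : 0 <= ln (INR k)) by (rewrite <- ln_1; apply ln_le; lra).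
  pose proof (ln_le_Rpower (INR k) (3 / 16) ltac:(lra) k1) as L. set (q := Rpower (INR k) (3 / 16)) in *.
  assert (q1 : 1 <= q) by (unfold q; rewrite <- (Rpower_O (INR k)) at 1 by lra; apply Rle_Rpower; lra).
  assert (E : Rpower (INR k) (- (1 + 1 / 8)) = q * q * Rpower (INR k) (- (3 / 2))).
  { unfold q. rewrite <- !Rpower_plus. f_equal. field. }
  rewrite E. pose proof (Rpower_pos (INR k) (- (3 / 2))) as r0.
  replace (/ (3 / 16)) with (16 / 3) in L by field.
  assert (P : 0 <= ln (INR k) ^ j <= 29 * (q * q)).
  { destruct j as [|[|[|j]]]; simpl; [nra | nra | nra | lia]. }
  split; [apply Rmult_le_pos; lra|]. rewrite <- !Rmult_assoc. apply Rmult_le_compat_r; lra.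
Qed.

(** Partial sums of [(-1)^j] times the j-th derivative of zeta. For [j = 0, 1] they are also the
    coefficients in the truncated lattice point counts. *)
Definition Zs (j : nat) (s : R) (Y : nat) : R := Rsum (fun k => ln (INR (S k)) ^ j * Rpower (INR (S k)) (- s)) Y.

Lemma Zs_bound j s Y : (j <= 2)%nat -> 3 / 2 <= s -> 0 <= Zs j s Y <= 261.
Proof.
  intros Hj Hs.
  assert (A : forall k, 0 <= ln (INR (S k)) ^ j * Rpower (INR (S k)) (- s) <= 29 * Rpower (INR (S k)) (- (1 + 1 / 8))).
  { intros k. destruct (ln_pow_le (S k) j ltac:(lia) Hj) as [B1 B2]. assert (k1 := INR_ge_1 (S k) ltac:(lia)).
    assert (L0 : 0 <= ln (INR (S k))) by (rewrite <- ln_1; apply ln_le; lra).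
    pose proof (pow_le _ j L0). split; [apply Rmult_le_pos; auto; left; apply Rpower_pos|].
    eapply Rle_trans; [|exact B2]. apply Rmult_le_compat_l; auto. apply Rle_Rpower; lra. }
  split; [apply Rsum_nonneg; intros; apply A|].
  eapply Rle_trans; [apply Rsum_le; intros; apply A|]. rewrite Rsum_scal.
  pose proof (sum_neg_le (1 / 8) Y ltac:(lra)). lra.
Qed.

Lemma Zs_lim j s : (j <= 2)%nat -> 3 / 2 <= s -> exists z : R, is_lim_seq (Zs j s) z.
Proof.
  intros Hj Hs. destruct (ex_finite_lim_seq_incr (Zs j s) 261) as [z Hz].
  - intros n. unfold Zs. cbn [Rsum].
    assert (L0 : 0 <= ln (INR (S n))) by (rewrite <- ln_1; apply ln_le; [lra | apply INR_ge_1; lia]).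
    pose proof (pow_le _ j L0). pose proof (Rpower_pos (INR (S n)) (- s)). nra.
  - intros n. now apply Zs_bound.
  - now exists z.
Qed.

Lemma zsum_Zs s Y : zsum (RtoC s) Y = RtoC (Zs 0 s Y).
Proof.
  unfold zsum, Zs. induction Y as [|Y IH]; cbn [Csum Rsum]; [reflexivity|].
  rewrite IH, RtoC_plus. f_equal. unfold Rpower_C, Rpower. rewrite <- RtoC_opp, <- RtoC_mult, Cexp_RtoC.
  f_equal. simpl. ring.
Qed.

Lemma zeta_Zs zeta s (z : R) : is_riemann_zeta zeta -> 1 < s -> is_lim_seq (Zs 0 s) z -> zeta (RtoC s) = RtoC z.
Proof.
  intros Hz Hs H. apply (clim_unique (zsum (RtoC s))); [apply zeta_series; auto|].
  apply clim_ext with (fun Y => RtoC (Zs 0 s Y)); [intros; symmetry; apply zsum_Zs | now apply is_lim_seq_clim].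
Qed.

Lemma exp_neg_quad y : 0 <= y -> Rabs (exp (- y) - 1 + y) <= / 2 * y ^ 2.
Proof.
  intros Hy. pose proof (exp_ineq1_le (- y)).
  assert (D : exp (- y) - 1 + y - / 2 * y ^ 2 <= exp (- 0) - 1 + 0 - / 2 * 0 ^ 2).
  { apply (deriv_nonpos_decr (fun y => exp (- y) - 1 + y - / 2 * y ^ 2) (fun y => - exp (- y) + 1 - y)); auto.
    - intros z _. auto_derive; auto. field.
    - intros z _. pose proof (exp_ineq1_le (- z)). lra. }
  rewrite Ropp_0, exp_0 in D. rewrite Rabs_pos_eq; lra.
Qed.

(** Termwise second-order expansion of the exponential; 131 exceeds half the bound 261 for [Zs 2].
    Being uniform in [Y], the estimate passes to the limit and differentiates the series. *)
Lemma Zs_quotient s h Y : 3 / 2 <= s -> 0 < h ->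
  Rabs ((Zs 0 (s + h) Y - Zs 0 s Y) / h + Zs 1 s Y) <= 131 * h.
Proof.
  intros Hs Hh. apply Rle_trans with (h / 2 * Zs 2 s Y).
  - unfold Zs. induction Y as [|Y IH]; cbn [Rsum].
    + replace ((0 - 0) / h + 0) with 0 by (field; lra). rewrite Rabs_R0. lra.
    + set (x := INR (S Y)) in *. set (L := ln x).
      assert (L0 : 0 <= L) by (unfold L; rewrite <- ln_1; apply ln_le; [lra | apply INR_ge_1; lia]).
      set (A := Rsum (fun k => ln (INR (S k)) ^ 0 * Rpower (INR (S k)) (- (s + h))) Y) in *.
      set (B := Rsum (fun k => ln (INR (S k)) ^ 0 * Rpower (INR (S k)) (- s)) Y) in *.
      set (D := Rsum (fun k => ln (INR (S k)) ^ 1 * Rpower (INR (S k)) (- s)) Y) in *.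
      assert (E : Rpower x (- (s + h)) = Rpower x (- s) * exp (- (h * L))).
      { unfold Rpower. rewrite <- exp_plus. f_equal. unfold L. ring. }
      rewrite E. set (r := Rpower x (- s)). assert (r0 : 0 < r) by apply Rpower_pos.
      replace ((A + L ^ 0 * (r * exp (- (h * L))) - (B + L ^ 0 * r)) / h + (D + L ^ 1 * r)) with
        (((A - B) / h + D) + r / h * (exp (- (h * L)) - 1 + h * L)) by (simpl; field; lra).
      eapply Rle_trans; [apply Rabs_triang|]. rewrite (Rmult_plus_distr_l (h / 2)). apply Rplus_le_compat; [exact IH|].
      pose proof (exp_neg_quad (h * L) ltac:(nra)) as Q.
      rewrite Rabs_mult, (Rabs_pos_eq (r / h)) by (apply Rdiv_le_0_compat; lra).
      apply Rle_trans with (r / h * (/ 2 * (h * L) ^ 2)).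
      * apply Rmult_le_compat_l; [apply Rdiv_le_0_compat; lra | exact Q].
      * right. field. lra.
  - pose proof (Zs_bound 2 s Y ltac:(lia) Hs). nra.
Qed.

Lemma zeta_derive_Zs zeta s (z : R) : is_riemann_zeta zeta -> 3 / 2 <= s -> is_lim_seq (Zs 1 s) z ->
  C_derive zeta (RtoC s) = RtoC (- z).
Proof.
  intros Hz Hs H1. unfold C_derive. apply C_lim_clim. intros eps He.
  destruct (inv_INR_lim (eps / 131) ltac:(lra)) as [N HN]. exists N. intros n Hn. specialize (HN n Hn).
  set (h := / (INR n + 1)) in *.
  assert (h0 : 0 < h) by (apply Rinv_0_lt_compat; pose proof (pos_INR n); lra).
  change (Cpt (fst (RtoC s) + h) (snd (RtoC s))) with (RtoC (s + h)).
  destruct (Zs_lim 0 s ltac:(lia) Hs) as [a Ha]. destruct (Zs_lim 0 (s + h) ltac:(lia) ltac:(lra)) as [b Hb].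
  rewrite (zeta_Zs zeta s a), (zeta_Zs zeta (s + h) b) by (auto; lra).
  rewrite <- !RtoC_minus, <- RtoC_div by lra. rewrite <- RtoC_minus, Cmod_R.
  replace (s + h - s) with h by ring.
  assert (Q : Rabs ((b - a) / h + z) <= 131 * h).
  { assert (Lm : is_lim_seq (fun Y => Rabs ((Zs 0 (s + h) Y - Zs 0 s Y) / h + Zs 1 s Y)) (Rabs ((b - a) / h + z))).
    { apply (is_lim_seq_abs _ (Finite ((b - a) / h + z))). apply is_lim_seq_plus'; auto. unfold Rdiv.
      apply is_lim_seq_mult'; [apply is_lim_seq_minus'; auto | apply is_lim_seq_const]. }
    apply (is_lim_seq_le _ (fun _ => 131 * h) (Finite _) (Finite _) (fun Y => Zs_quotient s h Y Hs h0) Lm), is_lim_seq_const. }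
  replace ((b - a) / h - - z) with ((b - a) / h + z) by ring. lra.
Qed.

(** * Divisor sums *)

Lemma lsum_swap (F : nat -> nat -> R) la lb :
  lsum (fun n => lsum (F n) lb) la = lsum (fun m => lsum (fun n => F n m) la) lb.
Proof.
  induction la as [|[w n] la IH]; simpl.
  - induction lb as [|[v m] lb IHb]; simpl; [reflexivity|]. rewrite <- IHb. ring.
  - now rewrite IH, lsum_plus, lsum_scal.
Qed.

Lemma ind_le_mul y n m : (0 < n)%nat -> ind_le y (n * m) = ind_le (y / INR n) m.
Proof.
  intros Hn. assert (n0 : 0 < INR n) by (apply lt_0_INR; lia). unfold ind_le. rewrite mult_INR.
  destruct (Rle_dec (INR n * INR m) y) as [A|A], (Rle_dec (INR m) (y / INR n)) as [B|B]; auto; exfalso.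
  - apply B. apply le_div_mul; lra.
  - apply A. apply (Rmult_le_compat_l (INR n)) in B; [|lra].
    replace (INR n * (y / INR n)) with y in B by (field; lra). exact B.
Qed.

Lemma Sl_lprod la lb y : lpos la -> Sl (lprod la lb) y = lsum (fun n => Sl lb (y / INR n)) la.
Proof.
  intros Ha. unfold Sl. rewrite lsum_lprod. apply lsum_ext; auto. intros n Hn.
  induction lb as [|[v m] lb IH]; simpl; [reflexivity|]. now rewrite IH, ind_le_mul.
Qed.

(** Inclusion and exclusion, term by term: [n m <= A B] forces [n <= A] or [m <= B], and both
    together imply it again. *)
Lemma hyperbola la lb A B : lpos la -> lpos lb -> 0 < A -> 0 < B ->
  Sl (lprod la lb) (A * B) = lsum (fun n => ind_le A n * Sl lb (A * B / INR n)) la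
    + lsum (fun m => ind_le B m * Sl la (A * B / INR m)) lb - Sl la A * Sl lb B.
Proof.
  intros Ha Hb HA HB. unfold Sl at 1. rewrite lsum_lprod.
  rewrite (lsum_ext _ (fun n => (ind_le A n * Sl lb (A * B / INR n)
     + lsum (fun m => ind_le B m * ind_le (A * B / INR m) n) lb) + - Sl lb B * ind_le A n)); auto.
  - rewrite !lsum_plus, lsum_swap, lsum_scal. fold (Sl la A).
    rewrite (lsum_ext (fun m => lsum _ la) (fun m => ind_le B m * Sl la (A * B / INR m))); auto.
    + ring.
    + intros m _. apply lsum_scal.
  - intros n Hn. unfold Sl. rewrite <- !lsum_scal.
    rewrite (Rmult_comm (- lsum _ lb)), <- Ropp_mult_distr_r, Ropp_mult_distr_l, <- lsum_scal, <- !lsum_plus.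
    apply lsum_ext; auto. intros m Hm. rewrite <- (ind_le_mul _ m n Hm), <- (ind_le_mul _ n m Hn), (Nat.mul_comm m n).
    assert (n0 : 0 < INR n) by (apply lt_0_INR; lia). assert (m0 : 0 < INR m) by (apply lt_0_INR; lia).
    unfold ind_le. rewrite mult_INR.
    destruct (Rle_dec (INR n) A), (Rle_dec (INR m) B), (Rle_dec (INR n * INR m) (A * B)); try ring; exfalso; nra.
Qed.

Definition lh (Y : nat) : wlist := wl (fun k => / INR k) (fun k => k) Y.

Lemma lpos_lh Y : lpos (lh Y).
Proof. apply lpos_wl. intros k Hk. split; auto. left. apply Rinv_0_lt_compat, lt_0_INR. lia. Qed.

Lemma lsum_ind_wl w g A Y : 0 <= A <= INR Y ->
  lsum (fun n => ind_le A n * g n) (wl w (fun k => k) Y) = Rsum (fun k => w (S k) * g (S k)) (flr A).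
Proof.
  intros HA. rewrite lsum_wl. rewrite <- (Rsum_ind _ A Y) by (try apply flr_le; lra).
  apply Rsum_ext. intros; ring.
Qed.

Lemma Rsum_diff a b c n : (forall k, (k < n)%nat -> Rabs (a k - b k) <= c k) ->
  Rabs (Rsum a n - Rsum b n) <= Rsum c n.
Proof.
  intros H. induction n as [|n IH]; simpl; [rewrite Rminus_diag, Rabs_R0; lra|].
  replace (Rsum a n + a n - (Rsum b n + b n)) with ((Rsum a n - Rsum b n) + (a n - b n)) by ring.
  eapply Rle_trans; [apply Rabs_triang|]. apply Rplus_le_compat; auto.
Qed.

Lemma flr_facts x : 1 <= x -> 1 <= INR (flr x) <= x /\ x < INR (flr x) + 1 /\ (0 < flr x)%nat /\
  0 <= ln x - ln (INR (flr x)) <= / INR (flr x) /\ / INR (flr x) <= 2 / x.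
Proof.
  intros Hx. destruct (flr_spec x ltac:(lra)) as [A B].
  assert (N0 : (0 < flr x)%nat). { apply INR_lt. simpl. lra. }
  assert (N1 := INR_ge_1 _ N0). repeat split; auto.
  - assert (ln (INR (flr x)) <= ln x) by (apply ln_le; lra). lra.
  - rewrite <- ln_div by lra. eapply Rle_trans; [apply ln_le_sub1, Rdiv_lt_0_compat; lra|].
    apply (Rmult_le_reg_r (INR (flr x))); [lra|]. field_simplify; lra.
  - replace (2 / x) with (/ (x / 2)) by (field; lra). apply Rinv_le_contravar; lra.
Qed.

Lemma harm_real x : 1 <= x -> Rabs (harm (flr x) - ln x - gam) <= 4 / x.
Proof.
  intros Hx. destruct (flr_facts x Hx) as (A & B & N0 & L & I). pose proof (harm_asymp _ N0) as H.
  apply Rabs_le_between in H. apply Rabs_le. unfold Rdiv in *. lra.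
Qed.

Lemma lharm_real x : 1 <= x -> Rabs (lharm (flr x) - / 2 * ln x ^ 2 - stj) <= 4 * (1 + ln x) / x.
Proof.
  intros Hx. destruct (flr_facts x Hx) as (A & B & N0 & L & I). pose proof (lharm_asymp _ N0) as H.
  assert (l0 : 0 <= ln (INR (flr x))) by (rewrite <- ln_1; apply ln_le; lra).
  set (a := ln (INR (flr x))) in *. set (i := / INR (flr x)) in *. set (l := ln x) in *.
  assert (i0 : 0 < i) by (apply Rinv_0_lt_compat; lra).
  assert (H1 : (1 + a) * i <= (1 + l) * i) by (apply Rmult_le_compat_r; lra).
  assert (H2 : 0 <= / 2 * l ^ 2 - / 2 * a ^ 2 <= (1 + l) * i) by (split; nra).
  assert (H3 : (1 + l) * i <= (1 + l) * (2 / x)) by (apply Rmult_le_compat_l; lra).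
  replace (4 * (1 + l) / x) with (2 * ((1 + l) * (2 / x))) by (field; lra).
  apply Rabs_le_between in H. apply Rabs_le. lra.
Qed.

Lemma Rsum_const c n : Rsum (fun _ => c) n = INR n * c.
Proof. induction n as [|n IH]; [simpl; ring|]. rewrite S_INR. simpl. rewrite IH. ring. Qed.

Lemma quot_range y r k : 0 < r -> y = r * r -> (k < flr r)%nat -> r <= y / INR (S k) <= y /\ 1 <= INR (S k) <= r.
Proof.
  intros Hr Hy Hk. destruct (flr_spec r ltac:(lra)) as [A B].
  assert (k1 := INR_ge_1 (S k) ltac:(lia)).
  assert (k2 : INR (S k) <= r) by (apply Rle_trans with (INR (flr r)); [apply le_INR; lia | lra]).
  repeat split; auto; [apply le_div_mul; nra | apply div_le_mul; nra].
Qed.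

Definition LL (Y : nat) : wlist := lprod (l1 Y) (l1 Y).

Lemma lpos_LL Y : lpos (LL Y).
Proof. apply lpos_lprod; apply lpos_l1. Qed.

Lemma divisor_sum y Y : 1 <= y <= INR Y -> Rabs (Sl (LL Y) y - (y * ln y + (2 * gam - 1) * y)) <= 12 * sqrt y.
Proof.
  intros Hy. set (r := sqrt y). assert (ry : r * r = y) by (apply sqrt_sqrt; lra).
  assert (r1 : 1 <= r) by (unfold r; rewrite <- sqrt_1; apply sqrt_le_1_alt; lra).
  assert (rY : r <= INR Y) by nra. unfold LL. rewrite <- ry at 1.
  rewrite (hyperbola _ _ r r) by (auto using lpos_l1; lra). rewrite ry.
  unfold l1 at 2 4. rewrite !lsum_ind_wl by lra. rewrite Sl_l1 by lra.
  destruct (flr_facts r r1) as (A & B & _). set (n := flr r) in *.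
  assert (E : Rabs (Rsum (fun k => 1 * Sl (l1 Y) (y / INR (S k))) n - y * harm n) <= INR n).
  { unfold harm. rewrite <- Rsum_scal, <- Rsum_1. apply Rsum_diff. intros k Hk.
    destruct (quot_range y r k ltac:(lra) ltac:(lra) Hk) as [Q1 Q2].
    rewrite Sl_l1 by lra. pose proof (flr_spec (y / INR (S k)) ltac:(lra)).
    change (y * / INR (S k)) with (y / INR (S k)). apply Rabs_le. lra. }
  pose proof (harm_real r r1) as H. fold n in H.
  assert (lr : ln y = 2 * ln r) by (rewrite <- ry, ln_mult by lra; ring).
  apply (Rmult_le_compat_l y) in H; [|lra]. replace (y * (4 / r)) with (4 * r) in H by (rewrite <- ry; field; lra).
  rewrite <- (Rabs_pos_eq y) in H at 1 by lra. rewrite <- Rabs_mult in H.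
  apply Rabs_le_between in E. apply Rabs_le_between in H. rewrite lr.
  assert (0 <= y - INR n * INR n <= 2 * r) by nra.
  apply Rabs_le. lra.
Qed.

Lemma Sl_small l x : lpos l -> x < 1 -> Sl l x = 0.
Proof.
  intros Hl Hx. unfold Sl. rewrite (lsum_ext _ (fun _ => 0 * 0)); auto.
  - rewrite lsum_scal. ring.
  - intros n Hn. pose proof (INR_ge_1 n Hn). unfold ind_le. destruct (Rle_dec (INR n) x); lra.
Qed.

(** For [y < 1] the count is zero but the main term is not. Covering this range lets the sum over
    [k] run up to the truncation instead of stopping at [k^b <= X], so that complete partial sums
    [Zs] appear. There [y^(1 - kp) |ln y|] stays bounded because [1 - kp >= 1/8]. *)
Lemma divisor_sum_all kp : 3 / 4 <= kp <= 7 / 8 -> exists C, 0 <= C /\ forall y Y, 0 < y <= INR Y ->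
  Rabs (Sl (LL Y) y - (y * ln y + (2 * gam - 1) * y)) <= C * Rpower y kp.
Proof.
  intros Hk. exists (12 + Rabs (2 * gam - 1)). pose proof (Rabs_pos (2 * gam - 1)) as g0. split; [lra|].
  intros y Y Hy. pose proof (Rpower_pos y kp) as p0. destruct (Rle_lt_dec 1 y) as [H|H].
  - eapply Rle_trans; [apply divisor_sum; lra|].
    assert (sqrt y <= Rpower y kp) by (rewrite <- Rpower_sqrt by lra; apply Rle_Rpower; lra). nra.
  - rewrite Sl_small by (auto using lpos_LL). rewrite Rminus_0_l, Rabs_Ropp.
    replace (y * ln y + (2 * gam - 1) * y) with (y * (ln y + (2 * gam - 1))) by ring.
    assert (Ly : ln y <= 0) by (rewrite <- ln_1; apply ln_le; lra).
    assert (E : y = Rpower y kp * exp ((1 - kp) * ln y)).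
    { unfold Rpower. rewrite <- exp_plus. replace (kp * ln y + (1 - kp) * ln y) with (ln y) by ring. rewrite exp_ln; lra. }
    rewrite E at 1. rewrite Rabs_mult, (Rabs_pos_eq (_ * exp _)).
    2:{ apply Rmult_le_pos; left; [auto | apply exp_pos]. }
    rewrite Rmult_assoc, (Rmult_comm (12 + _)). apply Rmult_le_compat_l; [lra|].
    set (z := - ln y). assert (z0 : 0 <= z) by (unfold z; lra).
    assert (W : exp ((1 - kp) * ln y) <= / (1 + z / 8)).
    { replace ((1 - kp) * ln y) with (- ((1 - kp) * z)) by (unfold z; ring). rewrite exp_Ropp.
      apply Rinv_le_contravar; [lra|]. pose proof (exp_ineq1_le ((1 - kp) * z)). nra. }
    assert (T : Rabs (ln y + (2 * gam - 1)) <= z + Rabs (2 * gam - 1)).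
    { eapply Rle_trans; [apply Rabs_triang|]. rewrite (Rabs_left1 (ln y)) by lra. unfold z. lra. }
    apply Rle_trans with (/ (1 + z / 8) * (z + Rabs (2 * gam - 1))).
    { apply Rmult_le_compat; auto using Rabs_pos. left; apply exp_pos. }
    apply (Rmult_le_reg_l (1 + z / 8)); [lra|]. rewrite <- Rmult_assoc, Rinv_r, Rmult_1_l by lra. nra.
Qed.

(** The sum of [d(n) / n] up to [B], again by the hyperbola method. The main term is the residue of
    [zeta(1 + w)^2 B^w / w] at [w = 0]. *)
Lemma harm_pair_sum B Y : 1 <= B <= INR Y ->
  Rabs (Sl (lprod (lh Y) (lh Y)) B - (/ 2 * ln B ^ 2 + 2 * gam * ln B + gam ^ 2 - 2 * stj))
   <= 32 * (1 + ln B) / sqrt B.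
Proof.
  intros HB. set (r := sqrt B). assert (rB : r * r = B) by (apply sqrt_sqrt; lra).
  assert (r1 : 1 <= r) by (unfold r; rewrite <- sqrt_1; apply sqrt_le_1_alt; lra).
  assert (rY : r <= INR Y) by nra. rewrite <- rB at 1.
  rewrite (hyperbola _ _ r r) by (auto using lpos_lh; lra). rewrite rB.
  unfold lh at 2 4. rewrite !lsum_ind_wl by lra.
  assert (Hh : forall x, 0 <= x <= INR Y -> Sl (lh Y) x = harm (flr x)).
  { intros x Hx. unfold lh. rewrite Sl_wl_id by auto. reflexivity. }
  rewrite Hh by lra. destruct (flr_facts r r1) as (A & B' & _). set (n := flr r) in *.
  assert (lr : ln B = 2 * ln r) by (rewrite <- rB, ln_mult by lra; ring).
  set (l := ln r) in *. assert (l0 : 0 <= l) by (unfold l; rewrite <- ln_1; apply ln_le; lra).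
  assert (E : Rabs (Rsum (fun k => / INR (S k) * Sl (lh Y) (B / INR (S k))) n
     - ((2 * l + gam) * harm n - lharm n)) <= 4 / r).
  { unfold harm at 1, lharm. rewrite <- Rsum_scal.
    replace (Rsum (fun k => (2 * l + gam) * / INR (S k)) n - Rsum (fun k => ln (INR (S k)) / INR (S k)) n) with
      (Rsum (fun k => / INR (S k) * (2 * l - ln (INR (S k)) + gam)) n).
    - apply Rle_trans with (Rsum (fun _ => 4 / B) n).
      + apply Rsum_diff. intros k Hk. destruct (quot_range B r k ltac:(lra) ltac:(lra) Hk) as [Q1 Q2].
        rewrite Hh by lra. pose proof (harm_real (B / INR (S k)) ltac:(lra)) as H.
        rewrite ln_div, lr in H by lra. rewrite <- Rmult_minus_distr_l, Rabs_mult, Rabs_inv, (Rabs_pos_eq (INR _)) by lra.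
        apply (Rmult_le_reg_l (INR (S k))); [lra|]. rewrite <- Rmult_assoc, Rinv_r, Rmult_1_l by lra.
        eapply Rle_trans; [eapply Rle_trans; [right|exact H]|right; field; lra]. f_equal. ring.
      + rewrite Rsum_const. replace (4 / r) with (r * (4 / B)) by (rewrite <- rB; field; lra).
        apply Rmult_le_compat_r; [apply Rdiv_le_0_compat; lra | lra].
    - replace (Rsum (fun k => ln (INR (S k)) / INR (S k)) n) with (- Rsum (fun k => - (1) * (ln (INR (S k)) / INR (S k))) n)
        by (rewrite Rsum_scal; ring).
      unfold Rminus. rewrite Ropp_involutive, <- Rsum_plus. apply Rsum_ext. intros k _. field. apply not_0_INR. lia. }
  pose proof (harm_real r r1) as H. pose proof (lharm_real r r1) as H'. fold n l in H, H'.
  rewrite lr. set (i := / r). assert (i0 : 0 < i <= 1) by (unfold i; split; [apply Rinv_0_lt_compat; lra | rewrite <- Rinv_1; apply Rinv_le_contravar; lra]).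
  unfold Rdiv in *. fold i in E, H, H'. fold i.
  set (d1 := harm n - l - gam) in *. set (d2 := lharm n - / 2 * l ^ 2 - stj) in *.
  set (S' := Rsum (fun k => / INR (S k) * Sl (lh Y) (B * / INR (S k))) n) in *.
  set (d3 := S' - ((2 * l + gam) * harm n - lharm n)) in *.
  replace (S' + S' - harm n * harm n - (/ 2 * (2 * l) ^ 2 + 2 * gam * (2 * l) + gam ^ 2 - 2 * stj)) with
    (2 * (l * d1) - 2 * d2 + 2 * d3 - d1 * d1) by (unfold d1, d2, d3; field).
  assert (dd : d1 * d1 <= 4 * (4 * i)).
  { apply Rabs_le_between in H. nra. }
  assert (ld : Rabs (l * d1) <= l * (4 * i)) by (rewrite Rabs_mult, (Rabs_pos_eq l) by lra; apply Rmult_le_compat_l; lra).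
  assert (0 <= d1 * d1) by nra. assert (0 <= l * i) by nra.
  apply Rabs_le_between in H'. apply Rabs_le_between in E. apply Rabs_le_between in ld.
  apply Rabs_le. lra.
Qed.

Lemma lsum_LL_inv F Y : lsum (fun n => F n * / INR n) (LL Y) = lsum F (lprod (lh Y) (lh Y)).
Proof.
  unfold LL, l1, lh. rewrite !lsum_lprod, !lsum_wl. apply Rsum_ext. intros k _.
  rewrite !lsum_wl, <- !Rsum_scal. apply Rsum_ext. intros j _. rewrite mult_INR, Rinv_mult. ring.
Qed.

(** One variable is played against the product of the other two, with both cut at [sqrt X]. The
    coefficients are those of the residue of [zeta(s)^3 X^s / s] at 1. The remainder of
    [harm_pair_sum] at [sqrt X] is [X^(-1/4)] up to a logarithm, and multiplied by [X] it gives the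
    exponent 3/4. *)
Lemma triple_divisor_sum : exists C, 0 <= C /\ forall X Y, 1 <= X <= INR Y ->
  Rabs (Sl (lprod (l1 Y) (LL Y)) X - Pm (/ 2) (3 * gam - 1) (3 * gam ^ 2 - 3 * gam + 1 - 3 * stj) X)
    <= C * ((1 + ln X) * Rpower X (3 / 4)).
Proof.
  set (g := Rabs gam). assert (g0 : 0 <= g) by apply Rabs_pos.
  exists (200 * (1 + g)). split; [lra|]. intros X Y HX.
  set (r := sqrt X). assert (rX : r * r = X) by (apply sqrt_sqrt; lra).
  assert (r1 : 1 <= r) by (unfold r; rewrite <- sqrt_1; apply sqrt_le_1_alt; lra).
  set (q := sqrt r). assert (qr : q * q = r) by (apply sqrt_sqrt; lra).
  assert (q1 : 1 <= q) by (unfold q; rewrite <- sqrt_1; apply sqrt_le_1_alt; lra).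
  assert (rq : q <= r) by nra. assert (rY : r <= INR Y) by nra.
  set (L := ln X). assert (L0 : 0 <= L) by (unfold L; rewrite <- ln_1; apply ln_le; lra).
  assert (lr : ln r = L / 2) by (unfold L; rewrite <- rX, ln_mult by lra; field).
  set (v := r * q). assert (rv : r <= v) by (unfold v; nra). assert (v1 : 1 <= v) by lra.
  assert (vE : Rpower X (3 / 4) = v).
  { unfold v. replace (3 / 4) with (/ 2 + / 2 * / 2) by field. rewrite Rpower_plus, <- Rpower_mult.
    rewrite Rpower_sqrt by lra. fold r. rewrite Rpower_sqrt by lra. reflexivity. }
  rewrite vE. rewrite <- rX at 1.
  rewrite (hyperbola _ _ r r) by (auto using lpos_l1, lpos_LL; lra). rewrite rX.
  unfold l1 at 1. rewrite lsum_ind_wl by lra. rewrite Sl_l1 by lra.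
  destruct (flr_facts r r1) as (A & B & N0 & _). set (n := flr r) in *.
  pose proof (divisor_sum r Y ltac:(lra)) as D. fold q in D. rewrite lr in D. set (Dr := Sl (LL Y) r) in *.
  pose proof (harm_pair_sum r Y ltac:(lra)) as Gp. fold q in Gp. rewrite lr in Gp.
  set (T1 := Rsum (fun k => 1 * Sl (LL Y) (X / INR (S k))) n).
  set (T2 := lsum (fun m => ind_le r m * Sl (l1 Y) (X / INR m)) (LL Y)).
  set (Gr := Sl (lprod (lh Y) (lh Y)) r) in *.
  assert (E1 : Rabs (T1 - X * ((L + 2 * gam - 1) * harm n - lharm n)) <= 48 * v).
  { unfold T1, harm, lharm.
    replace (X * ((L + 2 * gam - 1) * Rsum (fun k => / INR (S k)) n - Rsum (fun k => ln (INR (S k)) / INR (S k)) n)) with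
      (Rsum (fun k => X / INR (S k) * ln (X / INR (S k)) + (2 * gam - 1) * (X / INR (S k))) n).
    - apply Rle_trans with (Rsum (fun k => 12 * r * Rpower (INR (S k)) (1 / 2 - 1)) n).
      + apply Rsum_diff. intros k Hk. destruct (quot_range X r k ltac:(lra) ltac:(lra) Hk) as [Q1 Q2].
        rewrite Rmult_1_l. eapply Rle_trans; [apply divisor_sum; lra|]. right.
        rewrite sqrt_div by lra. fold r. replace (1 / 2 - 1) with (- / 2) by field.
        rewrite Rpower_Ropp, Rpower_sqrt by lra. unfold Rdiv. ring.
      + rewrite Rsum_scal. pose proof (sum_pow_le (1 / 2) n ltac:(lra) N0) as Sp.
        replace (2 / (1 / 2)) with 4 in Sp by field. 
        replace (Rpower (INR n) (1 / 2)) with (sqrt (INR n)) in Sp by (rewrite <- Rpower_sqrt by lra; f_equal; field).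
        assert (sqrt (INR n) <= q) by (apply sqrt_le_1_alt; lra).
        replace (48 * v) with (12 * r * (4 * q)) by (unfold v; ring). apply Rmult_le_compat_l; lra.
    - rewrite Rmult_minus_distr_l, <- Rmult_assoc, <- !Rsum_scal.
      replace (Rsum (fun k => X * (ln (INR (S k)) / INR (S k))) n) with (- Rsum (fun k => - (1) * (X * (ln (INR (S k)) / INR (S k)))) n)
        by (rewrite Rsum_scal; ring).
      unfold Rminus. rewrite Ropp_involutive, <- Rsum_plus. apply Rsum_ext. intros k _.
      assert (0 < INR (S k)) by (apply lt_0_INR; lia). rewrite ln_div by lra. fold L. field. lra. }
  (* Each floor of [X / m] is within 1 of [X / m], and the terms with [m <= r] have total weight
     [Dr]. *)
  assert (E2 : Rabs (T2 - X * Gr) <= Dr).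
  { unfold T2, Gr, Dr, Sl at 2. rewrite <- lsum_LL_inv, <- lsum_scal.
    assert (U : forall l, lpos l -> Rabs (lsum (fun m => ind_le r m * Sl (l1 Y) (X / INR m)) l
       - lsum (fun m => X * (ind_le r m * / INR m)) l) <= lsum (ind_le r) l).
    { clear - HX. intros l Hl. induction l as [|[w m] l IH]; simpl; [rewrite Rminus_0_r, Rabs_R0; lra|].
      destruct (lpos_cons _ _ _ Hl) as [[W M] Hl']. specialize (IH Hl').
      match goal with |- Rabs (?a + ?b - (?c + ?d)) <= _ => replace (a + b - (c + d)) with ((a - c) + (b - d)) by ring end.
      eapply Rle_trans; [apply Rabs_triang|]. apply Rplus_le_compat; auto.
      rewrite <- Rmult_minus_distr_l, Rabs_mult, (Rabs_pos_eq w) by auto. apply Rmult_le_compat_l; auto.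
      assert (m1 := INR_ge_1 m M).
      assert (Xm : 0 <= X / INR m <= INR Y).
      { split; [apply Rdiv_le_0_compat; lra | apply div_le_mul; nra]. }
      rewrite Sl_l1 by auto. pose proof (flr_spec _ (proj1 Xm)).
      replace (ind_le r m * INR (flr (X / INR m)) - X * (ind_le r m * / INR m)) with
        (ind_le r m * (INR (flr (X / INR m)) - X / INR m)) by (unfold Rdiv; ring).
      assert (i01 : 0 <= ind_le r m) by (unfold ind_le; destruct (Rle_dec (INR m) r); lra).
      rewrite Rabs_mult, (Rabs_pos_eq (ind_le r m)) by auto. rewrite <- (Rmult_1_r (ind_le r m)) at 2.
      apply Rmult_le_compat_l; auto. apply Rabs_le. lra. }
    apply U, lpos_LL. }
  pose proof (harm_real r r1) as H. pose proof (lharm_real r r1) as H'. fold n in H, H'. rewrite lr in H, H'.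
  set (d1 := harm n - L / 2 - gam) in *. set (d2 := lharm n - / 2 * (L / 2) ^ 2 - stj) in *.
  set (e1 := T1 - X * ((L + 2 * gam - 1) * harm n - lharm n)) in *. set (e2 := T2 - X * Gr) in *.
  set (e3 := Gr - (/ 2 * (L / 2) ^ 2 + 2 * gam * (L / 2) + gam ^ 2 - 2 * stj)) in *.
  set (e4 := Dr - (r * (L / 2) + (2 * gam - 1) * r)) in *.
  (* After substitution of the asymptotics all polynomial parts cancel identically. The products
     [r d1] and [r d2] are grouped because [d1] and [d2] are [O(1/r)] up to a logarithm. *)
  assert (key : T1 + T2 - INR n * Dr - Pm (/ 2) (3 * gam - 1) (3 * gam ^ 2 - 3 * gam + 1 - 3 * stj) X =
    e1 + r * ((L + 2 * gam - 1) * (r * d1)) - r * (r * d2) + e2 + r * r * e3 + (r - INR n) * Dr - r * e4).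
  { unfold e1, e2, e3, e4, d1, d2, Pm. fold L. rewrite <- rX. field. }
  rewrite key. clear key.
  assert (G : Rabs gam <= g) by (unfold g; lra). apply Rabs_le_between in G.
  set (W := (1 + L) * v). assert (W0 : v <= W) by (unfold W; nra). assert (Wr : r <= W) by lra.
  assert (LW : L * v <= W) by (unfold W; nra). assert (gW : 0 <= g * W) by nra.
  assert (Bd1 : Rabs (r * d1) <= 4).
  { rewrite Rabs_mult, (Rabs_pos_eq r) by lra. apply (Rmult_le_compat_l r) in H; [|lra].
    replace (r * (4 / r)) with 4 in H by (field; lra). exact H. }
  assert (Bd2 : Rabs (r * d2) <= 4 * (1 + L)).
  { rewrite Rabs_mult, (Rabs_pos_eq r) by lra. apply (Rmult_le_compat_l r) in H'; [|lra].
    replace (r * (4 * (1 + L / 2) / r)) with (4 * (1 + L / 2)) in H' by (field; lra). lra. }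
  assert (F1 : Rabs (r * ((L + 2 * gam - 1) * (r * d1))) <= 8 * (1 + g) * W).
  { rewrite Rabs_mult, (Rabs_pos_eq r), (Rabs_mult (L + 2 * gam - 1)) by lra.
    assert (Rabs (L + 2 * gam - 1) <= L + 2 * g + 1) by (apply Rabs_le; lra).
    apply Rle_trans with (r * ((L + 2 * g + 1) * 4)).
    - apply Rmult_le_compat_l; [lra|]. apply Rmult_le_compat; auto using Rabs_pos.
    - assert (r * (L + 2 * g + 1) <= v * (L + 2 * g + 1)) by (apply Rmult_le_compat_r; lra).
      assert (0 <= g * v) by nra. assert (0 <= g * (L * v)) by (apply Rmult_le_pos; nra).
      replace W with (v + L * v) in * by (unfold W; ring). nra. }
  assert (F2 : Rabs (r * (r * d2)) <= 4 * W).
  { rewrite Rabs_mult, (Rabs_pos_eq r) by lra. apply Rle_trans with (r * (4 * (1 + L))); [apply Rmult_le_compat_l; lra|].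
    unfold W. nra. }
  assert (F3 : Rabs (r * r * e3) <= 32 * W).
  { rewrite Rabs_mult, (Rabs_pos_eq (r * r)) by nra.
    apply Rle_trans with (r * r * (32 * (1 + L / 2) / q)); [apply Rmult_le_compat_l; nra|].
    replace (r * r * (32 * (1 + L / 2) / q)) with (32 * ((1 + L / 2) * v)).
    - apply Rmult_le_compat_l; [lra|]. apply Rmult_le_compat_r; lra.
    - unfold v. rewrite <- qr at 2. rewrite <- qr. field. lra. }
  assert (Dr0 : 0 <= Dr) by (apply Sl_nonneg, lpos_LL).
  assert (F4 : Dr <= (15 + 2 * g) * W).
  { apply Rabs_le_between in D. 
    assert (r * (L / 2) <= L * v) by nra. assert ((2 * gam - 1) * r <= (2 * g + 1) * v) by nra.
    assert (g * v <= g * W) by (apply Rmult_le_compat_l; lra). unfold e4 in D. lra. }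
  assert (F5 : Rabs ((r - INR n) * Dr) <= (15 + 2 * g) * W).
  { rewrite Rabs_pos_eq by (apply Rmult_le_pos; lra). nra. }
  assert (F6 : Rabs (r * e4) <= 12 * W).
  { rewrite Rabs_mult, (Rabs_pos_eq r) by lra. apply Rle_trans with (r * (12 * q)); [apply Rmult_le_compat_l; lra|].
    unfold v in W0. lra. }
  apply Rabs_le_between in E1, E2, F1, F2, F3, F5, F6. apply Rabs_le. split; lra.
Qed.

Lemma Rpower_div x y a : 0 < x -> 0 < y -> Rpower (x / y) a = Rpower x a * Rpower y (- a).
Proof. intros. unfold Rpower. rewrite <- exp_plus, ln_div by assumption. f_equal. ring. Qed.

(** The divisor sum at [X / k^b], weighted by [k^((b-1)/2)], has error [X^kp k^((b-1)/2 - b kp)],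
    and the hypothesis on [p] makes it summable over [k]. For [b >= 3] this allows [kp = 3/4]; for
    [b = 2] it forces [kp > 3/4], whence the epsilon in that case. *)
Lemma power_divisor_sum b kp p : (2 <= b)%nat -> 3 / 4 <= kp <= 7 / 8 -> 0 < p ->
  1 + p <= INR b * kp - (INR b - 1) / 2 ->
  exists C, 0 <= C /\ forall X Y, 1 <= X <= INR Y ->
  Rabs (Sl (l3 b Y) X - Pm 0 (Zs 0 ((INR b + 1) / 2) Y)
     ((2 * gam - 1) * Zs 0 ((INR b + 1) / 2) Y - INR b * Zs 1 ((INR b + 1) / 2) Y) X) <= C * Rpower X kp.
Proof.
  intros Hb Hk Hp Hc. destruct (divisor_sum_all kp Hk) as (C & C0 & HC).
  assert (0 < / p) by (apply Rinv_0_lt_compat; auto).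
  exists (C * (1 + / p)). split; [nra|]. intros X Y HX. unfold l3. fold (LL Y).
  rewrite Sl_lprod by apply lpos_lb. unfold lb. rewrite lsum_wl.
  set (s := (INR b + 1) / 2).
  replace (Pm 0 (Zs 0 s Y) ((2 * gam - 1) * Zs 0 s Y - INR b * Zs 1 s Y) X) with
    (Rsum (fun k => Rpower (INR (S k)) ((INR b - 1) / 2) *
       (X / INR (S k ^ b) * ln (X / INR (S k ^ b)) + (2 * gam - 1) * (X / INR (S k ^ b)))) Y).
  - apply Rle_trans with (Rsum (fun k => C * Rpower X kp * Rpower (INR (S k)) (- (1 + p))) Y).
    + apply Rsum_diff. intros k _. assert (k1 := INR_ge_1 (S k) ltac:(lia)).
      assert (K0 : (0 < S k ^ b)%nat) by (pose proof (Nat.pow_nonzero (S k) b); lia).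
      assert (K1 := INR_ge_1 _ K0).
      rewrite <- Rmult_minus_distr_l, Rabs_mult, (Rabs_pos_eq (Rpower _ _)) by (left; apply Rpower_pos).
      apply Rle_trans with (Rpower (INR (S k)) ((INR b - 1) / 2) * (C * Rpower (X / INR (S k ^ b)) kp)).
      * apply Rmult_le_compat_l; [left; apply Rpower_pos|]. apply HC. split.
        -- apply Rdiv_lt_0_compat; lra.
        -- apply div_le_mul; nra.
      * rewrite Rpower_div by lra.
        replace (Rpower (INR (S k)) ((INR b - 1) / 2) * (C * (Rpower X kp * Rpower (INR (S k ^ b)) (- kp)))) with
          (C * Rpower X kp * (Rpower (INR (S k)) ((INR b - 1) / 2) * Rpower (INR (S k ^ b)) (- kp))) by ring.
        apply Rmult_le_compat_l; [apply Rmult_le_pos; [auto | left; apply Rpower_pos]|].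
        unfold Rpower. rewrite <- exp_plus. apply exp_le. rewrite ln_pow_INR by lia.
        assert (0 <= ln (INR (S k))) by (rewrite <- ln_1; apply ln_le; lra). nra.
    + rewrite Rsum_scal. pose proof (sum_neg_le p Y Hp). pose proof (Rpower_pos X kp).
      assert (0 <= C * Rpower X kp) by (apply Rmult_le_pos; lra). nra.
  - unfold Pm, Zs.
    transitivity (Rsum (fun k => X * (ln X + (2 * gam - 1)) * (ln (INR (S k)) ^ 0 * Rpower (INR (S k)) (- s))
       + - (X * INR b) * (ln (INR (S k)) ^ 1 * Rpower (INR (S k)) (- s))) Y).
    + apply Rsum_ext. intros k _. assert (k1 := INR_ge_1 (S k) ltac:(lia)).
      assert (K0 : 0 < INR (S k ^ b)) by (apply lt_0_INR; pose proof (Nat.pow_nonzero (S k) b); lia).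
      rewrite ln_div, ln_pow_INR by (auto; lia || lra).
      assert (R : Rpower (INR (S k)) (- s) = Rpower (INR (S k)) ((INR b - 1) / 2) / INR (S k ^ b)).
      { rewrite <- (exp_ln (INR (S k ^ b))) by auto. rewrite ln_pow_INR by lia. unfold Rdiv.
        rewrite <- exp_Ropp. unfold Rpower. rewrite <- exp_plus. f_equal. unfold s. field. }
      rewrite R. simpl. field. lra.
    + rewrite Rsum_plus, !Rsum_scal. ring.
Qed.

(** * The asymptotic formulas *)

Lemma integral_asymp_ge2 zeta b kp p : is_riemann_zeta zeta -> (2 <= b)%nat -> 3 / 4 <= kp <= 7 / 8 -> 0 < p ->
  1 + p <= INR b * kp - (INR b - 1) / 2 ->
  exists C, 0 <= C /\ forall T, 20 <= T ->
  Cmod (zeta_integral zeta 1 (INR b) 1 T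
        - (zeta (RtoC ((1 + INR b) / 2)) * RtoC (T * ln T) + nu zeta b * RtoC T))%C <= C * Rpower T kp.
Proof.
  intros Hz Hb Hk Hp Hc. pose proof PI2_3_2 as P. pose proof PI_4 as P4.
  assert (b2 : 2 <= INR b) by (change 2 with (INR 2); apply le_INR; auto).
  set (s := (INR b + 1) / 2). assert (s3 : 3 / 2 <= s) by (unfold s; lra).
  destruct (Zs_lim 0 s ltac:(lia) s3) as [z0 Z0]. destruct (Zs_lim 1 s ltac:(lia) s3) as [z1 Z1].
  pose proof (zeta_Zs zeta s z0 Hz ltac:(lra) Z0) as E0. pose proof (zeta_derive_Zs zeta s z1 Hz s3 Z1) as E1.
  set (g := Rabs (2 * gam - 1)). assert (g0 : 0 <= g) by apply Rabs_pos.
  (* As 261 bounds every [Zs], this constant bounds the coefficients for all truncations at once. *)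
  destruct (fb_asymp b (1 + 261 * (1 + g + INR b)) ltac:(lia) ltac:(nra)) as (C1 & C1p & H1).
  destruct (power_divisor_sum b kp p Hb Hk Hp Hc) as (C2 & C2p & H2). fold s in H2.
  destruct (zeta_integral_fb zeta b Hz ltac:(lia)) as (C3 & C3p & H3).
  exists (C1 * (1 + C2) + C3). split; [assert (0 <= C1 * (1 + C2)) by (apply Rmult_le_pos; lra); lra|].
  intros T HT. set (X := T / (2 * PI)). assert (TX : T = 2 * PI * X) by (unfold X; field; lra).
  assert (HX : 2 <= X) by (unfold X; apply le_div_mul; lra). assert (XT : 2 * X <= T) by (rewrite TX; nra).
  set (c := (2 * gam - 1) * z0 - INR b * z1).
  assert (VT : Rpower T (3 / 4) <= Rpower T kp) by (apply Rle_Rpower; lra).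
  assert (V1 : 1 <= Rpower T kp) by (rewrite <- (Rpower_O T) at 1 by lra; apply Rle_Rpower; lra).
  pose proof (H1 T (C2 * Rpower T kp) (fun _ => 0) (Zs 0 s) (fun N => (2 * gam - 1) * Zs 0 s N - INR b * Zs 1 s N)
    (Pm 0 z0 c X) HT ltac:(apply Rmult_le_pos; lra)) as A.
  assert (A' : Cmod (CI (fun t => fb b (Cpt (1 / 2) t)) 4 T - RtoC (2 * PI * Pm 0 z0 c X))%C
     <= C1 * (Rpower T (3 / 4) + C2 * Rpower T kp)).
  { apply A; clear A.
    - intros N. pose proof (Zs_bound 0 s N ltac:(lia) s3) as B0. pose proof (Zs_bound 1 s N ltac:(lia) s3) as B1.
      split; [rewrite Rabs_R0; nra|]. split; [rewrite Rabs_pos_eq by lra; nra|].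
      unfold Rminus. eapply Rle_trans; [apply Rabs_triang|]. rewrite Rabs_Ropp, !Rabs_mult.
      unfold g in *. unfold Rminus in *. rewrite (Rabs_pos_eq (Zs 0 s N)), (Rabs_pos_eq (Zs 1 s N)), (Rabs_pos_eq (INR b)) by lra.
      nra.
    - intros N x Hx HN. fold X in Hx, HN. eapply Rle_trans; [apply H2; lra|].
      apply Rmult_le_compat_l; auto. apply Rpower_le_base; lra.
    - fold X. unfold Pm. apply is_lim_seq_clim.
      apply is_lim_seq_mult'; [apply is_lim_seq_const|]. apply is_lim_seq_plus'; [apply is_lim_seq_plus'|].
      + apply is_lim_seq_const.
      + apply is_lim_seq_mult'; [exact Z0 | apply is_lim_seq_const].
      + apply is_lim_seq_minus'; apply is_lim_seq_mult'; auto using is_lim_seq_const. }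
  (* With [2 pi X = T] and [ln X = ln T - ln (2 pi)] the count becomes the stated main term; this
     produces the [ln (2 pi)] in [nu]. *)
  replace (zeta (RtoC ((1 + INR b) / 2)) * RtoC (T * ln T) + nu zeta b * RtoC T)%C with (RtoC (2 * PI * Pm 0 z0 c X)).
  - eapply Rle_trans; [apply H3; lra|].
    assert (C1 * (Rpower T (3 / 4) + C2 * Rpower T kp) <= C1 * ((1 + C2) * Rpower T kp)) by (apply Rmult_le_compat_l; lra).
    assert (C3 <= C3 * Rpower T kp) by nra. lra.
  - unfold nu. replace ((1 + INR b) / 2) with s by (unfold s; field). fold s. rewrite E0, E1, euler_gamma_gam.
    rewrite <- !RtoC_mult, <- !RtoC_plus, <- RtoC_mult, <- RtoC_plus. f_equal. unfold Pm.
    rewrite <- Rmult_assoc, <- TX. unfold X. rewrite ln_div by lra. unfold c. ring.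
Qed.

Lemma lb_1 Y : lb 1 Y = l1 Y.
Proof.
  unfold lb, l1. induction Y as [|Y IH]; cbn [wl]; [reflexivity|]. rewrite IH. f_equal. f_equal.
  - replace ((INR 1 - 1) / 2) with 0 by (simpl; field). apply Rpower_O, lt_0_INR. lia.
  - apply Nat.pow_1_r.
Qed.

Lemma integral_asymp_1 zeta : is_riemann_zeta zeta ->
  exists C, 0 <= C /\ forall T, 20 <= T ->
  Cmod (zeta_integral zeta 1 (INR 1) 1 T
        - (RtoC (1 / 2 * T * ln T ^ 2 + coef1 * T * ln T) + coef0 zeta * RtoC T))%C <= C * (Rpower T (3 / 4) * ln T).
Proof.
  intros Hz. pose proof PI2_3_2 as P. pose proof PI_4 as P4.
  set (c1 := 3 * gam - 1). set (c2 := 3 * gam ^ 2 - 3 * gam + 1 - 3 * stj).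
  pose proof (Rabs_pos c1) as c10. pose proof (Rabs_pos c2) as c20.
  destruct (fb_asymp 1 (1 + Rabs c1 + Rabs c2) ltac:(lia) ltac:(lra)) as (C1 & C1p & H1).
  destruct triple_divisor_sum as (C2 & C2p & H2).
  destruct (zeta_integral_fb zeta 1 Hz ltac:(lia)) as (C3 & C3p & H3).
  exists (C1 * (1 + 2 * C2) + C3). split; [assert (0 <= C1 * (1 + 2 * C2)) by (apply Rmult_le_pos; lra); lra|].
  intros T HT. set (X := T / (2 * PI)). assert (TX : T = 2 * PI * X) by (unfold X; field; lra).
  assert (HX : 2 <= X) by (unfold X; apply le_div_mul; lra). assert (XT : 2 * X <= T) by (rewrite TX; nra).
  set (V := Rpower T (3 / 4)).
  assert (V1 : 1 <= V) by (unfold V; rewrite <- (Rpower_O T) at 1 by lra; apply Rle_Rpower; lra).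
  assert (L1 : 1 <= ln T).
  { apply Rle_trans with (ln (2 * 2)); [rewrite ln_mult by lra; pose proof ln_lt_2; lra | apply ln_le; lra]. }
  pose proof (H1 T (C2 * (2 * ln T * V)) (fun _ => / 2) (fun _ => c1) (fun _ => c2) (Pm (/ 2) c1 c2 X) HT
    ltac:(apply Rmult_le_pos; nra)) as A.
  assert (A' : Cmod (CI (fun t => fb 1 (Cpt (1 / 2) t)) 4 T - RtoC (2 * PI * Pm (/ 2) c1 c2 X))%C
     <= C1 * (V + C2 * (2 * ln T * V))).
  { apply A; clear A.
    - intros _. split; [rewrite Rabs_pos_eq; lra | lra].
    - intros N x Hx HN. fold X in Hx, HN. unfold l3. rewrite lb_1. fold (LL N).
      eapply Rle_trans; [apply H2; lra|]. apply Rmult_le_compat_l; auto.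
      assert (0 <= ln x) by (rewrite <- ln_1; apply ln_le; lra). assert (ln x <= ln T) by (apply ln_le; lra).
      apply Rmult_le_compat; [lra | left; apply Rpower_pos | lra |]. apply Rpower_le_base; lra.
    - fold X. apply clim_const. }
  replace (RtoC (1 / 2 * T * ln T ^ 2 + coef1 * T * ln T) + coef0 zeta * RtoC T)%C with (RtoC (2 * PI * Pm (/ 2) c1 c2 X)).
  - eapply Rle_trans; [apply H3; lra|].
    assert (V <= V * ln T) by nra.
    assert (C1 * (V + C2 * (2 * ln T * V)) <= C1 * ((1 + 2 * C2) * (V * ln T))) by (apply Rmult_le_compat_l; lra).
    assert (C3 <= C3 * (V * ln T)) by nra. lra.
  - unfold coef0. rewrite gamma1_stj by exact Hz. unfold coef1. rewrite euler_gamma_gam.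
    rewrite <- !RtoC_mult, <- !RtoC_plus, <- RtoC_mult, <- RtoC_plus. f_equal. unfold Pm.
    rewrite <- Rmult_assoc, <- TX. unfold X. rewrite ln_div by lra. unfold c1, c2. field.
Qed.

Theorem theorem1p4 (zeta : C -> C) (Hzeta : is_riemann_zeta zeta) (b : nat) :
  ((2 < b)%nat ->
   bigO_infty
     (fun T : R =>
        zeta_integral zeta 1 (INR b) 1 T
        - (zeta (RtoC ((1 + INR b) / 2)) * RtoC (T * ln T)
           + nu zeta b * RtoC T))%C
     (fun T : R => Rpower T (3 / 4) * ln T))
  /\
  (b = 2%nat ->
   forall eps : R, 0 < eps ->
   bigO_infty
     (fun T : R =>
        zeta_integral zeta 1 (INR b) 1 T
        - (zeta (RtoC ((1 + INR b) / 2)) * RtoC (T * ln T)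
           + nu zeta b * RtoC T))%C
     (fun T : R => Rpower T (3 / 4 + eps)))
  /\
  (b = 1%nat ->
   bigO_infty
     (fun T : R =>
        zeta_integral zeta 1 (INR b) 1 T
        - (RtoC (1 / 2 * T * ln T ^ 2 + coef1 * T * ln T) + coef0 zeta * RtoC T))%C
     (fun T : R => Rpower T (3 / 4) * ln T)).
Proof.
  split; [|split].
  - intros Hb. assert (b3 : 3 <= INR b) by (replace 3 with (INR 3) by (simpl; ring); apply le_INR; lia).
    (* With [kp = 3/4] the exponent of [k] is [b/4 + 1/2], at least [1 + 1/4] as soon as
       [b >= 3]. *)
    destruct (integral_asymp_ge2 zeta b (3 / 4) (1 / 4) Hzeta ltac:(lia) ltac:(lra) ltac:(lra) ltac:(lra)) as (C & C0 & H).
    exists C. exists 20. intros T HT. eapply Rle_trans; [apply H; lra|].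
    assert (1 <= ln T).
    { apply Rle_trans with (ln (2 * 2)); [rewrite ln_mult by lra; pose proof ln_lt_2; lra | apply ln_le; lra]. }
    pose proof (Rpower_pos T (3 / 4)). apply Rmult_le_compat_l; nra.
  (* The cap 1/8 keeps [kp = 3/4 + e] within the admissible 7/8. For [b = 2] the exponent of [k] is
     [2 kp - 1/2 = 1 + 2 e], so [p = 2 e]. *)
  - intros -> eps He. set (e := Rmin eps (1 / 8)).
    assert (e0 : 0 < e) by (apply Rmin_glb_lt; lra). pose proof (Rmin_l eps (1 / 8)) as e1. pose proof (Rmin_r eps (1 / 8)) as e2.
    fold e in e1, e2.
    destruct (integral_asymp_ge2 zeta 2 (3 / 4 + e) (2 * e) Hzeta ltac:(lia) ltac:(lra) ltac:(lra) ltac:(simpl; lra)) as (C & C0 & H).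
    exists C. exists 20. intros T HT. eapply Rle_trans; [apply H; lra|].
    apply Rmult_le_compat_l; auto. apply Rle_Rpower; lra.
  - intros ->. destruct (integral_asymp_1 zeta Hzeta) as (C & C0 & H).
    exists C. exists 20. intros T HT. apply H. lra.
Qed.
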